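(* Let $n\ge 2$, let $f:[0,\infty)\to\mathbb{R}$ be a smooth function, and equip $\mathbb{R}^{n+1}$ with the Riemannian metric $$ds^2=e^{-\frac{f(|x|^2)}{2n}}\sum_{i=1}^{n+1}dx_i^2 .$$ Suppose that $f''\ge 0$ and that there exist constants $0<m\le M$ such that $m\le f'\le M$ (derivatives of $f$ with respect to its variable $|x|^2$). Then there exists an embedded $f$-minimal hypersurface in $(\mathbb{R}^{n+1},ds^2)$ diffeomorphic to $S^1\times S^{n-1}$.
   Context: An immersed hypersurface of $\mathbb{R}^{n+1}$ is called $f$-minimal if it is minimal (zero mean curvature) with respect to the metric $ds^2$. Equivalently, its Euclidean mean curvature $H$ satisfies $H=\frac14\langle\nabla F,\mathbf n\rangle$, where $F(x)=f(|x|^2)$, $\nabla$ is the Euclidean gradient, $\mathbf n$ is the unit normal, and the sign convention is that $H=\frac12\langle x,\mathbf n\rangle$ is the self-shrinker equation (the case $F(x)=|x|^2$, for which the sphere of radius $\sqrt{2n}$ centered at the origin is a solution). *)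

(* Defs.v *)
From mathcomp Require Import all_boot all_order all_algebra.
From mathcomp Require Import all_classical all_reals all_analysis.

Set Implicit Arguments.
Unset Strict Implicit.
Unset Printing Implicit Defensive.

Import Order.TTheory GRing.Theory Num.Theory.
Import numFieldNormedType.Exports.

Local Open Scope classical_set_scope.
Local Open Scope ring_scope.

(* The library norm on 'rV[R]_k is the sup norm, so the Euclidean norm is
   introduced here; both induce the same topology. *)
Definition sqnorm {R : realType} {k : nat} (x : 'rV[R]_k) : R :=
  \sum_(i < k) x 0 i ^+ 2.

(* Functions on [0, +oo) are represented by functions R -> R whose values on
   negative numbers are never used: the derivative at t is the limit of the
   difference quotient along s -> t with s >= 0 and s != t, which is the
   one-sided derivative at t = 0. *)
Definition diff_quotient {R : realType} (f : R -> R) (t s : R) : R :=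
  (f s - f t) / (s - t).

Definition derive_halfline {R : realType} (f : R -> R) (t : R) : R :=
  lim (diff_quotient f t s @[s --> within `[0, +oo[ t^']).

Definition smooth_halfline {R : realType} (f : R -> R) : Prop :=
  forall (j : nat) (t : R), 0 <= t ->
    cvg (diff_quotient (iter j derive_halfline f) t s
           @[s --> within `[0, +oo[ t^']).

Definition pderive {R : realType} {k l : nat} (i : 'I_k)
    (g : 'rV[R]_k -> 'rV[R]_l) : 'rV[R]_k -> 'rV[R]_l :=
  fun x => 'D_(delta_mx 0 i) g x.

(* C^oo: all iterated partial derivatives exist and are continuous; this is
   meant for U open. *)
Definition smooth_on {R : realType} {k l : nat} (U : set 'rV[R]_k)
    (g : 'rV[R]_k -> 'rV[R]_l) : Prop :=
  forall (s : seq 'I_k) (x : 'rV[R]_k), U x ->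
    {for x, continuous (foldr pderive g s)} /\
    forall i : 'I_k, derivable (foldr pderive g s) x (delta_mx 0 i).

(* Smoothness on an arbitrary subset of a Euclidean space: existence of local
   smooth extensions (as in Milnor, or Guillemin and Pollack). *)
Definition smooth_within {R : realType} {k l : nat} (A : set 'rV[R]_k)
    (g : 'rV[R]_k -> 'rV[R]_l) : Prop :=
  forall x, A x -> exists (U : set 'rV[R]_k) (h : 'rV[R]_k -> 'rV[R]_l),
    [/\ open U, U x, smooth_on U h & forall y, A y -> U y -> h y = g y].

Definition diffeomorphism {R : realType} {k l : nat}
    (A : set 'rV[R]_k) (B : set 'rV[R]_l)
    (g : 'rV[R]_k -> 'rV[R]_l) (h : 'rV[R]_l -> 'rV[R]_k) : Prop :=
  [/\ smooth_within A g, smooth_within B h,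
      forall x, A x -> B (g x) /\ h (g x) = x &
      forall y, B y -> A (h y) /\ g (h y) = y].

Definition diffeomorphic {R : realType} {k l : nat}
    (A : set 'rV[R]_k) (B : set 'rV[R]_l) : Prop :=
  exists g h, diffeomorphism A B g h.

(* S^1 x S^(n-1), as a subset of R^2 x R^n = R^(2+n). *)
Definition S1xS (R : realType) (n : nat) : set 'rV[R]_(2 + n) :=
  [set x | sqnorm (lsubmx x) = 1 /\ sqnorm (rsubmx x) = 1].
Arguments S1xS : clear implicits.

Definition local_parametrization {R : realType} {n : nat}
    (S : set 'rV[R]_n.+1) (W : set 'rV[R]_n)
    (phi : 'rV[R]_n -> 'rV[R]_n.+1) : Prop :=
  open W /\ exists (U : set 'rV[R]_n.+1) (psi : 'rV[R]_n.+1 -> 'rV[R]_n),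
    open U /\ diffeomorphism W (S `&` U) phi psi.

(* Embedded hypersurfaces are n-dimensional submanifolds of R^(n+1), with the
   subspace topology. *)
Definition embedded_hypersurface {R : realType} {n : nat}
    (S : set 'rV[R]_n.+1) : Prop :=
  forall p, S p -> exists (W : set 'rV[R]_n) (phi : 'rV[R]_n -> 'rV[R]_n.+1),
    local_parametrization S W phi /\ exists2 w, W w & phi w = p.

(* A Riemannian metric on R^N is given by its Gram matrix at each point, in the
   standard coordinates. *)
Definition metric (R : realType) (N : nat) : Type := 'rV[R]_N -> 'M[R]_N.

Definition inner {R : realType} {N : nat} (g : metric R N) (p u v : 'rV[R]_N)
    : R :=
  (u *m g p *m v^T) 0 0.

(* christoffel g p c a b is the coefficient with upper index c. *)
Definition christoffel {R : realType} {N : nat} (g : metric R N)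
    (p : 'rV[R]_N) (c a b : 'I_N) : R :=
  2^-1 * \sum_(d < N) invmx (g p) c d *
    ('D_(delta_mx 0 a) (fun x => g x b d) p
     + 'D_(delta_mx 0 b) (fun x => g x a d) p
     - 'D_(delta_mx 0 d) (fun x => g x a b) p).

(* The Levi-Civita covariant derivative along phi of the j-th coordinate vector
   field in the direction of the i-th one. *)
Definition cov_pderive2 {R : realType} {n N : nat} (g : metric R N)
    (phi : 'rV[R]_n -> 'rV[R]_N) (w : 'rV[R]_n) (i j : 'I_n) : 'rV[R]_N :=
  \row_(c < N) (pderive i (pderive j phi) w 0 c
    + \sum_(a < N) \sum_(b < N) christoffel g (phi w) c a b
        * pderive i phi w 0 a * pderive j phi w 0 b).

Definition first_form {R : realType} {n N : nat} (g : metric R N)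
    (phi : 'rV[R]_n -> 'rV[R]_N) (w : 'rV[R]_n) : 'M[R]_n :=
  \matrix_(i, j) inner g (phi w) (pderive i phi w) (pderive j phi w).

Definition second_form {R : realType} {n N : nat} (g : metric R N)
    (phi : 'rV[R]_n -> 'rV[R]_N) (nu : 'rV[R]_N) (w : 'rV[R]_n) : 'M[R]_n :=
  \matrix_(i, j) inner g (phi w) (cov_pderive2 g phi w i j) nu.

Definition mean_curvature {R : realType} {n N : nat} (g : metric R N)
    (phi : 'rV[R]_n -> 'rV[R]_N) (nu : 'rV[R]_N) (w : 'rV[R]_n) : R :=
  \tr (invmx (first_form g phi w) *m second_form g phi nu w).

Definition unit_normal {R : realType} {n N : nat} (g : metric R N)
    (phi : 'rV[R]_n -> 'rV[R]_N) (w : 'rV[R]_n) (nu : 'rV[R]_N) : Prop :=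
  inner g (phi w) nu nu = 1 /\
  forall i, inner g (phi w) (pderive i phi w) nu = 0.

Definition minimal_hypersurface {R : realType} {n : nat} (g : metric R n.+1)
    (S : set 'rV[R]_n.+1) : Prop :=
  forall (W : set 'rV[R]_n) (phi : 'rV[R]_n -> 'rV[R]_n.+1),
    local_parametrization S W phi ->
    forall w nu, W w -> unit_normal g phi w nu ->
      mean_curvature g phi nu w = 0.

Definition f_metric {R : realType} {n : nat} (f : R -> R) : metric R n.+1 :=
  fun x => (expR (- (f (sqnorm x) / (2 * n%:R))))%:M.

Definition f_minimal {R : realType} {n : nat} (f : R -> R)
    (S : set 'rV[R]_n.+1) : Prop :=
  minimal_hypersurface (f_metric f) S.

(* Main.v *)
Require Import Defs.
From HB Require Import structures.
From mathcomp Require Import all_boot all_order all_algebra.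
From mathcomp Require Import all_classical all_reals all_analysis.
From mathcomp Require Import ring lra.
Set Implicit Arguments.
Unset Strict Implicit.
Unset Printing Implicit Defensive.
Import Order.TTheory GRing.Theory Num.Theory.
Import numFieldNormedType.Exports.
Local Open Scope classical_set_scope.
Local Open Scope ring_scope.

(** The hypersurface is an analogue of Angenent's shrinking doughnut: a closed curve in the half
    plane [r > 0] of points [(x, r)] is rotated about the [x]-axis. Parametrize the curve by arc
    length and let [th] be its tangent angle. Minimality in the conformal metric is then the system
    [x' = cos th], [r' = sin th], [th' = kap x r th], with [kap = (n - 1) cos th / r + (F / 2) (x
    sin th - r cos th)], where [F = f'] is taken at [x^2 + r^2]. Reflection in the line [x = 0]
    combined with reversal of time preserves this system. Hence a solution that leaves the line
    [x = 0] horizontally at height [b] and meets it again with [th = pi] closes up after reflection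
    ([closed_profile_of_arc]).

    The height is found by shooting. An [arc] is a piece of a solution that starts at [(0, b)] with
    [th = 0] and keeps [x > 0], [th >= 0] and a nondecreasing distance to the origin. [hits b] says
    that such an arc returns to the line [x = 0] with that distance still strictly increasing, that
    is, with [th < pi]. Four facts decide the matter. Small heights hit ([small_hit]): the start is
    a thin neck, the curve turns round at a small distance from the line, then climbs almost
    vertically with a slight tilt that brings it back. Hitting is an open condition ([hits_open]). A
    limit of hitting heights still has a returning arc ([hits_limit]), because the radius at the
    return is bounded a priori ([arc_bound]). The height [b0] at which the initial curvature
    vanishes has no returning arc ([no_critical_arc]). At the supremum of the hitting heights below
    [b0] the arc returns but cannot hit, by openness; the only alternative left by [arc_end] is
    [th = pi] ([torus_arc_family]).

    Convexity of [f] enters as monotonicity of [F] along arcs, where [x^2 + r^2] increases. It makes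
    it impossible for the angle or the radial speed to vanish before the end ([arc_th_gt0],
    [arc_kk_gt0]). The bounds on [f'] give the decay of the weight [r^(n-1) exp(-f/4)] and all the
    quantitative estimates.

    Along the arc [r] is strictly increasing and [x > 0], so the closed curve is simple
    ([curve_injective]), and the differential equation makes it smooth ([curve_derivation]). The
    rotated set is covered by charts made of the curve parameter and a stereographic projection
    ([torus_embedded]); rescaling the parameter to an angle gives the diffeomorphism
    ([torus_diffeomorphic]). In any parametrization its Euclidean second fundamental form has the
    eigenvalue [kap] along the profile and [- cos th / r] along the spheres ([second_order]). With
    the conformal correction the trace vanishes, which is exactly the equation for [th']
    ([torus_minimal]). *)

(** * Calculus of one real variable *)

Section RealCalculus.
Variable R : realType.
Implicit Types (f g h : R -> R) (a b s t x : R).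

Lemma DD f g x a b : is_derive x 1 f a -> is_derive x 1 g b ->
  is_derive x 1 (fun s => f s + g s) (a + b).
Proof. by move=> hf hg; apply: is_deriveD. Qed.

Lemma DN f x a : is_derive x 1 f a -> is_derive x 1 (fun s => - f s) (- a).
Proof. by move=> hf; apply: is_deriveN. Qed.

Lemma DB f g x a b : is_derive x 1 f a -> is_derive x 1 g b ->
  is_derive x 1 (fun s => f s - g s) (a - b).
Proof. by move=> hf hg; apply: is_deriveB. Qed.

Lemma DM f g x a b : is_derive x 1 f a -> is_derive x 1 g b ->
  is_derive x 1 (fun s => f s * g s) (a * g x + f x * b).
Proof.
move=> hf hg; apply: is_derive_eq (is_deriveM hf hg) _.
by rewrite /GRing.scale /=; ring.
Qed.

Lemma DC (c x : R) : is_derive x 1 (fun _ : R => c) 0.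
Proof. exact: is_derive_cst. Qed.

Lemma DI x : is_derive x 1 (fun s : R => s) 1.
Proof. exact: is_derive_id. Qed.

Lemma DComp f g x a b : is_derive (g x) 1 f a -> is_derive x 1 g b ->
  is_derive x 1 (fun s => f (g s)) (a * b).
Proof. by move=> hf hg; apply: is_derive1_comp. Qed.

Lemma DV f x a : f x != 0 -> is_derive x 1 f a ->
  is_derive x 1 (fun s => (f s)^-1) (- a / f x ^+ 2).
Proof.
move=> h0 hf; apply: is_derive_eq (is_deriveV h0 hf) _.
by rewrite /GRing.scale /= mulNr mulrC mulNr.
Qed.

Lemma Dcos f x a : is_derive x 1 f a ->
  is_derive x 1 (fun s => cos (f s)) (- sin (f x) * a).
Proof. by move=> hf; apply: (DComp (f := cos)). Qed.

Lemma Dsin f x a : is_derive x 1 f a ->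
  is_derive x 1 (fun s => sin (f s)) (cos (f x) * a).
Proof. by move=> hf; apply: (DComp (f := sin)). Qed.

Lemma Dexp f x a : is_derive x 1 f a ->
  is_derive x 1 (fun s => expR (f s)) (expR (f x) * a).
Proof. by move=> hf; apply: (DComp (f := expR)). Qed.

Lemma DX f n x a : is_derive x 1 f a ->
  is_derive x 1 (fun s => f s ^+ n) (n%:R * f x ^+ n.-1 * a).
Proof. move=> hf; rewrite (_ : (fun s => f s ^+ n) = f ^+ n); last by rewrite exprfctE.
exact: is_derive_eq (is_deriveX n hf) _. Qed.

Lemma D_eq f x a b : is_derive x 1 f a -> a = b -> is_derive x 1 f b.
Proof. by move=> h <-. Qed.

Lemma D_near f g x a : (\forall y \near x, f y = g y) ->
  is_derive x 1 f a -> is_derive x 1 g a.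
Proof. exact: near_eq_is_derive. Qed.

Lemma D_cont f x a : is_derive x 1 f a -> {for x, continuous f}.
Proof.
by case=> h _; apply: differentiable_continuous; apply/derivable1_diffP.
Qed.

Lemma cont_cst (c x : R) : {for x, continuous (fun _ : R => c)}.
Proof. exact: cvg_cst. Qed.

Lemma D_uniq f x a b : is_derive x 1 f a -> is_derive x 1 f b -> a = b.
Proof. by case=> _ <- [_ <-]. Qed.

Lemma cont_eps f x e : {for x, continuous f} -> 0 < e ->
  exists2 d, 0 < d & forall y, `|y - x| < d -> `|f y - f x| < e.
Proof.
move=> /cvgrPdist_lt /(_ e) h e0; move: (h e0) => /nbhs_ballP[d /= d0 hd].
exists d => // y hy; rewrite distrC; apply: hd.
by rewrite /ball /= distrC.
Qed.

Lemma eps_cont f x : (forall e, 0 < e -> exists2 d, 0 < d &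
  forall y, `|y - x| < d -> `|f y - f x| < e) -> {for x, continuous f}.
Proof.
move=> h; apply/cvgrPdist_lt => e e0; have [d d0 hd] := h _ e0.
apply/nbhs_ballP; exists d => //= y; rewrite /ball /= distrC => hy.
by rewrite distrC; apply: hd.
Qed.

Lemma mono_le f (f' : R -> R) a b : a <= b ->
  (forall s, a <= s <= b -> {for s, continuous f}) ->
  (forall s, a < s < b -> is_derive s 1 f (f' s)) ->
  (forall s, a < s < b -> 0 <= f' s) -> f a <= f b.
Proof.
move=> ab hc hd hp.
move: ab; rewrite le_eqVlt => /predU1P[->//|ab].
have hd' x : x \in `]a, b[ -> is_derive x 1 f (f' x).
  by rewrite in_itv /= => hx; apply: hd.
have hc' : {within `[a, b], continuous f}.
  apply: continuous_in_subspaceT => x; rewrite inE /= in_itv /= => hx.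
  exact: hc.
have [c] := MVT ab hd' hc'; rewrite in_itv /= => hcc he; rewrite -subr_ge0 he mulr_ge0 ?hp// subr_ge0.
exact: ltW.
Qed.

Lemma mono_lt f (f' : R -> R) a b : a < b ->
  (forall s, a <= s <= b -> {for s, continuous f}) ->
  (forall s, a < s < b -> is_derive s 1 f (f' s)) ->
  (forall s, a < s < b -> 0 < f' s) -> f a < f b.
Proof.
move=> ab hc hd hp.
have hd' x : x \in `]a, b[ -> is_derive x 1 f (f' x).
  by rewrite in_itv /= => hx; apply: hd.
have hc' : {within `[a, b], continuous f}.
  apply: continuous_in_subspaceT => x; rewrite inE /= in_itv /= => hx.
  exact: hc.
have [c] := MVT ab hd' hc'; rewrite in_itv /= => hcc he; by rewrite -subr_gt0 he mulr_gt0 ?hp// subr_gt0.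
Qed.

Lemma ivt f a b v : a <= b ->
  (forall s, a <= s <= b -> {for s, continuous f}) ->
  f a <= v <= f b -> exists2 c, a <= c <= b & f c = v.
Proof.
move=> ab hc hv; have hc' : {within `[a, b], continuous f}.
  apply: continuous_in_subspaceT => x; rewrite inE /= in_itv /= => hx.
  exact: hc.
have [|c] := IVT ab hc' (v := v).
  case/andP: hv => h1 h2; rewrite (min_idPl _) ?(max_idPr _) ?h1 ?h2//;
  exact: le_trans h2.
by rewrite in_itv /= => h1 h2; exists c.
Qed.

Lemma ivt_neg f a b v : a <= b ->
  (forall s, a <= s <= b -> {for s, continuous f}) ->
  f b <= v <= f a -> exists2 c, a <= c <= b & f c = v.
Proof.
move=> ab hc hv; have [||c h1 h2] := @ivt (fun s => - f s) a b (- v) ab.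
- by move=> s hs; apply: cvgN; apply: hc.
- by rewrite !lerN2 andbC.
by exists c => //; apply: oppr_inj.
Qed.

(* The first zero, as the infimum of the zeros. *)
Lemma first_zero f a b : a <= b ->
  (forall s, a <= s <= b -> {for s, continuous f}) ->
  0 < f a -> f b <= 0 ->
  exists2 c, a < c <= b & f c = 0 /\ forall s, a <= s < c -> 0 < f s.
Proof.
move=> ab hc fa fb.
pose Z := [set s | a <= s <= b /\ f s <= 0].
have Zb : Z b by rewrite /Z /= ab lexx.
have hl : has_lbound Z by exists a => s [/andP[]].
have hi : has_inf Z by split => //; exists b.
pose c := inf Z.
have ac : a <= c by apply: lb_le_inf; [exists b|move=> s [/andP[]]].
have cb : c <= b by exact: ge_inf.
have pos s : a <= s < c -> 0 < f s.
  move=> /andP[h1 h2]; rewrite ltNge; apply/negP => h3.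
  suff : c <= s by rewrite leNgt h2.
  by apply: ge_inf => //; split => //; rewrite h1 /= (le_trans (ltW h2)).
have cc : {for c, continuous f} by apply: hc; rewrite ac cb.
have fc0 : f c <= 0.
  rewrite leNgt; apply/negP => h; have [d d0 hd] := cont_eps cc h.
  have [s [hs1 hs2] hs3] := inf_adherent d0 hi.
  have hs4 : c <= s by apply: ge_inf.
  have : `|f s - f c| < f c.
    by apply: hd; rewrite ger0_norm ?subr_ge0// ltrBlDl.
  by rewrite ltr_norml => /andP[h4 _]; lra.
have ac' : a < c.
  by rewrite lt_neqAle ac andbT; apply/eqP => h; move: fc0 fa; rewrite -h; lra.
have fc1 : 0 <= f c.
  rewrite leNgt; apply/negP => h.
  have h' : 0 < - f c by lra.
  have [d d0 hd] := cont_eps cc h'.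
  pose s := Num.max a (c - d / 2).
  have sc : s < c by rewrite /s gt_max ac' /=; lra.
  have as_ : a <= s by rewrite /s le_max lexx.
  have cds : c - d / 2 <= s by rewrite /s le_max lexx orbT.
  have := pos s; rewrite as_ sc => /(_ isT).
  have : `|f s - f c| < - f c.
    by apply: hd; rewrite ltr_norml; apply/andP; split; lra.
  by rewrite ltr_norml => /andP[_]; lra.
exists c; first by rewrite ac' cb.
by split=> //; apply/le_anti; rewrite fc0 fc1.
Qed.

(** The product of [f] with the integrating factor [expR (- (C * s))] is nonincreasing. Applied to a
    negative function with a negative constant, it also yields lower bounds. *)
Lemma gronwall f (f' : R -> R) (C a b : R) : a <= b ->
  (forall s, a <= s <= b -> {for s, continuous f}) ->
  (forall s, a < s < b -> is_derive s 1 f (f' s)) ->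
  (forall s, a < s < b -> f' s <= C * f s) ->
  f b <= f a * expR (C * (b - a)).
Proof.
move=> ab hc hd hf.
have de s : is_derive s 1 (fun s => - expR (- (C * s)))
    (- (expR (- (C * s)) * - (0 * s + C * 1))).
  exact: DN (Dexp (DN (DM (DC C s) (DI s)))).
have : - expR (- (C * a)) * f a <= - expR (- (C * b)) * f b.
  apply: (mono_le ab (f := fun s => - expR (- (C * s)) * f s)
    (f' := fun s => - (expR (- (C * s)) * - (0 * s + C * 1)) * f s +
              - expR (- (C * s)) * f' s)).
  - by move=> s hs; apply: cvgM; [exact: D_cont (de s)|exact: hc].
  - by move=> s hs; exact: DM (de s) (hd s hs).
  - move=> s hs; rewrite [X in 0 <= X](_ : _ = expR (- (C * s)) * (C * f s - f' s)).
      by rewrite mulr_ge0 ?expR_ge0// subr_ge0 hf.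
    by ring.
rewrite !mulNr lerN2 => h.
have -> : expR (C * (b - a)) = expR (C * b) * expR (- (C * a)).
  by rewrite -expRD; congr expR; ring.
rewrite -(@ler_pM2l _ (expR (- (C * b)))) ?expR_gt0//.
apply: le_trans h _; rewrite mulrCA [X in _ <= _ * X]mulrA -expRD addNr expR0 mul1r.
by rewrite mulrC.
Qed.

Lemma D_local_min f x d e : is_derive x 1 f d -> 0 < e ->
  (forall y, `|y - x| < e -> derivable f y 1) ->
  (forall y, `|y - x| < e -> f x <= f y) -> d = 0.
Proof.
move=> hd e0 hdf he.
have hab y : y \in `]x - e, x + e[ -> `|y - x| < e.
  by rewrite in_itv /= ltr_norml => /andP[h1 h2]; apply/andP; split; lra.
apply: D_uniq hd _; apply: (@derive1_at_min _ _ (x - e) (x + e)).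
- by lra.
- by move=> t /hab; exact: hdf.
- by rewrite in_itv /=; apply/andP; split; lra.
- by move=> t /hab; exact: he.
Qed.

End RealCalculus.

(** * Primitives and geometric limits *)

Section Primitive.
Variable R : realType.
Implicit Types (f g : R -> R) (a b s t x : R).

Lemma D0_const f a b : a <= b ->
  (forall s, a <= s <= b -> is_derive s 1 f 0) -> f a = f b.
Proof.
move=> ab hd; apply/le_anti/andP; split.
  apply: (@mono_le _ f (fun=> 0)) => // s hs.
    by apply: D_cont; apply: hd.
  by apply: hd; case/andP: hs => ? ?; rewrite !ltW.
rewrite -lerN2; apply: (@mono_le _ (fun s => - f s) (fun=> 0)) => // s hs.
  by apply: cvgN; apply: D_cont; apply: hd.
have hs' : a <= s <= b by case/andP: hs => ? ?; rewrite !ltW.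
by apply: (D_eq (DN (hd s hs'))); rewrite oppr0.
Qed.

Lemma local_primitive g T : 0 < T -> continuous g ->
  exists P, P 0 = 0 /\ forall x, - T < x < T -> is_derive x 1 P (g x).
Proof.
move=> T0 gc.
pose F x := (\int[@lebesgue_measure R]_(t in `[- T, x]) g t)%R.
exists (fun x => F x - F 0); split; first by rewrite subrr.
move=> x /andP[x1 x2].
have hi : (@lebesgue_measure R).-integrable `[- T, T] (EFin \o g).
  apply: continuous_compact_integrable; first exact: segment_compact.
  exact: continuous_subspaceT.
have [h1 h2] := @continuous_FTC1_closed R g (- T) x T x2 hi x1 (gc x).
have dF : is_derive x 1 F (g x) by rewrite -h2 derive1E; apply/derivableP.
by apply: (D_eq (DB dF (DC (F 0) x))); rewrite subr0.
Qed.

Lemma primitive g : continuous g ->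
  exists P, P 0 = 0 /\ forall x, is_derive x 1 P (g x).
Proof.
move=> gc.
have /choice[P hP] : forall n : nat, exists P, P 0 = 0 /\
    forall x, - n.+1%:R < x < n.+1%:R -> is_derive x 1 P (g x).
  by move=> n; apply: local_primitive => //; rewrite ltr0n.
have agree m n x : (m <= n)%N -> `|x| < m.+1%:R -> P n x = P m x.
  move=> mn hx; have hmn : m.+1%:R <= n.+1%:R :> R by rewrite ler_nat.
  have hd s : `|s| <= `|x| -> is_derive s 1 (fun s => P n s - P m s) 0.
    move=> hs; have := le_lt_trans hs hx; rewrite ltr_norml => hs1.
    have hn : - n.+1%:R < s < n.+1%:R.
      by case/andP: hs1 => h1 h2; apply/andP; split; lra.
    by apply: (D_eq (DB ((hP n).2 s hn) ((hP m).2 s hs1))); rewrite subrr.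
  have h0 : P n 0 - P m 0 = 0 by rewrite (hP n).1 (hP m).1 subrr.
  apply/eqP; rewrite -subr_eq0 -h0; apply/eqP.
  have [x0|x0] := leP 0 x.
    symmetry; apply: (D0_const (f := fun s => P n s - P m s)) => // s hs.
    by have [h1 h2] := andP hs; apply: hd; rewrite !ger0_norm.
  apply: (D0_const (f := fun s => P n s - P m s)) => // [|s hs]; first exact: ltW.
  by have [h1 h2] := andP hs; apply: hd; rewrite !ler0_norm ?lerN2 // ltW.
(* The local primitives agree on common intervals, since they vanish at [0] and have the same
   derivative. At [x] any index at least the integer part of [|x|] may therefore be used. *)
exists (fun x => P (Num.truncn `|x|) x); split; first by rewrite (hP _).1.
move=> x; pose m := Num.truncn (`|x| + 1).
have hm : `|x| + 1 < m.+1%:R by exact: truncnS_gt.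
have dPm : is_derive x 1 (P m) (g x) by apply: (hP m).2; rewrite -ltr_norml; lra.
apply: (@D_near _ (P m)) dPm.
apply/nbhs_ballP; exists 1 => //= y; rewrite /ball /= => hy.
have hy1 : `|y| < m.+1%:R.
  rewrite (_ : y = x - (x - y)); last by ring.
  by have := ler_normB x (x - y); lra.
have [h|h] := leqP (Num.truncn `|y|) m.
  by rewrite (agree (Num.truncn `|y|) m) //; exact: truncnS_gt.
by rewrite (agree m (Num.truncn `|y|)) // ltnW.
Qed.

(** Integration gains the factor [A] in the norm weighted by [expR (A * |t|)]; for large [A] this
    turns the Picard operator into a contraction on the whole line. *)
Lemma primitive_bound g P c A t : 0 <= c -> 0 < A -> P 0 = 0 ->
  (forall x, is_derive x 1 P (g x)) ->
  (forall x, `|g x| <= c * A * expR (A * `|x|)) ->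
  `|P t| <= c * expR (A * `|t|).
Proof.
move=> c0 A0.
(* Changing the signs of the function and of the variable reduces both bounds, on both half lines,
   to an upper bound for positive arguments. *)
suff H g' P' s : 0 <= s -> P' 0 = 0 -> (forall x, is_derive x 1 P' (g' x)) ->
    (forall x, 0 <= x -> `|g' x| <= c * A * expR (A * x)) ->
    P' s <= c * expR (A * s).
  move=> P0 hP hg; have Pm : - P 0 = 0 by rewrite P0 oppr0.
  have [t0|t0] := leP 0 t.
    rewrite (ger0_norm t0) ler_norml; apply/andP; split.
      rewrite lerNl; apply: (H (fun x => - g x) (fun x => - P x)) => //.
      by move=> x x0; rewrite normrN; have := hg x; rewrite (ger0_norm x0).
    by apply: (H g) => // x x0; have := hg x; rewrite (ger0_norm x0).
  have dPN x : is_derive x 1 (fun s => P (- s)) (- g (- x)).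
    by apply: (D_eq (DComp (hP (- x)) (DN (DI x)))); ring.
  have hgN x : 0 <= x -> `|g (- x)| <= c * A * expR (A * x).
    by move=> x0; have := hg (- x); rewrite normrN (ger0_norm x0).
  rewrite (ltr0_norm t0) ler_norml -[P t](congr1 P (opprK t)).
  apply/andP; split.
    rewrite lerNl; apply: (H (fun x => g (- x)) (fun x => - P (- x))) => //.
    - by lra.
    - by rewrite oppr0.
    - by move=> x; apply: (D_eq (DN (dPN x))); rewrite opprK.
  apply: (H (fun x => - g (- x)) (fun x => P (- x))) => //.
  - by lra.
  - by rewrite oppr0.
  - by move=> x x0; rewrite normrN hgN.
move=> s0 P0 hP hg.
have de x : is_derive x 1 (fun s => c * expR (A * s)) (c * A * expR (A * x)).
  by apply: (D_eq (DM (DC c x) (Dexp (DM (DC A x) (DI x))))); ring.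
suff : c * expR (A * 0) - P' 0 <= c * expR (A * s) - P' s.
  by rewrite mulr0 expR0 P0; lra.
apply: (@mono_le _ (fun s => c * expR (A * s) - P' s)
  (fun s => c * A * expR (A * s) - g' s)) => //.
- by move=> x _; exact: D_cont (DB (de x) (hP x)).
- move=> x /andP[x0 _]; rewrite subr_ge0.
  by apply: le_trans (hg x (ltW x0)); apply: ler_norm.
Qed.

(** The sequences [u k - 2 M / 2 ^ k] and [u k + 2 M / 2 ^ k] are monotone in opposite directions,
    and the limit is the supremum of the first. *)
Lemma geometric_limit (u : nat -> R) M : 0 <= M ->
  (forall k, `|u k.+1 - u k| <= M / 2 ^+ k) ->
  exists l, forall k, `|l - u k| <= 2 * M / 2 ^+ k.
Proof.
move=> M0 hu.
have p2 k : 0 < (2 : R) ^+ k by rewrite exprn_gt0.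
have e2 k : 2 * M / 2 ^+ k.+1 = M / 2 ^+ k.
  by rewrite exprS; field; rewrite gt_eqF.
have lo i j : u i - 2 * M / 2 ^+ i <= u (i + j)%N - 2 * M / 2 ^+ (i + j).
  elim: j => [|j ih]; first by rewrite addn0.
  apply: le_trans ih _; rewrite addnS e2; have := hu (i + j)%N.
  rewrite ler_norml => /andP[h _]; have := e2 (i + j)%N; lra.
have hi i j : u (i + j)%N + 2 * M / 2 ^+ (i + j) <= u i + 2 * M / 2 ^+ i.
  elim: j => [|j ih]; first by rewrite addn0.
  apply: le_trans _ ih; rewrite addnS e2; have := hu (i + j)%N.
  rewrite ler_norml => /andP[_ h]; have := e2 (i + j)%N; lra.
have nn k : 0 <= 2 * M / 2 ^+ k by rewrite divr_ge0 ?exprn_ge0// mulr_ge0.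
have cross i j : u i - 2 * M / 2 ^+ i <= u j + 2 * M / 2 ^+ j.
  apply: le_trans (lo i j) _; apply: le_trans (hi j i).
  by rewrite addnC; have := nn (j + i)%N; lra.
pose E := [set u k - 2 * M / 2 ^+ k | k in [set: nat]].
have hE : has_sup E.
  split; first by exists (u 0%N - 2 * M / 2 ^+ 0); exists 0%N.
  by exists (u 0%N + 2 * M / 2 ^+ 0) => _ [k _ <-].
exists (sup E) => k; rewrite ler_norml; apply/andP; split.
  have : u k - 2 * M / 2 ^+ k <= sup E.
    by apply: ub_le_sup; [exact: hE.2|exists k].
  lra.
have : sup E <= u k + 2 * M / 2 ^+ k.
  by apply: ge_sup; [exact: hE.1|move=> _ [j _ <-]].
lra.
Qed.

End Primitive.

(** * Global flow of a bounded Lipschitz vector field *)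

Section ODE.
Variables (R : realType) (d : nat).
Local Notation st := ('I_d -> R).
Variables (F : st -> st) (K B : R).
Hypothesis K0 : 0 <= K.
Hypothesis B0 : 0 <= B.
Hypothesis F_lip : forall u v i, `|F u i - F v i| <= K * \sum_j `|u j - v j|.
Hypothesis F_bnd : forall u i, `|F u i| <= B.

Definition solution (y : R -> st) : Prop :=
  forall (t : R) i, is_derive t (1 : R) (fun s => y s i) (F (y t) i).

Lemma sum_small (y : R -> st) (t e : R) : 0 < e ->
  (forall j, {for t, continuous (fun s => y s j)}) ->
  exists2 r, 0 < r & forall s, `|s - t| < r -> \sum_j `|y s j - y t j| < e.
Proof.
move=> e0 hy.
pose e' := e / d.+1%:R.
have e'0 : 0 < e' by rewrite divr_gt0// ltr0n.
have /choice[r hr] : forall j : 'I_d, exists r, 0 < r /\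
    forall s, `|s - t| < r -> `|y s j - y t j| < e'.
  by move=> j; have [r r0 hr] := cont_eps (hy j) e'0; exists r.
exists (\big[Num.min/1]_j r j).
  by elim/big_ind : _ => // [a b ha hb|j _]; [rewrite lt_min ha hb|case: (hr j)].
move=> s hs.
apply: (@le_lt_trans _ _ (\sum_(j < d) e')).
  apply: ler_sum => j _; apply: ltW; apply: (hr j).2.
  by apply: lt_le_trans hs _; apply: bigmin_le_cond.
rewrite sumr_const card_ord -[_ *+ d]mulr_natr /e' -mulrA -[ltRHS]mulr1 ltr_pM2l//.
by rewrite mulrC ltr_pdivrMr ?ltr0n// mul1r ltr_nat.
Qed.

Lemma F_cont (y : R -> st) (i : 'I_d) :
  (forall j, continuous (fun s => y s j)) -> continuous (fun s => F (y s) i).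
Proof.
move=> hy t; apply: eps_cont => e e0.
have K1 : 0 < K + 1 by have := K0; lra.
have e1 : 0 < e / (K + 1) by rewrite divr_gt0.
have [r r0 hr] := sum_small e1 (fun j => hy j t).
exists r => // s /hr hs; apply: le_lt_trans (F_lip _ _ _) _.
move: hs; rewrite ltr_pdivlMr// => h; apply: le_lt_trans _ h.
by rewrite mulrC ler_wpM2l ?sumr_ge0//; lra.
Qed.

(** Picard iteration, carried out at once on the whole line in the exponentially weighted norm. *)
Lemma ode_exists (a : st) : exists2 y, y 0 = a & solution y.
Proof.
have K0' := K0; have B0' := B0.
have /choice[P hP] : forall g : R -> R, exists p : R -> R, continuous g ->
    p 0 = 0 /\ forall x : R, is_derive x (1 : R) p (g x).
  move=> g; have [h|h] := pselect (continuous g); last by exists g.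
  by have [p hp] := primitive h; exists p.
pose step (y : R -> st) : R -> st := fun t i => a i + P (fun s => F (y s) i) t.
pose y k := iter k step (fun _ => a).
have stepD z : (forall j, continuous (fun s => z s j)) ->
    forall (t : R) i, is_derive t (1 : R) (fun s => step z s i) (F (z t) i).
  move=> hz t i.
  have := DD (DC (a i) t) ((hP _ (F_cont (i := i) hz)).2 t).
  by rewrite add0r.
have yc k j : continuous (fun s => y k s j).
  elim: k j => [|k ih] j t; first exact: cvg_cst.
  exact: D_cont (stepD _ ih t j).
(* The choice [A >= 2 d K] makes each Picard step halve the weighted distance. *)
pose A := 2 * d%:R * K + 1.
have d0 : 0 <= d%:R :> R by [].
have A0 : 0 < A.
  by rewrite /A; have := mulr_ge0 d0 K0; lra.
pose E (t : R) : R := expR (A * `|t|).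
have E0 t : 0 <= E t by exact: expR_ge0.
have pb (g1 g2 : R -> R) (t c : R) : 0 <= c -> continuous g1 -> continuous g2 ->
    (forall x, `|g1 x - g2 x| <= c * A * E x) -> `|P g1 t - P g2 t| <= c * E t.
  move=> c0 h1 h2 h12.
  apply: (@primitive_bound R (fun x => g1 x - g2 x) (fun x => P g1 x - P g2 x)) => //.
    by rewrite (hP _ h1).1 (hP _ h2).1 subrr.
  by move=> x; exact: (DB ((hP _ h1).2 x) ((hP _ h2).2 x)).
have c0 : continuous (fun _ : R => 0 : R) by move=> x; exact: cvg_cst.
have P00 t : P (fun=> 0) t = 0.
  have [h1 h2] := hP _ c0; apply: etrans _ h1.
  exact: is_derive_0_is_cst h2.
have [C C0 CA] : exists2 C, 0 <= C & C * A = B.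
  by exists (B / A); [rewrite divr_ge0// ltW|rewrite divfK// gt_eqF].
have E1 t : 1 <= E t.
  by rewrite /E -expR0 ler_expR mulr_ge0// ltW.
have diff k t i : `|y k.+1 t i - y k t i| <= C / 2 ^+ k * E t.
  elim: k t i => [|k ih] t i.
    rewrite /y /= /step addrC addKr expr0 divr1 -[P _ t]subr0 -(P00 t).
    apply: pb => //; first by apply: F_cont => j; exact: (yc 0%N j).
    move=> x; rewrite subr0 CA.
    apply: le_trans (F_bnd _ _) _; rewrite -[leLHS]mulr1.
    exact: ler_wpM2l.
  rewrite /y iterS [iter k.+1 _ _]iterS -/(y k) -iterS -/(y k.+1) /step.
  rewrite opprD addrACA subrr add0r.
  have p2 : 0 < (2 : R) ^+ k by rewrite exprn_gt0.
  apply: pb.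
  - by rewrite divr_ge0// exprn_ge0.
  - by apply: F_cont; exact: (yc k.+1).
  - by apply: F_cont; exact: (yc k).
  move=> x; apply: le_trans (F_lip _ _ _) _.
  apply: (@le_trans _ _ (K * \sum_(j < d) C / 2 ^+ k * E x)).
    by apply: ler_wpM2l => //; apply: ler_sum => j _; exact: ih.
  rewrite sumr_const card_ord -[_ *+ d]mulr_natr.
  have Q0 : 0 <= C / 2 ^+ k * E x.
    by rewrite mulr_ge0 ?divr_ge0 ?exprn_ge0 ?E0.
  rewrite (_ : C / 2 ^+ k.+1 * A * E x = C / 2 ^+ k * E x * (A / 2)); last first.
    by rewrite exprS invfM; ring.
  rewrite mulrCA; apply: ler_wpM2l => //; rewrite /A; lra.
have /choice[l hl] : forall ti : R * 'I_d, exists l, forall k,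
    `|l - y k ti.1 ti.2| <= 2 * (C * E ti.1) / 2 ^+ k.
  move=> [t i] /=; apply: (@geometric_limit _ (fun k => y k t i) (C * E t)).
    exact: mulr_ge0.
  by move=> k; rewrite mulrAC.
pose z (t : R) (i : 'I_d) : R := l (t, i).
(* All iterates are Lipschitz in time with constant [B], which makes their pointwise limit
   continuous. *)
have yB k (t t' : R) i : `|y k t i - y k t' i| <= B * `|t - t'|.
  wlog tt : t t' / t' <= t.
    move=> H; have [h|h] := leP t' t; first exact: H.
    by rewrite distrC [X in _ * X]distrC; apply: H; exact: ltW.
  case: k => [|k]; first by rewrite subrr normr0 mulr_ge0.
  have hd (x : R) := stepD (y k) (yc k) x i.
  have db (x e : R) : is_derive x (1 : R) (fun s => e * s) e.
    by apply: (D_eq (DM (DC e x) (DI x))); ring.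
  rewrite (ger0_norm (_ : 0 <= t - t')) ?subr_ge0//.
  have fb x := F_bnd (y k x) i.
  rewrite ler_norml; apply/andP; split.
    suff : step (y k) t' i + B * t' <= step (y k) t i + B * t.
      rewrite -[y k.+1]/(step (y k)); lra.
    apply: (@mono_le _ (fun s => step (y k) s i + B * s)
      (fun s => F (y k s) i + B)) => // s hs.
    - exact: D_cont (DD (hd s) (db s B)).
    - by have := fb s; rewrite ler_norml => /andP[]; lra.
  suff : B * t' - step (y k) t' i <= B * t - step (y k) t i.
    rewrite -[y k.+1]/(step (y k)); lra.
  apply: (@mono_le _ (fun s => B * s - step (y k) s i)
    (fun s => B - F (y k s) i)) => // s hs.
  - exact: D_cont (DB (db s B) (hd s)).
  - by have := fb s; rewrite ler_norml => /andP[]; lra.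
have small (x e : R) : 0 <= x -> 0 < e -> exists k, x / 2 ^+ k < e.
  move=> x0 e0; exists (Num.bound (x / e)).
  have h : x / e < 2 ^+ Num.bound (x / e).
    apply: lt_le_trans (archi_boundP _) _; first by rewrite divr_ge0// ltW.
    by rewrite -natrX ler_nat ltnW// ltn_expl.
  by rewrite ltr_pdivrMr ?exprn_gt0// mulrC -ltr_pdivrMr.
have eq_small (x y' : R) (M : R) : 0 <= M ->
    (forall k, `|x - y'| <= M / 2 ^+ k) -> x = y'.
  move=> M0 h; apply/eqP; rewrite -subr_eq0 -normr_le0 leNgt; apply/negP => h1.
  by have [k hk] := small _ _ M0 h1; have := h k; rewrite leNgt hk.
have zc j : continuous (fun s => z s j).
  move=> t; apply: eps_cont => e e0; exists (e / (B + 1)).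
    by rewrite divr_gt0//; lra.
  move=> s; rewrite ltr_pdivlMr; last by lra.
  move=> hs; apply: le_lt_trans _ hs.
  have M0 : 0 <= 2 * (C * E s) + 2 * (C * E t).
    by rewrite addr_ge0 ?mulr_ge0 ?E0.
  rewrite leNgt; apply/negP => h.
  have h' : 0 < `|z s j - z t j| - `|s - t| * (B + 1) by rewrite subr_gt0.
  have [k hk] := small _ _ M0 h'.
  have h1 := hl (s, j) k; have h2 := hl (t, j) k; have h3 := yB k s t j.
  rewrite -/(z s j) -/(z t j) /= in h1 h2.
  have : `|z s j - z t j| <= `|z s j - y k s j| + `|y k s j - y k t j| + `|z t j - y k t j|.
    rewrite (_ : z s j - z t j = (z s j - y k s j) + (y k s j - y k t j) - (z t j - y k t j)).
      by apply: le_trans (ler_normB _ _) _; rewrite lerD2r ler_normD.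
    by ring.
  have := normr_ge0 (s - t).
  move: hk h1 h2 h3; rewrite mulrDl !mulrDr; lra.
(* Both sides are within a multiple of [2 ^- k] of the iterate [y k.+1]. *)
have zE t i : step z t i = z t i.
  apply: (eq_small _ _ (3 * (C * E t))).
    by rewrite !mulr_ge0 ?E0.
  move=> k; have p2 : 0 < (2 : R) ^+ k by rewrite exprn_gt0.
  have h1 : `|step z t i - y k.+1 t i| <= 2 * C / 2 ^+ k / 2 * E t.
    rewrite [y k.+1]/(step (y k)) /step opprD addrACA subrr add0r.
    apply: pb.
    - by rewrite !divr_ge0 ?exprn_ge0 ?mulr_ge0.
    - exact: F_cont.
    - by apply: F_cont; exact: yc.
    move=> x; apply: le_trans (F_lip _ _ _) _.
    apply: (@le_trans _ _ (K * \sum_(j < d) 2 * (C * E x) / 2 ^+ k)).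
      by apply: ler_wpM2l => //; apply: ler_sum => j _; exact: (hl (x, j)).
    rewrite sumr_const card_ord -[_ *+ d]mulr_natr.
    have Q0 : 0 <= 2 * (C * E x) / 2 ^+ k.
      by rewrite divr_ge0 ?exprn_ge0 ?mulr_ge0 ?E0.
    rewrite (_ : 2 * C / 2 ^+ k / 2 * A * E x = 2 * (C * E x) / 2 ^+ k * (A / 2)); last first.
      by ring.
    rewrite mulrCA; apply: ler_wpM2l => //; rewrite /A; lra.
  have h2 := hl (t, i) k.+1; rewrite -/(z t i) /= in h2.
  rewrite (_ : step z t i - z t i = (step z t i - y k.+1 t i) - (z t i - y k.+1 t i)); last by ring.
  apply: le_trans (ler_normB _ _) _.
  move: h1 h2; rewrite exprS.
  rewrite (_ : 2 * C / 2 ^+ k / 2 * E t = (C * E t) / 2 ^+ k); last first.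
    by field; rewrite gt_eqF.
  rewrite (_ : 2 * (C * E t) / (2 * 2 ^+ k) = (C * E t) / 2 ^+ k); last first.
    by field; rewrite gt_eqF.
  have : 0 <= C * E t / 2 ^+ k.
    by rewrite divr_ge0 ?exprn_ge0 ?mulr_ge0 ?E0.
  rewrite (_ : 3 * (C * E t) / 2 ^+ k = 3 * (C * E t / 2 ^+ k)); last by ring.
  lra.
exists z.
  by apply/funext => i; rewrite -zE /step (hP _ (F_cont (i := i) zc)).1 addr0.
move=> t i; have := stepD z zc t i.
by congr is_derive; apply/funext => s; rewrite zE.
Qed.

(** The squared Euclidean distance [f] of two solutions satisfies [|f'| <= 2 d^2 K f]; [gronwall] is
    applied in both directions of time. *)
Lemma ode_lipschitz (y z : R -> st) (t : R) : solution y -> solution z ->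
  \sum_i (y t i - z t i) ^+ 2 <=
  (\sum_i (y 0 i - z 0 i) ^+ 2) * expR (2 * d%:R * d%:R * K * `|t|).
Proof.
move=> hy hz.
pose f s := \sum_i (y s i - z s i) ^+ 2.
pose f' s := \sum_i 2 * (y s i - z s i) * (F (y s) i - F (z s) i).
have Df (s : R) : is_derive s (1 : R) f (f' s).
  rewrite /f (_ : (fun s => _) = \sum_i (fun s => (y s i - z s i) ^+ 2)); last first.
    by apply/funext => u; rewrite fct_sumE.
  apply: is_derive_sum => i; apply: (D_eq (DX 2 (DB (hy s i) (hz s i)))).
  by rewrite expr1.
have bnd s : `|f' s| <= 2 * d%:R * d%:R * K * f s.
  pose D := \sum_j `|y s j - z s j|.
  have le1 j : `|y s j - z s j| ^+ 2 <= f s.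
    rewrite /f (bigD1 j)//= -[X in _ <= X + _]real_normK ?num_real// lerDl.
    by apply: sumr_ge0 => i _; exact: sqr_ge0.
  have f0 : 0 <= f s by apply: sumr_ge0 => i _; exact: sqr_ge0.
  have prod i j : `|y s i - z s i| * `|y s j - z s j| <= f s.
    have := le1 i; have := le1 j.
    move: `|y s i - z s i| `|y s j - z s j| => p q h1 h2.
    have : 0 <= (p - q) ^+ 2 by exact: sqr_ge0.
    rewrite sqrrB; lra.
  apply: (@le_trans _ _ (\sum_(i < d) 2 * d%:R * K * f s)).
    apply: le_trans (ler_norm_sum _ _ _) _; apply: ler_sum => i _.
    rewrite !normrM (ger0_norm (_ : 0 <= 2))// -!mulrA ler_pM2l//.
    apply: (@le_trans _ _ (`|y s i - z s i| * (K * D))).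
      by apply: ler_wpM2l => //; exact: F_lip.
    rewrite mulrCA [leRHS]mulrCA; apply: ler_wpM2l => //.
    rewrite /D mulr_sumr; apply: (@le_trans _ _ (\sum_(j < d) f s)).
      by apply: ler_sum => j _; exact: prod.
    by rewrite sumr_const card_ord -[_ *+ d]mulr_natl.
  by rewrite sumr_const card_ord -[_ *+ d]mulr_natl; rewrite le_eqVlt; apply/orP; left; apply/eqP; ring.
have [t0|t0] := leP 0 t.
  have := @gronwall _ f f' (2 * d%:R * d%:R * K) 0 t t0.
  rewrite subr0 ger0_norm//; apply.
  - by move=> s _; exact: D_cont (Df s).
  - by move=> s _; apply: le_trans (bnd s); exact: ler_norm.
have := @gronwall _ (fun s => f (- s)) (fun s => - f' (- s)) (2 * d%:R * d%:R * K) 0 (- t).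
rewrite subr0 ltr0_norm// opprK oppr0; apply; first by lra.
- move=> s _; exact: D_cont (DComp (Df (- s)) (DN (DI s))).
- by move=> s _; apply: (D_eq (DComp (Df (- s)) (DN (DI s)))); ring.
- by move=> s _; apply: le_trans (bnd (- s)); rewrite -normrN; exact: ler_norm.
Qed.

Lemma ode_unique (y z : R -> st) : solution y -> solution z ->
  y 0 = z 0 -> y = z.
Proof.
move=> hy hz h0; apply/funext => t; apply/funext => i.
have := ode_lipschitz t hy hz; rewrite h0.
rewrite [X in _ <= X * _]big1; last by move=> j _; rewrite subrr expr0n.
rewrite mul0r => h; apply/eqP; rewrite -subr_eq0 -sqrf_eq0 eq_le sqr_ge0 andbT.
apply: le_trans h; rewrite (bigD1 i)//= lerDl.
by apply: sumr_ge0 => j _; exact: sqr_ge0.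
Qed.

End ODE.

(** * Half-line derivatives at positive points *)

Section HalfLine.
Variable R : realType.
Implicit Types (f g : R -> R) (t l : R).

Lemma is_derive_eps f t l : (forall e, 0 < e -> exists2 d, 0 < d &
    forall h, h != 0 -> `|h| < d -> `|l - (f (t + h) - f t) / h| < e) ->
  is_derive t (1 : R) f l.
Proof.
move=> H.
have cv : h^-1 *: (f (h *: 1 + t) - f t) @[h --> 0^'] --> l.
  apply/cvgrPdist_lt => e e0; have [d d0 hd] := H e e0.
  rewrite /dnbhs near_withinE; apply/nbhs_ballP; exists d => //= h.
  rewrite /ball /= sub0r normrN => hh hn.
  rewrite /GRing.scale /= mulr1 mulrC [h + t]addrC; exact: hd.
apply: DeriveDef; first by apply/cvg_ex; exists l.
by apply/cvg_lim.
Qed.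

Lemma derive_halflineP f t : 0 < t ->
  cvg (diff_quotient f t s @[s --> within `[0, +oo[ t^']) ->
  is_derive t (1 : R) f (derive_halfline f t).
Proof.
move=> t0 hc; apply: is_derive_eps => e e0.
move/cvgrPdist_lt: hc => /(_ e e0).
rewrite near_withinE /dnbhs near_withinE => /nbhs_ballP[d /= d0 hd].
(* Increments smaller than [t] keep [t + h] in the half line, so that the restricted limit is an
   ordinary one. *)
exists (Num.min d t); first by rewrite lt_min d0.
move=> h h0; rewrite lt_min => /andP[hd1 ht].
have hb : ball t d (t + h) by rewrite /ball /= opprD addNKr normrN.
have hn : t + h != t by rewrite -subr_eq0 [t + h]addrC addrK.
have ht' : 0 <= t + h by move: ht; rewrite ltr_norml => /andP[]; lra.
have := hd _ hb hn; rewrite in_itv /= andbT => /(_ ht').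
by rewrite /diff_quotient [t + h - t]addrC addKr.
Qed.

End HalfLine.

(** * Truncation and bounded Lipschitz functions *)

Section Clip.
Variable R : realType.
Implicit Types (a b x y L c : R).

Definition clip a b x : R := Num.max a (Num.min x b).

Lemma clip_id a b x : a <= x -> x <= b -> clip a b x = x.
Proof. by move=> ax xb; rewrite /clip (min_idPl xb) (max_idPr ax). Qed.

Lemma clip_ge a b x : a <= clip a b x.
Proof. by rewrite /clip le_max lexx. Qed.

Lemma clip_le a b x : a <= b -> clip a b x <= b.
Proof. by move=> ab; rewrite /clip ge_max ab ge_min lexx orbT. Qed.

Lemma clipN L x : 0 <= L -> clip (- L) L (- x) = - clip (- L) L x.
Proof.
move=> L0; rewrite /clip /Num.min /Num.max.
by case: (ltrP (- x) L) => h1; case: (ltrP x L) => h2;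
  repeat case: ltrP => ?; lra.
Qed.

Lemma clip_lip a b x y : `|clip a b x - clip a b y| <= `|x - y|.
Proof.
have min_lip (u v c : R) : `|Num.min u c - Num.min v c| <= `|u - v|.
  rewrite /Num.min; have := ler_norm (u - v); have := ler_norm (v - u); rewrite distrC => h1 h2.
  by case: (ltrP u c) => h3; case: (ltrP v c) => h4; rewrite ler_norml; apply/andP; split; lra.
have max_lip (u v c : R) : `|Num.max c u - Num.max c v| <= `|u - v|.
  rewrite /Num.max; have := ler_norm (u - v); have := ler_norm (v - u); rewrite distrC => h1 h2.
  by case: (ltrP c u) => h3; case: (ltrP c v) => h4; rewrite ler_norml; apply/andP; split; lra.
exact: le_trans (max_lip _ _ _) (min_lip _ _ _).
Qed.

End Clip.

Section BoundedLipschitz.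
Variables (R : realType) (d : nat).
Local Notation st := ('I_d -> R).
Implicit Types (g h : st -> R) (u v : st).

Definition dist1 u v := \sum_j `|u j - v j|.

(** Boundedness is included because products of Lipschitz functions are Lipschitz only when the
    factors are bounded. *)
Definition bounded_lipschitz g := exists K B, [/\ 0 <= K, 0 <= B,
  forall u v, `|g u - g v| <= K * dist1 u v & forall u, `|g u| <= B].

Lemma dist1_ge0 u v : 0 <= dist1 u v.
Proof. exact: sumr_ge0. Qed.

Lemma dist1_ge u v i : `|u i - v i| <= dist1 u v.
Proof. by rewrite /dist1 (bigD1 i)//= lerDl sumr_ge0. Qed.

Lemma blD g h : bounded_lipschitz g -> bounded_lipschitz h ->
  bounded_lipschitz (fun u => g u + h u).
Proof.
move=> [K [B [K0 B0 h1 h2]]] [K' [B' [K0' B0' h1' h2']]].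
exists (K + K'), (B + B'); split; rewrite ?addr_ge0//.
  move=> u v; rewrite opprD addrACA mulrDl; apply: le_trans (ler_normD _ _) _.
  exact: lerD.
by move=> u; apply: le_trans (ler_normD _ _) _; exact: lerD.
Qed.

Lemma blM g h : bounded_lipschitz g -> bounded_lipschitz h ->
  bounded_lipschitz (fun u => g u * h u).
Proof.
move=> [K [B [K0 B0 h1 h2]]] [K' [B' [K0' B0' h1' h2']]].
exists (B * K' + B' * K), (B * B'); split; rewrite ?addr_ge0 ?mulr_ge0//.
  move=> u v; rewrite (_ : _ - _ = g u * (h u - h v) + h v * (g u - g v)); last by ring.
  apply: le_trans (ler_normD _ _) _; rewrite mulrDl !normrM -!mulrA.
  by apply: lerD; apply: ler_pM.
by move=> u; rewrite normrM; apply: ler_pM.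
Qed.

Lemma bl_cst (a : R) : bounded_lipschitz (fun=> a).
Proof.
exists 0, `|a|; split=> // u v; first by rewrite subrr normr0 mul0r.
Qed.

Lemma bl_comp g (p : R -> R) (K B : R) : bounded_lipschitz g -> 0 <= K -> 0 <= B ->
  (forall u v, `|p (g u) - p (g v)| <= K * `|g u - g v|) ->
  (forall u, `|p (g u)| <= B) -> bounded_lipschitz (fun u => p (g u)).
Proof.
move=> [K' [B' [K0' B0' h1' h2']]] K0 B0 h1 h2.
exists (K * K'), B; split=> //; first exact: mulr_ge0.
move=> u v; apply: le_trans (h1 u v) _; rewrite -mulrA.
exact: ler_wpM2l.
Qed.

Lemma bl_clip (a b : R) i : a <= b -> bounded_lipschitz (fun u => clip a b (u i)).
Proof.
move=> ab; exists 1, (`|a| + `|b|); split; rewrite ?addr_ge0//.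
  move=> u v; rewrite mul1r; apply: le_trans (clip_lip _ _ _ _) _.
  exact: dist1_ge.
move=> u; have h1 := clip_ge a b (u i); have h2 := clip_le (u i) ab.
have := ler_norm (- a); have := ler_norm b; rewrite normrN => h3 h4.
have := normr_ge0 a; have := normr_ge0 b.
by rewrite ler_norml => ? ?; apply/andP; split; lra.
Qed.

Lemma derive_lip (p p' : R -> R) (a b K x y : R) :
  (forall s, a <= s <= b -> is_derive s (1 : R) p (p' s)) ->
  (forall s, a <= s <= b -> `|p' s| <= K) ->
  a <= x <= b -> a <= y <= b -> `|p x - p y| <= K * `|x - y|.
Proof.
move=> hd hK; wlog xy : x y / y <= x.
  move=> H hx hy; have [h|h] := leP y x; first exact: H.
  by rewrite distrC [X in _ * X]distrC; apply: H => //; exact: ltW.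
move=> /andP[x1 x2] /andP[y1 y2].
have hs s : y < s < x -> a <= s <= b.
  by move=> /andP[h1 h2]; apply/andP; split; lra.
have hs' s : y <= s <= x -> a <= s <= b.
  by move=> /andP[h1 h2]; apply/andP; split; lra.
have dK (s : R) : is_derive s (1 : R) (fun s => K * s) K.
  by apply: (D_eq (DM (DC K s) (DI s))); ring.
have dp s (h : a <= s <= b) := DD (dK s) (hd s h).
have dm s (h : a <= s <= b) := DB (dK s) (hd s h).
rewrite (ger0_norm (_ : 0 <= x - y)) ?subr_ge0// ler_norml; apply/andP; split.
  have : K * y + p y <= K * x + p x.
    apply: (@mono_le _ (fun s => K * s + p s) (fun s => K + p' s) _ _ xy).
    - by move=> s /hs' h; exact: D_cont (dp s h).
    - by move=> s /hs h; exact: dp s h.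
    - by move=> s /hs /hK; rewrite ler_norml => /andP[]; lra.
  lra.
have : K * y - p y <= K * x - p x.
  apply: (@mono_le _ (fun s => K * s - p s) (fun s => K - p' s) _ _ xy).
  - by move=> s /hs' h; exact: D_cont (dm s h).
  - by move=> s /hs h; exact: dm s h.
  - by move=> s /hs /hK; rewrite ler_norml => /andP[]; lra.
lra.
Qed.

Lemma cos_lip (x y : R) : `|cos x - cos y| <= `|x - y|.
Proof.
rewrite -[X in _ <= X]mul1r.
apply: (@derive_lip cos (fun s => - sin s) (Num.min x y) (Num.max x y)).
- by move=> s _; rewrite normrN; exact: sin_max.
- by rewrite ge_min le_max !lexx.
- by rewrite ge_min le_max !lexx !orbT.
Qed.

Lemma sin_lip (x y : R) : `|sin x - sin y| <= `|x - y|.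
Proof.
rewrite -[X in _ <= X]mul1r.
apply: (@derive_lip sin (fun s => cos s) (Num.min x y) (Num.max x y)).
- by move=> s _; exact: cos_max.
- by rewrite ge_min le_max !lexx.
- by rewrite ge_min le_max !lexx !orbT.
Qed.

Lemma bl_cos i : bounded_lipschitz (fun u => cos (u i)).
Proof.
exists 1, 1; split=> // [u v|u]; last exact: cos_max.
by rewrite mul1r; apply: le_trans (cos_lip _ _) (dist1_ge _ _ _).
Qed.

Lemma bl_sin i : bounded_lipschitz (fun u => sin (u i)).
Proof.
exists 1, 1; split=> // [u v|u]; last exact: sin_max.
by rewrite mul1r; apply: le_trans (sin_lip _ _) (dist1_ge _ _ _).
Qed.

End BoundedLipschitz.

(* [F] is the derivative of [f] in the variable [|x|^2]; the behaviour at [0]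
   plays no role. *)
Record profile_data (R : realType) (m M : R) (f F F1 : R -> R) : Prop := {
  pd_m : 0 < m;
  pd_f : forall u : R, 0 < u -> is_derive u (1 : R) f (F u);
  pd_F : forall u : R, 0 < u -> is_derive u (1 : R) F (F1 u);
  pd_F1 : forall u : R, 0 < u -> {for u, continuous F1};
  pd_mono : forall u v : R, 0 < u -> u <= v -> F u <= F v;
  pd_lo : forall u : R, 0 < u -> m <= F u;
  pd_hi : forall u : R, 0 < u -> F u <= M }.

(** * The truncated profile equation *)

Section Field.
Variables (R : realType) (m M : R) (f F F1 : R -> R) (n1 : nat).
Hypothesis pd : profile_data m M f F F1.
Local Notation N := (n1%:R : R).

Definition i0 : 'I_3 := @Ordinal 3 0 isT.
Definition i1 : 'I_3 := @Ordinal 3 1 isT.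
Definition i2 : 'I_3 := @Ordinal 3 2 isT.

Definition mk3 (a b c : R) : 'I_3 -> R :=
  fun i => if i == i0 then a else if i == i1 then b else c.

(** The curvature of the profile prescribed by minimality. The first term balances the [N = n - 1]
    rotational principal curvatures, the second is the normal derivative of the conformal factor. *)
Definition kap (x r th : R) : R :=
  N * cos th / r + F (x ^+ 2 + r ^+ 2) / 2 * (x * sin th - r * cos th).

(** The position is truncated to a compact region away from [r = 0]; the angle enters only through
    its sine and cosine, which are already bounded and Lipschitz. *)
Definition field (c L : R) (u : 'I_3 -> R) : 'I_3 -> R :=
  mk3 (cos (u i2)) (sin (u i2))
      (kap (clip (- L) L (u i0)) (clip c L (u i1)) (u i2)).

Lemma field_bl (c L : R) i : 0 < c -> c <= L ->
  bounded_lipschitz (fun u => field c L u i).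
Proof.
move=> c0 cL; rewrite /field /mk3.
have [_|_] := eqVneq i i0; first exact: bl_cos.
have [_|_] := eqVneq i i1; first exact: bl_sin.
have L0 : 0 < L by lra.
have bx : bounded_lipschitz (fun u : 'I_3 -> R => clip (- L) L (u i0)).
  by apply: bl_clip; lra.
have br : bounded_lipschitz (fun u : 'I_3 -> R => clip c L (u i1)).
  exact: bl_clip.
have rpos u : c <= clip c L (u i1) by exact: clip_ge.
have bri : bounded_lipschitz (fun u : 'I_3 -> R => (clip c L (u i1))^-1).
  apply: (@bl_comp _ _ _ GRing.inv (c ^- 2) c^-1 br).
  - by rewrite invr_ge0 exprn_ge0// ltW.
  - by rewrite invr_ge0 ltW.
  - move=> u v; have := rpos u; have := rpos v.
    move: (clip c L (u i1)) (clip c L (v i1)) => a b hb ha.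
    have a0 : 0 < a by lra.
    have b0 : 0 < b by lra.
    rewrite (_ : a^-1 - b^-1 = (b - a) / (b * a)); last first.
      by field; rewrite !gt_eqF.
    rewrite normrM distrC mulrC normfV (ger0_norm (_ : 0 <= b * a)); last first.
      by rewrite mulr_ge0// ltW.
    apply: ler_wpM2r => //; rewrite lef_pV2 ?posrE ?exprn_gt0 ?mulr_gt0//.
    by rewrite expr2; apply: ler_pM => //; exact: ltW.
  - move=> u; have := rpos u; move: (clip _ _ _) => a ha.
    have a0 : 0 < a by lra.
    by rewrite ger0_norm ?lef_pV2 ?posrE// invr_ge0 ltW.
have bu : bounded_lipschitz (fun u : 'I_3 -> R =>
    clip (- L) L (u i0) ^+ 2 + clip c L (u i1) ^+ 2).
  by apply: blD; apply: blM.
have urange (u : 'I_3 -> R) : c ^+ 2 <=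
    clip (- L) L (u i0) ^+ 2 + clip c L (u i1) ^+ 2 <= 2 * L ^+ 2.
  have h1 := rpos u; have h2 : clip c L (u i1) <= L by exact: clip_le.
  have h3 : - L <= clip (- L) L (u i0) by exact: clip_ge.
  have h4 : clip (- L) L (u i0) <= L by apply: clip_le; lra.
  have h5 : clip (- L) L (u i0) ^+ 2 <= L ^+ 2.
    by move: h3 h4; move: (clip _ _ _) => k h3 h4; nra.
  have h6 : clip c L (u i1) ^+ 2 <= L ^+ 2.
    by rewrite ler_pXn2r ?nnegrE//; lra.
  have h7 : c ^+ 2 <= clip c L (u i1) ^+ 2.
    by rewrite ler_pXn2r ?nnegrE//; lra.
  have := sqr_ge0 (clip (- L) L (u i0)).
  by move=> h8; apply/andP; split; lra.
have c2 : 0 < c ^+ 2 by rewrite exprn_gt0.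
(* On the truncated region [x^2 + r^2] lies in a compact interval of positive numbers, where the
   continuous function [F1] is bounded; hence [F] is Lipschitz there. *)
have [K K0 hK] : exists2 K, 0 <= K & forall s, c ^+ 2 <= s <= 2 * L ^+ 2 -> `|F1 s| <= K.
  have hle : c ^+ 2 <= 2 * L ^+ 2 by case/andP: (urange (fun=> 0)); exact: le_trans.
  have cF1 : {within `[c ^+ 2, 2 * L ^+ 2], continuous (fun s => `|F1 s|)}.
    apply: continuous_in_subspaceT => s; rewrite inE /= in_itv /= => /andP[hs _].
    apply: cvg_norm; apply: (pd_F1 pd); lra.
  have [k _ hk] := EVT_max hle cF1.
  by exists `|F1 k| => // s hs; apply: hk; rewrite in_itv.
have bF : bounded_lipschitz (fun u : 'I_3 -> R =>
    F (clip (- L) L (u i0) ^+ 2 + clip c L (u i1) ^+ 2)).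
  apply: (@bl_comp _ _ _ F K (`|m| + `|M|) bu K0); first exact: addr_ge0.
    move=> u v; apply: (@derive_lip _ F F1 (c ^+ 2) (2 * L ^+ 2)) => //.
    by move=> s /andP[hs _]; apply: (pd_F pd); lra.
  move=> u; have /andP[h _] := urange u.
  have h1 : 0 < clip (- L) L (u i0) ^+ 2 + clip c L (u i1) ^+ 2 by lra.
  have := pd_lo pd h1; have := pd_hi pd h1.
  have := pd_m pd; have := ler_norm M; have := normr_ge0 m; have := normr_ge0 M.
  by move=> *; rewrite ger0_norm; lra.
apply: blD.
  by apply: blM => //; apply: blM; [exact: bl_cst|exact: bl_cos].
apply: blM; first by apply: blM => //; exact: bl_cst.
apply: blD; first by apply: blM => //; exact: bl_sin.
have -> : (fun u : 'I_3 -> R => - (clip c L (u i1) * cos (u i2))) =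
    (fun u => (- 1) * (clip c L (u i1) * cos (u i2))).
  by apply/funext => u; rewrite mulN1r.
by apply: blM; [exact: bl_cst|apply: blM => //; exact: bl_cos].
Qed.

Lemma field_consts (c L : R) : 0 < c -> c <= L -> exists K B, [/\ 0 <= K, 0 <= B,
  forall u v i, `|field c L u i - field c L v i| <= K * \sum_j `|u j - v j| &
  forall u i, `|field c L u i| <= B].
Proof.
move=> c0 cL.
have [K0 [B0 [? ? h0 b0]]] := field_bl i0 c0 cL.
have [K1 [B1 [? ? h1 b1]]] := field_bl i1 c0 cL.
have [K2 [B2 [? ? h2 b2]]] := field_bl i2 c0 cL.
have ei (i : 'I_3) : [\/ i = i0, i = i1 | i = i2].
  case: i => [[|[|[|//]]] hi].
  - by constructor 1; apply: val_inj.
  - by constructor 2; apply: val_inj.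
  - by constructor 3; apply: val_inj.
exists (K0 + K1 + K2), (B0 + B1 + B2); split; rewrite ?addr_ge0//.
  move=> u v i; rewrite -/(dist1 u v) !mulrDl.
  have p0 := mulr_ge0 (_ : 0 <= K0) (dist1_ge0 u v).
  have p1 := mulr_ge0 (_ : 0 <= K1) (dist1_ge0 u v).
  have p2 := mulr_ge0 (_ : 0 <= K2) (dist1_ge0 u v).
  have := h0 u v; have := h1 u v; have := h2 u v.
  by have := p0 ltac:(done); have := p1 ltac:(done); have := p2 ltac:(done);
    case: (ei i) => ->; lra.
move=> u i; have := b0 u; have := b1 u; have := b2 u.
by case: (ei i) => ->; lra.
Qed.

End Field.

(** * Profile curves: symmetries, dependence on the height, conservation identities *)

Section Profile.
Variables (R : realType) (m M : R) (f F F1 : R -> R) (n1 : nat).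
Hypothesis pd : profile_data m M f F F1.
Hypothesis n1_gt0 : (0 < n1)%N.
Local Notation N := (n1%:R : R).
Local Notation kap := (kap F n1).

Lemma N_ge1 : 1 <= N.
Proof. by rewrite (ler_nat _ 1). Qed.

(* The angle equation holds only in the region [c <= r], [x^2 + r^2 <= L^2];
   outside of it the field is truncated, so that solutions are global. *)
Record psol (c L : R) (x r th : R -> R) : Prop := {
  ps_x : forall s : R, is_derive s (1 : R) x (cos (th s));
  ps_r : forall s : R, is_derive s (1 : R) r (sin (th s));
  ps_th : forall s : R, is_derive s (1 : R) th
     (kap (clip (- L) L (x s)) (clip c L (r s)) (th s)) }.

Definition box (c L x r : R) := c <= r /\ x ^+ 2 + r ^+ 2 <= L ^+ 2.

Lemma kap_box (c L x r th : R) : 0 < c -> c <= L -> box c L x r ->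
  kap (clip (- L) L x) (clip c L r) th = kap x r th.
Proof.
move=> c0 cL [h1 h2].
have L0 : 0 < L by lra.
have hr : r <= L.
  by rewrite leNgt; apply/negP => h; have := sqr_ge0 x; nra.
have hx1 : x <= L.
  by rewrite leNgt; apply/negP => h; have := sqr_ge0 r; nra.
have hx2 : - L <= x.
  by rewrite leNgt; apply/negP => h; have := sqr_ge0 r; nra.
by rewrite !clip_id.
Qed.

Section Solutions.
Variables (c L : R).
Hypothesis c0 : 0 < c.
Hypothesis cL : c <= L.

Let Y (x r th : R -> R) : R -> 'I_3 -> R := fun s => mk3 (x s) (r s) (th s).

Lemma psol_solution x r th : psol c L x r th ->
  solution (field F n1 c L) (Y x r th).
Proof.
move=> [h1 h2 h3] t i; rewrite /field /Y /mk3 /=.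
by case: (i == i0) => //; case: (i == i1).
Qed.

Lemma solution_psol y : solution (field F n1 c L) y ->
  psol c L (fun s => y s i0) (fun s => y s i1) (fun s => y s i2).
Proof.
by move=> h; split => s; [exact: (h s i0)|exact: (h s i1)|exact: (h s i2)].
Qed.

(** One global solution is chosen for each initial height, with a Lipschitz dependence on the height
    that is uniform on bounded time intervals; this is all the continuity that shooting requires. *)
Lemma psol_family : exists X Rr Th : R -> R -> R,
  (forall b, [/\ psol c L (X b) (Rr b) (Th b), X b 0 = 0, Rr b 0 = b & Th b 0 = 0]) /\
  forall S, exists2 C, 0 <= C & forall b b' s, `|s| <= S ->
    [/\ `|X b s - X b' s| <= C * `|b - b'|, `|Rr b s - Rr b' s| <= C * `|b - b'| &
        `|Th b s - Th b' s| <= C * `|b - b'| ].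
Proof.
have [K [B [K0 B0 hK hB]]] := field_consts n1 pd c0 cL.
have /choice[y hy] : forall b : R, exists y, y 0 = mk3 0 b 0 /\
    solution (field F n1 c L) y.
  by move=> b; have [y] := ode_exists K0 B0 hK hB (mk3 0 b 0); exists y.
exists (fun b s => y b s i0), (fun b s => y b s i1), (fun b s => y b s i2).
split.
  move=> b; have [h1 h2] := hy b; by split; rewrite ?h1//; exact: (solution_psol h2).
move=> S; pose C := Num.sqrt (expR (2 * 3%:R * 3%:R * K * S)).
have C0 : 0 <= C by exact: sqrtr_ge0.
exists C => // b b' s hs.
suff H i : `|y b s i - y b' s i| <= C * `|b - b'| by split.
have [h1 h2] := hy b; have [h1' h2'] := hy b'.
have := ode_lipschitz K0 hK s h2 h2'.
rewrite h1 h1' !big_ord_recr !big_ord0 /= /mk3 /= !subrr !expr0n /= !addr0 !add0r.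
move=> h.
have hi : (y b s i - y b' s i) ^+ 2 <= (C * (b - b')) ^+ 2.
  apply: (@le_trans _ _ ((b - b') ^+ 2 * expR (2 * 3%:R * 3%:R * K * `|s|))).
    apply: le_trans h; have e (i' j : 'I_3) : val i' = val j -> i' = j by exact: val_inj.
    have := sqr_ge0 (y b s i0 - y b' s i0); have := sqr_ge0 (y b s i1 - y b' s i1).
    have := sqr_ge0 (y b s i2 - y b' s i2).
    set j0 := widen_ord _ _; set j1 := widen_ord _ _; set j2 := ord_max.
    have -> : j0 = i0 by exact: e.
    have -> : j1 = i1 by exact: e.
    have -> : j2 = i2 by exact: e.
    case: i => [[|[|[|//]]] hi].
    - rewrite (e (Ordinal hi) i0 erefl); lra.
    - rewrite (e (Ordinal hi) i1 erefl); lra.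
    - rewrite (e (Ordinal hi) i2 erefl); lra.
  rewrite exprMn mulrC sqr_sqrtr ?expR_ge0// ler_wpM2r ?sqr_ge0// ler_expR.
  by apply: ler_wpM2l => //; rewrite !mulr_ge0.
have : `|y b s i - y b' s i| ^+ 2 <= `|C * (b - b')| ^+ 2.
  by rewrite !real_normK ?num_real.
rewrite ler_pXn2r ?nnegrE ?normr_ge0// => h3.
by apply: le_trans h3 _; rewrite normrM (ger0_norm C0).
Qed.

Lemma psol_shift x r th t : psol c L x r th ->
  psol c L (fun s => x (s + t)) (fun s => r (s + t)) (fun s => th (s + t)).
Proof.
move=> [h1 h2 h3]; have ds (s : R) : is_derive s (1 : R) (fun s => s + t) 1.
  by apply: (D_eq (DD (DI s) (DC t s))); rewrite addr0.
split => s.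
- by apply: (D_eq (DComp (g := fun s => s + t) (h1 (s + t)) (ds s))); rewrite mulr1.
- by apply: (D_eq (DComp (g := fun s => s + t) (h2 (s + t)) (ds s))); rewrite mulr1.
- by apply: (D_eq (DComp (g := fun s => s + t) (h3 (s + t)) (ds s))); rewrite mulr1.
Qed.

Lemma kapN (x r th : R) : kap (- x) r (- th) = kap x r th.
Proof. by rewrite /kap sinN cosN sqrrN; ring. Qed.

Lemma kapD2pi (x r th : R) : kap x r (th + pi *+ 2) = kap x r th.
Proof. by rewrite /kap (sinD2pi th) (cosD2pi th). Qed.

(** Reflection in the line [x = 0] together with reversal of time. The truncation of [x] is
    symmetric so that it respects this symmetry. *)
Lemma psol_reflect x r th : psol c L x r th ->
  psol c L (fun s => - x (- s)) (fun s => r (- s)) (fun s => - th (- s)).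
Proof.
move=> [h1 h2 h3]; have ds (s : R) : is_derive s (1 : R) (fun s => - s) (- 1).
  exact: DN (DI s).
have L0 : 0 <= L by have := c0; have := cL; lra.
split => s.
- by apply: (D_eq (DN (DComp (g := fun s => - s) (h1 (- s)) (ds s)))); rewrite cosN; ring.
- by apply: (D_eq (DComp (g := fun s => - s) (h2 (- s)) (ds s))); rewrite sinN; ring.
- apply: (D_eq (DN (DComp (g := fun s => - s) (h3 (- s)) (ds s)))).
  by rewrite clipN// kapN; ring.
Qed.

Lemma psol_D2pi x r th : psol c L x r th ->
  psol c L x r (fun s => th s + pi *+ 2).
Proof.
move=> [h1 h2 h3]; split => s.
- by rewrite (cosD2pi (th s)).
- by rewrite (sinD2pi (th s)).
- by rewrite kapD2pi; apply: (D_eq (DD (h3 s) (DC (pi *+ 2) s))); rewrite addr0.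
Qed.

Lemma psol_unique x r th x' r' th' : psol c L x r th -> psol c L x' r' th' ->
  x 0 = x' 0 -> r 0 = r' 0 -> th 0 = th' 0 -> [/\ x = x', r = r' & th = th'].
Proof.
move=> h h' e1 e2 e3; have [K [B [K0 B0 hK hB]]] := field_consts n1 pd c0 cL.
have E : Y x r th = Y x' r' th'.
  apply: (ode_unique K0 hK (psol_solution h) (psol_solution h')).
  by rewrite /Y e1 e2 e3.
split; apply/funext => s.
- by have := congr1 (fun y => y s i0) E.
- by have := congr1 (fun y => y s i1) E.
- by have := congr1 (fun y => y s i2) E.
Qed.

End Solutions.

Section Identities.
Variables (c L : R) (x r th : R -> R).
Hypothesis c0 : 0 < c.
Hypothesis cL : c <= L.
Hypothesis ps : psol c L x r th.
Implicit Type s : R.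

(** In terms of position and unit tangent, [kk] is the radial speed and [qq] the angular momentum,
    which is the support function up to sign. The weight [ww] is the area density of the rotated
    hypersurface in the conformal metric up to a constant: profile curves are geodesics for length
    weighted by [ww]. *)
Definition rho2 s := x s ^+ 2 + r s ^+ 2.
Definition qq s := x s * sin (th s) - r s * cos (th s).
Definition kk s := x s * cos (th s) + r s * sin (th s).
Definition ww s := r s ^+ n1 * expR (- (f (rho2 s) / 4)).
Definition kp s := kap (clip (- L) L (x s)) (clip c L (r s)) (th s).

Lemma kpE s : box c L (x s) (r s) -> kp s = kap (x s) (r s) (th s).
Proof. exact: kap_box. Qed.

Lemma x_cont s : {for s, continuous x}. Proof. exact: D_cont (ps_x ps s). Qed.
Lemma r_cont s : {for s, continuous r}. Proof. exact: D_cont (ps_r ps s). Qed.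
Lemma th_cont s : {for s, continuous th}. Proof. exact: D_cont (ps_th ps s). Qed.

Lemma D_qq s : is_derive s (1 : R) qq (kk s * kp s).
Proof.
apply: (D_eq (DB (DM (ps_x ps s) (Dsin (ps_th ps s)))
                 (DM (ps_r ps s) (Dcos (ps_th ps s))))).
by rewrite /kk /kp; ring.
Qed.

Lemma cs1 (t : R) : cos t ^+ 2 = 1 - sin t ^+ 2.
Proof. by rewrite -(cos2Dsin2 t); ring. Qed.

Lemma D_kk s : is_derive s (1 : R) kk (1 - qq s * kp s).
Proof.
apply: (D_eq (DD (DM (ps_x ps s) (Dcos (ps_th ps s)))
                 (DM (ps_r ps s) (Dsin (ps_th ps s))))).
by rewrite /qq -(cos2Dsin2 (th s)) /kp; ring.
Qed.

Lemma D_rho2 s : is_derive s (1 : R) rho2 (2 * kk s).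
Proof.
apply: (D_eq (DD (DX 2 (ps_x ps s)) (DX 2 (ps_r ps s)))).
by rewrite /kk; ring.
Qed.

Lemma rho2_gt0 s : 0 < r s -> 0 < rho2 s.
Proof. by move=> h; have := sqr_ge0 (x s); rewrite /rho2; nra. Qed.

Lemma qk s : rho2 s = qq s ^+ 2 + kk s ^+ 2.
Proof.
have := cs1 (th s); rewrite /rho2 /qq /kk => e.
have -> : (x s * sin (th s) - r s * cos (th s)) ^+ 2 +
  (x s * cos (th s) + r s * sin (th s)) ^+ 2 =
  (x s ^+ 2 + r s ^+ 2) * (cos (th s) ^+ 2 + sin (th s) ^+ 2) by ring.
by rewrite cos2Dsin2 mulr1.
Qed.

Lemma cos_qk s : rho2 s * cos (th s) = kk s * x s - qq s * r s.
Proof.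
have -> : kk s * x s - qq s * r s = rho2 s * cos (th s) by rewrite /kk /qq /rho2; ring.
by [].
Qed.

Lemma D_ww s : 0 < r s -> is_derive s (1 : R) ww
  (ww s * (N * sin (th s) / r s - F (rho2 s) * kk s / 2)).
Proof.
move=> r0; have h := pd_f pd (rho2_gt0 r0).
apply: (D_eq (DM (DX n1 (ps_r ps s))
  (Dexp (DN (DM (DComp h (D_rho2 s)) (DC 4^-1 s)))))).
have e : r s ^+ n1 = r s ^+ n1.-1 * r s by rewrite -exprSr prednK.
rewrite /ww e; move: (r s ^+ n1.-1) (expR _) (F _) (sin _) => p E G S.
by field; rewrite gt_eqF.
Qed.

Lemma ww_gt0 s : 0 < r s -> 0 < ww s.
Proof. by move=> h; rewrite /ww mulr_gt0 ?exprn_gt0 ?expR_gt0. Qed.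

Definition wcos s := ww s * cos (th s).
Definition wq s := ww s * qq s.

(** The momentum of the weighted geodesic along the [x]-axis; its rate of change is the
    [x]-derivative of the weight. *)
Lemma D_wcos s : box c L (x s) (r s) ->
  is_derive s (1 : R) wcos (- (ww s * F (rho2 s) * x s / 2)).
Proof.
move=> hb; have r0 : 0 < r s by case: hb; have := c0; lra.
apply: (D_eq (DM (D_ww r0) (Dcos (ps_th ps s)))).
rewrite -/(kp s) kpE// /kap -/(rho2 s) /kk.
have := cs1 (th s); move: (cos (th s)) (sin (th s)) (F _) (ww _) => C S G w e.
transitivity (- (w * G * x s / 2) * (C ^+ 2 + S ^+ 2)); last by rewrite e subrK mulr1.
by field; rewrite gt_eqF.
Qed.

(** The momentum of the weighted geodesic under rotations of the half plane. The factor depending on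
    [f] is invariant under them, so only the factor [r ^ n1] contributes. *)
Lemma D_wq s : box c L (x s) (r s) ->
  is_derive s (1 : R) wq (ww s * N * x s / r s).
Proof.
move=> hb; have r0 : 0 < r s by case: hb; have := c0; lra.
apply: (D_eq (DM (D_ww r0) (D_qq s))).
rewrite kpE// /kap -/(rho2 s) /kk /qq.
have := cs1 (th s); move: (cos (th s)) (sin (th s)) (F _) (ww _) => C S G w e.
transitivity (w * N * x s / r s * (C ^+ 2 + S ^+ 2)); last by rewrite e subrK mulr1.
by field; rewrite gt_eqF.
Qed.

Lemma D_yy s : 0 < r s ->
  is_derive s (1 : R) (fun s => x s / r s) (- (qq s / r s ^+ 2)).
Proof.
move=> r0; have rn : r s != 0 by rewrite gt_eqF.
apply: (D_eq (DM (ps_x ps s) (DV rn (ps_r ps s)))).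
by rewrite /qq; field.
Qed.

Lemma ww_cont s : 0 < r s -> {for s, continuous ww}.
Proof. by move=> h; exact: D_cont (D_ww h). Qed.

Lemma wcos_cont s : 0 < r s -> {for s, continuous wcos}.
Proof. by move=> h; exact: D_cont (DM (D_ww h) (Dcos (ps_th ps s))). Qed.

Lemma wq_cont s : 0 < r s -> {for s, continuous wq}.
Proof. by move=> h; exact: D_cont (DM (D_ww h) (D_qq s)). Qed.

End Identities.
End Profile.

(** * Arcs leaving the line [x = 0] *)

Section Arcs.
Variables (R : realType) (m M : R) (f F F1 : R -> R) (n1 : nat).
Hypothesis pd : profile_data m M f F F1.
Hypothesis n1_gt0 : (0 < n1)%N.
Local Notation N := (n1%:R : R).

Lemma closure_le (g : R -> R) (l a : R) : 0 < l -> {for l, continuous g} ->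
  (forall s, 0 < s < l -> g s <= a) -> g l <= a.
Proof.
move=> l0 hc hg; rewrite leNgt; apply/negP => h.
have h' : 0 < g l - a by rewrite subr_gt0.
have [d d0 hd] := cont_eps hc h'.
pose e := Num.min (d / 2) (l / 2).
have e0 : 0 < e by rewrite lt_min; apply/andP; split; lra.
have ed : e <= d / 2 by rewrite ge_min lexx.
have el : e <= l / 2 by rewrite ge_min lexx orbT.
have hs : 0 < l - e < l by apply/andP; split; lra.
have h1 := hg _ hs.
have h2 : `|l - e - l| < d.
  by rewrite (_ : l - e - l = - e) ?normrN ?gtr0_norm//; [lra|ring].
by have := hd _ h2; rewrite ltr_norml => /andP[]; lra.
Qed.

Lemma closure_ge (g : R -> R) (l a : R) : 0 < l -> {for l, continuous g} ->
  (forall s, 0 < s < l -> a <= g s) -> a <= g l.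
Proof.
move=> l0 hc hg; rewrite -lerN2; apply: (@closure_le (fun s => - g s) l) => //.
  exact: cvgN.
by move=> s hs; rewrite lerN2 hg.
Qed.

Lemma cos_sin_sum (C S : R) : 0 <= C -> 0 <= S -> C ^+ 2 + S ^+ 2 = 1 -> 1 <= C + S.
Proof. by move=> c0 s0 h; rewrite leNgt; apply/negP => h1; nra. Qed.

(* [k >= 0] says that the distance to the origin does not decrease. *)
Definition good (L : R) (x r th : R -> R) (l : R) := forall s : R, 0 < s < l ->
  [/\ 0 < x s, 0 <= kk x r th s, 0 <= th s & rho2 x r s <= L ^+ 2].

Record arc (c L b l : R) (x r th : R -> R) : Prop := {
  arc_c0 : 0 < c; arc_cL : c <= L; arc_cb : c <= b; arc_l0 : 0 < l;
  arc_ps : psol F n1 c L x r th;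
  arc_x0 : x 0 = 0; arc_r0 : r 0 = b; arc_t0 : th 0 = 0;
  arc_gd : good L x r th l }.

Section Good.
Variables (c L b l : R) (x r th : R -> R).
Hypothesis A : arc c L b l x r th.
Let c0 := arc_c0 A.
Let cL := arc_cL A.
Let cb := arc_cb A.
Let l0 := arc_l0 A.
Let ps := arc_ps A.
Let x0 := arc_x0 A.
Let r0 := arc_r0 A.
Let t0 := arc_t0 A.
Let gd := arc_gd A.
Local Notation kk := (kk x r th).
Local Notation qq := (qq x r th).
Local Notation rho2 := (rho2 x r).
Local Notation ww := (ww f n1 x r).
Local Notation wcos := (wcos f n1 x r th).
Local Notation wq := (wq f n1 x r th).

(** If the angle reached [pi] inside the arc, the radial speed there would be [- x < 0]. *)
Lemma th_lt_pi s : 0 < s < l -> th s < pi.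
Proof.
move=> /andP[s0 sl]; rewrite ltNge; apply/negP => h.
have [||t /andP[ht1 ht2] ht] := @ivt _ th 0 s pi (ltW s0).
- by move=> u _; exact: th_cont ps u.
- by rewrite t0 pi_ge0.
have tpos : 0 < t.
  rewrite lt_neqAle ht1 andbT; apply/eqP => e; move: ht; rewrite -e t0.
  by have := pi_gt0 R; lra.
have htl : 0 < t < l by rewrite tpos; lra.
have [h1 h2 _ _] := gd htl.
by move: h2; rewrite /kk ht sinpi cospi; lra.
Qed.

Lemma sin_th_ge0 s : 0 < s < l -> 0 <= sin (th s).
Proof.
move=> hs; have [_ _ h _] := gd hs.
by apply: sin_ge0_pi; rewrite h ltW// th_lt_pi.
Qed.

Lemma r_le s t : 0 <= s -> s <= t -> t <= l -> r s <= r t.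
Proof.
move=> s0 st tl; apply: (mono_le st (f' := fun s => sin (th s))).
- by move=> u _; exact: r_cont ps u.
- by move=> u _; exact: ps_r ps u.
- by move=> u /andP[h1 h2]; rewrite sin_th_ge0// (le_lt_trans s0 h1) (lt_le_trans h2 tl).
Qed.

Lemma r_ge s : 0 <= s <= l -> b <= r s.
Proof. by move=> /andP[h1 h2]; rewrite -r0; exact: r_le. Qed.

Lemma r_gt0 s : 0 <= s <= l -> 0 < r s.
Proof. by move=> /r_ge; have := c0; have := cb; lra. Qed.

Lemma rho2_le s t : 0 <= s -> s <= t -> t <= l -> rho2 s <= rho2 t.
Proof.
move=> s0 st tl; apply: (mono_le st (f' := fun s => 2 * kk s)).
- by move=> u _; exact: D_cont (D_rho2 ps u).
- by move=> u _; exact: D_rho2 ps u.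
- move=> u /andP[h1 h2].
  have hu : 0 < u < l by rewrite (le_lt_trans s0 h1) (lt_le_trans h2 tl).
  by have [_ h _ _] := gd hu; rewrite mulr_ge0.
Qed.

Lemma rho2_L s : 0 <= s <= l -> rho2 s <= L ^+ 2.
Proof.
move=> /andP[s0 sl]; apply: le_trans (rho2_le s0 sl (lexx l)) _.
apply: (@closure_le rho2) => //; first exact: D_cont (D_rho2 ps l).
by move=> u /gd[].
Qed.

Lemma in_box s : 0 <= s <= l -> box c L (x s) (r s).
Proof.
by move=> hs; split; [have := r_ge hs; have := cb; lra|exact: rho2_L].
Qed.

Lemma x_ge0 s : 0 <= s <= l -> 0 <= x s.
Proof.
move=> /andP[]; rewrite le_eqVlt => /predU1P[<-|s0 sl]; first by rewrite x0.
apply: (@closure_ge x s) => //; first exact: x_cont ps s.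
by move=> u /andP[h1 h2]; have [|h _ _ _] := gd (s := u); [apply/andP; split; lra|exact: ltW].
Qed.

Lemma xr_le s : 0 <= s <= l -> x s <= L /\ r s <= L.
Proof.
move=> hs; have h1 := rho2_L hs; have h2 := x_ge0 hs; have h3 := r_gt0 hs.
have L0 : 0 < L by have := c0; have := cL; lra.
by move: h1; rewrite /rho2 => h1; split; rewrite leNgt; apply/negP => h4; nra.
Qed.

Lemma F_gt0 s : 0 <= s <= l -> 0 < F (rho2 s).
Proof.
move=> hs; have h := pd_lo pd (rho2_gt0 x (r_gt0 hs)).
by apply: lt_le_trans h; exact: pd_m pd.
Qed.

Lemma wcos_lt s t : 0 <= s -> s < t -> t <= l -> wcos t < wcos s.
Proof.
move=> s0 st tl; rewrite -ltrN2.
have hu u : s <= u <= t -> 0 <= u <= l by move=> /andP[h1 h2]; apply/andP; split; lra.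
have hu' u : s < u < t -> 0 <= u <= l by move=> /andP[h1 h2]; apply/andP; split; lra.
apply: (mono_lt st (f := fun s => - wcos s)
  (f' := fun s => - - (ww s * F (rho2 s) * x s / 2))).
- move=> u h; apply: cvgN; apply: (wcos_cont pd n1_gt0 ps); exact: r_gt0 (hu u h).
- move=> u h; exact: DN (D_wcos pd n1_gt0 c0 cL ps (in_box (hu' u h))).
- move=> u h; rewrite opprK; have h1 := hu' u h.
  have hu2 : 0 < u < l by move: h => /andP[h2 h3]; apply/andP; split; lra.
  have [h4 _ _ _] := gd hu2.
  have a1 := F_gt0 h1; have a2 := ww_gt0 f n1 x (r_gt0 h1).
  by apply: divr_gt0 => //; apply: mulr_gt0 => //; exact: mulr_gt0.
Qed.

(** Since [wcos] is strictly decreasing, [cos th] changes sign at most once: the arc moves away from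
    the line [x = 0], then back towards it. *)
Lemma cos_gt0_before s t : 0 <= s -> s < t -> t <= l -> 0 <= cos (th t) ->
  0 < cos (th s).
Proof.
move=> s0 st tl h; have h1 := wcos_lt s0 st tl.
have rs : 0 < r s by apply: r_gt0; apply/andP; split; lra.
have rt : 0 < r t by apply: r_gt0; apply/andP; split; lra.
have h2 : 0 <= wcos t by rewrite mulr_ge0// ltW// ww_gt0.
by have : 0 < wcos s; [lra|rewrite pmulr_rgt0// ww_gt0].
Qed.

Lemma x_lt_cos s t : 0 <= s -> s < t -> t <= l -> 0 <= cos (th t) -> x s < x t.
Proof.
move=> s0 st tl h; apply: (mono_lt st (f' := fun s => cos (th s))).
- by move=> u _; exact: x_cont ps u.
- by move=> u _; exact: ps_x ps u.
- by move=> u /andP[h1 h2]; apply: (@cos_gt0_before u t) => //; lra.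
Qed.

Lemma cos_end_lt0 : x l = 0 -> cos (th l) < 0.
Proof.
move=> xl; rewrite ltNge; apply/negP => h.
by have := x_lt_cos (lexx 0) l0 (lexx l) h; rewrite x0 xl ltxx.
Qed.

(** The nose is the point of the arc farthest from the line [x = 0]. It separates the rising part,
    where [x] grows, from the falling part. *)
Lemma nose : cos (th l) < 0 -> exists2 s, 0 < s < l & cos (th s) = 0.
Proof.
move=> h.
have [||s /andP[s1 s2] hs] := @ivt_neg _ (fun s => cos (th s)) 0 l 0 (ltW l0).
- by move=> u _; exact: D_cont (Dcos (ps_th ps u)).
- by rewrite t0 cos0 ler01 ltW.
exists s => //; apply/andP; split; rewrite lt_neqAle ?s1 ?s2 andbT; apply/eqP => e.
  by move: hs; rewrite -e t0 cos0 => /eqP; rewrite oner_eq0.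
by move: h; rewrite -e hs ltxx.
Qed.

Lemma th_le_pi : th l <= pi.
Proof.
apply: closure_le => //; first exact: th_cont ps l.
by move=> s /th_lt_pi/ltW.
Qed.

(** On the rising part sine and cosine are nonnegative and their sum is at least [1], so [x + r]
    grows at least at unit rate. On the falling part the same holds for [r - x]. *)
Lemma length_rising s : 0 <= s <= l -> 0 <= cos (th s) -> s <= 2 * L.
Proof.
move=> hs h; have /andP[s0 sl] := hs.
have [hx hr] := xr_le hs; have bp : 0 < b by exact: lt_le_trans cb.
have dp s := DB (DD (ps_x ps s) (ps_r ps s)) (DI s).
suff : x 0 + r 0 - 0 <= x s + r s - s by rewrite x0 r0; lra.
apply: (mono_le s0 (f := fun s => x s + r s - s)
    (f' := fun s => cos (th s) + sin (th s) - 1)).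
- by move=> u _; exact: D_cont (dp u).
- move=> u /andP[h1 h3]; rewrite subr_ge0; apply: cos_sin_sum.
  + by apply: ltW; apply: (@cos_gt0_before u s) => //; exact: ltW.
  + by apply: sin_th_ge0; rewrite h1 (lt_le_trans h3).
  + exact: cos2Dsin2.
Qed.

Lemma falling_gain s t : 0 <= s -> s <= t -> t <= l -> cos (th s) = 0 ->
  r s - x s - s <= r t - x t - t.
Proof.
move=> s0 st tl h.
have dm s := DB (DB (ps_r ps s) (ps_x ps s)) (DI s).
apply: (mono_le st (f := fun s => r s - x s - s)
    (f' := fun s => sin (th s) - cos (th s) - 1)).
- by move=> u _; exact: D_cont (dm u).
- move=> u /andP[h1 h3]; have ul := lt_le_trans h3 tl.
  rewrite subr_ge0 addrC; apply: cos_sin_sum.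
  + rewrite oppr_ge0 leNgt; apply/negP => h4.
    by have := @cos_gt0_before s u s0 h1 (ltW ul) (ltW h4); rewrite h ltxx.
  + by apply: sin_th_ge0; rewrite (le_lt_trans s0 h1).
  + by rewrite sqrrN cos2Dsin2.
Qed.

Lemma length_falling s : 0 <= s <= l -> cos (th s) = 0 -> l - s <= 2 * L.
Proof.
move=> hs h; have /andP[s0 sl] := hs.
have [hx hr] := xr_le hs; have hl : 0 <= l <= l by rewrite lexx ltW.
have [_ hrl] := xr_le hl; have xl := x_ge0 hl; have rs := r_gt0 hs.
by have := falling_gain s0 sl (lexx l) h; lra.
Qed.

Lemma arc_length : l <= 4 * L.
Proof.
have hl : 0 <= l <= l by rewrite lexx ltW.
have L0 : 0 < L := lt_le_trans c0 cL.
have [h|h] := leP 0 (cos (th l)).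
  by have := length_rising hl h; lra.
have [s /andP[s0 sl] hs] := nose h.
have hs' : 0 <= s <= l by rewrite !ltW.
have := length_rising hs'; rewrite hs lexx => /(_ isT).
by have := length_falling hs' hs; lra.
Qed.

End Good.
End Arcs.

(** * A priori bound for the radius at the return *)

Section Bound.
Variables (R : realType) (m M : R) (f F F1 : R -> R) (n1 : nat).
Hypothesis pd : profile_data m M f F F1.
Hypothesis n1_gt0 : (0 < n1)%N.
Local Notation N := (n1%:R : R).

Lemma f_le (u v : R) : 0 < u -> u <= v -> f u <= f v.
Proof.
move=> u0 uv; apply: (mono_le uv (f' := F)).
- by move=> s /andP[s1 _]; apply: D_cont (pd_f pd _); lra.
- by move=> s /andP[s1 _]; apply: (pd_f pd); lra.
- move=> s /andP[s1 _]; have s0 : 0 < s by lra.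
  by apply: le_trans (pd_lo pd s0); exact: ltW (pd_m pd).
Qed.

Lemma f_ge (u : R) : 1 <= u -> f 1 + m * (u - 1) <= f u.
Proof.
move=> u1; have dm (s : R) : is_derive s (1 : R) (fun s => m * s) m.
  by apply: (D_eq (DM (DC m s) (DI s))); ring.
have df s (h : 0 < s) := DB (pd_f pd h) (dm s).
have : f 1 - m * 1 <= f u - m * u.
  apply: (mono_le u1 (f := fun s => f s - m * s) (f' := fun s => F s - m)).
  - by move=> s /andP[s1 _]; apply: D_cont (df s _); lra.
  - by move=> s /andP[s1 _]; apply: df; lra.
  - by move=> s /andP[s1 _]; have := pd_lo pd (_ : 0 < s); rewrite subr_ge0; apply; lra.
lra.
Qed.

(** Since [f' >= m > 0], the exponent grows at least linearly in [rho ^ 2], hence in [rho], and the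
    exponential beats every power. *)
Lemma weight_decay (p : nat) (e : R) : 0 < e -> exists2 T, 1 <= T &
  forall rho, T <= rho -> rho ^+ p * expR (- (f (rho ^+ 2) / 4)) < e.
Proof.
move=> e0; have m0 := pd_m pd.
(* The exponential is split into [p + 1] equal factors, each at most [1 / (a * rho)]. *)
pose a := m / 4 / p.+1%:R.
have a0 : 0 < a by rewrite !divr_gt0.
pose K := expR (- ((f 1 - m) / 4)).
have K0 : 0 < K by exact: expR_gt0.
pose T := 1 + K / a ^+ p.+1 / e.
have T1 : 1 <= T by rewrite lerDl !divr_ge0 ?exprn_ge0// ltW.
exists T => // rho hT.
have rho1 : 1 <= rho by lra.
have h1 : expR (- (f (rho ^+ 2) / 4)) <= K * expR (- (a * rho)) ^+ p.+1.
  rewrite -expRM_natl /K -expRD ler_expR.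
  have := f_ge (_ : 1 <= rho ^+ 2); rewrite exprn_ege1// => /(_ isT) hf.
  have -> : p.+1%:R * - (a * rho) = - (m / 4 * rho).
    have aux (P : R) : P != 0 -> P * - (m / 4 / P * rho) = - (m / 4 * rho) by move=> hP; field.
    by rewrite /a aux// pnatr_eq0.
  have : rho <= rho ^+ 2 by nra.
  by move=> h; have := mulr_ge0 (ltW m0) (_ : 0 <= rho ^+ 2 - rho); rewrite subr_ge0 => /(_ h); lra.
have h2 : expR (- (a * rho)) <= (a * rho)^-1.
  rewrite expRN lef_pV2 ?posrE ?expR_gt0 ?mulr_gt0//; last by lra.
  by have := expR_ge1Dx (a * rho); lra.
have ar0 : 0 < a * rho by rewrite mulr_gt0//; lra.
have rp : 0 < rho ^+ p by rewrite exprn_gt0//; lra.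
apply: (@le_lt_trans _ _ (rho ^+ p * (K * (a * rho)^-1 ^+ p.+1))).
  rewrite ler_wpM2l ?(ltW rp)//; apply: le_trans h1 _.
  rewrite ler_wpM2l ?(ltW K0)// ler_pXn2r ?nnegrE ?expR_ge0 ?invr_ge0 ?(ltW ar0)//.
have -> : rho ^+ p * (K * (a * rho)^-1 ^+ p.+1) = K / a ^+ p.+1 / rho.
  rewrite exprVn exprMn (exprS rho); field.
  have rho0 : 0 < rho by lra.
  by rewrite !gt_eqF ?exprn_gt0.
rewrite ltr_pdivrMr; last by lra.
by rewrite [e * _]mulrC -ltr_pdivrMr//; move: hT; rewrite /T; lra.
Qed.

(* Early behaviour: the angular momentum [q] is still negative and the slope
   [x / r] is already bounded below. *)
Lemma arc_start (c B : R) : 0 < c -> c <= B -> exists s0 y0,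
  [/\ 0 < s0, 0 < y0 & forall L b l x r th, b <= B -> arc F n1 c L b l x r th ->
    x l = 0 -> [/\ s0 < l, qq x r th s0 < 0 & y0 * r s0 <= x s0]].
Proof.
move=> c0 cB; have M0 : 0 <= M.
  by have := pd_lo pd c0; have := pd_hi pd c0; have := pd_m pd; lra.
pose C1 := N / c + M / 2 * (B + 2) + 1.
have NC : 0 <= N / c by rewrite divr_ge0// ltW.
have MB : 0 <= M / 2 * (B + 2) by rewrite mulr_ge0//; lra.
(* [C1] bounds the curvature as long as [x <= 1] and [c <= r <= B + 1]; with [s0] chosen below, the
   angle stays at most [1 / 2] up to time [s0]. *)
have C10 : 0 < C1 by rewrite /C1; lra.
pose s0 := Num.min (C1^-1 / 2) (Num.min (c / 2) 1).
have s00 : 0 < s0 by rewrite !lt_min divr_gt0 ?invr_gt0//= divr_gt0//=.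
have s0C : C1 * s0 <= 1 / 2.
  apply: (@le_trans _ _ (C1 * (C1^-1 / 2))).
    by rewrite ler_pM2l// ge_min lexx.
  by rewrite mulrA divff ?gt_eqF.
have s0c : s0 <= c / 2 by rewrite !ge_min lexx orbT.
have s01 : s0 <= 1 by rewrite !ge_min lexx !orbT.
exists s0, (s0 / 2 / (B + 1)); split => //.
  by rewrite !divr_gt0//; lra.
move=> L b l x r th bB A xl; case: (A) => _ cL cb l0 ps x0 r0 t0 gd.
(* That the arc lasts beyond [s0] is not yet known. It follows once [x s >= s / 2] holds up to [l'],
   because [x] vanishes at [l]. *)
pose l' := Num.min s0 l.
have l's0 : l' <= s0 by rewrite ge_min lexx.
have l'l : l' <= l by rewrite ge_min lexx orbT.
have dc (C s : R) : is_derive s (1 : R) (fun s => C * s) C.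
  by apply: (D_eq (DM (DC C s) (DI s))); ring.
have hb s : 0 <= s <= l' -> 0 <= s <= l by move=> /andP[? ?]; apply/andP; split; lra.
have xs s : 0 <= s <= l' -> x s <= s.
  move=> /andP[s1 s2]; have : s - x s >= 0 - x 0.
    apply: (mono_le s1 (f := fun s => s - x s) (f' := fun s => 1 - cos (th s))).
    - by move=> u _; exact: D_cont (DB (DI u) (ps_x ps u)).
    - by move=> u _; exact: DB (DI u) (ps_x ps u).
    - by move=> u _; rewrite subr_ge0 cos_le1.
  by rewrite x0; lra.
have rs s : 0 <= s <= l' -> r s <= B + 1.
  move=> /andP[s1 s2]; have : s - r s >= 0 - r 0.
    apply: (mono_le s1 (f := fun s => s - r s) (f' := fun s => 1 - sin (th s))).
    - by move=> u _; exact: D_cont (DB (DI u) (ps_r ps u)).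
    - by move=> u _; exact: DB (DI u) (ps_r ps u).
    - by move=> u _; rewrite subr_ge0 sin_le1.
  by rewrite r0; lra.
have rc s : 0 <= s <= l' -> c <= r s.
  by move=> hs; have := r_ge A (hb s hs); lra.
have x_0 s : 0 <= s <= l' -> 0 <= x s.
  by move=> hs; exact: (x_ge0 A (hb s hs)).
have kb s : 0 <= s <= l' -> kp F n1 c L x r th s <= C1.
  move=> hs; rewrite (kpE _ _ _ c0 cL); last exact: (in_box A (hb s hs)).
  have h1 := xs s hs; have h2 := rs s hs; have h3 := rc s hs; have h4 := x_0 s hs.
  have rp : 0 < r s by lra.
  have h5 : N * cos (th s) / r s <= N / c.
    apply: (@le_trans _ _ (N / r s)).
      by rewrite ler_pM2r ?invr_gt0// ler_piMr// cos_le1.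
    by rewrite ler_wpM2l// lef_pV2.
  have h6 : x s * sin (th s) - r s * cos (th s) <= B + 2.
    have := ler_wpM2l h4 (sin_le1 (th s)).
    have := ler_wpM2l (ltW rp) (cos_geN1 (th s)).
    by move: hs => /andP[_ hs]; lra.
  have hF1 := pd_lo pd (rho2_gt0 x rp); have hF2 := pd_hi pd (rho2_gt0 x rp).
  rewrite /kap -/(rho2 x r s) /C1.
  have m0 := pd_m pd.
  suff : F (rho2 x r s) / 2 * (x s * sin (th s) - r s * cos (th s)) <= M / 2 * (B + 2) by lra.
  apply: (@le_trans _ _ (F (rho2 x r s) / 2 * (B + 2))).
    by apply: ler_wpM2l => //; lra.
  by apply: ler_wpM2r; lra.
have ths s : 0 <= s <= l' -> th s <= C1 * s.
  move=> /andP[s1 s2]; have : C1 * s - th s >= C1 * 0 - th 0.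
    apply: (mono_le s1 (f := fun s => C1 * s - th s)
      (f' := fun s => C1 - kp F n1 c L x r th s)).
    - by move=> u _; exact: D_cont (DB (dc C1 u) (ps_th ps u)).
    - by move=> u _; exact: DB (dc C1 u) (ps_th ps u).
    - by move=> u /andP[u1 u2]; rewrite subr_ge0; apply: kb; apply/andP; split; lra.
  by rewrite t0 mulr0; lra.
have th_0 s : 0 <= s <= l' -> 0 <= th s.
  move=> /andP[]; rewrite le_eqVlt => /predU1P[<-|s1 s2]; first by rewrite t0.
  apply: (@closure_ge _ th s) => //; first exact: th_cont ps s.
  move=> u /andP[h1 h2]; have hu : 0 < u < l by apply/andP; split; lra.
  by have [_ _ h _] := gd _ hu.
have thb s : 0 <= s <= l' -> th s <= 1 / 2.
  move=> hs; apply: le_trans (ths s hs) _; apply: le_trans s0C.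
  by rewrite ler_pM2l//; case/andP: hs; lra.
have cosb s : 0 <= s <= l' -> 1 / 2 <= cos (th s).
  move=> hs; have := cos_lip 0 (th s); rewrite cos0 sub0r normrN.
  rewrite (ger0_norm (th_0 s hs)) ler_norml => /andP[_].
  by have := thb s hs; lra.
have xb s : 0 <= s <= l' -> s / 2 <= x s.
  move=> /andP[s1 s2]; have : x s - 2^-1 * s >= x 0 - 2^-1 * 0.
    apply: (mono_le s1 (f := fun s => x s - 2^-1 * s) (f' := fun s => cos (th s) - 2^-1)).
    - by move=> u _; exact: D_cont (DB (ps_x ps u) (dc 2^-1 u)).
    - by move=> u _; exact: DB (ps_x ps u) (dc 2^-1 u).
    - move=> u /andP[u1 u2]; have := cosb u; rewrite (ltW u1) /= => H.
      by have := H ltac:(lra); lra.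
  by rewrite x0 mulr0; lra.
have s0l : s0 < l.
  rewrite ltNge; apply/negP => h.
  have e : l' = l by apply: min_idPr.
  by have := xb l; rewrite e lexx (ltW l0) => /(_ isT); rewrite xl; lra.
have e : l' = s0 by apply: min_idPl; exact: ltW.
have hs0 : 0 <= s0 <= l' by rewrite e lexx ltW.
split=> //.
  have h1 := xs _ hs0; have h2 := rc _ hs0; have h3 := cosb _ hs0.
  have h4 := sin_le1 (th s0); have h5 := x_0 _ hs0.
  have h6 : sin (th s0) <= 1 / 2.
    have := sin_lip (th s0) 0; rewrite sin0 !subr0 (ger0_norm (th_0 _ hs0)).
    have := ler_norm (sin (th s0)); have := thb _ hs0; lra.
  have h7 : x s0 * sin (th s0) <= c / 2 * (1 / 2).
    apply: (@le_trans _ _ (x s0 * (1 / 2))); first by apply: ler_wpM2l.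
    by apply: ler_wpM2r; lra.
  have h8 : c * (1 / 2) <= r s0 * cos (th s0).
    by apply: ler_pM => //; lra.
  by rewrite /qq; lra.
apply: le_trans (xb _ hs0); rewrite -[leRHS]mulr1 -mulrA.
apply: ler_wpM2l; first by lra.
rewrite mulrC ler_pdivrMr; last by lra.
by rewrite mul1r; exact: rs.
Qed.

End Bound.

Section Bound2.
Variables (R : realType) (m M : R) (f F F1 : R -> R) (n1 : nat).
Hypothesis pd : profile_data m M f F F1.
Hypothesis n1_gt0 : (0 < n1)%N.
Local Notation N := (n1%:R : R).

Lemma quot_ge0 (w k y z : R) : 0 < w -> 1 <= k -> 0 <= y -> 0 < z ->
  0 <= w * k * y / z.
Proof.
move=> w0 k1 y0 z0; apply: divr_ge0; last exact: ltW.
by apply: mulr_ge0 => //; apply: mulr_ge0; [exact: ltW|lra].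
Qed.

(* At the point where [q = 0] the tangent is radial. From there on
   [th + r1^2 (m / 4) (x / r)] is nondecreasing, which bounds that point. *)
Lemma arc_middle (c L b l : R) x r th (s1 y0 : R) :
  arc F n1 c L b l x r th -> x l = 0 -> 0 < s1 < l -> qq x r th s1 = 0 ->
  0 < y0 -> y0 * r s1 <= x s1 ->
  rho2 x r s1 <= 4 * N / m + 4 * pi / (m * y0) + (4 * pi / (m * c)) ^+ 2.
Proof.
move=> A xl /andP[s10 s1l] q1 y00 hy; case: (A) => c0 cL cb l0 ps x0 r0 t0 gd.
have m0 := pd_m pd; have N1 := N_ge1 R n1_gt0; have pi0 := pi_gt0 R.
have hs1 : 0 <= s1 <= l by rewrite !ltW.
have hs1' : 0 < s1 < l by rewrite s10.
have rp : 0 < r s1 by exact: r_gt0 A s1 hs1.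
have rcs : c <= r s1 by have := r_ge A hs1; lra.
have e1 : 0 <= 4 * N / m by rewrite divr_ge0// ?(ltW m0)//; lra.
have e2 : 0 <= 4 * pi / (m * y0) by rewrite divr_ge0// ?mulr_ge0 ?ltW.
have e3 : 0 <= (4 * pi / (m * c)) ^+ 2 by exact: sqr_ge0.
(* Only the case [N / rho2 < m / 4] remains; the inequality then persists, since the distance to the
   origin does not decrease. *)
have [h|h] := leP (rho2 x r s1) (4 * N / m); first by lra.
pose C := r s1 ^+ 2 * m / 4.
have C0 : 0 <= C by rewrite !mulr_ge0 ?exprn_ge0 ?ltW//; lra.
have dc (K s : R) : is_derive s (1 : R) (fun=> K) 0 by exact: DC.
have hl : 0 <= l <= l by rewrite lexx ltW.
have box_in s : s1 <= s <= l -> 0 <= s <= l by move=> /andP[h1 ->]; rewrite (le_trans (ltW s10) h1).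
have wq0 s : s1 < s < l -> 0 <= qq x r th s.
  move=> /andP[h1 h2].
  have : wq f n1 x r th s1 <= wq f n1 x r th s.
    apply: (mono_le (ltW h1) (f := wq f n1 x r th)
      (f' := fun s => ww f n1 x r s * N * x s / r s)).
    - move=> u /andP[u1 u2]; apply: (wq_cont pd n1_gt0 ps); apply: (r_gt0 A).
      by rewrite (le_trans (ltW s10) u1) (le_trans u2 (ltW h2)).
    - move=> u /andP[u1 u2]; apply: (D_wq pd n1_gt0 c0 cL ps); apply: (in_box A).
      by rewrite (ltW (lt_trans s10 u1)) (ltW (lt_trans u2 h2)).
    - move=> u /andP[u1 u2]; have hu : 0 <= u <= l.
        by rewrite (ltW (lt_trans s10 u1)) (ltW (lt_trans u2 h2)).
      have a1 := ww_gt0 f n1 x (r_gt0 A hu); have a2 := x_ge0 A hu.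
      have a3 := r_gt0 A hu.
      exact: quot_ge0.
  rewrite /wq q1 mulr0 => h3.
  have rs : 0 < r s by apply: (r_gt0 A); rewrite (ltW (lt_trans s10 h1)) ltW.
  by move: h3; rewrite pmulr_rge0// ww_gt0.
(* The curvature is at least [q * (m / 2 - m / 4)], because its rotational term is bounded below by
   [- q * N / rho2]. The derivative of [C * (x / r)] is [- q * C / r ^ 2], and [C / r ^ 2 <= m / 4]
   as [r] does not decrease. *)
have mono : th s1 + C * (x s1 / r s1) <= th l + C * (x l / r l).
  have dy s (hs : s1 <= s <= l) := DD (ps_th ps s)
    (DM (DC C s) (D_yy ps (r_gt0 A (box_in s hs)))).
  apply: (mono_le (ltW s1l) (f := fun s => th s + C * (x s / r s))
    (f' := fun s => kp F n1 c L x r th s + (0 * (x s / r s) +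
       C * - (qq x r th s / r s ^+ 2)))).
  - by move=> s hs; exact: D_cont (dy s hs).
  - by move=> s /andP[? ?]; apply: dy; rewrite !ltW.
  - move=> s hs; have q0 := wq0 s hs; case/andP: hs => h1 h2.
    have hs' : 0 < s < l by rewrite (lt_trans s10 h1) h2.
    have hs : 0 <= s <= l by rewrite !ltW//; case/andP: hs'.
    rewrite (kpE _ _ _ c0 cL (in_box A hs)) /kap -/(rho2 x r s) -/(qq x r th s).
    have rs := r_gt0 A hs; have x_s := x_ge0 A hs.
    have rr : r s1 <= r s by exact: (r_le A (ltW s10) (ltW h1) (ltW h2)).
    have rho : rho2 x r s1 <= rho2 x r s by exact: (rho2_le A (ltW s10) (ltW h1) (ltW h2)).
    have rhop := rho2_gt0 x rs.
    have [_ k0 _ _] := gd s hs'.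
    have hF := pd_lo pd rhop.
    have ecos : cos (th s) = (kk x r th s * x s - qq x r th s * r s) / rho2 x r s.
      by rewrite -cos_qk mulrC mulrA mulVf ?mul1r// gt_eqF.
    have -> : N * cos (th s) / r s = N * (kk x r th s * x s) / (rho2 x r s * r s)
        - qq x r th s * (N / rho2 x r s).
      by rewrite ecos; field; rewrite !gt_eqF.
    have a1 : 0 <= N * (kk x r th s * x s) / (rho2 x r s * r s).
      apply: divr_ge0; last by rewrite mulr_ge0 ?ltW.
      by apply: mulr_ge0; [lra|apply: mulr_ge0 => //; exact: ltW].
    have a2 : N / rho2 x r s <= m / 4.
      rewrite ler_pdivrMr//; move: h; rewrite ltr_pdivrMr// => h.
      have := ler_wpM2r (ltW m0) rho; lra.
    have a3 : C / r s ^+ 2 <= m / 4.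
      rewrite ler_pdivrMr ?exprn_gt0// /C -mulrA mulrC ler_wpM2l//; first by lra.
      by rewrite ler_pXn2r ?nnegrE// ltW.
    have -> : C * - (qq x r th s / r s ^+ 2) = - (qq x r th s * (C / r s ^+ 2)) by ring.
    have b2 := ler_wpM2l q0 a2; have b3 := ler_wpM2l q0 a3.
    have b4 := ler_wpM2r q0 hF.
    lra.
have thl := th_le_pi A; have [_ _ th1 _] := gd s1 hs1'.
rewrite xl mul0r mulr0 addr0 in mono.
have xy : C * (x s1 / r s1) = m / 4 * (x s1 * r s1).
  by rewrite /C; field; rewrite gt_eqF.
(* At the end [x = 0] and [th <= pi], so the monotone quantity is at most [pi] at [s1]. The bounds
   [x >= y0 * r] and [r >= c] then control both coordinates. *)
have xr : m / 4 * (x s1 * r s1) <= pi by rewrite -xy; lra.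
have x1 : 0 <= x s1 by exact: x_ge0 A s1 hs1.
have b1 : r s1 ^+ 2 <= 4 * pi / (m * y0).
  rewrite ler_pdivlMr ?mulr_gt0//.
  have := ler_wpM2r (ltW rp) hy; have : 0 <= m / 4 by lra.
  by move=> h4 h5; have := ler_wpM2l h4 h5; lra.
have b2 : x s1 <= 4 * pi / (m * c).
  rewrite ler_pdivlMr ?mulr_gt0//.
  have := ler_wpM2l x1 rcs; have : 0 <= m / 4 by lra.
  by move=> h4 h5; have := ler_wpM2l h4 h5; lra.
have b3 : x s1 ^+ 2 <= (4 * pi / (m * c)) ^+ 2.
  rewrite ler_pXn2r// ?nnegrE//.
  by apply: le_trans b2.
by rewrite /rho2; lra.
Qed.

End Bound2.

Lemma sqr_le_affine (R : realType) (y K : R) : y ^+ 2 <= K -> y <= K + 1.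
Proof. by have := sqr_ge0 (y - 1); rewrite sqrrB1; have := sqr_ge0 y; lra. Qed.

Lemma sqr_shift_le (R : realType) (x y x1 y1 h : R) : 0 <= x -> 0 <= y ->
  x <= x1 + h -> y <= y1 + h ->
  x ^+ 2 + y ^+ 2 <= 2 * (x1 ^+ 2 + y1 ^+ 2) + 4 * h ^+ 2.
Proof.
move=> x0 y0 hx hy; have := sqr_ge0 (x1 - h); have := sqr_ge0 (y1 - h).
have x2 : x ^+ 2 <= (x1 + h) ^+ 2 by rewrite ler_pXn2r ?nnegrE//; lra.
have r2 : y ^+ 2 <= (y1 + h) ^+ 2 by rewrite ler_pXn2r ?nnegrE//; lra.
by move: x2 r2; rewrite !sqrrB !sqrrD; lra.
Qed.

Section Bound2.
Variables (R : realType) (m M : R) (f F F1 : R -> R) (n1 : nat).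
Hypothesis pd : profile_data m M f F F1.
Hypothesis n1_gt0 : (0 < n1)%N.
Local Notation N := (n1%:R : R).

Lemma wq_mono (c L b l : R) x r th s t : arc F n1 c L b l x r th ->
  0 <= s -> s <= t -> t <= l -> wq f n1 x r th s <= wq f n1 x r th t.
Proof.
move=> A hs st tl; case: (A) => c0 cL cb l0 ps x0 r0 t0 gd.
have N1 := N_ge1 R n1_gt0.
have hin u : s <= u <= t -> 0 <= u <= l.
  by move=> /andP[h1 h2]; rewrite (le_trans hs h1) (le_trans h2 tl).
apply: (mono_le st (f := wq f n1 x r th)
    (f' := fun s => ww f n1 x r s * N * x s / r s)).
- by move=> u hu; apply: (wq_cont pd n1_gt0 ps); apply: (r_gt0 A); exact: hin.
- move=> u /andP[u1 u2]; apply: (D_wq pd n1_gt0 c0 cL ps); apply: (in_box A).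
  by apply: hin; rewrite !ltW.
- move=> u /andP[u1 u2]; have hu : 0 <= u <= l by apply: hin; rewrite !ltW.
  apply: quot_ge0 => //; [exact: ww_gt0 (r_gt0 A hu)|exact: x_ge0 A _ hu|].
  exact: r_gt0 A _ hu.
Qed.

(** The constant is a lower bound for the derivative of [wq]: in it [r] is estimated from below by
    [c] in the weight and from above by [R2 + 1] in the denominator. *)
Lemma wq_growth (c L b l : R) x r th (s1 h y R2 : R) : arc F n1 c L b l x r th ->
  0 <= s1 -> 0 < h -> s1 + h <= l -> 0 < y -> 0 < R2 ->
  (forall s, s1 < s < s1 + h -> y <= x s /\ rho2 x r s <= R2) ->
  wq f n1 x r th s1 + c ^+ n1 * expR (- (f R2 / 4)) * y / (R2 + 1) * h <=
  wq f n1 x r th (s1 + h).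
Proof.
move=> A s10 h0 hl y0 R20 hyp; case: (A) => c0 cL cb l0 ps x0 r0 t0 gd.
have N1 := N_ge1 R n1_gt0.
set g := _ / (R2 + 1).
have hin u : s1 <= u <= s1 + h -> 0 <= u <= l.
  by move=> /andP[h1 h2]; rewrite (le_trans s10 h1) (le_trans h2 hl).
have dg (s : R) : is_derive s (1 : R) (fun s => g * s) g.
  by apply: (D_eq (DM (DC g s) (DI s))); ring.
have dw s (hs : s1 <= s <= s1 + h) := DB (D_wq pd n1_gt0 c0 cL ps (in_box A (hin s hs))) (dg s).
have s1h : s1 <= s1 + h by rewrite lerDl ltW.
suff : wq f n1 x r th s1 - g * s1 <= wq f n1 x r th (s1 + h) - g * (s1 + h) by lra.
apply: (mono_le s1h (f := fun s => wq f n1 x r th s - g * s)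
    (f' := fun s => ww f n1 x r s * N * x s / r s - g)).
- by move=> s hs; exact: D_cont (dw s hs).
- by move=> s /andP[? ?]; apply: dw; rewrite !ltW.
move=> s hs; rewrite subr_ge0; have [yx hR] := hyp s hs.
have hs' : 0 <= s <= l by apply: hin; case/andP: hs => ? ?; rewrite !ltW.
have rs := r_gt0 A hs'; have rcs : c <= r s by apply: le_trans cb _; exact: r_ge A _ hs'.
have rR : r s <= R2 + 1.
  by apply: sqr_le_affine; apply: le_trans hR; rewrite /rho2 lerDr sqr_ge0.
have fR : f (rho2 x r s) <= f R2 by apply: (f_le pd) => //; exact: rho2_gt0.
have cn : 0 <= c ^+ n1 by rewrite exprn_ge0// ltW.
have R21 : 0 < R2 + 1 by rewrite addr_gt0.
rewrite /g; apply: ler_pM.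
- by rewrite !mulr_ge0 ?expR_ge0// ltW.
- by rewrite invr_ge0 ltW.
- rewrite -[X in _ <= X]mulrA; apply: ler_pM.
  + by rewrite mulr_ge0 ?expR_ge0.
  + exact: ltW.
  + rewrite /ww; apply: ler_pM; rewrite ?expR_ge0//.
      by rewrite ler_pXn2r ?nnegrE// ltW.
    by rewrite ler_expR lerN2 ler_pM2r.
  + by apply: le_trans yx _; apply: ler_peMl => //; exact: x_ge0 A s hs'.
- by rewrite lef_pV2 ?posrE.
Qed.

(** The momentum [wq] never decreases. After the point where it vanishes, [x] stays bounded below
    for a definite time, so [wq] gains a definite amount and keeps it up to the return. There [wq]
    is at most [r ^ (n1 + 1) * expR (- (f (r ^ 2) / 4))], which is small for large [r]. The bound is
    the same for every truncation [L]. *)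
Lemma arc_bound (c B : R) : 0 < c -> c <= B -> exists2 T, 0 < T &
  forall L b l x r th, b <= B -> arc F n1 c L b l x r th -> x l = 0 ->
  r l <= T.
Proof.
move=> c0 cB; have [s0 [y0 [s00 y00 hstart]]] := arc_start n1 pd c0 cB.
have m0 := pd_m pd; have N1 := N_ge1 R n1_gt0; have pi0 := pi_gt0 R.
have [R1 R1E] : exists R1, R1 = 4 * N / m + 4 * pi / (m * y0) + (4 * pi / (m * c)) ^+ 2.
  by eexists.
have R10 : 0 <= R1.
  rewrite R1E !addr_ge0 ?sqr_ge0//; first by rewrite divr_ge0 ?(ltW m0)//; lra.
  by rewrite divr_ge0 ?mulr_ge0 ?ltW.
have [xm xmE] : exists xm, xm = y0 * c by eexists.
have xm0 : 0 < xm by rewrite xmE mulr_gt0.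
have [h hE] : exists h, 2 * h = xm by exists (xm / 2); field.
have h0 : 0 < h by lra.
have [R2 R2E] : exists R2, R2 = 2 * R1 + 4 * h ^+ 2 + 1 by eexists.
have h20 : 0 <= h ^+ 2 by exact: sqr_ge0.
have R20 : 0 < R2 by rewrite R2E; lra.
have [g gE] : exists g, g = c ^+ n1 * expR (- (f R2 / 4)) * h / (R2 + 1) by eexists.
have g0 : 0 < g.
  by rewrite gE divr_gt0 ?mulr_gt0 ?exprn_gt0 ?expR_gt0//; lra.
have gh : 0 < g * h by exact: mulr_gt0.
have [T T1 hT] := weight_decay pd n1.+1 gh.
exists T; first by lra.
move=> L b l x r th bB A xl; case: (A) => _ cL cb l0 ps x0 r0 t0 gd.
have [s0l q0 yx] := hstart _ _ _ _ _ _ bB A xl.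
have hl : 0 <= l <= l by rewrite lexx ltW.
have cl := cos_end_lt0 pd n1_gt0 A xl.
have rl := r_gt0 A hl.
have ql : 0 < qq x r th l by rewrite /qq xl; have := mulr_gt0 rl (_ : 0 < - cos (th l)); lra.
have [||s1 /andP[s01 s1l] q1] := @ivt _ (qq x r th) s0 l 0 (ltW s0l).
- by move=> s _; exact: D_cont (D_qq ps s).
- by rewrite !ltW.
have s01' : s0 < s1.
  by rewrite lt_neqAle s01 andbT; apply/eqP => e; move: q1; rewrite -e; lra.
have s1l' : s1 < l.
  by rewrite lt_neqAle s1l andbT; apply/eqP => e; move: q1; rewrite e; lra.
have wqm s t := @wq_mono c L b l x r th s t A.
(* Up to [s1] the angular momentum is nonpositive, hence [x / r] does not decrease. *)
have yx1 : y0 * r s1 <= x s1.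
  have rs0 : 0 < r s0 by apply: (r_gt0 A); rewrite !ltW.
  have rs1 : 0 < r s1 by apply: (r_gt0 A); rewrite (ltW (lt_trans s00 s01')) ltW.
  rewrite -ler_pdivlMr//; apply: (@le_trans _ _ (x s0 / r s0)).
    by rewrite ler_pdivlMr.
  have hin s : s0 <= s <= s1 -> 0 <= s <= l by move=> /andP[h1 h2]; rewrite (le_trans (ltW s00) h1) (le_trans h2 (ltW s1l')).
  apply: (mono_le s01 (f := fun s => x s / r s) (f' := fun s => - (qq x r th s / r s ^+ 2))).
  - by move=> s hs; apply: D_cont (D_yy ps (r_gt0 A (hin s hs))).
  - by move=> s /andP[h1 h2]; apply: (D_yy ps); apply/(r_gt0 A)/hin; rewrite !ltW.
  - move=> s /andP[u1 u2].
    have rs : 0 < r s by apply/(r_gt0 A)/hin; rewrite !ltW.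
    rewrite oppr_ge0 pmulr_lle0 ?invr_gt0 ?exprn_gt0//.
    have := wqm s s1 (le_trans (ltW s00) (ltW u1)) (ltW u2) s1l; rewrite /wq q1 mulr0.
    by rewrite pmulr_rle0// ww_gt0.
have hs1 : 0 < s1 < l by rewrite (lt_trans s00 s01') s1l'.
have hR1 := arc_middle pd n1_gt0 A xl hs1 q1 y00 yx1; rewrite -R1E in hR1.
have xs1 : xm <= x s1.
  apply: le_trans yx1; rewrite xmE ler_pM2l//; apply: le_trans cb _.
  by apply: (r_ge A); case/andP: hs1 => ? ?; rewrite !ltW.
(* The curve has unit speed, so for the time [h], half of the lower bound [xm] for [x s1], it keeps
   [x >= h] and stays in a ball of squared radius [R2]. *)
have xh s : s1 <= s -> x s1 - (s - s1) <= x s.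
  move=> hs; have : x s1 + s1 <= x s + s.
    apply: (mono_le hs (f := fun s => x s + s) (f' := fun s => cos (th s) + 1)).
    - by move=> u _; exact: D_cont (DD (ps_x ps u) (DI u)).
    - by move=> u _; exact: DD (ps_x ps u) (DI u).
    - by move=> u _; rewrite -lerBlDr sub0r cos_geN1.
  lra.
have xh' s : s1 <= s -> x s <= x s1 + (s - s1).
  move=> hs; have : s1 - x s1 <= s - x s.
    apply: (mono_le hs (f := fun s => s - x s) (f' := fun s => 1 - cos (th s))).
    - by move=> u _; exact: D_cont (DB (DI u) (ps_x ps u)).
    - by move=> u _; exact: DB (DI u) (ps_x ps u).
    - by move=> u _; rewrite subr_ge0 cos_le1.
  lra.
have rh' s : s1 <= s -> r s <= r s1 + (s - s1).
  move=> hs; have : s1 - r s1 <= s - r s.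
    apply: (mono_le hs (f := fun s => s - r s) (f' := fun s => 1 - sin (th s))).
    - by move=> u _; exact: D_cont (DB (DI u) (ps_r ps u)).
    - by move=> u _; exact: DB (DI u) (ps_r ps u).
    - by move=> u _; rewrite subr_ge0 sin_le1.
  lra.
have hl2 : s1 + h < l.
  have := xh l s1l; rewrite xl; lra.
have s10 : 0 < s1 by exact: lt_trans s01'.
have hs1' : 0 <= s1 <= l by rewrite !ltW.
have r10 := r_gt0 A hs1'.
have grow : wq f n1 x r th s1 + g * h <= wq f n1 x r th (s1 + h).
  rewrite gE; apply: (wq_growth A (ltW s10) h0 (ltW hl2) h0 R20) => s /andP[u1 u2].
  have a1 := xh s (ltW u1); have a2 := xh' s (ltW u1); have a3 := rh' s (ltW u1).
  have hs : 0 <= s <= l by rewrite (ltW (lt_trans s10 u1)) (ltW (lt_trans u2 hl2)).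
  have rs := r_gt0 A hs; have xs0 := x_ge0 A hs.
  split; first by lra.
  have := @sqr_shift_le _ (x s) (r s) (x s1) (r s1) h xs0 (ltW rs).
  rewrite -/(rho2 x r s) -/(rho2 x r s1) R2E => H.
  have sh : s - s1 <= h by rewrite lerBlDl ltW.
  have := H (le_trans a2 (lerD (lexx _) sh)) (le_trans a3 (lerD (lexx _) sh)); lra.
have w2 := wqm (s1 + h) l (ltW (addr_gt0 s10 h0)) (ltW hl2) (lexx l).
have wq1 : wq f n1 x r th s1 = 0 by rewrite /wq q1 mulr0.
have big : g * h <= wq f n1 x r th l by lra.
rewrite leNgt; apply/negP => hTr; have := hT _ (ltW hTr).
apply/negP; rewrite -leNgt; apply: le_trans big _.
have -> : wq f n1 x r th l =
    r l ^+ n1.+1 * expR (- (f (r l ^+ 2) / 4)) * - cos (th l).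
  by rewrite /wq /ww /rho2 /qq xl expr0n /= add0r (exprSr _ n1); ring.
apply: ler_piMr; first by rewrite mulr_ge0 ?exprn_ge0 ?expR_ge0// ltW.
by rewrite lerNl cos_geN1.
Qed.

End Bound2.

(** * Uniform behaviour near the starting point *)

Section Start.
Variables (R : realType) (m M : R) (f F F1 : R -> R) (n1 : nat).
Hypothesis pd : profile_data m M f F F1.
Hypothesis n1_gt0 : (0 < n1)%N.
Local Notation N := (n1%:R : R).

Lemma Dscale (C s : R) : is_derive s (1 : R) (fun s => C * s) C.
Proof. by apply: (D_eq (DM (DC C s) (DI s))); ring. Qed.

Lemma abs_growth (g g' : R -> R) (C s : R) : 0 <= s ->
  (forall u, is_derive u (1 : R) g (g' u)) -> (forall u, 0 < u < s -> `|g' u| <= C) ->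
  `|g s - g 0| <= C * s.
Proof.
move=> s0 hd hC.
have h1 : C * 0 + g 0 <= C * s + g s.
  apply: (mono_le s0 (f := fun u => C * u + g u) (f' := fun u => C + g' u)).
  - by move=> u _; exact: D_cont (DD (Dscale C u) (hd u)).
  - by move=> u _; exact: DD (Dscale C u) (hd u).
  - by move=> u /hC; rewrite ler_norml => /andP[]; lra.
have h2 : C * 0 - g 0 <= C * s - g s.
  apply: (mono_le s0 (f := fun u => C * u - g u) (f' := fun u => C - g' u)).
  - by move=> u _; exact: D_cont (DB (Dscale C u) (hd u)).
  - by move=> u _; exact: DB (Dscale C u) (hd u).
  - by move=> u /hC; rewrite ler_norml => /andP[]; lra.
by rewrite ler_norml; apply/andP; split; lra.
Qed.

(* For initial radii close to [b], uniformly: [x] increases, and so do the angle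
   and [k] if the initial curvature is positive. *)
Lemma near_start (c L b B : R) : 0 < c -> c <= b -> b < B -> B + 1 <= L ->
  exists2 e, 0 < e & forall b' x r th, `|b' - b| < e -> c <= b' ->
    psol F n1 c L x r th -> x 0 = 0 -> r 0 = b' -> th 0 = 0 ->
    forall s, 0 < s <= e -> [/\ 0 < x s, rho2 x r s < L ^+ 2 &
      0 < kap F n1 0 b 0 -> 0 < kk x r th s /\ 0 < th s].
Proof.
move=> c0 cb bB BL; have cL : c <= L by lra.
have [K [D [K0 D0 hK hD]]] := field_consts n1 pd c0 cL.
have [k0 k0E] : exists k0, k0 = kap F n1 0 b 0 by exists (kap F n1 0 b 0).
(* The requirements on [e] keep, in order: the cosine at least [1 / 2]; the angular momentum
   nonpositive, so that [k' > 0]; the curvature positive if it is so initially; the curve inside the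
   truncation radius. *)
have [e [e0 eD ee2 ee3 [ee4 ee5]]] : exists e, [/\ 0 < e, D * e <= 1 / 2, e <= c / 8,
    (0 < k0 -> K * ((3 + D) * e) < k0) & e <= 1 /\ e <= (B - b) / 4].
  have C10 : 0 < D + 1 by lra.
  have C20 : 0 < K * (3 + D) + 1.
    have h3 : 0 <= 3 + D by lra.
    by have := mulr_ge0 K0 h3; lra.
  pose e1 := if 0 < k0 then k0 / (K * (3 + D) + 1) else 1.
  have e10 : 0 < e1 by rewrite /e1; case: ifP => // h; rewrite divr_gt0.
  have b4 : 0 < (B - b) / 4 by lra.
  have [e' [e'0 h1 h2 h3 [h4 h5]]] : exists e, [/\ 0 < e, e <= (D + 1)^-1 / 2, e <= c / 8,
      e <= e1 / 2 & e <= 1 /\ e <= (B - b) / 4].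
    exists (Num.min (Num.min ((D + 1)^-1 / 2) (c / 8)) (Num.min (e1 / 2) (Num.min 1 ((B - b) / 4)))).
    by rewrite !lt_min b4 !divr_gt0 ?invr_gt0 ?ltr01// !ge_min !lexx !orbT.
  exists e'; split => //.
    apply: (@le_trans _ _ ((D + 1) * ((D + 1)^-1 / 2))).
      by apply: ler_pM => //; [exact: ltW|lra].
    by rewrite mulrA divff ?gt_eqF.
  move=> k00; move: h3; rewrite /e1 k00 => h3; rewrite mulrA.
  apply: (@le_lt_trans _ _ ((K * (3 + D) + 1) * (k0 / (K * (3 + D) + 1) / 2))).
    by apply: ler_pM => //; [apply: mulr_ge0 => //; lra|exact: ltW|lra].
  by rewrite mulrA mulrCA divff ?gt_eqF// mulr1; lra.
exists e => // b' x r th hb' cb' ps x0 r0 t0.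
have xs s : 0 <= s -> `|x s| <= s.
  move=> s0; have := abs_growth (g := x) (C := 1) s0 (ps_x ps) (fun u _ => cos_max (th u)).
  by rewrite x0 subr0 mul1r.
have rs s : 0 <= s -> `|r s - b'| <= s.
  move=> s0; have := abs_growth (g := r) (C := 1) s0 (ps_r ps) (fun u _ => sin_max (th u)).
  by rewrite r0 mul1r.
have kD u : `|kp F n1 c L x r th u| <= D.
  exact: (hD (mk3 (x u) (r u) (th u)) i2).
have ts s : 0 <= s -> `|th s| <= D * s.
  move=> s0; have := abs_growth (g := th) (C := D) s0 (ps_th ps) (fun u _ => kD u).
  by rewrite t0 subr0.
have Ds s : 0 <= s <= e -> D * s <= 1 / 2.
  by move=> /andP[s0 se]; apply: le_trans eD; exact: ler_wpM2l.
have cosb s : 0 <= s <= e -> 1 / 2 <= cos (th s).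
  move=> hs; have := cos_lip 0 (th s); rewrite cos0 sub0r normrN.
  rewrite ler_norml => /andP[_]; have := Ds s hs; case/andP: hs => s0 _.
  by have := ts s s0; lra.
have xpos s : 0 < s <= e -> 0 < x s.
  move=> /andP[s0 se]; rewrite -x0; apply: (mono_lt s0 (f' := fun s => cos (th s))).
  - by move=> u _; exact: x_cont ps u.
  - by move=> u _; exact: ps_x ps u.
  - move=> u /andP[u0 us]; have : 0 <= u <= e by rewrite ltW//= (le_trans (ltW us)).
    by move=> /cosb; lra.
have bb' : b' < b + e /\ b - e < b'.
  by move: hb'; rewrite ltr_norml => /andP[? ?]; split; lra.
have absle (u v : R) : `|u| <= v -> - v <= u /\ u <= v by rewrite ler_norml => /andP.
move=> s hs; have /andP[s0 se] := hs; split; first exact: xpos.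
  have [_ h1] := absle _ _ (xs s (ltW s0)); have h2 := xpos s hs.
  have [h3 h4] := absle _ _ (rs s (ltW s0)).
  have h5 : 0 < x s + r s by lra.
  have h6 : x s + r s < L by lra.
  have : 0 <= x s * r s by rewrite mulr_ge0 ?ltW//; lra.
  have : (x s + r s) ^+ 2 < L ^+ 2 by rewrite ltr_pXn2r ?nnegrE//; lra.
  by rewrite sqrrD /rho2; lra.
rewrite -k0E => k00.
(* The curvature is compared with its value [k0] at the starting point of height [b] through the
   Lipschitz constant of the field. *)
have kpos u : 0 <= u <= e -> 0 < kp F n1 c L x r th u.
  move=> /andP[u0 ue].
  have := hK (mk3 (x u) (r u) (th u)) (mk3 0 b 0) i2.
  have -> : field F n1 c L (mk3 0 b 0) i2 = k0.
    rewrite k0E /field /mk3 /=; apply: kap_box => //; split => //.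
    by rewrite expr0n /= add0r ler_pXn2r ?nnegrE//; lra.
  rewrite !big_ord_recr big_ord0 /= /mk3 /= subr0 subr0 add0r.
  have h1 := xs u u0; have h2 := ts u u0.
  have h3 : `|r u - b| <= u + e.
    have -> : r u - b = (r u - b') + (b' - b) by ring.
    by apply: le_trans (ler_normD _ _) _; have := rs u u0; lra.
  have h4 : `|x u| + `|r u - b| + `|th u| <= (3 + D) * e.
    have : D * u <= D * e by apply: ler_wpM2l.
    by rewrite mulrDl; lra.
  have h5 : K * (`|x u| + `|r u - b| + `|th u|) <= K * ((3 + D) * e) by apply: ler_wpM2l.
  have h6 := ee3 k00.
  move=> h7; have [] := absle _ _ h7.
  rewrite -/(kp F n1 c L x r th u) => h8 _.
  have : - (K * (`|x u| + `|r u - b| + `|th u|)) <= kp F n1 c L x r th u - k0 by exact: h8.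
  lra.
have thpos u : 0 < u <= e -> 0 < th u.
  move=> /andP[u0 ue]; rewrite -t0; apply: (mono_lt u0 (f' := kp F n1 c L x r th)).
  - by move=> v _; exact: th_cont ps v.
  - by move=> v _; exact: ps_th ps v.
  - by move=> v /andP[v0 vu]; apply: kpos; rewrite ltW//= (le_trans (ltW vu)).
split; last exact: thpos.
have k0' : kk x r th 0 = 0 by rewrite /kk x0 t0 sin0; ring.
rewrite -[X in X < _]k0'; apply: (mono_lt s0 (f' := fun s => 1 - qq x r th s * kp F n1 c L x r th s)).
- by move=> v _; exact: D_cont (D_kk ps v).
- by move=> v _; exact: D_kk ps v.
move=> v /andP[v0 vs]; have hv : 0 <= v <= e by rewrite ltW//= (le_trans (ltW vs)).
have hv' : 0 < v <= e by rewrite v0 (le_trans (ltW vs)).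
have [_ h1] := absle _ _ (xs v (ltW v0)); have h2 := xpos v hv'.
have [h3 h4] := absle _ _ (rs v (ltW v0)).
have ve : v <= e by case/andP: hv.
have q0 : qq x r th v <= 0.
  have h5 : x v * sin (th v) <= c / 8.
    apply: (@le_trans _ _ (x v * 1)); last by lra.
    by apply: ler_wpM2l; [exact: ltW|exact: sin_le1].
  have h6 : c / 2 * (1 / 2) <= r v * cos (th v).
    by apply: ler_pM; rewrite ?cosb//; lra.
  by rewrite /qq; lra.
by have := mulr_le0_ge0 q0 (ltW (kpos v hv)); lra.
Qed.

(** The derivative of the radial speed, arranged so that everything beyond [N + 1 - F * rho2 / 2]
    carries a factor [kk]. The first term is nonincreasing along an arc and decides what can happen
    at a zero of [kk]. *)
Lemma kk_deriv (c L : R) x r th s : 0 < c -> c <= L -> box c L (x s) (r s) ->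
  1 - qq x r th s * kp F n1 c L x r th s =
  (N + 1 - F (rho2 x r s) * rho2 x r s / 2) +
  kk x r th s * (F (rho2 x r s) * kk x r th s / 2 - N * kk x r th s / rho2 x r s
     - N * qq x r th s * x s / (r s * rho2 x r s)).
Proof.
move=> c0 cL hb; rewrite (kpE _ _ _ c0 cL hb) /kap -/(rho2 x r s) -/(qq x r th s).
have rs : 0 < r s by case: hb; lra.
have rho0 := rho2_gt0 x rs.
have ecos : cos (th s) = (kk x r th s * x s - qq x r th s * r s) / rho2 x r s.
  by rewrite -cos_qk mulrC mulrA mulVf ?mul1r// gt_eqF.
have := qk x r th s; rewrite ecos; move: rho0.
move: (F _) => G; move: (rho2 x r s) (qq x r th s) (kk x r th s) (x s) (r s) rs.
move=> w q k y z z0 w0 e.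
have wn : w != 0 by rewrite gt_eqF.
have zn : z != 0 by rewrite gt_eqF.
have eq : q ^+ 2 = w - k ^+ 2 by rewrite e; ring.
transitivity (1 - N * q * k * y / (w * z) + N * q ^+ 2 / w - G / 2 * q ^+ 2).
  by field; rewrite zn wn.
by rewrite eq; field; rewrite zn wn.
Qed.

End Start.

(** * Strict positivity of the angle and of the radial speed *)

Section Strict.
Variables (R : realType) (m M : R) (f F F1 : R -> R) (n1 : nat).
Hypothesis pd : profile_data m M f F F1.
Hypothesis n1_gt0 : (0 < n1)%N.
Local Notation N := (n1%:R : R).
Variables (c L b l B : R) (x r th : R -> R).
Hypothesis A : arc F n1 c L b l x r th.
Hypothesis xl : x l = 0.
Hypothesis bB : b < B.
Hypothesis BL : B + 1 <= L.
Hypothesis k0 : 0 < kap F n1 0 b 0.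

Lemma arc_near_start : exists2 e, 0 < e < l & forall s, 0 < s <= e ->
  0 < kk x r th s /\ 0 < th s.
Proof.
case: (A) => c0 cL cb l0 ps x0 r0 t0 gd.
have [e e0 he] := near_start n1 pd c0 cb bB BL.
have hb : `|b - b| < e by rewrite subrr normr0.
have H := he b x r th hb cb ps x0 r0 t0.
exists e => [|s /H[_ _ h]]; last exact: h.
rewrite e0 ltNge; apply/negP => le.
by have [|h _ _] := H l; [rewrite l0 le|move: h; rewrite xl ltxx].
Qed.

(** At a first zero the angle would have a local minimum with vanishing curvature, so
    [G = N / r - F * r / 2] would vanish there. As [r] and [F] are nondecreasing along the arc, [G]
    would be nonnegative before, hence the angle nondecreasing, although it is already positive near
    the start. *)
Lemma arc_th_gt0 s : 0 < s <= l -> 0 < th s.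
Proof.
case: (A) => c0 cL cb l0 ps x0 r0 t0 gd.
move=> /andP[s0]; rewrite le_eqVlt => /predU1P[->|sl].
  have := cos_end_lt0 pd n1_gt0 A xl; rewrite lt_neqAle => h.
  have h1 : 0 <= th l by have tc : {for l, continuous th} := D_cont (ps_th ps l); apply: (closure_ge l0 tc) => u /gd[].
  rewrite lt_neqAle h1 andbT; apply/eqP => e.
  by have := cos_end_lt0 pd n1_gt0 A xl; rewrite -e cos0; lra.
have [e /andP[e0 el] he] := arc_near_start.
rewrite ltNge; apply/negP => hth.
have es : e < s.
  rewrite ltNge; apply/negP => h; have [|_ h2] := he s; first by rewrite s0 h.
  by move: h2; rewrite ltNge hth.
have tc u : {for u, continuous th} by exact: D_cont (ps_th ps u).
have te : 0 < th e by apply: (he e _).2; rewrite e0 lexx.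
have [s1 /andP[es1 s1s] [hs1 pos]] := first_zero (ltW es) (fun u _ => tc u) te hth.
have s10 : 0 < s1 by exact: lt_trans es1.
have s1l : s1 < l by exact: le_lt_trans sl.
have hs1l : 0 <= s1 <= l by rewrite !ltW.
have kp0 : kp F n1 c L x r th s1 = 0.
  pose d := Num.min s1 (l - s1).
  have d0 : 0 < d by rewrite lt_min s10 subr_gt0.
  apply: (D_local_min (ps_th ps s1) d0); first by move=> y _; case: (ps_th ps y).
  move=> y; rewrite ltr_norml lt_min => /andP[h1 /andP[_ h2]].
  rewrite hs1; have : - s1 < y - s1 by apply: le_lt_trans h1; rewrite lerN2 ge_min lexx.
  by move=> h3; have [|_ _ h4 _] := gd y; first by apply/andP; split; lra.
have cs : 0 <= cos (th s1) by rewrite hs1 cos0.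
pose G s := N / r s - F (rho2 x r s) / 2 * r s.
have G1 : G s1 = 0.
  rewrite -kp0 (kpE _ _ _ c0 cL (in_box A hs1l)) /kap hs1 cos0 sin0 /G /rho2; ring.
have hin u : 0 <= u <= s1 -> 0 <= u <= l.
  by move=> /andP[-> h]; exact: le_trans (ltW s1l).
have Gp u : 0 <= u <= s1 -> 0 <= G u.
  move=> hu; have hul := hin u hu; have /andP[u0 us] := hu; rewrite -G1 /G.
  have ru := r_gt0 A hul; have rr := r_le A u0 us (ltW s1l).
  have rh := rho2_le A u0 us (ltW s1l).
  have hF := pd_mono pd (rho2_gt0 x ru) rh.
  have F0 := F_gt0 pd A hul.
  apply: lerB.
    by apply: ler_wpM2l => //; rewrite lef_pV2 ?posrE// (lt_le_trans ru).
  by apply: ler_pM => //; [rewrite divr_ge0 ?ltW|exact: ltW|rewrite ler_pM2r].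
have : th e <= th s1.
  apply: (mono_le (ltW es1) (f' := kp F n1 c L x r th)).
  - by move=> u _; exact: th_cont ps u.
  - by move=> u _; exact: ps_th ps u.
  move=> u /andP[u1 u2]; have u0 : 0 < u by exact: lt_trans u1.
  have hu : 0 <= u <= s1 by rewrite !ltW.
  have hul := hin u hu.
  rewrite (kpE _ _ _ c0 cL (in_box A hul)) /kap.
  have -> : N * cos (th u) / r u + F (x u ^+ 2 + r u ^+ 2) / 2 *
      (x u * sin (th u) - r u * cos (th u)) =
      cos (th u) * G u + F (rho2 x r u) / 2 * (x u * sin (th u)).
    by rewrite /G /rho2; ring.
  have h1 := cos_gt0_before pd n1_gt0 A (ltW u0) u2 (ltW s1l) cs.
  have h2 : 0 <= sin (th u) by apply: (sin_th_ge0 A); rewrite u0 (lt_trans u2).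
  have h3 := F_gt0 pd A hul; have h4 := x_ge0 A hul.
  by rewrite addr_ge0// ?mulr_ge0 ?(ltW h1) ?Gp ?(ltW h3).
rewrite hs1; apply/negP; rewrite -ltNge; apply: (he e _).2.
by rewrite e0 lexx.
Qed.

(** A first interior zero of [kk] would be a local minimum, forcing [N + 1 - F * rho2 / 2] to vanish
    there and thus to be nonnegative before. Then [kk' >= - C * kk], and [gronwall] keeps [kk]
    positive. *)
Lemma arc_kk_gt0 s : 0 < s < l -> 0 < kk x r th s.
Proof.
case: (A) => c0 cL cb l0 ps x0 r0 t0 gd.
move=> /andP[s0 sl]; have [e /andP[e0 el] he] := arc_near_start.
rewrite ltNge; apply/negP => hk.
have es : e < s.
  rewrite ltNge; apply/negP => h; have [|h2 _] := he s; first by rewrite s0 h.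
  by move: h2; rewrite ltNge hk.
have kc u : {for u, continuous (kk x r th)} by exact: D_cont (D_kk ps u).
have ke : 0 < kk x r th e by apply: (he e _).1; rewrite e0 lexx.
have [s1 /andP[es1 s1s] [hs1 pos]] := first_zero (ltW es) (fun u _ => kc u) ke hk.
have s10 : 0 < s1 by exact: lt_trans es1.
have s1l : s1 < l by exact: le_lt_trans sl.
have hs1l : 0 <= s1 <= l by rewrite !ltW.
have k'0 : 1 - qq x r th s1 * kp F n1 c L x r th s1 = 0.
  pose d := Num.min s1 (l - s1).
  have d0 : 0 < d by rewrite lt_min s10 subr_gt0.
  apply: (D_local_min (D_kk ps s1) d0); first by move=> y _; case: (D_kk ps y).
  move=> y; rewrite ltr_norml lt_min => /andP[h1 /andP[_ h2]].
  rewrite hs1; have : - s1 < y - s1 by apply: le_lt_trans h1; rewrite lerN2 ge_min lexx.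
  by move=> h3; have [|_ h4 _ _] := gd y; first by apply/andP; split; lra.
rewrite (kk_deriv F n1 th c0 cL (in_box A hs1l)) hs1 mul0r addr0 in k'0.
have hin u : 0 <= u <= s1 -> 0 <= u <= l.
  by move=> /andP[-> h]; exact: le_trans (ltW s1l).
have L0 : 0 < L by lra.
have M0 : 0 <= M.
  by have := pd_lo pd c0; have := pd_hi pd c0; have := pd_m pd; lra.
(* Bounds for the factor of [kk] in [kk_deriv], from [c <= r] and from [|x|], [|q|], [kk] all being
   at most [L]. *)
pose C := M * L / 2 + N * L / c ^+ 2 + N * L * L / (c * c ^+ 2).
have bound u : 0 <= u <= s1 -> - (C * kk x r th u) <= 1 - qq x r th u * kp F n1 c L x r th u.
  move=> hu; have hul := hin u hu; have /andP[u0 us] := hu.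
  rewrite (kk_deriv F n1 th c0 cL (in_box A hul)).
  have ru := r_gt0 A hul; have rho0 := rho2_gt0 x ru.
  have rh := rho2_le A u0 us (ltW s1l).
  have hF := pd_mono pd rho0 rh; have F0 := F_gt0 pd A hul.
  have hFM := pd_hi pd rho0.
  have hA : F (rho2 x r u) * rho2 x r u <= F (rho2 x r s1) * rho2 x r s1.
    by apply: ler_pM => //; exact: ltW.
  have hk0 : 0 <= kk x r th u.
    move: u0; rewrite le_eqVlt => /predU1P[<-|u0]; first by rewrite /kk x0 t0 sin0 mul0r mulr0 addr0.
    by have [|_ h _ _] := gd u; first by rewrite u0 (le_lt_trans us).
  have cr : c <= r u by apply: le_trans cb (r_ge A hul).
  have c2 : 0 < c ^+ 2 by rewrite exprn_gt0.
  have crho : c ^+ 2 <= rho2 x r u.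
    apply: (@le_trans _ _ (r u ^+ 2)); first by rewrite ler_pXn2r ?nnegrE// ltW.
    by rewrite /rho2 lerDr sqr_ge0.
  have rL := rho2_L A hul; have qkE := qk x r th u.
  have kL : kk x r th u <= L.
    have : kk x r th u ^+ 2 <= L ^+ 2 by apply: le_trans rL; rewrite qkE lerDr sqr_ge0.
    by rewrite ler_pXn2r ?nnegrE// ltW.
  have qL : `|qq x r th u| <= L.
    have : `|qq x r th u| ^+ 2 <= L ^+ 2.
      by rewrite real_normK ?num_real//; apply: le_trans rL; rewrite qkE lerDl sqr_ge0.
    by rewrite ler_pXn2r ?nnegrE ?normr_ge0// ltW.
  have [xL _] := xr_le A hul; have hx := x_ge0 A hul.
  have p1 : 0 <= F (rho2 x r u) * kk x r th u / 2.
    by rewrite !mulr_ge0// ltW.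
  have p2 : N * kk x r th u / rho2 x r u <= N * L / c ^+ 2.
    apply: ler_pM; rewrite ?mulr_ge0 ?invr_ge0 ?(ltW rho0)//; first by rewrite ler_wpM2l.
    by rewrite lef_pV2 ?posrE.
  have p3 : `|N * qq x r th u * x u / (r u * rho2 x r u)| <= N * L * L / (c * c ^+ 2).
    rewrite !normrM (ger0_norm (_ : 0 <= N))// (ger0_norm hx) normfV.
    rewrite (ger0_norm (_ : 0 <= r u * rho2 x r u)); last by rewrite mulr_ge0 ?ltW.
    apply: ler_pM; rewrite ?mulr_ge0 ?invr_ge0 ?mulr_ge0 ?(ltW rho0) ?(ltW ru)//.
      by apply: ler_pM => //; rewrite ?mulr_ge0// ler_wpM2l.
    rewrite lef_pV2 ?posrE ?mulr_gt0//.
    by apply: ler_pM => //; exact: ltW.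
  have p4 : - C <= F (rho2 x r u) * kk x r th u / 2 - N * kk x r th u / rho2 x r u
     - N * qq x r th u * x u / (r u * rho2 x r u).
    have : 0 <= M * L / 2 by rewrite divr_ge0// mulr_ge0// ltW.
    move: p3; rewrite /C ler_norml => /andP[_ p3]; lra.
  have := ler_wpM2l hk0 p4; rewrite mulrN [kk x r th u * C]mulrC; lra.
have := @gronwall _ (fun s => - kk x r th s) (fun s => - (1 - qq x r th s * kp F n1 c L x r th s))
  (- C) e s1 (ltW es1).
rewrite hs1 oppr0 => H.
have : 0 <= - kk x r th e * expR (- C * (s1 - e)).
  apply: H.
  - by move=> u _; apply: cvgN; exact: kc.
  - by move=> u _; exact: DN (D_kk ps u).
  - move=> u /andP[u1 u2].
    have := bound u; rewrite (ltW (lt_trans e0 u1)) (ltW u2) => /(_ isT).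
    by rewrite mulrNN; lra.
by apply/negP; rewrite -ltNge mulNr oppr_lt0 mulr_gt0 ?expR_gt0.
Qed.

(** On the line [x = 0] the radial speed is [r * sin th], with [0 < th <= pi]. *)
Lemma arc_end : 0 < kk x r th l \/ th l = pi.
Proof.
case: (A) => c0 cL cb l0 ps x0 r0 t0 gd.
have hl : 0 <= l <= l by rewrite lexx ltW.
have rl := r_gt0 A hl.
have k0l : 0 <= kk x r th l.
  by have tc := D_cont (D_kk ps l); apply: (closure_ge l0 tc) => u /gd[].
have [->|] := eqVneq (th l) pi; first by right.
move=> h; left; rewrite /kk xl mul0r add0r mulr_gt0//.
apply: sin_gt0_pi; rewrite arc_th_gt0 ?l0 ?lexx//= lt_neqAle h /=.
exact: th_le_pi A.
Qed.

End Strict.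

(** * The shooting argument *)

Section Nearness.
Variable R : realType.
Implicit Types a b c e q z : R.

Lemma near_gt0 a b : `|a - b| < b -> 0 < a.
Proof. by rewrite ltr_norml => /andP[h _]; lra. Qed.

Lemma near_lt a b c : `|a - b| < c - b -> a < c.
Proof. by rewrite ltr_norml => /andP[_ h]; lra. Qed.

Lemma near_ge a b z : `|a - b| < z -> 0 <= a -> - z <= b.
Proof. by rewrite ltr_norml => /andP[_ h] a0; lra. Qed.

Lemma near_le a b c z : `|a - b| < z -> a <= c -> b <= c + z.
Proof. by rewrite ltr_norml => /andP[h _] ac; lra. Qed.

Lemma sum4_lt a b c e q z : `|a| <= q -> `|b| <= q -> `|c| <= q -> `|e| <= q ->
  4 * q < z -> `|a + b + c + e| < z.
Proof.
move=> ha hb hc he hq; have h1 := ler_normD (a + b + c) e.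
have h2 := ler_normD (a + b) c; have h3 := ler_normD a b; lra.
Qed.

End Nearness.

Section Shooting.
Variables (R : realType) (m M : R) (f F F1 : R -> R) (n1 : nat).
Hypothesis pd : profile_data m M f F F1.
Hypothesis n1_gt0 : (0 < n1)%N.
Local Notation N := (n1%:R : R).

Lemma kap_start b : kap F n1 0 b 0 = N / b - F (b ^+ 2) / 2 * b.
Proof. by rewrite /kap sin0 cos0 expr0n /= add0r; ring. Qed.

(* The radius of the cylinder through which the initial curvature changes sign. *)
Lemma critical_radius : exists2 b0, 0 < b0 & kap F n1 0 b0 0 = 0 /\
  forall b, 0 < b -> b < b0 -> 0 < kap F n1 0 b 0.
Proof.
have m0 := pd_m pd; have N1 := N_ge1 R n1_gt0.
have M0 : 0 < M.
  by have := pd_lo pd ltr01; have := pd_hi pd ltr01; lra.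
(* The initial curvature is [(2 * N - g b) / (2 * b)]; the bounds on [F] place a crossing of the
   level [2 * N] between [a] and [z], and monotonicity of [F] makes [g] strictly increasing. *)
pose g b := F (b ^+ 2) * b ^+ 2.
have gc b : 0 < b -> {for b, continuous g}.
  move=> b0; have b2 : 0 < b ^+ 2 by rewrite exprn_gt0.
  have d2 := DX 2 (DI b).
  exact: D_cont (DM (DComp (g := fun s => s ^+ 2) (pd_F pd b2) d2) d2).
pose a := Num.min 1 (N / M).
have a0 : 0 < a by rewrite lt_min ltr01 divr_gt0//; lra.
pose z := 1 + 2 * N / m.
have z1 : 1 <= z by rewrite /z lerDl divr_ge0 ?(ltW m0)//; lra.
have a1 : a <= 1 by rewrite /a ge_min lexx.
have az : a <= z by exact: le_trans z1.
have ga : g a <= 2 * N.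
  have a2 : 0 < a ^+ 2 by rewrite exprn_gt0.
  apply: (@le_trans _ _ (M * a)).
    apply: ler_pM; rewrite ?(ltW a2)//; last by nra.
      by apply: le_trans (pd_lo pd a2); exact: ltW.
    exact: pd_hi pd _ a2.
  apply: (@le_trans _ _ (M * (N / M))).
    by rewrite ler_pM2l// /a ge_min lexx orbT.
  by rewrite mulrCA divff ?gt_eqF//; lra.
have gz : 2 * N <= g z.
  have z2 : 0 < z ^+ 2 by rewrite exprn_gt0//; lra.
  apply: (@le_trans _ _ (m * z)).
    have -> : m * z = m + 2 * N by rewrite /z; field; rewrite gt_eqF.
    lra.
  have zz : z <= z ^+ 2 by nra.
  apply: ler_pM => //; [exact: ltW|lra|].
  exact: pd_lo pd _ z2.
have gc' s : a <= s <= z -> {for s, continuous g} by move=> /andP[h _]; apply: gc; lra.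
have gaz : g a <= 2 * N <= g z by rewrite ga gz.
have [b0 /andP[ab0 b0z] hb0] := ivt az gc' gaz.
have b00 : 0 < b0 by lra.
have kE b : 0 < b -> kap F n1 0 b 0 = (2 * N - g b) / (2 * b).
  by move=> bp; rewrite kap_start /g; field; rewrite gt_eqF.
exists b0 => //; split; first by rewrite kE// hb0 subrr mul0r.
move=> b bp bb0; rewrite kE// divr_gt0//; last by rewrite mulr_gt0.
rewrite subr_gt0 -hb0 /g.
have b2 : 0 < b ^+ 2 by rewrite exprn_gt0.
have b2' : b ^+ 2 < b0 ^+ 2 by rewrite ltr_pXn2r ?nnegrE// ltW.
apply: (@lt_le_trans _ _ (F (b ^+ 2) * b0 ^+ 2)).
  by rewrite ltr_pM2l// (lt_le_trans m0)// (pd_lo pd b2).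
apply: ler_wpM2r; first by rewrite exprn_ge0// ltW.
by apply: (pd_mono pd) => //; exact: ltW.
Qed.

Lemma min_pos (g : R -> R) (a b : R) : a <= b ->
  (forall s, {for s, continuous g}) -> (forall s, a <= s <= b -> 0 < g s) ->
  exists2 e, 0 < e & forall s, a <= s <= b -> e <= g s.
Proof.
move=> ab gc gp; have [|k hk hm] := EVT_min ab (f := g).
  by apply: continuous_subspaceT => s; exact: gc.
exists (g k); first by apply: gp; move: hk; rewrite in_itv.
by move=> s hs; apply: hm; rewrite in_itv.
Qed.

Section Family.
Variables (c L b0 T : R) (X Rr Th : R -> R -> R).
Hypothesis c0 : 0 < c.
Hypothesis cb0 : c < b0.
Hypothesis BL : b0 + 2 <= L.
Hypothesis T0 : 0 < T.
Hypothesis TL : T < L.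
Hypothesis hb0 : kap F n1 0 b0 0 = 0.
Hypothesis hb : forall b, 0 < b -> b < b0 -> 0 < kap F n1 0 b 0.
Hypothesis fam : forall b, [/\ psol F n1 c L (X b) (Rr b) (Th b),
  X b 0 = 0, Rr b 0 = b & Th b 0 = 0].
Hypothesis dep : forall S, exists2 C, 0 <= C & forall b b' s, `|s| <= S ->
    [/\ `|X b s - X b' s| <= C * `|b - b'|, `|Rr b s - Rr b' s| <= C * `|b - b'| &
        `|Th b s - Th b' s| <= C * `|b - b'| ].
Hypothesis hT : forall L b l x r th, b <= b0 -> arc F n1 c L b l x r th ->
  x l = 0 -> r l <= T.

Local Notation K b := (kk (X b) (Rr b) (Th b)).
Local Notation rho b := (rho2 (X b) (Rr b)).

Let cL : c <= L. Proof. by have := cb0; have := BL; lra. Qed.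

Lemma close_solutions b S e : 0 < e -> 0 <= S -> exists2 d, 0 < d &
  forall b', `|b' - b| < d -> forall s, 0 <= s <= S ->
  [/\ `|X b' s - X b s| < e, `|K b' s - K b s| < e, `|Th b' s - Th b s| < e &
      `|rho b' s - rho b s| < e].
Proof.
move=> e0 S0; have [C C0 hC] := dep S.
(* [B] bounds sine, cosine and all coordinates up to time [S]. Each difference below splits into
   four products of a factor at most [B] with a difference at most [C * t]. *)
have [B [B1 BS Bb BD]] : exists B, [/\ 1 <= B, S <= B, S + (`|b| + 1) <= B & 1 <= 4 * B].
  by have := normr_ge0 b; exists (S + `|b| + 1); split; lra.
have [D DE] : exists D, D = 4 * B by eexists.
have D1 : 1 <= D by rewrite DE.
pose d := Num.min 1 (e / ((C + 1) * D)).
have CD : 0 < (C + 1) * D by rewrite mulr_gt0//; lra.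
have d0 : 0 < d by rewrite lt_min ltr01 divr_gt0.
exists d => // b' hb' s /andP[s0 sS].
have hs : `|s| <= S by rewrite ger0_norm.
move: (hC b' b s hs) hb'; set t := `|b' - b| => -[h1 h2 h3] hb'.
have t0 : 0 <= t by exact: normr_ge0.
have t1 : t < 1 by apply: lt_le_trans hb' _; rewrite /d ge_min lexx.
have te : (C + 1) * t * D < e.
  rewrite mulrAC mulrC -ltr_pdivlMr//; apply: lt_le_trans hb' _.
  by rewrite /d ge_min lexx orbT.
have [ps x0 r0 th0] := fam b; have [ps' x0' r0' th0'] := fam b'.
have gx b1 : `|X b1 s| <= S.
  have [ps1 x01 _ _] := fam b1.
  have := abs_growth (g := X b1) (C := 1) s0 (ps_x ps1) (fun u _ => cos_max (Th b1 u)).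
  by rewrite x01 subr0 mul1r; lra.
have gr b1 : `|Rr b1 s| <= S + `|b1|.
  have [ps1 _ r01 _] := fam b1.
  have := abs_growth (g := Rr b1) (C := 1) s0 (ps_r ps1) (fun u _ => sin_max (Th b1 u)).
  have := ler_normD (Rr b1 s - b1) b1; rewrite subrK r01 mul1r; lra.
have bb : `|b'| <= `|b| + 1.
  by have := ler_normD (b' - b) b; rewrite subrK -/t; lra.
have Ct : 0 <= C * t by exact: mulr_ge0.
have CtD : C * t * D <= (C + 1) * t * D.
  by rewrite ler_wpM2r//; [lra|rewrite ler_wpM2r//; lra].
have Ct1 : C * t <= C * t * D by rewrite ler_peMr.
have gx1 := gx b; have gx2 := gx b'; have gr1 := gr b; have gr2 := gr b'.
have Cte : C * t < e := le_lt_trans (le_trans Ct1 CtD) te.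
have CD4 : 4 * (B * (C * t)) < e.
  by apply: le_lt_trans te; apply: le_trans CtD; rewrite DE mulrA mulrC.
have prod (u v w : R) : `|u| <= w -> w <= B -> `|v| <= C * t -> `|u * v| <= B * (C * t).
  by move=> hu wB hv; rewrite normrM; apply: ler_pM => //; exact: le_trans hu wB.
have gr1' : S + `|b| <= B by apply: le_trans Bb; rewrite lerD2l lerDl.
have gr2' : S + `|b'| <= B by apply: le_trans Bb; rewrite lerD2l.
split; [exact: le_lt_trans h1 Cte| |exact: le_lt_trans h3 Cte|].
- have -> : K b' s - K b s = cos (Th b' s) * (X b' s - X b s) +
      X b s * (cos (Th b' s) - cos (Th b s)) + sin (Th b' s) * (Rr b' s - Rr b s) +
      Rr b s * (sin (Th b' s) - sin (Th b s)) by rewrite /kk; ring.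
  exact: (sum4_lt (prod _ _ _ (cos_max _) B1 h1)
    (prod _ _ _ gx1 BS (le_trans (cos_lip _ _) h3)) (prod _ _ _ (sin_max _) B1 h2)
    (prod _ _ _ gr1 gr1' (le_trans (sin_lip _ _) h3)) CD4).
- have -> : rho b' s - rho b s = X b' s * (X b' s - X b s) + X b s * (X b' s - X b s)
     + Rr b' s * (Rr b' s - Rr b s) + Rr b s * (Rr b' s - Rr b s) by rewrite /rho2; ring.
  exact: (sum4_lt (prod _ _ _ gx2 BS h1) (prod _ _ _ gx1 BS h1) (prod _ _ _ gr2 gr2' h2)
    (prod _ _ _ gr1 gr1' h2) CD4).
Qed.

(** The strict inequality at the end excludes [th = pi] and makes the condition stable under small
    changes of the height. *)
Definition hits b := exists l, [/\ arc F n1 c L b l (X b) (Rr b) (Th b),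
  X b l = 0 & 0 < K b l].

Lemma Xc b s : {for s, continuous (X b)}.
Proof. by have [ps _ _ _] := fam b; exact: D_cont (ps_x ps s). Qed.

Lemma Thc b s : {for s, continuous (Th b)}.
Proof. by have [ps _ _ _] := fam b; exact: D_cont (ps_th ps s). Qed.

Lemma Kc b s : {for s, continuous (K b)}.
Proof. by have [ps _ _ _] := fam b; exact: D_cont (D_kk ps s). Qed.

Lemma rhoc b s : {for s, continuous (rho b)}.
Proof. by have [ps _ _ _] := fam b; exact: D_cont (D_rho2 ps s). Qed.

Arguments Xc : clear implicits.
Arguments Thc : clear implicits.
Arguments Kc : clear implicits.
Arguments rhoc : clear implicits.

Lemma rho_end b l : arc F n1 c L b l (X b) (Rr b) (Th b) -> X b l = 0 -> b <= b0 ->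
  forall s, 0 <= s <= l -> rho b s <= T ^+ 2.
Proof.
move=> A xl bb s /andP[s0 sl]; apply: le_trans (rho2_le A s0 sl (lexx l)) _.
rewrite /rho2 xl expr0n add0r ler_pXn2r ?nnegrE//; [exact: hT bb A xl| |exact: ltW].
by apply: ltW; apply: (r_gt0 A); rewrite (le_trans s0 sl) lexx.
Qed.

(** The crossing is transversal, because [cos th < 0] at the end, and the remaining conditions are
    strict away from the start. They survive a small perturbation up to a time slightly past the
    crossing; near the start [near_start] is uniform in the height. *)
Lemma hits_open b : c <= b -> b < b0 -> hits b ->
  exists2 d, 0 < d & forall b', `|b' - b| < d -> c <= b' -> hits b'.
Proof.
move=> cb bb0 [l [A xl kl]]; have [ps x0 r0 t0] := fam b.
have l0 := arc_l0 A.
have TL2 : T ^+ 2 < L ^+ 2.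
  by rewrite ltr_pXn2r ?nnegrE//; have := T0; have := TL; lra.
have bp : 0 < b by exact: lt_le_trans cb.
have k0 := hb bp bb0.
have bB : b < b0 + 1 by lra.
have BL' : b0 + 1 + 1 <= L by have := BL; lra.
have [e e0 he] := near_start n1 pd c0 cb bB BL'.
have cl := cos_end_lt0 pd n1_gt0 A xl.
have thl : 0 < Th b l by apply: (arc_th_gt0 pd n1_gt0 A xl bB BL' k0); rewrite l0 lexx.
have rl : rho b l < L ^+ 2.
  apply: le_lt_trans TL2; apply: (rho_end A xl (ltW bb0)).
  by rewrite lexx ltW.
(* The solution is followed past its end [l] to a time [l'] with [x < 0], so that nearby solutions
   also change sign before [l']. *)
have [eta eta0 heta] : exists2 eta, 0 < eta & forall s, l <= s <= l + eta ->
    [/\ 0 < K b s, 0 < Th b s, rho b s < L ^+ 2 & cos (Th b s) < 0].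
  have [d1 d10 h1] := cont_eps (Kc b l) kl.
  have [d2 d20 h2] := cont_eps (Thc b l) thl.
  have rl' : 0 < L ^+ 2 - rho b l by rewrite subr_gt0.
  have cl' : 0 < - cos (Th b l) by rewrite oppr_gt0.
  have [d3 d30 h3] := cont_eps (rhoc b l) rl'.
  have cc : {for l, continuous (fun s => cos (Th b s))} := D_cont (Dcos (ps_th ps l)).
  have [d4 d40 h4] := cont_eps cc cl'.
  pose d := Num.min (Num.min d1 d2) (Num.min d3 d4).
  have d0 : 0 < d by rewrite !lt_min d10 d20 d30 d40.
  have [k1 k2 k3 k4] : [/\ d <= d1, d <= d2, d <= d3 & d <= d4].
    by rewrite /d !ge_min !lexx !orbT.
  exists (d / 2) => [|s /andP[s1 s2]]; first by lra.
  have sd : `|s - l| < d by rewrite ger0_norm ?subr_ge0//; lra.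
  split; [exact: near_gt0 (h1 s (lt_le_trans sd k1))|exact: near_gt0 (h2 s (lt_le_trans sd k2))|
    exact: near_lt (h3 s (lt_le_trans sd k3))|].
  by apply: near_lt; rewrite sub0r; exact: h4 s (lt_le_trans sd k4).
pose l' := l + eta; have ll' : l < l' by rewrite ltrDl.
have xl' : X b l' < 0.
  rewrite -oppr_gt0 -[X in X < _]oppr0 -xl.
  apply: (mono_lt ll' (f := fun s => - X b s) (f' := fun s => - cos (Th b s))).
  - by move=> u _; apply: cvgN; exact: Xc.
  - by move=> u _; exact: DN (ps_x ps u).
  - move=> u /andP[u1 u2]; rewrite oppr_gt0.
    by have [|_ _ _ ?] := heta u; first by rewrite !ltW.
have el : e < l.
  rewrite ltNge; apply/negP => le.
  have bbe : `|b - b| < e by rewrite subrr normr0.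
  have [|h _ _] := he b _ _ _ bbe cb ps x0 r0 t0 l; first by rewrite l0 le.
  by move: h; rewrite xl ltxx.
have el' : e <= l' by rewrite ltW// (lt_trans el).
have Kp s : e <= s <= l' -> 0 < K b s.
  move=> /andP[s1 s2]; have [sl|sl] := ltP s l; last by have [|] := heta s; first by rewrite sl.
  by apply: (arc_kk_gt0 pd A xl bB BL' k0); rewrite (lt_le_trans e0).
have Tp s : e <= s <= l' -> 0 < Th b s.
  move=> /andP[s1 s2]; have [sl|sl] := ltP s l; last by have [|] := heta s; first by rewrite sl.
  by apply: (arc_th_gt0 pd n1_gt0 A xl bB BL' k0); rewrite (lt_le_trans e0)//= ltW.
have rp s : e <= s <= l' -> 0 < L ^+ 2 - rho b s.
  move=> /andP[s1 s2]; have [sl|sl] := ltP s l; last first.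
    by have [|_ _ ? _] := heta s; [rewrite sl|rewrite subr_gt0].
  rewrite subr_gt0; apply: le_lt_trans TL2; apply: (rho_end A xl (ltW bb0)).
  by rewrite (ltW sl) (le_trans (ltW e0)).
have [e1 e10 he1] := min_pos el' (Kc b) Kp.
have [e2 e20 he2] := min_pos el' (Thc b) Tp.
have rcc s : {for s, continuous (fun s => L ^+ 2 - rho b s)}.
  by apply: cvgB; [exact: cst_continuous|exact: rhoc].
have [e3 e30 he3] := min_pos el' rcc rp.
(* [ee] is a common margin for all strict inequalities on [[e, l']] and for the sign of [x] at [l'];
   solutions closer than [ee] inherit them. *)
pose ee := Num.min (Num.min e1 e2) (Num.min e3 (- X b l')).
have ee0 : 0 < ee by rewrite !lt_min e10 e20 e30 oppr_gt0 xl'.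
have [k1 k2 k3 k4] : [/\ ee <= e1, ee <= e2, ee <= e3 & ee <= - X b l'].
  by rewrite /ee !ge_min !lexx !orbT.
have l'0 : 0 <= l' by rewrite ltW// (lt_trans l0).
have [d d0 hd] := close_solutions b ee0 l'0.
exists (Num.min d e); first by rewrite lt_min d0 e0.
move=> b'; rewrite lt_min => /andP[b'd b'e] cb'; have [ps' x0' r0' t0'] := fam b'.
have xneg : X b' l' <= 0.
  have [|h _ _ _] := hd b' b'd l'; first by rewrite l'0 lexx.
  by move: h; rewrite ltr_norml => /andP[_]; lra.
have start s : 0 < s <= e -> [/\ 0 < X b' s, rho b' s < L ^+ 2 & 0 < K b' s /\ 0 < Th b' s].
  by move=> hs; have [h1 h2 h3] := he b' _ _ _ b'e cb' ps' x0' r0' t0' s hs; split => //; exact: h3.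
have xe : 0 < X b' e by have [|? _ _] := start e; first by rewrite e0 lexx.
have [l1 /andP[el1 l1l'] [xl1 xpos]] := first_zero el' (fun s _ => Xc b' s) xe xneg.
have rest s : e <= s <= l' -> [/\ 0 < K b' s, 0 < Th b' s & rho b' s < L ^+ 2].
  move=> hs; have h1 := he1 s hs; have h2 := he2 s hs; have h3 := he3 s hs.
  have /andP[s1 s2] := hs.
  have [|_] := hd b' b'd s; first by rewrite (le_trans (ltW e0) s1).
  move=> a1 a2 a3; split.
  - exact: near_gt0 (lt_le_trans a1 (le_trans k1 h1)).
  - exact: near_gt0 (lt_le_trans a2 (le_trans k2 h2)).
  - exact: near_lt (lt_le_trans a3 (le_trans k3 h3)).
exists l1; split => //; last by have [|] := rest l1; first by rewrite (ltW el1).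
split => //; first exact: lt_trans el1.
move=> s /andP[s0 sl1]; have [se|se] := leP s e.
  by have [|h1 h2 [h3 h4]] := start s; [rewrite s0|split => //; exact: ltW].
have [|h1 h2 h3] := rest s; first by rewrite (ltW se) (le_trans (ltW sl1)).
by split; rewrite ?(ltW h1) ?(ltW h2) ?(ltW h3)//; apply: xpos; rewrite (ltW se).
Qed.

(** The limiting solution must return, since the approximating arcs have length at most [4 * L]. Up
    to its first return the nearby arcs are still running, so the weak inequalities pass to the
    limit; the bound [T < L] on the return radius keeps the limit inside the truncation. *)
Lemma hits_limit b : c <= b -> b <= b0 ->
  (forall d, 0 < d -> exists b', [/\ `|b' - b| < d, c <= b', b' <= b0 & hits b']) ->
  exists2 l, arc F n1 c L b l (X b) (Rr b) (Th b) & X b l = 0.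
Proof.
move=> cb bb0 H; have [ps x0 r0 t0] := fam b.
have TL2 : T ^+ 2 < L ^+ 2.
  by rewrite ltr_pXn2r ?nnegrE//; have := T0; have := TL; lra.
have bp : 0 < b by exact: lt_le_trans cb.
have L0 : 0 < L by have := BL; have := c0; have := cb0; lra.
have bB : b < b0 + 1 by lra.
have BL' : b0 + 1 + 1 <= L by have := BL; lra.
have [e e0 he] := near_start n1 pd c0 cb bB BL'.
have start b' s : `|b' - b| < e -> c <= b' -> 0 < s <= e -> 0 < X b' s.
  move=> h1 h2 h3; have [ps' x0' r0' t0'] := fam b'.
  by have [] := he b' _ _ _ h1 h2 ps' x0' r0' t0' s h3.
have stay S : 0 <= S -> (forall s, e <= s <= S -> 0 < X b s) ->
    exists2 d, 0 < d & forall b', `|b' - b| < d -> c <= b' -> forall s, 0 < s <= S -> 0 < X b' s.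
  move=> S0 hS; have [Se|Se] := leP S e.
    exists e => // b' h1 h2 s /andP[s0 sS]; apply: start => //.
    by rewrite s0 (le_trans sS).
  have [z z0 hz] := min_pos (ltW Se) (Xc b) hS.
  have [d d0 hd] := close_solutions b z0 S0.
  exists (Num.min d e) => [|b']; first by rewrite lt_min d0.
  rewrite lt_min => /andP[h1 h2] h3 s /andP[s0 sS].
  have [se|se] := leP s e; first by apply: start; rewrite ?s0.
  have [|h4 _ _ _] := hd b' h1 s; first by rewrite (ltW s0).
  have := hz s; rewrite (ltW se) sS => /(_ isT) h5.
  by move: h4; rewrite ltr_norml => /andP[h4 _]; lra.
have long b' l : arc F n1 c L b' l (X b') (Rr b') (Th b') -> X b' l = 0 -> l <= 4 * L.
  by move=> A' _; exact: (arc_length pd n1_gt0 A').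
(* If [x] stayed positive up to time [4 * L], it would do so for nearby heights too, contradicting
   [arc_length]. *)
have eL : exists2 s, e <= s & X b s <= 0.
  have [h|h] := pselect (forall s, e <= s -> 0 < X b s); last first.
    have [s /not_implyP[h1 h2]] := (existsNP (fun s => e <= s -> 0 < X b s)).2 h.
    by exists s => //; rewrite leNgt; apply/negP.
  have L4 : 0 <= 4 * L by lra.
  have [|d d0 hd] := stay _ L4; first by move=> s /andP[? _]; exact: h.
  have [b' [h1 h2 h3 [l [A xl _]]]] := H d d0.
  have := hd b' h1 h2 l; rewrite (arc_l0 A) (long _ _ A xl) => /(_ isT).
  by rewrite xl ltxx.
have [S eS XS] := eL.
have xe : 0 < X b e by apply: start => //; rewrite ?subrr ?normr0// e0 lexx.
have [l /andP[el lS] [xl xpos]] := first_zero eS (fun s _ => Xc b s) xe XS.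
have l0 : 0 < l by exact: lt_trans el.
exists l => //; split => //.
move=> s /andP[s0 sl].
have xs : 0 < X b s.
  have [se|se] := leP s e; first by apply: start; rewrite ?subrr ?normr0// s0.
  by apply: xpos; rewrite (ltW se).
have [d d0 hd] : exists2 d, 0 < d & forall b', `|b' - b| < d -> c <= b' ->
    forall u, 0 < u <= s -> 0 < X b' u.
  apply: stay; first exact: ltW.
  by move=> u /andP[u1 u2]; apply: xpos; rewrite u1 (le_lt_trans u2).
(* A nearby hitting arc lasts beyond [s], because the nearby [x] is positive on all of []0, s]]. *)
have approx z : 0 < z -> [/\ - z <= K b s, - z <= Th b s & rho b s <= T ^+ 2 + z].
  move=> z0; have [d' d'0 hd'] := close_solutions b z0 (ltW s0).
  have dd : 0 < Num.min d d' by rewrite lt_min d0.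
  have [b' []] := H _ dd; rewrite lt_min => /andP[h1 h2] cb' b'b0 [l2 [A x2 _]].
  have sl2 : s < l2.
    rewrite ltNge; apply/negP => h; have := hd b' h1 cb' l2.
    by rewrite (arc_l0 A) h x2 ltxx => /(_ isT).
  have [|_] := hd' b' h2 s; first by rewrite lexx ltW.
  have [|_ h3 h4 _] := arc_gd A (s := s); first by rewrite s0.
  have := rho_end A x2 b'b0 (s := s); rewrite (ltW s0) (ltW sl2) => /(_ isT) h5 a1 a2 a3.
  split; [exact: near_ge a1 h3|exact: near_ge a2 h4|exact: near_le a3 h5].
have lim (u v : R) : (forall z, 0 < z -> u <= v + z) -> u <= v.
  by move=> h; rewrite leNgt; apply/negP => h'; have := h ((u - v) / 2); lra.
split => //.
- by apply: lim => z /approx[? _ _]; lra.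
- by apply: lim => z /approx[_ ? _]; lra.
- by apply: le_trans (_ : _ <= T ^+ 2) (ltW TL2); apply: lim => z /approx[].
Qed.

(* From the critical radius the curve bends down, so it never returns. *)
Lemma no_critical_arc l : arc F n1 c L b0 l (X b0) (Rr b0) (Th b0) ->
  X b0 l = 0 -> False.
Proof.
move=> A xl; case: (A) => _ _ cb l0 ps x0 r0 t0 gd.
have cl := cos_end_lt0 pd n1_gt0 A xl.
have M0 : 0 <= M.
  by have := pd_lo pd c0; have := pd_hi pd c0; have := pd_m pd; lra.
have cc s : {for s, continuous (fun s => cos (Th b0 s))} := D_cont (Dcos (ps_th ps s)).
(* The cosine becomes negative by the end, so it takes the value [1 / 2]. Up to that time
   [th' <= (M * L / 2) * th] with initial angle [0], which forces the angle to vanish. *)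
have [||s2 /andP[s20 s2l] hs2] := @ivt_neg _ (fun s => cos (Th b0 s)) 0 l (1 / 2) (ltW l0).
- by move=> u _; exact: cc.
- by rewrite t0 cos0; apply/andP; split; lra.
have L0 : 0 < L by have := BL; have := c0; have := cb0; lra.
have : Th b0 s2 <= Th b0 0 * expR (M / 2 * L * (s2 - 0)).
  apply: (gronwall (f' := kp F n1 c L (X b0) (Rr b0) (Th b0)) s20).
  - by move=> u _; exact: Thc.
  - by move=> u _; exact: ps_th ps u.
  move=> s /andP[h1 h2]; have hs : 0 <= s <= l by rewrite (ltW h1) (le_trans (ltW h2)).
  have hs' : 0 < s < l by rewrite h1 (lt_le_trans h2).
  rewrite (kpE _ _ _ c0 cL (in_box A hs)) /kap.
  have rs := r_gt0 A hs; have rho0 := rho2_gt0 (X b0) rs.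
  have bs := r_ge A hs.
  have cs : 0 <= cos (Th b0 s).
    by apply: ltW; apply: (cos_gt0_before pd n1_gt0 A (ltW h1) h2 s2l); rewrite hs2.
  have [xp _ thp _] := gd s hs'.
  have b00 : 0 < b0 by exact: lt_trans cb0.
  have rb : rho2 (X b0) (Rr b0) 0 <= rho2 (X b0) (Rr b0) s.
    by apply: (rho2_le A) => //; case/andP: hs.
  have hF0 : F (b0 ^+ 2) <= F (rho2 (X b0) (Rr b0) s).
    apply: (pd_mono pd); first by rewrite exprn_gt0.
    by move: rb; rewrite {1}/rho2 x0 r0 expr0n add0r.
  have G0 : N / Rr b0 s - F (rho2 (X b0) (Rr b0) s) / 2 * Rr b0 s <= 0.
    rewrite -hb0 kap_start; apply: lerB.
      by rewrite ler_wpM2l// lef_pV2 ?posrE.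
    apply: ler_pM; rewrite ?(ltW b00)//.
      by rewrite divr_ge0// ltW// (lt_le_trans (pd_m pd))// (pd_lo pd)// exprn_gt0.
    by rewrite ler_pM2r.
  have h3 := pd_hi pd rho0; have h4 := pd_lo pd rho0.
  have m0 := pd_m pd.
  have [xL _] := xr_le A hs.
  have sth : sin (Th b0 s) <= Th b0 s.
    have := sin_lip (Th b0 s) 0; rewrite sin0 !subr0 (ger0_norm thp).
    by have := ler_norm (sin (Th b0 s)); lra.
  have sth0 := sin_th_ge0 A hs'.
  have -> : N * cos (Th b0 s) / Rr b0 s + F (X b0 s ^+ 2 + Rr b0 s ^+ 2) / 2 *
      (X b0 s * sin (Th b0 s) - Rr b0 s * cos (Th b0 s)) =
      cos (Th b0 s) * (N / Rr b0 s - F (rho2 (X b0) (Rr b0) s) / 2 * Rr b0 s) +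
      F (rho2 (X b0) (Rr b0) s) / 2 * X b0 s * sin (Th b0 s) by rewrite /rho2; ring.
  have g1 := mulr_ge0_le0 cs G0.
  have g2 : F (rho2 (X b0) (Rr b0) s) / 2 * X b0 s * sin (Th b0 s) <= M / 2 * L * Th b0 s.
    by apply: ler_pM => //; [rewrite mulr_ge0 ?(ltW xp)//; lra|apply: ler_pM => //; lra].
  lra.
rewrite t0 mul0r => th2.
have : 0 <= Th b0 s2.
  move: s20; rewrite le_eqVlt => /predU1P[<-|s20]; first by rewrite t0.
  have [e|e] := eqVneq s2 l; first by move: cl; rewrite -e hs2; lra.
  by have [|_ _ ? _] := gd s2; first by rewrite s20 lt_neqAle e.
move=> th2'; have e : Th b0 s2 = 0 by apply/le_anti; rewrite th2 th2'.
by move: hs2; rewrite e cos0; lra.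
Qed.

(** At the supremum of the hitting heights the arc returns by [hits_limit]. The supremum is below
    [b0] by [no_critical_arc], and it is not itself a hitting height by [hits_open]; [arc_end]
    leaves only [th = pi]. *)
Lemma torus_arc_family : hits c -> exists b l, [/\
  arc F n1 c L b l (X b) (Rr b) (Th b), X b l = 0, Th b l = pi &
  forall s, 0 < s < l -> 0 < Th b s].
Proof.
move=> hc; pose E := [set b | [/\ c <= b, b < b0 & hits b]].
have Ec : E c by split.
have hs : has_sup E by split; [exists c|exists b0 => b [_ /ltW]].
pose b := sup E.
have cb : c <= b by apply: ub_le_sup; [exact: hs.2|].
have bb0 : b <= b0 by apply: ge_sup; [exact: hs.1|move=> u [_ /ltW]].
have appr d : 0 < d -> exists b', [/\ `|b' - b| < d, c <= b', b' <= b0 & hits b'].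
  move=> d0; have [b' [h1 h2 h3] h4] := sup_adherent d0 hs.
  exists b'; split => //; last exact: ltW.
  rewrite distrC ger0_norm ?subr_ge0; first by rewrite -/b in h4; lra.
  by apply: ub_le_sup; [exact: hs.2|].
have [l A xl] := hits_limit cb bb0 appr.
move: bb0; rewrite le_eqVlt => /predU1P[e|bb0].
  by case: (@no_critical_arc l); rewrite -e.
have bp : 0 < b by exact: lt_le_trans cb.
have bB : b < b0 + 1 by lra.
have BL' : b0 + 1 + 1 <= L by have := BL; lra.
have [kl|th] := arc_end pd n1_gt0 A xl bB BL' (hb bp bb0); last first.
  exists b, l; split => // s /andP[s0 sl].
  by apply: (arc_th_gt0 pd n1_gt0 A xl bB BL' (hb bp bb0)); rewrite s0 ltW.
have hbt : hits b by exists l.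
have [d d0 hd] := hits_open cb bb0 hbt.
pose b1 := Num.min (b + d / 2) ((b + b0) / 2).
have bb1 : b < b1 by rewrite lt_min; apply/andP; split; lra.
have b1d : b1 <= b + d / 2 by rewrite ge_min lexx.
have b1b0 : b1 <= (b + b0) / 2 by rewrite ge_min lexx orbT.
have hb1 : hits b1.
  by apply: hd; [rewrite gtr0_norm ?subr_gt0//; lra|exact: le_trans cb (ltW bb1)].
have : b1 <= b.
  apply: ub_le_sup; first exact: hs.2.
  by split => //; [exact: le_trans cb (ltW bb1)|lra].
by rewrite leNgt bb1.
Qed.

End Family.
End Shooting.

(** * Small starting heights: the rising part *)

Lemma sin_ge_half (R : realType) (S C : R) : 0 <= S -> 0 <= C -> C <= 1 / 2 ->
  C ^+ 2 + S ^+ 2 = 1 -> 1 / 2 <= S.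
Proof. by move=> s0 c0 c1 h; rewrite leNgt; apply/negP => h1; nra. Qed.

Section SmallStart.
Variables (R : realType) (m M : R) (f F F1 : R -> R) (n1 : nat).
Hypothesis pd : profile_data m M f F F1.
Hypothesis n1_gt0 : (0 < n1)%N.
Local Notation N := (n1%:R : R).

Variables (c L l : R) (x r th : R -> R).
Implicit Types s t u v : R.
Hypothesis A : arc F n1 c L c l x r th.
Local Notation rho2 := (rho2 x r).
Local Notation ww := (ww f n1 x r).
Local Notation wcos := (wcos f n1 x r th).

(** The weight is compared with [r ^ n1] from both sides. Below the radius [r1] the term [F * r / 2]
    is at most half of the rotational term [N / r], so the curve bends like a catenary. *)
Variables (r1 e1 e2 : R).
Hypothesis r10 : 0 < r1.
Hypothesis r11 : r1 <= 1.
Hypothesis Mr1 : M * r1 ^+ 2 <= N.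
Hypothesis e10 : 0 < e1.
Hypothesis e12 : e1 <= e2.
Hypothesis ww_hi : forall s, 0 <= s <= l -> ww s <= e2 * r s ^+ n1.
Hypothesis ww_lo : forall s, 0 <= s <= l -> r s <= 2 -> e1 * r s ^+ n1 <= ww s.

Let c0 : 0 < c. Proof. by case: A. Qed.
Let l0 : 0 < l. Proof. by case: A. Qed.
Let ps : psol F n1 c L x r th. Proof. by case: A. Qed.
Let x0 : x 0 = 0. Proof. by case: A. Qed.
Let r0 : r 0 = c. Proof. by case: A. Qed.
Let t0 : th 0 = 0. Proof. by case: A. Qed.
Let e20 : 0 < e2. Proof. exact: lt_le_trans e12. Qed.
Let m0 : 0 < m. Proof. exact: pd_m pd. Qed.

Lemma sub_range s t : 0 <= s -> s <= t -> t <= l -> (0 <= s <= l) * (0 <= t <= l).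
Proof. by move=> h1 h2 h3; rewrite h1 h3 (le_trans h2 h3) (le_trans h1 h2). Qed.

Lemma M_ge0 : 0 <= M.
Proof.
have h := pd_lo pd ltr01; have h' := pd_hi pd ltr01.
exact: le_trans (ltW m0) (le_trans h h').
Qed.

(** While [r <= D] on the rising part, the curvature is at least [(N / (2 * r)) * cos th], hence at
    least [N / (2 * D)] times the speed of [x]. *)
Lemma th_growth D s t : 0 <= s -> s <= t -> t <= l -> 0 <= cos (th t) ->
  r t <= r1 -> 0 < D -> r t <= D ->
  th s - N / (2 * D) * x s <= th t - N / (2 * D) * x t.
Proof.
move=> s0 st tl ht hr D0 hD.
have N1 := N_ge1 R n1_gt0; have M0 := M_ge0.
have dd u := DB (ps_th ps u) (DM (DC (N / (2 * D)) u) (ps_x ps u)).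
apply: (mono_le st (f := fun s => th s - N / (2 * D) * x s) (f' := fun s =>
  kap F n1 (clip (- L) L (x s)) (clip c L (r s)) (th s) - N / (2 * D) * cos (th s))).
- by move=> u _; exact: D_cont (dd u).
- by move=> u _; apply: (D_eq (dd u)); rewrite mul0r add0r.
- move=> u /andP[su ut]; have u0 := le_trans s0 (ltW su).
  have [hu _] := sub_range u0 (ltW ut) tl.
  have hu' : 0 < u < l by rewrite (le_lt_trans s0 su) (lt_le_trans ut tl).
  rewrite kap_box ?(arc_cL A)//; last by exact: (in_box A hu).
  have rp := r_gt0 A hu; have rle := r_le A u0 (ltW ut) tl.
  have cp := cos_gt0_before pd n1_gt0 A u0 ut tl ht.
  have sp := sin_th_ge0 A hu'.
  have xp := x_ge0 A hu; have Fp := F_gt0 pd A hu.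
  have FM := pd_hi pd (rho2_gt0 x rp).
  rewrite /kap -/(rho2 u) subr_ge0.
  move: (F _) (cos _) (sin _) (x u) (r u) rp rle cp sp xp Fp FM => G C S X r' rp rle cp sp xp Fp FM.
  have h1 : N / (2 * D) <= N / (2 * r').
    rewrite ler_wpM2l ?ler0n// lef_pV2 ?posrE ?mulr_gt0//.
    by rewrite ler_wpM2l//; exact: le_trans rle hD.
  have h2 : G / 2 * r' <= N / (2 * r').
    rewrite ler_pdivlMr ?mulr_gt0//.
    have -> : G / 2 * r' * (2 * r') = G * r' ^+ 2 by field.
    apply: le_trans Mr1; apply: ler_pM => //; [exact: ltW|exact: sqr_ge0|].
    by apply: lerXn2r; rewrite ?nnegrE; [exact: ltW|exact: ltW|exact: le_trans rle hr].
  have h3 : 0 <= G / 2 * (X * S) by rewrite !mulr_ge0// ltW.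
  have -> : N * C / r' + G / 2 * (X * S - r' * C) =
    (2 * (N / (2 * r')) - G / 2 * r') * C + G / 2 * (X * S) by field; rewrite gt_eqF.
  rewrite -[leLHS]addr0; apply: lerD => //; apply: ler_wpM2r; first exact: ltW.
  by lra.
Qed.

Lemma th_le t : 0 <= t <= l -> th t <= pi.
Proof.
move=> /andP[]; rewrite le_eqVlt => /predU1P[<- _|h]; first by rewrite t0 pi_ge0.
rewrite le_eqVlt => /predU1P[->|h']; first exact: (th_le_pi A).
by apply: ltW; apply: (th_lt_pi A); rewrite h.
Qed.

Lemma wcos_le s t : 0 <= s -> s <= t -> t <= l -> wcos t <= wcos s.
Proof.
move=> s0; rewrite le_eqVlt => /predU1P[->//|st] tl.
by apply: ltW; exact: (wcos_lt pd n1_gt0 A s0 st tl).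
Qed.

Lemma wcos_start : wcos 0 <= e2 * c ^+ n1.
Proof.
rewrite /wcos t0 cos0 mulr1 -r0; apply: ww_hi; rewrite lexx; exact: ltW.
Qed.

(** The momentum [wcos] does not exceed its initial value, which is of order [c ^ n1]; dividing by
    the weight leaves a power of [c / r]. *)
Lemma cos_small t : 0 <= t <= l -> r t <= 2 -> 0 <= cos (th t) ->
  cos (th t) <= e2 / e1 * (c / r t).
Proof.
move=> ht rt hc; have /andP[t00 tl] := ht; have rp := r_gt0 A ht.
have h := le_trans (wcos_le (lexx 0) t00 tl) wcos_start.
have h2 : e1 * r t ^+ n1 * cos (th t) <= e2 * c ^+ n1.
  by apply: le_trans h; apply: (ler_wpM2r hc); exact: ww_lo.
have cr : c <= r t := r_ge A ht.
have h3 : cos (th t) <= e2 / e1 * (c / r t) ^+ n1.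
  rewrite expr_div_n mulrACA -invfM ler_pdivlMr ?mulr_gt0 ?exprn_gt0//.
  by rewrite mulrC.
apply: le_trans h3 _; apply: ler_wpM2l; first by rewrite divr_ge0 ?ltW.
have cr1 : c / r t <= 1 by rewrite ler_pdivrMr// mul1r.
have cr0 : 0 <= c / r t by rewrite divr_ge0 ?ltW.
by rewrite -[leRHS]expr1; apply: ler_wiXn2l.
Qed.

(** The rising part has the width of a catenoidal neck. While [r] is of order [c], the angle bound
    [pi] and [th_growth] give a width of order [c]. Beyond that the curve is steep and
    [x' <= 2 * Q * c * r' / r], which integrates to order [c * |ln c|]. *)
Lemma x_small t : 0 <= t <= l -> 0 <= cos (th t) -> r t <= r1 ->
  x t <= 4 * (e2 / e1) * c * pi - 2 * (e2 / e1) * c * ln c.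
Proof.
move=> ht hc hr; have /andP[t00 tl] := ht.
have [Q [QE Q1]] : exists Q, Q = e2 / e1 /\ 1 <= Q.
  by exists (e2 / e1); split => //; rewrite ler_pdivlMr ?mul1r.
rewrite -QE; have N1 := N_ge1 R n1_gt0; have pi0 := pi_gt0 R.
have Q0 : 0 < Q := lt_le_trans ltr01 Q1.
have D0 : 0 < 2 * Q * c by rewrite !mulr_gt0.
have rp := r_gt0 A ht; have cr : c <= r t := r_ge A ht.
have c1 : c <= 1 := le_trans cr (le_trans hr r11).
have cQ : c <= 2 * Q * c by rewrite -[leLHS]mul1r; apply: ler_wpM2r; [exact: ltW|lra].
have first u : 0 <= u -> u <= t -> r u <= 2 * Q * c -> x u <= 4 * Q * c * pi.
  move=> u0 ut ru; have [_ hu] := sub_range (lexx 0) u0 (le_trans ut tl).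
  have hcu : 0 <= cos (th u).
    move: ut; rewrite le_eqVlt => /predU1P[->//|ut].
    by apply: ltW; exact: (cos_gt0_before pd n1_gt0 A u0 ut tl hc).
  have ru1 : r u <= r1 := le_trans (r_le A u0 ut tl) hr.
  have := th_growth (lexx 0) u0 (le_trans ut tl) hcu ru1 D0 ru.
  rewrite t0 x0 mulr0 subrr subr_ge0 => h.
  have h1 := le_trans h (th_le hu).
  have h2 : N * x u <= pi * (2 * (2 * Q * c)).
    by rewrite -ler_pdivrMr ?mulr_gt0// mulrAC.
  have h3 : 1 * x u <= N * x u by apply: (ler_wpM2r (x_ge0 A hu)).
  by rewrite mul1r in h3; apply: le_trans h3 _; apply: le_trans h2 _; lra.
have lc : 0 <= - ln c by rewrite oppr_ge0 -ln1 ler_ln ?posrE.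
have Qln : 0 <= 2 * Q * c * (- ln c) by rewrite mulr_ge0// ltW.
have [h|h] := leP (r t) (2 * Q * c).
  by have := first t t00 (lexx t) h; lra.
have [||u /andP[u0 ut] ru] := @ivt _ r 0 t (2 * Q * c) t00.
- by move=> u _; exact: r_cont ps u.
- by rewrite r0 cQ ltW.
have ru' : r u <= 2 * Q * c by rewrite ru.
have hx := first u u0 ut ru'.
have dd s (h : 0 <= s <= l) :=
  DB (DM (DC (2 * Q * c) s) (DComp (is_derive1_ln (r_gt0 A h)) (ps_r ps s))) (ps_x ps s).
have : 2 * Q * c * ln (r u) - x u <= 2 * Q * c * ln (r t) - x t.
  apply: (mono_le ut (f := fun s => 2 * Q * c * ln (r s) - x s)
    (f' := fun s => 2 * Q * c * ((r s)^-1 * sin (th s)) - cos (th s))).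
  - move=> s /andP[us st]; have s0 := le_trans u0 us.
    by have [hs _] := sub_range s0 st tl; exact: D_cont (dd s hs).
  - move=> s /andP[/ltW us /ltW st]; have s0 := le_trans u0 us.
    by have [hs _] := sub_range s0 st tl; apply: (D_eq (dd s hs)); rewrite mul0r add0r.
  - move=> s /andP[us st]; have s0 := le_trans u0 (ltW us).
    have [hs _] := sub_range s0 (ltW st) tl.
    have hs' : 0 < s < l by rewrite (le_lt_trans u0 us) (lt_le_trans st tl).
    have rs := r_gt0 A hs; have rsu := r_le A u0 (ltW us) (le_trans (ltW st) tl).
    have rst := r_le A s0 (ltW st) tl.
    have cp := cos_gt0_before pd n1_gt0 A s0 st tl hc.
    have rs2 : r s <= 2 by apply: le_trans rst _; apply: le_trans hr _; have := r11; lra.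
    have := cos_small hs rs2 (ltW cp); rewrite -QE => h1.
    have h2 : Q * (c / r s) <= 1 / 2.
      by rewrite mulrA ler_pdivrMr//; move: rsu; rewrite ru; lra.
    have h3 := sin_ge_half (sin_th_ge0 A hs') (ltW cp) (le_trans h1 h2) (cos2Dsin2 (th s)).
    rewrite subr_ge0; apply: le_trans h1 _.
    have -> : 2 * Q * c * ((r s)^-1 * sin (th s)) = 2 * sin (th s) * (Q * (c / r s)).
      by field; rewrite gt_eqF.
    rewrite -[leLHS]mul1r; apply: ler_wpM2r; last by lra.
    by rewrite !mulr_ge0 ?invr_ge0 ?ltW.
have h1 : ln (r t) <= 0 by rewrite -ln1 ler_ln ?posrE// (le_trans hr).
have h2 : ln c <= ln (r u).
  by rewrite ler_ln ?posrE// ru.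
have h3 : 2 * Q * c * ln (r t) <= 0 by rewrite mulr_ge0_le0// ltW.
have h4 : 2 * Q * c * ln c <= 2 * Q * c * ln (r u) by rewrite ler_wpM2l// ltW.
by lra.
Qed.

Lemma wcos_drop k s t : 0 <= s -> s <= t -> t <= l ->
  (forall u, s < u < t -> k <= ww u * F (rho2 u) * x u / 2) ->
  k * (t - s) <= wcos s - wcos t.
Proof.
move=> s0 st tl hk.
suff : - wcos s - k * s <= - wcos t - k * t by rewrite mulrBr; lra.
have dd u (h : 0 <= u <= l) :=
  DB (DN (D_wcos pd n1_gt0 c0 (arc_cL A) ps (in_box A h))) (DM (DC k u) (DI u)).
apply: (mono_le st (f := fun s => - wcos s - k * s)
  (f' := fun s => ww s * F (rho2 s) * x s / 2 - k)).
- move=> u /andP[su ut].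
  by have [h _] := sub_range (le_trans s0 su) ut tl; exact: D_cont (dd u h).
- move=> u /andP[/ltW su /ltW ut]; have [h _] := sub_range (le_trans s0 su) ut tl.
  by apply: (D_eq (dd u h)); rewrite opprK mul0r add0r mulr1.
- by move=> u /hk; rewrite subr_ge0.
Qed.

Lemma wcos_drop_le k s t : 0 <= s -> s <= t -> t <= l ->
  (forall u, s < u < t -> ww u * F (rho2 u) * x u / 2 <= k) ->
  wcos s - wcos t <= k * (t - s).
Proof.
move=> s0 st tl hk.
suff : k * s + wcos s <= k * t + wcos t by rewrite mulrBr; lra.
have dd u (h : 0 <= u <= l) :=
  DD (DM (DC k u) (DI u)) (D_wcos pd n1_gt0 c0 (arc_cL A) ps (in_box A h)).
apply: (mono_le st (f := fun s => k * s + wcos s)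
  (f' := fun s => k - ww s * F (rho2 s) * x s / 2)).
- move=> u /andP[su ut].
  by have [h _] := sub_range (le_trans s0 su) ut tl; exact: D_cont (dd u h).
- move=> u /andP[/ltW su /ltW ut]; have [h _] := sub_range (le_trans s0 su) ut tl.
  by apply: (D_eq (dd u h)); rewrite mul0r add0r mulr1.
- by move=> u /hk; rewrite subr_ge0.
Qed.

Lemma r_speed s t : s <= t -> r t - r s <= t - s.
Proof.
move=> st; suff : s - r s <= t - r t by lra.
have dd u := DB (DI u) (ps_r ps u).
apply: (mono_le st (f := fun s => s - r s) (f' := fun s => 1 - sin (th s))).
- by move=> u _; exact: D_cont (dd u).
- by move=> u _; rewrite subr_ge0 sin_le1.
Qed.

(** If the curve still rose at radius [r1], the momentum [wcos] would have stayed nonnegative, so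
    the part between radii [r1 / 2] and [r1] could only consume the initial amount; this bounds [X],
    the value of [x] at radius [r1 / 2], by a multiple of [c ^ n1]. But on the way to the radius
    [eps] the momentum keeps at least half of [e1 * c ^ n1], so [X] is at least a multiple of
    [c ^ n1 * (ln eps - ln c)], which is larger for small [c]. *)
Lemma no_late_nose t eps c4 : 0 <= t <= l -> r t = r1 -> 0 <= cos (th t) ->
  c <= eps -> eps <= r1 / 2 -> c4 = m / 2 * e1 * (r1 / 2) ^+ n1 * (r1 / 2) ->
  e2 * c ^+ n1 <= eps * c4 -> M * e2 ^+ 2 * (eps ^+ n1 * eps) <= c4 * e1 / 2 ->
  2 * e2 ^+ 2 < e1 * c4 * (ln eps - ln c) -> False.
Proof.
move=> ht rt hc ceps epsr c4E k1 k2 k3; have /andP[t00 tl] := ht.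
have M0 := M_ge0; have eps0 : 0 < eps := lt_le_trans c0 ceps.
have r12 : 0 < r1 / 2 by rewrite divr_gt0.
have c40 : 0 < c4 by rewrite c4E !mulr_gt0 ?exprn_gt0.
have cn : 0 < c ^+ n1 by rewrite exprn_gt0.
have [||sh /andP[sh0 sht] rsh] := @ivt _ r 0 t (r1 / 2) t00.
- by move=> u _; exact: r_cont ps u.
- by rewrite r0 rt (le_trans ceps epsr); lra.
have [||se /andP[se0 seh] rse] := @ivt _ r 0 sh eps sh0.
- by move=> u _; exact: r_cont ps u.
- by rewrite r0 rsh ceps.
have hlt : sh < t.
  by rewrite lt_neqAle sht andbT; apply/eqP => e; move: rt; rewrite -e rsh; lra.
have shl := le_trans sht tl; have sel := le_trans seh shl.
have [_ hsh] := sub_range (lexx 0) sh0 shl; have [_ hse] := sub_range (lexx 0) se0 sel.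
have xmono u v : 0 <= u -> u <= v -> v <= sh -> x u <= x v.
  move=> u0; rewrite le_eqVlt => /predU1P[->//|uv] vs; apply: ltW.
  apply: (x_lt_cos pd n1_gt0 A u0 uv); first exact: le_trans shl.
  by apply: ltW; exact: (cos_gt0_before pd n1_gt0 A (le_trans u0 (ltW uv)) (le_lt_trans vs hlt) tl hc).
have [X XE] : exists X, X = x sh by exists (x sh).
have X0 : 0 <= X by rewrite XE; exact: (x_ge0 A hsh).
have hX : c4 * X <= e2 * c ^+ n1.
  have hw : 0 <= wcos t by rewrite mulr_ge0// ltW// ww_gt0// (r_gt0 A ht).
  have h1 := wcos_drop (k := m / 2 * e1 * (r1 / 2) ^+ n1 * X) sh0 sht tl.
  have h2 : m / 2 * e1 * (r1 / 2) ^+ n1 * X * (t - sh) <= wcos sh - wcos t.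
    apply: h1 => u /andP[su ut]; have u0 := le_trans sh0 (ltW su).
    have [hu _] := sub_range u0 (ltW ut) tl.
    have ru1 := r_le A u0 (ltW ut) tl; rewrite rt in ru1.
    have ru2 := r_le A sh0 (ltW su) (le_trans (ltW ut) tl); rewrite rsh in ru2.
    have ru3 : r u <= 2 by apply: le_trans ru1 _; apply: le_trans r11 _; lra.
    have hx : X <= x u.
      rewrite XE ltW//; apply: (x_lt_cos pd n1_gt0 A sh0 su (le_trans (ltW ut) tl)).
      by apply: ltW; exact: (cos_gt0_before pd n1_gt0 A u0 ut tl hc).
    have hF := pd_lo pd (rho2_gt0 x (r_gt0 A hu)).
    have hww : e1 * (r1 / 2) ^+ n1 <= ww u.
      apply: le_trans (ww_lo hu ru3); apply: ler_wpM2l; first exact: ltW.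
      by apply: lerXn2r ru2; rewrite nnegrE; [exact: ltW|exact: ltW (r_gt0 A hu)].
    have -> : m / 2 * e1 * (r1 / 2) ^+ n1 * X = e1 * (r1 / 2) ^+ n1 * m * X / 2.
      by move: (_ ^+ n1) => p; field.
    have p0 : 0 <= e1 * (r1 / 2) ^+ n1 by rewrite mulr_ge0 ?exprn_ge0// ltW.
    have pm : 0 <= e1 * (r1 / 2) ^+ n1 * m by rewrite mulr_ge0// ltW.
    rewrite ler_wpM2r ?invr_ge0//; apply: (ler_pM pm X0 _ hx).
    by apply: (ler_pM p0 (ltW m0) hww hF).
  have h3 : r1 / 2 <= t - sh by have := r_speed sht; rewrite rt rsh; lra.
  have h4 := le_trans (wcos_le (lexx 0) sh0 shl) wcos_start.
  have h5 : wcos sh - wcos t <= wcos sh by rewrite gerBl.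
  apply: le_trans (le_trans h5 h4); apply: le_trans h2.
  have -> : c4 * X = m / 2 * e1 * (r1 / 2) ^+ n1 * X * (r1 / 2) by rewrite c4E mulrAC.
  have p0 : 0 <= m / 2 * e1 * (r1 / 2) ^+ n1 * X.
    by rewrite mulr_ge0// !mulr_ge0 ?exprn_ge0// ltW.
  exact: (ler_wpM2l p0 h3).
have Xeps : X <= eps.
  by rewrite -(ler_pM2l c40) (mulrC c4 eps); exact: (le_trans hX).
(* On the rising part [x + r] grows at least at unit rate, and both coordinates are at most [eps] at
   time [se]. *)
have se2 : se <= 2 * eps.
  suff : x 0 + r 0 - 0 <= x se + r se - se.
    by have := xmono se sh se0 seh (lexx sh); rewrite -XE x0 r0 rse; have := c0; lra.
  have dp s := DB (DD (ps_x ps s) (ps_r ps s)) (DI s).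
  apply: (mono_le se0 (f := fun s => x s + r s - s)
      (f' := fun s => cos (th s) + sin (th s) - 1)).
  - by move=> u _; exact: D_cont (dp u).
  - move=> u /andP[u0 us]; rewrite subr_ge0; apply: cos_sin_sum (cos2Dsin2 _).
    + by apply: ltW; apply: (cos_gt0_before pd n1_gt0 A (ltW u0) (lt_le_trans us (le_trans seh sht)) tl hc).
    + by apply: (sin_th_ge0 A); rewrite u0 (lt_le_trans us).
(* The loss of [wcos] up to [se] is at most its rate, proportional to [X], times the time [2 * eps];
   by the bound on [X] and the choice of [eps] this is at most half of [e1 * c ^ n1]. *)
have hcos u : 0 <= u <= se -> c ^+ n1 * e1 / 2 <= wcos u.
  move=> /andP[u0 us]; have ul := le_trans us sel.
  have h1 : wcos 0 - wcos u <= M / 2 * e2 * eps ^+ n1 * X * (u - 0).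
    apply: wcos_drop_le => // v /andP[v0 vu].
    have vs := le_trans (ltW vu) us; have vl := le_trans vs sel.
    have [hv _] := sub_range (ltW v0) vs sel; have rv := r_gt0 A hv.
    have rve := r_le A (ltW v0) vs sel; rewrite rse in rve.
    have xv := xmono v sh (ltW v0) (le_trans vs seh) (lexx _); rewrite -XE in xv.
    have hF := pd_hi pd (rho2_gt0 x rv).
    have hww : ww v <= e2 * eps ^+ n1.
      apply: le_trans (ww_hi hv) _; apply: ler_wpM2l; first exact: ltW.
      by apply: lerXn2r rve; rewrite nnegrE; [exact: ltW|exact: ltW].
    have -> : M / 2 * e2 * eps ^+ n1 * X = e2 * eps ^+ n1 * M * X / 2.
      by move: (_ ^+ n1) => p; field.
    have w0 := ltW (ww_gt0 f n1 x rv); have F0 := ltW (F_gt0 pd A hv).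
    have xv0 := x_ge0 A hv.
    rewrite ler_wpM2r ?invr_ge0//; apply: (ler_pM (mulr_ge0 w0 F0) xv0 _ xv).
    exact: (ler_pM w0 F0 hww hF).
  have h0 : e1 * c ^+ n1 <= wcos 0.
    rewrite /wcos t0 cos0 mulr1 -{1}r0; apply: ww_lo; first by rewrite lexx ltW.
    by rewrite r0; have := le_trans ceps epsr; have := r11; lra.
  have h2 : M / 2 * e2 * eps ^+ n1 * X * (u - 0) <= c ^+ n1 * e1 / 2.
    have p0 : 0 <= M / 2 * e2 * eps ^+ n1.
      by rewrite !mulr_ge0 ?exprn_ge0// ltW.
    rewrite subr0 -(ler_pM2l c40).
    apply: (@le_trans _ _ (M / 2 * e2 * eps ^+ n1 * (e2 * c ^+ n1) * (2 * eps))).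
      have -> : c4 * (M / 2 * e2 * eps ^+ n1 * X * u) =
        M / 2 * e2 * eps ^+ n1 * (c4 * X) * u by move: (eps ^+ n1) => p; ring.
      have q0 : 0 <= M / 2 * e2 * eps ^+ n1 * (c4 * X).
        by rewrite mulr_ge0// mulr_ge0// ltW.
      exact: (ler_pM q0 u0 (ler_wpM2l p0 hX) (le_trans us se2)).
    have -> : M / 2 * e2 * eps ^+ n1 * (e2 * c ^+ n1) * (2 * eps) =
      M * e2 ^+ 2 * (eps ^+ n1 * eps) * c ^+ n1.
      by move: (eps ^+ n1) (c ^+ n1) => p q; field.
    have -> : c4 * (c ^+ n1 * e1 / 2) = c4 * e1 / 2 * c ^+ n1 by ring.
    exact: (ler_wpM2r (ltW cn)).
  by lra.
have dd s (h : 0 <= s <= l) := DB (ps_x ps s)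
  (DM (DC (c ^+ n1 * e1 / 2 / e2) s) (DComp (is_derive1_ln (r_gt0 A h)) (ps_r ps s))).
(* The lower bound on [wcos] and [w <= e2 * r] give [x' >= (c ^ n1 * e1 / (2 * e2)) * r' / r],
   integrated from radius [c] to [eps]. *)
have : x 0 - c ^+ n1 * e1 / 2 / e2 * ln (r 0) <= x se - c ^+ n1 * e1 / 2 / e2 * ln (r se).
  apply: (mono_le se0 (f := fun s => x s - c ^+ n1 * e1 / 2 / e2 * ln (r s))
    (f' := fun s => cos (th s) - c ^+ n1 * e1 / 2 / e2 * ((r s)^-1 * sin (th s)))).
  - by move=> s /andP[s0 st]; have [hs _] := sub_range s0 st sel; exact: D_cont (dd s hs).
  - move=> s /andP[/ltW s0 /ltW st]; have [hs _] := sub_range s0 st sel.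
    by apply: (D_eq (dd s hs)); rewrite mul0r add0r.
  - move=> s /andP[s0 st]; have [hs _] := sub_range (ltW s0) (ltW st) sel.
    have rs := r_gt0 A hs; have rle := r_le A (ltW s0) (ltW st) sel.
    have hu : 0 <= s <= se by rewrite !ltW.
    have cp := cos_gt0_before pd n1_gt0 A (ltW s0) (lt_le_trans st (le_trans seh sht)) tl hc.
    rewrite rse in rle; rewrite subr_ge0.
    have rs1 : r s <= 1 by apply: le_trans rle _; have := r11; lra.
    have h1 : ww s <= e2 * r s.
      apply: le_trans (ww_hi hs) _; apply: ler_wpM2l; first exact: ltW.
      by rewrite -[leRHS]expr1; apply: ler_wiXn2l => //; exact: ltW.
    have h2 : c ^+ n1 * e1 / 2 <= e2 * r s * cos (th s).
      by apply: le_trans (hcos s hu) _; exact: (ler_wpM2r (ltW cp)).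
    have h3 : c ^+ n1 * e1 / 2 / e2 / r s <= cos (th s).
      by rewrite ler_pdivrMr// ler_pdivrMr//; have -> : cos (th s) * r s * e2 = e2 * r s * cos (th s) by ring.
    apply: le_trans h3; rewrite mulrA -[leRHS]mulr1; apply: ler_wpM2l; last exact: sin_le1.
    by rewrite !mulr_ge0 ?invr_ge0 ?ltW.
rewrite x0 r0 rse sub0r => h.
have h1 : c ^+ n1 * e1 / 2 / e2 * (ln eps - ln c) <= X.
  by have := xmono se sh se0 seh (lexx sh); rewrite -XE mulrBr; lra.
have h2 : c4 * (c ^+ n1 * e1 / 2 / e2 * (ln eps - ln c)) <= e2 * c ^+ n1.
  by apply: le_trans hX; exact: (ler_wpM2l (ltW c40)).
have : e1 * c4 * (ln eps - ln c) <= 2 * e2 ^+ 2.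
  rewrite -(ler_pM2r cn) -subr_ge0.
  have -> : 2 * e2 ^+ 2 * c ^+ n1 - e1 * c4 * (ln eps - ln c) * c ^+ n1 =
    2 * e2 * (e2 * c ^+ n1 - c4 * (c ^+ n1 * e1 / 2 / e2 * (ln eps - ln c))).
    by move: (c ^+ n1) (ln eps) (ln c) => p q v; field; rewrite gt_eqF.
  by rewrite mulr_ge0 ?subr_ge0// mulr_ge0// ltW.
by rewrite leNgt k3.
Qed.

End SmallStart.

(** * Small starting heights: the falling part *)

Section SmallEnd.
Variables (R : realType) (m M : R) (f F F1 : R -> R) (n1 : nat).
Hypothesis pd : profile_data m M f F F1.
Hypothesis n1_gt0 : (0 < n1)%N.
Local Notation N := (n1%:R : R).

Variables (c L l : R) (x r th : R -> R).
Implicit Types s t u v : R.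
Hypothesis A : arc F n1 c L c l x r th.
Local Notation rho2 := (rho2 x r).
Local Notation ww := (ww f n1 x r).
Local Notation wcos := (wcos f n1 x r th).
Local Notation kk := (kk x r th).

Variable e2 : R.
Hypothesis e20 : 0 < e2.
Hypothesis ww_hi : forall s, 0 <= s <= l -> ww s <= e2 * r s ^+ n1.

Variable s2 : R.
Hypothesis s20 : 0 < s2.
Hypothesis s2l : s2 < l.
Hypothesis cs2 : cos (th s2) = 0.
Local Notation U := (x s2).

Let l0 : 0 < l. Proof. by case: A. Qed.
Let ps : psol F n1 c L x r th. Proof. by case: A. Qed.
Let m0 : 0 < m. Proof. exact: pd_m pd. Qed.

Let rng s : s2 <= s -> s <= l -> 0 <= s <= l.
Proof. by move=> h ->; rewrite (le_trans (ltW s20) h). Qed.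

Let U0 : 0 < U.
Proof. by case: A => _ _ _ _ _ _ _ _ /(_ s2); rewrite s20 s2l => /(_ isT)[]. Qed.

Lemma cos_after s : s2 <= s -> s <= l -> cos (th s) <= 0.
Proof.
rewrite le_eqVlt => /predU1P[<- _|h sl]; first by rewrite cs2.
rewrite leNgt; apply/negP => h1.
by have := cos_gt0_before pd n1_gt0 A (ltW s20) h sl (ltW h1); rewrite cs2 ltxx.
Qed.

Lemma x_after s t : s2 <= s -> s <= t -> t <= l -> x t <= x s.
Proof.
move=> hs st tl; rewrite -lerN2; have dd u := DN (ps_x ps u).
apply: (mono_le st (f := fun s => - x s) (f' := fun s => - cos (th s))).
- by move=> u _; exact: D_cont (dd u).
- move=> u /andP[h1 h2]; rewrite oppr_ge0; apply: cos_after.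
    exact: le_trans hs (ltW h1).
  exact: le_trans (ltW h2) tl.
Qed.

Lemma sin_ge0_arc s : 0 <= s <= l -> 0 <= sin (th s).
Proof.
move=> hs; apply: sin_ge0_pi; rewrite (th_le A hs) andbT.
move: hs => /andP[]; rewrite le_eqVlt => /predU1P[<- _|s0].
  by rewrite (arc_t0 A).
rewrite le_eqVlt => /predU1P[->|sl].
  have tc : {for l, continuous th} := D_cont (ps_th ps l).
  by apply: (closure_ge l0 tc) => u hu; have [] := arc_gd A hu.
by have [|_ _ ? _] := arc_gd A (s := s); first by rewrite s0.
Qed.

(** The momentum [wcos] vanishes at the nose, and afterwards its rate is proportional to [x <= U].
    The tilt is therefore of order [U], and the curve is nearly vertical. *)
Lemma cos_after_le e s : 0 < e -> s2 <= s -> s <= l -> e * r s ^+ n1 <= ww s ->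
  - cos (th s) <= M * e2 / (2 * e) * U * (s - s2).
Proof.
move=> e0 hs sl hw; have M0 := M_ge0 pd; have hs' := rng hs sl; have rs := r_gt0 A hs'.
have rn : 0 < r s ^+ n1 by rewrite exprn_gt0.
have h1 : wcos s2 - wcos s <= M / 2 * e2 * r s ^+ n1 * U * (s - s2).
  apply: (wcos_drop_le pd n1_gt0 A (ltW s20) hs sl) => u /andP[/ltW hu /ltW us].
  have ul := le_trans us sl; have hu' := rng hu ul; have ru := r_gt0 A hu'.
  have ww1 : ww u <= e2 * r s ^+ n1.
    apply: le_trans (ww_hi hu') _; apply: (ler_wpM2l (ltW e20)).
    have h := r_le A (le_trans (ltW s20) hu) us sl.
    by apply: lerXn2r h; rewrite nnegrE ltW.
  have w0 := ltW (ww_gt0 f n1 x ru); have F0 := ltW (F_gt0 pd A hu').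
  have -> : M / 2 * e2 * r s ^+ n1 * U = e2 * r s ^+ n1 * M * U / 2.
    by move: (r s ^+ n1) => p; field.
  rewrite ler_wpM2r ?invr_ge0//.
  apply: (ler_pM (mulr_ge0 w0 F0) (x_ge0 A hu') _ (x_after (lexx _) hu ul)).
  exact: (ler_pM w0 F0 ww1 (pd_hi pd (rho2_gt0 x ru))).
have h2 : 0 <= - cos (th s) by rewrite oppr_ge0 cos_after.
have h3 : e * r s ^+ n1 * (- cos (th s)) <= M / 2 * e2 * r s ^+ n1 * U * (s - s2).
  apply: le_trans h1; rewrite /wcos cs2 mulr0 sub0r -mulrN.
  exact: (ler_wpM2r h2 hw).
rewrite -(ler_pM2l (mulr_gt0 e0 rn)); apply: le_trans h3 _; rewrite le_eqVlt.
apply/orP; left; apply/eqP; move: (r s ^+ n1) => p.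
by field; rewrite gt_eqF.
Qed.

Variables (B eB : R).
Hypothesis B1 : 1 <= B.
Hypothesis eB0 : 0 < eB.
Hypothesis rB : forall s, 0 <= s <= l -> r s <= B.
Hypothesis ww_B : forall s, 0 <= s <= l -> eB * r s ^+ n1 <= ww s.
Hypothesis U1 : U <= 1.
Hypothesis CU : M * e2 / (2 * eB) * U * (B + 1) <= 1 / 2.
Hypothesis CUU : M * e2 / (2 * eB) * U * U < 1 / 4.

(** [r - x] grows at least at unit rate, so the elapsed time is at most [B + 1], and the hypothesis
    [CU] bounds the tilt by [1 / 2]. *)
Lemma sin_after s : s2 <= s -> s <= l -> 1 / 2 <= sin (th s).
Proof.
move=> hs sl; have hs' := rng hs sl; have M0 := M_ge0 pd.
have h0 : s - s2 <= B + 1.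
  have h := falling_gain pd n1_gt0 A (ltW s20) hs sl cs2.
  have h1 := rB hs'; have h2 := x_ge0 A hs'.
  have h3 : 0 < r s2 by apply: (r_gt0 A); rewrite !ltW.
  by have := U1; lra.
have C0 : 0 <= M * e2 / (2 * eB) * U.
  by rewrite mulr_ge0 ?(ltW U0)// divr_ge0 ?mulr_ge0// ltW.
have h1 := le_trans (cos_after_le eB0 hs sl (ww_B hs')) (ler_wpM2l C0 h0).
have h2 := cos_after hs sl.
apply: (sin_ge_half (C := - cos (th s))); rewrite ?oppr_ge0//.
- exact: sin_ge0_arc.
- exact: le_trans h1 CU.
- by rewrite sqrrN cos2Dsin2.
Qed.

Lemma r_after s : s2 <= s -> s <= l -> (s - s2) / 2 <= r s.
Proof.
move=> hs sl; have dd u := DB (ps_r ps u) (DM (DC 2^-1 u) (DI u)).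
have : r s2 - 2^-1 * s2 <= r s - 2^-1 * s.
  apply: (mono_le hs (f := fun s => r s - 2^-1 * s) (f' := fun s => sin (th s) - 1 / 2)).
  - by move=> u _; exact: D_cont (dd u).
  - by move=> u _; apply: (D_eq (dd u)); rewrite mul0r add0r mulr1 mul1r.
  - move=> u /andP[h1 h2]; rewrite subr_ge0; apply: sin_after; first exact: ltW.
    exact: le_trans (ltW h2) sl.
have h3 : 0 < r s2 by apply: (r_gt0 A); rewrite !ltW.
by lra.
Qed.

(** The negative part [x * cos th] is quadratic in [U] times [r], whereas [r * sin th >= r / 2]. *)
Lemma kk_after s : s2 <= s -> s <= l -> 0 < kk s.
Proof.
move=> hs sl; have hs' := rng hs sl; have M0 := M_ge0 pd.
have rs := r_gt0 A hs'; have xs := x_ge0 A hs'.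
have h1 := cos_after_le eB0 hs sl (ww_B hs').
have h2 := cos_after hs sl; have h3 := sin_after hs sl; have h4 := r_after hs sl.
have C0 : 0 <= M * e2 / (2 * eB) * U.
  by rewrite mulr_ge0 ?(ltW U0)// divr_ge0 ?mulr_ge0// ltW.
have h5 : x s * - cos (th s) <= U * (M * e2 / (2 * eB) * U * (2 * r s)).
  apply: ler_pM => //; first by rewrite oppr_ge0.
    exact: x_after.
  by apply: le_trans h1 _; apply: (ler_wpM2l C0); lra.
have h6 : U * (M * e2 / (2 * eB) * U * (2 * r s)) < 1 / 4 * (2 * r s).
  by rewrite mulrA (mulrC U) ltr_pM2r// mulr_gt0.
have h7 : r s * (1 / 2) <= r s * sin (th s) by apply: (ler_wpM2l (ltW rs)).
by move: h5; rewrite /kk mulrN; lra.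
Qed.

(** Shortly after the nose [wcos] has dropped to at most [- c7 * U], and it keeps decreasing. Where
    [r >= Rc] the weight is at most [c7 / 2], so [- cos th >= 2 * U]. Crossing from radius [Rc] to
    [Rc + 1] takes at least unit time and would lower [x] by [2 * U], more than the at most [U]
    available. *)
Lemma radius_not_reached e1 eta c7 Rc : 0 < e1 ->
  (forall s, 0 <= s <= l -> r s <= 2 -> e1 * r s ^+ n1 <= ww s) ->
  r s2 <= 1 -> 0 < eta -> eta <= 1 -> M * e2 / (2 * e1) * eta ^+ 2 <= 1 / 2 ->
  c7 = e1 * (eta / 4) ^+ n1 * m / 4 * (eta / 2) -> 3 <= Rc -> B = Rc + 1 ->
  (forall s, 0 <= s <= l -> Rc <= r s -> ww s <= c7 / 2) -> r l = B -> False.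
Proof.
move=> e10 ww_lo rs2 eta0 eta1 Ceta c7E Rc3 BE ww_c rl.
have M0 := M_ge0 pd.
have sp t : s2 <= t -> t <= l -> r t - r s2 <= t - s2 by move=> h _; exact: r_speed A _ _ h.
have C0 : 0 <= M * e2 / (2 * e1) * U.
  by rewrite mulr_ge0 ?(ltW U0)// divr_ge0 ?mulr_ge0// ltW.
(* The drop of [wcos] is collected on [[a, b]]: past [a] the radius is at least [eta / 4], and up to
   [b] one still has [x >= U / 2]. *)
have [a [b [aE bE]]] : exists a b, a = s2 + eta / 2 /\ b = s2 + eta.
  by exists (s2 + eta / 2), (s2 + eta).
have sl : s2 <= l := ltW s2l.
have bl : b <= l by have := sp l sl (lexx l); lra.
have [s2a ab] : s2 <= a /\ a <= b by split; lra.
have s2b := le_trans s2a ab.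
have rb u : s2 <= u -> u <= b -> r u <= 2 by move=> h1 h2; have := sp u h1 (le_trans h2 bl); lra.
have xb u : s2 <= u -> u <= b -> U / 2 <= x u.
  move=> h1 h2; have ul := le_trans h2 bl.
  have dd v := DD (ps_x ps v) (DM (DC (M * e2 / (2 * e1) * U * eta) v) (DI v)).
  have : x s2 + M * e2 / (2 * e1) * U * eta * s2 <= x u + M * e2 / (2 * e1) * U * eta * u.
    apply: (mono_le h1 (f := fun s => x s + M * e2 / (2 * e1) * U * eta * s)
      (f' := fun s => cos (th s) + M * e2 / (2 * e1) * U * eta)).
    - by move=> v _; exact: D_cont (dd v).
    - by move=> v _; apply: (D_eq (dd v)); rewrite mul0r add0r mulr1.
    - move=> v /andP[/ltW h3 /ltW h4]; have vl := le_trans h4 ul.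
      have vb := le_trans h4 h2.
      have h5 := cos_after_le e10 h3 vl (ww_lo v (rng h3 vl) (rb v h3 vb)).
      have h6 : v - s2 <= eta by rewrite lerBlDl -bE.
      by have := le_trans h5 (ler_wpM2l C0 h6); lra.
  have h3 : u - s2 <= eta by lra.
  have h4 : M * e2 / (2 * e1) * U * eta * (u - s2) <= U / 2.
    apply: le_trans (ler_wpM2l _ h3) _; first by rewrite mulr_ge0// ltW.
    have -> : M * e2 / (2 * e1) * U * eta * eta = U * (M * e2 / (2 * e1) * eta ^+ 2) by ring.
    have -> : U / 2 = U * (1 / 2) by rewrite mul1r.
    exact: (ler_wpM2l (ltW U0)).
  by move: h4; rewrite mulrBr; lra.
have eta4 : 0 < eta / 4 by rewrite divr_gt0.
have en : 0 < e1 * (eta / 4) ^+ n1 by rewrite mulr_gt0 ?exprn_gt0.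
have hwb : wcos b <= - (c7 * U).
  have h1 : e1 * (eta / 4) ^+ n1 * m * (U / 2) / 2 * (b - a) <= wcos a - wcos b.
    apply: (wcos_drop pd n1_gt0 A (le_trans (ltW s20) s2a) ab bl) => u /andP[/ltW h1 /ltW h2].
    have h3 := le_trans s2a h1; have ul := le_trans h2 bl; have hu := rng h3 ul.
    have ru := r_gt0 A hu; have hr : eta / 4 <= r u by have := r_after h3 ul; lra.
    rewrite ler_wpM2r ?invr_ge0//; apply: ler_pM; [|by rewrite divr_ge0// ltW| |exact: xb].
      by rewrite mulr_ge0// ltW.
    apply: (ler_pM (ltW en) (ltW m0) _ (pd_lo pd (rho2_gt0 x ru))).
    apply: le_trans (ww_lo u hu (rb u h3 h2)); apply: (ler_wpM2l (ltW e10)).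
    by apply: lerXn2r hr; rewrite nnegrE ltW.
  have h2 : wcos a <= 0.
    rewrite /wcos mulr_ge0_le0 ?cos_after//; last exact: le_trans ab bl.
    by apply/ltW/ww_gt0/(r_gt0 A)/rng => //; exact: le_trans ab bl.
  have -> : c7 * U = e1 * (eta / 4) ^+ n1 * m * (U / 2) / 2 * (b - a).
    by rewrite c7E aE bE; move: (_ ^+ n1) => p; field.
  by lra.
have [||tc /andP[btc tcl] rtc] := @ivt _ r b l Rc bl.
- by move=> u _; exact: r_cont ps u.
- by rewrite rl BE (le_trans (rb b s2b (lexx b)))//; lra.
have c70 : 0 < c7.
  by rewrite c7E; apply: mulr_gt0; [rewrite divr_gt0 ?mulr_gt0 ?exprn_gt0|rewrite divr_gt0].
have ltc : 1 <= l - tc by have := r_speed A tcl; rewrite rl rtc BE; lra.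
have dd v := DN (DD (ps_x ps v) (DM (DC (2 * U) v) (DI v))).
have : - (x tc + 2 * U * tc) <= - (x l + 2 * U * l).
  apply: (mono_le tcl (f := fun s => - (x s + 2 * U * s))
    (f' := fun s => - (cos (th s) + 2 * U))).
  - by move=> v _; exact: D_cont (dd v).
  - by move=> v _; apply: (D_eq (dd v)); rewrite mul0r add0r mulr1.
  - move=> v /andP[/ltW h1 /ltW h2]; have bv := le_trans btc h1.
    have h3 := le_trans s2b bv; have hv := rng h3 h2.
    have v0 := le_trans (ltW s20) (le_trans s2b bv).
    have hr := r_le A (le_trans (ltW s20) (le_trans s2b btc)) h1 h2; rewrite rtc in hr.
    have hw := ww_c v hv hr; have hc := cos_after h3 h2.
    have h4 := le_trans (wcos_le pd n1_gt0 A (le_trans (ltW s20) s2b) bv h2) hwb.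
    have h5 : c7 * U <= c7 / 2 * (- cos (th v)).
      have h6 : ww v * (- cos (th v)) <= c7 / 2 * (- cos (th v)).
        by apply: (ler_wpM2r _ hw); rewrite oppr_ge0.
      by apply: le_trans h6; rewrite mulrN -lerN2 opprK.
    have h6 : c7 * (2 * U) <= c7 * (- cos (th v)) by lra.
    by move: h6; rewrite (ler_pM2l c70); lra.
have xtc := x_after (lexx s2) (le_trans s2b btc) tcl.
have xl : 0 <= x l by apply: (x_ge0 A); rewrite lexx ltW.
have h1 : 2 * U * 1 <= 2 * U * (l - tc) by apply: (ler_wpM2l _ ltc); rewrite mulr_ge0// ltW.
by have := U0; move: h1; rewrite mulrBr; lra.
Qed.

End SmallEnd.

(** * Choice of constants and the hitting property for small heights *)

Lemma small_choice (R : realType) (K a b : R) : 0 <= K -> 0 < a -> 0 < b ->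
  exists e, [/\ 0 < e, e <= b & K * e <= a].
Proof.
move=> K0 a0 b0; have K1 : 0 < K + 1 by apply: ltr_wpDl.
exists (Num.min b (a / (K + 1))); split; first by rewrite lt_min b0 divr_gt0.
  by rewrite ge_min lexx.
apply: (@le_trans _ _ ((K + 1) * (a / (K + 1)))); last by rewrite mulrCA divff ?mulr1// gt_eqF.
apply: ler_pM => //; first by rewrite le_min ltW// divr_ge0// ltW.
  by rewrite lerDl.
by rewrite ge_min lexx orbT.
Qed.

Section SmallArc.
Variables (R : realType) (m M : R) (f F F1 : R -> R) (n1 : nat).
Hypothesis pd : profile_data m M f F F1.
Hypothesis n1_gt0 : (0 < n1)%N.
Local Notation N := (n1%:R : R).

Lemma f_lower (u : R) : 0 < u -> f 1 - M <= f u.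
Proof.
move=> u0; have M0 := M_ge0 pd; have [h|h] := leP 1 u.
  by have := f_le pd ltr01 h; lra.
have dd (s : R) (h : 0 < s) := DB (DM (DC M s) (DI s)) (pd_f pd h).
have : M * u - f u <= M * 1 - f 1.
  apply: (mono_le (ltW h) (f := fun s => M * s - f s) (f' := fun s => M - F s)).
  - by move=> s /andP[h1 _]; exact: D_cont (dd s (lt_le_trans u0 h1)).
  - move=> s /andP[h1 _]; apply: (D_eq (dd s (lt_trans u0 h1))).
    by rewrite mul0r add0r mulr1.
  - by move=> s /andP[h1 _]; rewrite subr_ge0; exact: (pd_hi pd (lt_trans u0 h1)).
have : 0 <= M * u by rewrite mulr_ge0// ltW.
by lra.
Qed.

Lemma ww_ge (x r : R -> R) (s v : R) : 0 < r s -> rho2 x r s <= v ->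
  expR (- (f v / 4)) * r s ^+ n1 <= ww f n1 x r s.
Proof.
move=> rs hv; rewrite /ww mulrC; apply: ler_wpM2l; first by rewrite exprn_ge0// ltW.
by rewrite ler_expR lerN2 ler_pM2r ?invr_gt0// (f_le pd (rho2_gt0 x rs)).
Qed.

Lemma ww_le (x r : R -> R) (s v : R) : 0 < r s -> v <= f (rho2 x r s) ->
  ww f n1 x r s <= expR (- (v / 4)) * r s ^+ n1.
Proof.
move=> rs hv; rewrite /ww mulrC; apply: ler_wpM2r; first by rewrite exprn_ge0// ltW.
by rewrite ler_expR lerN2 ler_pM2r ?invr_gt0.
Qed.

(** [e1], [e2] and [eB] compare the weight with [r ^ n1] for [r <= 2], everywhere, and for [r <= B],
    while [x <= 1]. [r1], [eps] and [c4] serve [no_late_nose]; [eta] and [c7] serve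
    [radius_not_reached], with [B - 1] the radius beyond which the weight is at most [c7 / 2]. [D]
    bounds [x] at the nose, and [c] is the starting height, chosen last. *)
Record small_constants (e1 e2 eB r1 eps c4 eta c7 B D c : R) : Prop := {
  sc_e1 : e1 = expR (- (f 5 / 4));
  sc_e2 : e2 = expR (- ((f 1 - M) / 4));
  sc_eB : eB = expR (- (f (B ^+ 2 + 1) / 4));
  sc_r1 : 0 < r1 /\ r1 <= 1;
  sc_Mr1 : M * r1 ^+ 2 <= N;
  sc_c4 : c4 = m / 2 * e1 * (r1 / 2) ^+ n1 * (r1 / 2);
  sc_eps : eps <= r1 / 2 /\ M * e2 ^+ 2 * (eps ^+ n1 * eps) <= c4 * e1 / 2;
  sc_eta : [/\ 0 < eta, eta <= 1 & M * e2 / (2 * e1) * eta ^+ 2 <= 1 / 2];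
  sc_c7 : c7 = e1 * (eta / 4) ^+ n1 * m / 4 * (eta / 2);
  sc_B : 4 <= B;
  sc_decay : forall rho, B - 1 <= rho -> rho ^+ n1 * expR (- (f (rho ^+ 2) / 4)) < c7 / 2;
  sc_D : [/\ D < 1, M * e2 / (2 * eB) * D * (B + 1) <= 1 / 2 & M * e2 / (2 * eB) * D * D < 1 / 4];
  sc_c : 0 < c /\ c <= eps;
  sc_c_c4 : e2 * c ^+ n1 <= eps * c4;
  sc_c_ln : 2 * e2 ^+ 2 < e1 * c4 * (ln eps - ln c);
  sc_c_D : 4 * (e2 / e1) * c * pi - 2 * (e2 / e1) * c * ln c <= D }.

Lemma small_constants_exist (beta : R) : 0 < beta ->
  exists c, c < beta /\ exists e1 e2 eB r1 eps c4 eta c7 B D,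
    small_constants e1 e2 eB r1 eps c4 eta c7 B D c.
Proof.
move=> beta0; have M0 := M_ge0 pd; have m0 := pd_m pd; have N1 := N_ge1 R n1_gt0.
have [e1 e1E] : exists e1, e1 = expR (- (f 5 / 4)) by eexists.
have [e2 e2E] : exists e2, e2 = expR (- ((f 1 - M) / 4)) by eexists.
have e10 : 0 < e1 by rewrite e1E expR_gt0.
have e20 : 0 < e2 by rewrite e2E expR_gt0.
have M1 : 0 < M + 1 by apply: ltr_wpDl.
have [r1 [r10 r11 Mr]] := small_choice M0 ltr01 ltr01.
have Mr1 : M * r1 ^+ 2 <= N.
  apply: le_trans N1; apply: le_trans Mr; apply: (ler_wpM2l M0).
  by rewrite expr2 ler_piMr// ltW.
have [c4 c4E] : exists c4, c4 = m / 2 * e1 * (r1 / 2) ^+ n1 * (r1 / 2) by eexists.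
have c40 : 0 < c4 by rewrite c4E !mulr_gt0 ?exprn_gt0 ?divr_gt0.
have r12 : 0 < r1 / 2 by rewrite divr_gt0.
have c4e1 : 0 < c4 * e1 / 2 by rewrite divr_gt0 ?mulr_gt0.
have Me : 0 <= M * e2 ^+ 2 by rewrite mulr_ge0 ?sqr_ge0.
have [eps [eps0 epsr Keps]] := small_choice Me c4e1 r12.
have eps1 : eps <= 1 by lra.
have Keps' : M * e2 ^+ 2 * (eps ^+ n1 * eps) <= c4 * e1 / 2.
  apply: le_trans Keps; apply: (ler_wpM2l Me); apply: ler_piMl; first exact: ltW.
  by rewrite exprn_ile1// ltW.
have C6 : 0 <= M * e2 / (2 * e1) by rewrite divr_ge0 ?mulr_ge0// ltW.
have half : 0 < 1 / 2 :> R by rewrite divr_gt0.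
have [eta [eta0 eta1 Keta]] := small_choice C6 half ltr01.
have Keta' : M * e2 / (2 * e1) * eta ^+ 2 <= 1 / 2.
  by apply: le_trans Keta; apply: (ler_wpM2l C6); rewrite expr2 ler_piMr// ltW.
have [c7 c7E] : exists c7, c7 = e1 * (eta / 4) ^+ n1 * m / 4 * (eta / 2) by eexists.
have c72 : 0 < c7 / 2.
  apply: divr_gt0 => //; rewrite c7E; apply: mulr_gt0; last by rewrite divr_gt0.
  by rewrite divr_gt0 ?mulr_gt0 ?exprn_gt0 ?divr_gt0.
have [T T1 hT] := weight_decay pd n1 c72.
have [B [B4 BT]] : exists B, 4 <= B /\ T <= B - 1 by exists (T + 4); split; lra.
have [eB eBE] : exists eB, eB = expR (- (f (B ^+ 2 + 1) / 4)) by eexists.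
have eB0 : 0 < eB by rewrite eBE expR_gt0.
have CB : 0 <= M * e2 / (2 * eB) by rewrite divr_ge0 ?mulr_ge0// ltW.
have CB1 : 0 <= M * e2 / (2 * eB) * (B + 1) by rewrite mulr_ge0//; lra.
have e8 : 0 < 1 / 8 :> R by rewrite divr_gt0.
have [D [D0 D1 KD]] := small_choice CB1 e8 half.
have [Q QE] : exists Q, Q = e2 / e1 by eexists.
have Q0 : 0 < Q by rewrite QE divr_gt0.
have pi0 := pi_gt0 R.
have KQ : 0 <= 4 * Q * pi + 4 * Q by rewrite addr_ge0 ?mulr_ge0// ltW.
have [d1 [d10 d1b Kd1]] := small_choice KQ D0 ltr01.
have ec4 : 0 < eps * c4 by rewrite mulr_gt0.
have [K' K'E] : exists K', K' = 2 * e2 ^+ 2 / (e1 * c4) + 1 by eexists.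
have b2 : 0 < beta / 2 by rewrite divr_gt0.
have eK : 0 < eps * expR (- K') by rewrite mulr_gt0 ?expR_gt0.
have [d2 [d20 d2b Kd2]] := small_choice (ltW e20) ec4 eps0.
have [d [[dp d1' d2'] [db dK]]] : exists d, [/\ 0 < d, d <= d1 & d <= d2] /\
    (d <= beta / 2 /\ d <= eps * expR (- K')).
  exists (Num.min (Num.min d1 d2) (Num.min (beta / 2) (eps * expR (- K')))).
  by rewrite !lt_min d10 d20 b2 eK !ge_min !lexx !orbT.
have d_1 : d <= 1 := le_trans d1' d1b.
have cd : d * d <= d by rewrite ler_piMr// ltW.
have c0 : 0 < d * d by rewrite mulr_gt0.
(* A square is taken because [c * |ln c| = 2 * d * (d * |ln d|) <= 2 * d] for [c = d ^ 2], so a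
   linear condition on [d] controls the logarithmic term. *)
exists (d * d); split; first by apply: le_lt_trans cd _; lra.
exists e1, e2, eB, r1, eps, c4, eta, c7, B, D; split => //.
- by move=> rho h; apply: hT; exact: le_trans BT h.
- have h : M * e2 / (2 * eB) * D <= 1 / 8.
    by apply: le_trans KD; rewrite ler_pM2r// ler_peMr//; lra.
  split; first by lra.
    by rewrite mulrAC; lra.
  apply: le_lt_trans (_ : 1 / 8 * 1 < _); last by lra.
  by apply: ler_pM => //; [rewrite mulr_ge0// ltW|exact: ltW|lra].
- by split => //; exact: (le_trans cd (le_trans d2' d2b)).
- apply: le_trans Kd2; apply: (ler_wpM2l (ltW e20)); apply: (le_trans _ (le_trans cd d2')).
  rewrite -[leRHS]expr1; apply: ler_wiXn2l => //; first exact: ltW.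
  exact: (le_trans cd d_1).
- have h : ln (d * d) <= ln eps - K'.
    have -> : ln eps - K' = ln (eps * expR (- K')) by rewrite lnM ?posrE ?expR_gt0// expRK.
    by rewrite ler_ln ?posrE//; exact: le_trans cd dK.
  have ec : 0 < e1 * c4 by rewrite mulr_gt0.
  rewrite [ltRHS]mulrC -ltr_pdivrMr//; apply: lt_le_trans (_ : K' <= _); last by lra.
  by rewrite K'E ltrDl.
- rewrite -QE; have h : - ln d <= d^-1.
    by rewrite -lnV ?posrE//; apply: ltW; apply: ln_sublinear; rewrite invr_gt0.
  have -> : ln (d * d) = ln d + ln d by rewrite lnM.
  have h1 : d * (- ln d) <= 1 by rewrite -(mulfV (lt0r_neq0 dp)); apply: (ler_wpM2l (ltW dp)).
  have h2 : 4 * Q * d * (d * - ln d) <= 4 * Q * d * 1.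
    by apply: ler_wpM2l h1; rewrite !mulr_ge0// ltW.
  have h3 : 4 * Q * pi * (d * d) <= 4 * Q * pi * d.
    by apply: ler_wpM2l cd; rewrite !mulr_ge0// ltW.
  apply: le_trans (le_trans _ Kd1) _; last exact: lexx.
  apply: le_trans (_ : (4 * Q * pi + 4 * Q) * d <= _); last by rewrite ler_wpM2l.
  by move: h2 h3; rewrite !mulrN !mulrA; lra.
Qed.

End SmallArc.

Section SmallHit.
Variables (R : realType) (m M : R) (f F F1 : R -> R) (n1 : nat).
Hypothesis pd : profile_data m M f F F1.
Hypothesis n1_gt0 : (0 < n1)%N.
Local Notation N := (n1%:R : R).
Variables (e1 e2 eB r1 eps c4 eta c7 B D c : R).
Hypothesis K : small_constants m M f n1 e1 e2 eB r1 eps c4 eta c7 B D c.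

Section OneArc.
Variables (L l : R) (x r th : R -> R).
Implicit Types s t : R.
Hypothesis A : arc F n1 c L c l x r th.
Hypothesis rB : forall s, 0 <= s <= l -> r s <= B.
Hypothesis x1 : forall s, 0 <= s <= l -> x s <= 1.

Let e10 : 0 < e1. Proof. by rewrite (sc_e1 K) expR_gt0. Qed.
Let e20 : 0 < e2. Proof. by rewrite (sc_e2 K) expR_gt0. Qed.
Let eB0 : 0 < eB. Proof. by rewrite (sc_eB K) expR_gt0. Qed.
Let r10 : 0 < r1. Proof. by have [] := sc_r1 K. Qed.
Let r11 : r1 <= 1. Proof. by have [] := sc_r1 K. Qed.
Let l0 : 0 < l. Proof. by case: A. Qed.

Let e12 : e1 <= e2.
Proof.
rewrite (sc_e1 K) (sc_e2 K) ler_expR lerN2 ler_pM2r ?invr_gt0//.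
exact: (f_lower pd).
Qed.

Lemma rho2_bound s v : 0 <= s <= l -> 0 <= v -> r s <= v -> rho2 x r s <= v ^+ 2 + 1.
Proof.
move=> hs v0 hv; rewrite /rho2 addrC; apply: lerD.
  by apply: lerXn2r hv; rewrite nnegrE// ltW// (r_gt0 A hs).
by rewrite exprn_ile1 ?x1// (x_ge0 A hs).
Qed.

Lemma arc_ww_hi s : 0 <= s <= l -> ww f n1 x r s <= e2 * r s ^+ n1.
Proof.
move=> hs; have rs := r_gt0 A hs; rewrite (sc_e2 K); apply: ww_le => //.
exact: (f_lower pd (rho2_gt0 x rs)).
Qed.

Lemma arc_ww_lo s : 0 <= s <= l -> r s <= 2 -> e1 * r s ^+ n1 <= ww f n1 x r s.
Proof.
move=> hs h2; rewrite (sc_e1 K); apply: (ww_ge n1 pd (r_gt0 A hs)).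
have h0 : 0 <= 2 :> R by [].
by apply: le_trans (rho2_bound hs h0 h2) _; lra.
Qed.

Lemma arc_ww_B s : 0 <= s <= l -> eB * r s ^+ n1 <= ww f n1 x r s.
Proof.
move=> hs; rewrite (sc_eB K); apply: (ww_ge n1 pd (r_gt0 A hs)).
have h0 : 0 <= B by apply: le_trans (sc_B K).
exact: (rho2_bound hs h0 (rB hs)).
Qed.

Lemma rising_radius s : 0 <= s <= l -> 0 <= cos (th s) -> r s < r1.
Proof.
move=> hs hc; have /andP[s0 sl] := hs; rewrite ltNge; apply/negP => hr.
have [||t /andP[t0 ts] rt] := @ivt _ r 0 s r1 s0.
- by move=> u _; exact: r_cont (arc_ps A) u.
- have [_ h1] := sc_c K; have [h2 _] := sc_eps K.
  rewrite (arc_r0 A) hr andbT; apply: le_trans h1 (le_trans h2 _).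
  by have := r10; lra.
have ht : 0 <= t <= l by rewrite t0 (le_trans ts sl).
have hct : 0 <= cos (th t).
  move: ts; rewrite le_eqVlt => /predU1P[->//|ts].
  by apply: ltW; exact: (cos_gt0_before pd n1_gt0 A t0 ts sl hc).
have [k1 k2] := sc_eps K; have [_ k3] := sc_c K.
exact: (no_late_nose pd n1_gt0 A r10 r11 e10 e12 arc_ww_hi arc_ww_lo ht rt hct k3 k1
  (sc_c4 K) (sc_c_c4 K) k2 (sc_c_ln K)).
Qed.

Lemma rising_x s : 0 <= s <= l -> 0 <= cos (th s) -> x s <= D.
Proof.
move=> hs hc; apply: le_trans (sc_c_D K).
exact: (x_small pd n1_gt0 A r10 r11 (sc_Mr1 K) e10 e12 arc_ww_hi arc_ww_lo hs hc
  (ltW (rising_radius hs hc))).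
Qed.

(** If the end lies on the rising part, it is still close to the start: [r < r1] and [x <= D].
    Otherwise the nose has been passed with [x <= D] there, and the estimates of the falling part
    apply. In every case the only condition that can fail at the end is [x > 0]. *)
Lemma arc_exit : [/\ 0 < kk x r th l, 0 < th l, x l < 1 & 0 < x l -> r l < B].
Proof.
have hl : 0 <= l <= l by rewrite lexx ltW.
have [D1 D2 D3] := sc_D K; have B4 := sc_B K.
have rl := r_gt0 A hl; have sl := sin_ge0_arc A hl.
have kap0 : 0 < r1 by exact: r10.
have [h|h] := leP 0 (cos (th l)).
  have rr := rising_radius hl h; have xl := rising_x hl h.
  have x0 : 0 < x l.
    by have := x_lt_cos pd n1_gt0 A (lexx 0) l0 (lexx l) h; rewrite (arc_x0 A).
  split; [| |exact: le_lt_trans xl D1|by move=> _; have := r11; lra].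
    rewrite /kk; move: h; rewrite le_eqVlt => /predU1P[h0|h0].
      have : 1 / 2 <= sin (th l).
        apply: sin_ge_half (cos2Dsin2 (th l)) => //; rewrite -h0//.
      by move=> h1; rewrite -h0 mulr0 add0r mulr_gt0//; lra.
    by rewrite ltr_pwDl ?mulr_gt0// mulr_ge0// ltW.
  have := th_growth pd n1_gt0 A r10 (sc_Mr1 K) (lexx 0) (ltW l0) (lexx l) h (ltW rr) r10 (ltW rr).
  rewrite (arc_t0 A) (arc_x0 A) mulr0 subrr subr_ge0; apply: lt_le_trans.
  by rewrite mulr_gt0// divr_gt0 ?mulr_gt0// ltr0n.
have [s2 /andP[s20 s2l] cs2] := nose A h.
have hs2 : 0 <= s2 <= l by rewrite (ltW s20) (ltW s2l).
have hc2 : 0 <= cos (th s2) by rewrite cs2 lexx.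
have rr := rising_radius hs2 hc2; have UD := rising_x hs2 hc2.
have U0 := x_ge0 A hs2; have M0 := M_ge0 pd.
have B1 : 1 <= B by apply: le_trans B4; rewrite ler1n.
have CB : 0 <= M * e2 / (2 * eB) by rewrite divr_ge0 ?mulr_ge0// ltW.
have CU : M * e2 / (2 * eB) * x s2 * (B + 1) <= 1 / 2.
  apply: le_trans D2; apply: ler_wpM2r; first by lra.
  exact: (ler_wpM2l CB UD).
have CUU : M * e2 / (2 * eB) * x s2 * x s2 < 1 / 4.
  exact: le_lt_trans (ler_pM (mulr_ge0 CB U0) U0 (ler_wpM2l CB UD) UD) D3.
have U1 : x s2 <= 1 := le_trans UD (ltW D1).
split.
- exact: (kk_after pd n1_gt0 A e20 arc_ww_hi s20 s2l cs2 eB0 rB arc_ww_B U1 CU CUU (ltW s2l) (lexx l)).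
- have th0 : 0 <= th l.
    have tc : {for l, continuous th} := D_cont (ps_th (arc_ps A) l).
    by apply: (closure_ge l0 tc) => u hu; have [] := arc_gd A hu.
  rewrite lt_neqAle th0 andbT; apply/eqP => e.
  by move: h; rewrite -e cos0; rewrite ltr10.
- apply: le_lt_trans (x_after pd n1_gt0 A s20 cs2 (lexx s2) (ltW s2l) (lexx l)) _.
  exact: le_lt_trans UD D1.
- move=> _; rewrite lt_neqAle (rB hl) andbT; apply/eqP => rlB.
  have [eta0 eta1 Keta] := sc_eta K.
  have [Rc [RcE Rc3]] : exists Rc, B = Rc + 1 /\ 3 <= Rc by exists (B - 1); split; lra.
  apply: (radius_not_reached pd n1_gt0 A e20 arc_ww_hi s20 s2l cs2 eB0 rB arc_ww_B U1 CU
    e10 arc_ww_lo (le_trans (ltW rr) r11) eta0 eta1 Keta (sc_c7 K) Rc3 RcE _ rlB) => s hs hr.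
  apply: ltW; have rs := r_gt0 A hs.
  have hB : B - 1 <= r s by rewrite RcE addrK.
  apply: le_lt_trans (sc_decay K hB); rewrite /ww; apply: ler_wpM2l.
    by rewrite exprn_ge0// ltW.
  rewrite ler_expR lerN2 ler_pM2r ?invr_gt0//; apply: (f_le pd); first by rewrite exprn_gt0.
  by rewrite /rho2 lerDr sqr_ge0.
Qed.

End OneArc.

(** The solution is followed up to the first time at which one of the conditions [x > 0], [kk > 0],
    [th > 0], [r < B], [x < 1] fails; by [arc_exit] that condition is [x > 0]. *)
Lemma small_hit (L : R) (x r th : R -> R) : B + 2 <= L -> psol F n1 c L x r th ->
  x 0 = 0 -> r 0 = c -> th 0 = 0 ->
  exists l, [/\ arc F n1 c L c l x r th, x l = 0 & 0 < kk x r th l].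
Proof.
move=> BL ps x00 r00 t00; have B4 := sc_B K; have [c0 ceps] := sc_c K.
have [r10 r11] := sc_r1 K; have N1 := N_ge1 R n1_gt0; have M0 := M_ge0 pd.
have cr : c <= r1 / 2 by have [h _] := sc_eps K; exact: le_trans ceps h.
have c2 : c <= 1 / 2 by apply: le_trans cr _; rewrite ler_pM2r ?invr_gt0.
have cB : c < B by lra.
have BL1 : B + 1 <= L by lra.
have cL : c <= L by lra.
have k0 : 0 < kap F n1 0 c 0.
  rewrite /kap sin0 cos0 mulr1 !mul0r sub0r expr0n /= add0r mulr1.
  have c20 : 0 < c ^+ 2 by rewrite exprn_gt0.
  have FM := pd_hi pd c20.
  have h1 : F (c ^+ 2) * c ^+ 2 <= M * r1 ^+ 2.
    apply: ler_pM => //; [|exact: ltW|].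
      by apply: le_trans (pd_lo pd c20); exact: ltW (pd_m pd).
    by apply: lerXn2r; rewrite ?nnegrE ?ltW//; lra.
  have h2 := le_trans h1 (sc_Mr1 K).
  rewrite mulrN -mulNr addrC -(ltr_pM2r c0) mul0r mulrDl divfK ?gt_eqF//.
  by move: h2; rewrite expr2 mulrA; lra.
have [e e0 he] := near_start n1 pd c0 (lexx c) cB BL1.
have hcc : `|c - c| < e by rewrite subrr normr0.
have H := he c x r th hcc (lexx c) ps x00 r00 t00.
have [e' [e'0 e'e e'2]] : exists e', [/\ 0 < e', e' <= e & e' <= 1 / 2].
  by exists (Num.min e (1 / 2)); rewrite lt_min e0 divr_gt0// !ge_min !lexx orbT.
(* The minimum turns the five conditions into the positivity of one continuous function, to which
   [first_zero] applies. Squares are used for the bound on [r], whose sign is not known in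
   advance. *)
pose phi s := Num.min (x s) (Num.min (kk x r th s) (Num.min (th s) (Num.min (B ^+ 2 - r s ^+ 2) (1 - x s)))).
have phiP s : 0 < phi s -> [/\ 0 < x s, 0 < kk x r th s, 0 < th s, r s ^+ 2 < B ^+ 2 & x s < 1].
  by rewrite /phi !lt_min !subr_gt0 => /and5P[].
have start s : 0 < s <= e' -> 0 < phi s.
  move=> /andP[s0 se]; have [|h1 _ /(_ k0)[h2 h3]] := H s; first by rewrite s0 (le_trans se).
  have gx := abs_growth (g := x) (C := 1) (ltW s0) (ps_x ps) (fun u _ => cos_max (th u)).
  have gr := abs_growth (g := r) (C := 1) (ltW s0) (ps_r ps) (fun u _ => sin_max (th u)).
  have gx' := le_trans (ler_norm _) gx; rewrite x00 mul1r subr0 in gx'.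
  have hr : `|r s| <= 1.
    rewrite -[r s](subrK c) -{1}r00; apply: le_trans (ler_normD _ _) _.
    by rewrite (gtr0_norm c0); move: gr; rewrite mul1r; lra.
  have hr2 : r s ^+ 2 <= 1 by rewrite -real_normK ?num_real// exprn_ile1.
  have hB : 4 ^+ 2 <= B ^+ 2 by apply: lerXn2r B4; rewrite nnegrE//; lra.
  rewrite /phi !lt_min h1 h2 h3 /= !subr_gt0; apply/andP; split; last by lra.
  by apply: le_lt_trans hr2 _; apply: lt_le_trans hB; rewrite expr2; lra.
have phic s : {for s, continuous phi}.
  have kc : {for s, continuous (kk x r th)} := D_cont (D_kk ps s).
  have xc : {for s, continuous x} := D_cont (ps_x ps s).
  have tc : {for s, continuous th} := D_cont (ps_th ps s).
  have rc : {for s, continuous (fun s => B ^+ 2 - r s ^+ 2)} :=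
    D_cont (DB (DC (B ^+ 2) s) (DX 2 (ps_r ps s))).
  have xc' : {for s, continuous (fun s => 1 - x s)} := D_cont (DB (DC 1 s) (ps_x ps s)).
  exact: (continuous_min xc (continuous_min kc (continuous_min tc (continuous_min rc xc')))).
have mk_arc l : 0 < l -> (forall s, 0 < s < l -> 0 < phi s) -> arc F n1 c L c l x r th.
  move=> l0 hl; split => // s hs; have [h1 h2 h3 h4 h5] := phiP s (hl s hs).
  split; [exact: h1|exact: ltW|exact: ltW|].
  have hx : x s ^+ 2 <= 1 by rewrite exprn_ile1 ?ltW.
  have hL : (B + 2) ^+ 2 <= L ^+ 2 by apply: lerXn2r BL; rewrite nnegrE; lra.
  by rewrite /rho2; apply: le_trans hL; move: hx h4; rewrite sqrrD; lra.
have S0 : e' <= 4 * L + 1 by lra.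
(* If no condition failed up to time [4 * L + 1], there would be an arc longer than [arc_length]
   allows. *)
have [s1 /andP[es1 _] hs1] : exists2 s, e' <= s <= 4 * L + 1 & phi s <= 0.
  apply: contrapT => hno.
  have A : arc F n1 c L c (4 * L + 1) x r th.
    apply: mk_arc => [|s /andP[s0 sS]]; first by lra.
    have [h|h] := leP s e'; first by apply: start; rewrite s0.
    by rewrite ltNge; apply/negP => h'; apply: hno; exists s; rewrite ?(ltW h) ?(ltW sS).
  by have := arc_length pd n1_gt0 A; lra.
have pe : 0 < phi e' by apply: start; rewrite e'0 lexx.
have [l /andP[el ls] [pl hl]] := first_zero es1 (fun s _ => phic s) pe hs1.
have l0 : 0 < l := lt_trans e'0 el.
have A : arc F n1 c L c l x r th.
  apply: mk_arc => // s /andP[s0 sl]; have [h|h] := leP s e'; first by apply: start; rewrite s0.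
  by apply: hl; rewrite sl (ltW h).
have ge0 s : 0 <= s <= l -> 0 <= phi s.
  move=> /andP[s0 sl].
  move: s0; rewrite le_eqVlt => /predU1P[<-|s0].
    rewrite /phi !le_min x00 r00 t00 /kk x00 r00 t00 sin0 mulr0 mul0r addr0 !lexx /=.
    rewrite subr0 ler01 andbT subr_ge0; apply: lerXn2r; rewrite ?nnegrE; lra.
  move: sl; rewrite le_eqVlt => /predU1P[->|sl]; first by rewrite pl.
  apply: ltW; have [h|h] := leP s e'; first by apply: start; rewrite s0.
  by apply: hl; rewrite sl (ltW h).
have ge0' s (hs : 0 <= s <= l) : r s <= B /\ x s <= 1.
  have := ge0 s hs; rewrite /phi !le_min !subr_ge0 => /and5P[_ _ _ h h1]; split => //.
  have B0 : 0 <= B by apply: le_trans B4.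
  by move: h; rewrite -ler_sqrt ?sqr_ge0 ?exprn_ge0// !sqrtr_sqr (ger0_norm B0); apply: le_trans (ler_norm _).
have rB s hs := (ge0' s hs).1; have x1 s hs := (ge0' s hs).2.
have [h1 h2 h3 h4] := arc_exit A rB x1.
have xl : 0 <= x l by apply: (x_ge0 A); rewrite lexx ltW.
exists l; split => //; apply/eqP; rewrite eq_le xl andbT leNgt; apply/negP => xl0.
have : 0 < phi l.
  rewrite /phi !lt_min xl0 h1 h2 !subr_gt0 h3 andbT /=; have h := h4 xl0.
  have rl : 0 < r l by apply: (r_gt0 A); rewrite lexx ltW.
  by rewrite ltr_pXn2r ?nnegrE// ltW// (lt_trans rl).
by rewrite pl ltxx.
Qed.
End SmallHit.

(** * The closed profile curve *)

Section Closing.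
Variables (R : realType) (m M : R) (f F F1 : R -> R) (n1 : nat).

(** A full turn takes time [2 * l]: the arc on [[0, l]] followed by its mirror image. The equation
    for the angle holds in its original form, without truncation. *)
Record closed_profile (l : R) (x r th : R -> R) : Prop := {
  cp_l : 0 < l;
  cp_x : forall s : R, is_derive s (1 : R) x (cos (th s));
  cp_r : forall s : R, is_derive s (1 : R) r (sin (th s));
  cp_th : forall s : R, is_derive s (1 : R) th (kap F n1 (x s) (r s) (th s));
  cp_rgt0 : forall s, 0 < r s;
  cp_xper : forall s, x (s + 2 * l) = x s;
  cp_rper : forall s, r (s + 2 * l) = r s;
  cp_thper : forall s, th (s + 2 * l) = th s + pi *+ 2;
  cp_xodd : forall s, x (- s) = - x s;
  cp_reven : forall s, r (- s) = r s;
  cp_xl : x l = 0;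
  cp_xgt0 : forall s, 0 < s < l -> 0 < x s;
  cp_sin : forall s, 0 < s < l -> 0 < sin (th s) }.

Hypothesis pd : profile_data m M f F F1.
Hypothesis n1_gt0 : (0 < n1)%N.

(** By uniqueness the solution is invariant under the reflection based at time [0], where [th = 0],
    and under the one based at time [l], where [th = pi] and [2 * pi] has to be added. Composing the
    two gives the period. *)
Lemma closed_profile_of_arc (c L b l : R) (x r th : R -> R) :
  arc F n1 c L b l x r th -> x l = 0 -> th l = pi ->
  (forall s, 0 < s < l -> 0 < th s) -> closed_profile l x r th.
Proof.
move=> A xl thl tp; case: (A) => c0 cL cb l0 ps x0 r0 t0 gd.
have [ex er eth] : [/\ (fun s => - x (- s)) = x, (fun s => r (- s)) = r &
    (fun s => - th (- s)) = th].
  apply: (psol_unique pd c0 cL (psol_reflect c0 cL ps) ps).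
  - by rewrite oppr0 x0 oppr0.
  - by rewrite oppr0.
  - by rewrite oppr0 t0 oppr0.
have psl := psol_shift l ps.
have [lx lr lth] : [/\ (fun s => - x (- s + l)) = (fun s => x (s + l)),
    (fun s => r (- s + l)) = (fun s => r (s + l)) &
    (fun s => - th (- s + l) + pi *+ 2) = (fun s => th (s + l))].
  apply: (psol_unique pd c0 cL (psol_D2pi (psol_reflect c0 cL psl)) psl).
  - by rewrite oppr0 add0r xl oppr0.
  - by rewrite oppr0.
  - by rewrite oppr0 add0r thl mulr2n; ring.
have xodd s : x (- s) = - x s by rewrite -{2}ex opprK.
have reven s : r (- s) = r s by rewrite -{2}er.
have thodd s : th (- s) = - th s by rewrite -{2}eth opprK.
have e2 s : s + 2 * l = (s + l) + l by ring.
have e1 s : - (s + l) + l = - s by ring.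
have xper s : x (s + 2 * l) = x s.
  by rewrite e2 -(congr1 (fun g => g (s + l)) lx) e1 xodd opprK.
have rper s : r (s + 2 * l) = r s.
  by rewrite e2 -(congr1 (fun g => g (s + l)) lr) e1 reven.
have thper s : th (s + 2 * l) = th s + pi *+ 2.
  by rewrite e2 -(congr1 (fun g => g (s + l)) lth) e1 thodd opprK.
(* The arc lies in the box, and parity together with periodicity carries this to all times by
   induction on the number of lengths [l] in [|s|]; hence the truncation never acts. *)
have hbox s : box c L (x s) (r s).
  have [k hk] : exists k : nat, `|s| <= k%:R * l.
    exists (Num.bound (`|s| / l)); rewrite -ler_pdivrMr// ltW//.
    by apply: archi_boundP; rewrite divr_ge0// ltW.
  have inner t : `|t| <= l -> box c L (x t) (r t).
    have [t0'|t0'] := leP 0 t; first by rewrite ger0_norm// => h; apply: (in_box A); rewrite t0'.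
    rewrite ltr0_norm// => h; have [|h1 h2] := in_box A (s := - t).
      by rewrite h oppr_ge0 ltW.
    by move: h1 h2; rewrite reven xodd sqrrN.
  elim: k s hk => [|k IH] s; first by rewrite mul0r => h; apply: inner; exact: le_trans h (ltW l0).
  move=> h; have [/inner//|h1] := leP `|s| l.
  have kl : 0 <= k%:R * l by rewrite mulr_ge0// ltW.
  have k1 : l <= k%:R * l.
    rewrite ler_peMl// ?(ltW l0)// (ler_nat _ 1) lt0n; apply/eqP => k0.
    by move: h h1; rewrite k0 mul1r ltNge => ->.
  move: h; rewrite -natr1 mulrDl mul1r => h.
  have [s0|s0] := leP 0 s.
    rewrite ger0_norm// in h h1; rewrite -(subrK (2 * l) s) xper rper; apply: IH.
    by rewrite ler_norml; apply/andP; split; lra.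
  rewrite ltr0_norm// in h h1; rewrite -xper -rper; apply: IH.
  by rewrite ler_norml; apply/andP; split; lra.
split => //.
- exact: ps_x ps.
- exact: ps_r ps.
- move=> s; apply: (D_eq (ps_th ps s)); exact: kap_box.
- by move=> s; have [h _] := hbox s; exact: lt_le_trans h.
- by move=> s /gd[].
- move=> s hs; apply: sin_gt0_pi; rewrite (tp s hs) /=; exact: (th_lt_pi A).
Qed.

Lemma closed_profile_exists : exists l x r th, closed_profile l x r th.
Proof.
have [b0 b00 [hb0 hb]] := critical_radius pd n1_gt0.
have [c [cb0 [e1 [e2 [eB [r1 [eps [c4 [eta [c7 [B [D K]]]]]]]]]]]] :=
  small_constants_exist pd n1_gt0 b00.
have [c0 _] := sc_c K.
(* The bound [T] is the same for all truncation radii, so [L] can be chosen after it. *)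
have [T T0 hT] := arc_bound pd n1_gt0 c0 (ltW cb0).
have [L [BL bL TL]] : exists L, [/\ B + 2 <= L, b0 + 2 <= L & T < L].
  exists (Num.max (B + 2) (Num.max (b0 + 2) (T + 1))).
  by split; rewrite ?le_max ?lexx ?orbT// !lt_max ltrDl ltr01 !orbT.
have cL : c <= L by lra.
have [X [Rr [Th [fam dep]]]] := psol_family n1 pd c0 cL.
have hc : hits F n1 c L X Rr Th c.
  by have [ps h1 h2 h3] := fam c; exact: (small_hit pd n1_gt0 K BL ps h1 h2 h3).
have [b [l [A xl thl tp]]] := torus_arc_family pd n1_gt0 c0 cb0 bL T0 TL hb0 hb fam dep hT hc.
by exists l, (X b), (Rr b), (Th b); exact: (closed_profile_of_arc A xl thl tp).
Qed.

End Closing.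

(** * Smooth functions of several variables *)

Section LineDerivative.
Variables (R : realType) (V : normedModType R).
Implicit Types (x v : V) (h u : V -> R).

Lemma line_quotient h x v : (fun t : R => t^-1 *: ((h \o shift x) (t *: v) - h x)) =
  (fun t : R => t^-1 *: (((fun s : R => h (x + s *: v)) \o shift 0) (t *: 1) -
     h (x + (0 : R) *: v))).
Proof.
by apply/funext => t /=; rewrite scale0r addr0 addr0 /GRing.scale/= mulr1 [t *: v + x]addrC.
Qed.

Lemma is_derive_line h x v (a : R) :
  is_derive x v h a <-> is_derive (0 : R) 1 (fun t : R => h (x + t *: v)) a.
Proof.
split=> -[h1 h2].
- split; first by move: h1; rewrite /derivable line_quotient.
  by move: h2; rewrite /derive line_quotient.
- split; first by move: h1; rewrite /derivable line_quotient.
  by move: h2; rewrite /derive line_quotient.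
Qed.

Lemma is_derive_comp (phi : R -> R) u x v (a b : R) :
  is_derive (u x) (1 : R) phi b -> is_derive x v u a ->
  is_derive x v (fun y => phi (u y)) (b * a).
Proof.
move=> hp /is_derive_line hu; apply/is_derive_line.
have hp' : is_derive (u (x + (0 : R) *: v)) (1 : R) phi b by rewrite scale0r addr0.
exact: (is_derive1_comp hp' hu).
Qed.

End LineDerivative.

Section Algebra.
Variables (R : realType) (T : Type).

(** The algebra of functions generated by [G]. By the product rule, closure under differentiation
    has to be checked on generators only. *)
Inductive alg (G : (T -> R) -> Prop) : (T -> R) -> Prop :=
| alg_gen g : G g -> alg G g
| alg_cst c : alg G (fun=> c)
| alg_add g h : alg G g -> alg G h -> alg G (fun x => g x + h x)
| alg_mul g h : alg G g -> alg G h -> alg G (fun x => g x * h x).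

Lemma alg_opp G g : alg G g -> alg G (fun x => - g x).
Proof.
move=> hg; rewrite (_ : (fun x => _) = fun x => -1 * g x).
  exact: (alg_mul (alg_cst G (-1)) hg).
by apply/funext => x; rewrite mulN1r.
Qed.

Lemma alg_sub G g h : alg G g -> alg G h -> alg G (fun x => g x - h x).
Proof. by move=> hg hh; apply: alg_add => //; exact: alg_opp. Qed.

Lemma alg_subset (G G' : (T -> R) -> Prop) g :
  (forall h, G h -> alg G' h) -> alg G g -> alg G' g.
Proof.
move=> GG; elim=> {g} [g /GG//|c|g h _ ag _ ah|g h _ ag _ ah].
- exact: alg_cst.
- exact: alg_add.
- exact: alg_mul.
Qed.

End Algebra.

Section Smooth.
Variables (R : realType) (k : nat).
Local Notation V := 'rV[R]_k.
Local Notation e i := (delta_mx 0 i : V).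
Implicit Types (U : set V) (h g u : V -> R) (i j : 'I_k).

Definition pder i h : V -> R := fun x => 'D_(e i) h x.

Definition smooth U h := forall (s : seq 'I_k) x, U x ->
  {for x, continuous (foldr pder h s)} /\
  forall i, derivable (foldr pder h s) x (e i).

(** A coinductive form of smoothness: any class of continuous functions that contains the partial
    derivatives of its members, up to equality on [U], consists of smooth functions. *)
Definition dclosed U (P : (V -> R) -> Prop) := forall h, P h ->
  (forall x, U x -> {for x, continuous h}) /\
  forall i, exists2 h', P h' & forall x, U x -> is_derive x (e i) h (h' x).

Lemma near_is_derive U g h x i (a : R) : open U -> U x -> (forall y, U y -> g y = h y) ->
  is_derive x (e i) h a -> is_derive x (e i) g a.
Proof.
move=> Uo Ux gh; apply: near_eq_is_derive.
by near=> y; apply/esym/gh; near: y; exact: open_nbhs_nbhs.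
Unshelve. all: by end_near. Qed.

Lemma near_continuous U g h x : open U -> U x -> (forall y, U y -> g y = h y) ->
  {for x, continuous h} -> {for x, continuous g}.
Proof.
move=> Uo Ux gh hc; rewrite /prop_for /continuous_at gh//.
have E : \forall y \near nbhs x, h y = g y.
  by near=> y; apply/esym/gh; near: y; exact: open_nbhs_nbhs.
exact: cvg_trans (near_eq_cvg E) hc.
Unshelve. all: by end_near. Qed.

Lemma dclosed_smooth U P h : open U -> dclosed U P -> P h -> smooth U h.
Proof.
move=> Uo HP Ph s; suff [g Pg hg] : exists2 g, P g &
    forall x, U x -> foldr pder h s x = g x.
  move=> x Ux; have [gc gd] := HP g Pg; split.
    exact: near_continuous Uo Ux hg (gc x Ux).
  move=> i; have [g' _ hg'] := gd i.
  by have [] := near_is_derive Uo Ux hg (hg' x Ux).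
elim: s => [|i s [g Pg hg]]; first by exists h.
have [_ /(_ i)[g' Pg' hg']] := HP g Pg; exists g' => // x Ux /=.
by have [] := near_is_derive Uo Ux hg (hg' x Ux).
Qed.

Lemma smooth_dclosed U : dclosed U (smooth U).
Proof.
move=> h sh; split => [x Ux|i]; first exact: (sh [::] x Ux).1.
exists (pder i h) => [s x Ux|x Ux].
  by have := sh (rcons s i) x Ux; rewrite foldr_rcons.
by split => //; exact: (sh [::] x Ux).2.
Qed.

Lemma alg_dclosed U G : (forall g, G g -> (forall x, U x -> {for x, continuous g}) /\
    forall i, exists2 h', alg G h' & forall x, U x -> is_derive x (e i) g (h' x)) ->
  dclosed U (alg G).
Proof.
move=> HG h; elim=> {h} [g /HG//|c|g h ag [gc gd] ah [hc hd]|g h ag [gc gd] ah [hc hd]].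
- split=> [x _|i]; first exact: (@cst_continuous _ _ c x).
  by exists (fun=> 0); [exact: alg_cst|move=> x _; exact: is_derive_cst].
- split=> [x Ux|i]; first exact: continuousD (gc x Ux) (hc x Ux).
  have [g' ag' hg'] := gd i; have [h' ah' hh'] := hd i.
  exists (fun x => g' x + h' x); first exact: alg_add.
  by move=> x Ux; exact: is_deriveD (hg' x Ux) (hh' x Ux).
- split=> [x Ux|i]; first exact: continuousM (gc x Ux) (hc x Ux).
  have [g' ag' hg'] := gd i; have [h' ah' hh'] := hd i.
  exists (fun x => g x * h' x + h x * g' x).
    by apply: alg_add; apply: alg_mul.
  by move=> x Ux; exact: is_deriveM (hg' x Ux) (hh' x Ux).
Qed.

(** New functions may be adjoined to the smooth ones if their partial derivatives are polynomial in
    themselves and in smooth functions. Inverses and the pair sine and cosine are of this kind. *)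
Lemma smooth_extend U G : open U -> (forall g, G g ->
    (forall x, U x -> {for x, continuous g}) /\
    forall i, exists2 h', alg (fun h => G h \/ smooth U h) h' &
      forall x, U x -> is_derive x (e i) g (h' x)) ->
  forall h, alg (fun h => G h \/ smooth U h) h -> smooth U h.
Proof.
move=> Uo HG h; apply: dclosed_smooth Uo _; apply: alg_dclosed => g [/HG//|sg].
have [gc gd] := smooth_dclosed sg; split=> // i.
by have [g' sg' hg'] := gd i; exists g' => //; apply: alg_gen; right.
Qed.

Section Closure.
Variable U : set V.
Hypothesis Uo : open U.

Let alg_smooth h : alg (smooth U) h -> smooth U h.
Proof.
by apply: dclosed_smooth Uo _; apply: alg_dclosed => g sg;
  have [gc gd] := smooth_dclosed sg; split=> // i;
  have [g' sg' hg'] := gd i; exists g' => //; apply: alg_gen.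
Qed.

Lemma smooth_cst c : smooth U (fun=> c).
Proof. exact: alg_smooth (alg_cst _ _). Qed.

Lemma smoothD g h : smooth U g -> smooth U h -> smooth U (fun x => g x + h x).
Proof. by move=> sg sh; apply/alg_smooth/alg_add; exact: alg_gen. Qed.

Lemma smoothM g h : smooth U g -> smooth U h -> smooth U (fun x => g x * h x).
Proof. by move=> sg sh; apply/alg_smooth/alg_mul; exact: alg_gen. Qed.

Lemma smoothN g : smooth U g -> smooth U (fun x => - g x).
Proof. by move=> sg; apply/alg_smooth/alg_opp; exact: alg_gen. Qed.

Lemma smoothB g h : smooth U g -> smooth U h -> smooth U (fun x => g x - h x).
Proof. by move=> sg sh; exact: (smoothD sg (smoothN sh)). Qed.

Lemma smoothX n g : smooth U g -> smooth U (fun x => g x ^+ n).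
Proof.
move=> sg; elim: n => [|n IH]; first exact: smooth_cst.
by rewrite (_ : (fun x => _) = fun x => g x * g x ^+ n);
  [exact: smoothM|apply/funext => x; rewrite exprS].
Qed.

Lemma smooth_sum (I : finType) (g : I -> V -> R) : (forall a, smooth U (g a)) ->
  smooth U (fun x => \sum_a g a x).
Proof.
move=> sg; elim: (index_enum I) => [|a s IH].
  by rewrite (_ : (fun x => _) = fun=> 0);
    [exact: smooth_cst|apply/funext => x; rewrite big_nil].
rewrite (_ : (fun x => _) = fun x => g a x + \sum_(b <- s) g b x).
  exact: (smoothD (sg a) IH).
by apply/funext => x; rewrite big_cons.
Qed.

(** The class of smooth functions enlarged by all functions equal to [h] on [U] is again closed
    under partial derivatives. *)
Lemma smooth_congr g h : (forall x, U x -> g x = h x) -> smooth U h -> smooth U g.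
Proof.
move=> gh sh; apply: (@dclosed_smooth U (fun g => smooth U g \/ forall x, U x -> g x = h x)) => //;
  last by right.
move=> g' [sg'|hg'].
  have [c d] := smooth_dclosed sg'; split=> // i; have [d' h1 h2] := d i.
  by exists d' => //; left.
have [c d] := smooth_dclosed sh; split=> [x Ux|i].
  exact: near_continuous Uo Ux hg' (c x Ux).
have [h' sh' hh'] := d i; exists h'; first by left.
by move=> x Ux; exact: near_is_derive Uo Ux hg' (hh' x Ux).
Qed.

Lemma smooth_of_partials h (h' : 'I_k -> V -> R) :
  (forall x, U x -> {for x, continuous h}) -> (forall i, smooth U (h' i)) ->
  (forall i x, U x -> is_derive x (e i) h (h' i x)) -> smooth U h.
Proof.
move=> hc sh hd; apply: (@smooth_extend U (eq h)) => //; last by apply: alg_gen; left.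
by move=> g <-; split=> // i; exists (h' i) => [|x Ux]; [apply: alg_gen; right|exact: hd].
Qed.

Lemma smooth_comp_of (phi phi' : R -> R) u : smooth U u ->
  (forall x, U x -> is_derive (u x) (1 : R) phi (phi' (u x))) ->
  smooth U (fun x => phi' (u x)) -> smooth U (fun x => phi (u x)).
Proof.
move=> su hd sd; have [c d] := smooth_dclosed su.
apply: (smooth_of_partials (h' := fun i x => phi' (u x) * pder i u x)).
- move=> x Ux; apply: (@continuous_comp _ _ _ u phi); first exact: c.
  apply: differentiable_continuous; apply/derivable1_diffP.
  by have [] := hd x Ux.
- move=> i; have si : smooth U (pder i u).
    by move=> s x Ux; have := su (rcons s i) x Ux; rewrite foldr_rcons.
  exact: (smoothM sd si).
- move=> i x Ux; apply: is_derive_comp; first exact: hd.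
  by split => //; exact: (su [::] x Ux).2.
Qed.

Lemma smoothV u : smooth U u -> (forall x, U x -> u x != 0) ->
  smooth U (fun x => (u x)^-1).
Proof.
move=> su u0; have [c d] := smooth_dclosed su.
apply: (@smooth_extend U (eq (fun x => (u x)^-1))) => //; last by apply: alg_gen; left.
move=> _ <-; split=> [x Ux|i]; first by apply: continuousV; [exact: u0|exact: c].
have [u' su' hu'] := d i.
exists (fun x => - ((u x)^-1 * (u x)^-1) * u' x).
  apply: alg_mul; last by apply: alg_gen; right.
  by apply: alg_opp; apply: alg_mul; apply: alg_gen; left.
move=> x Ux; have h0 := u0 x Ux.
apply: is_derive_eq (is_derive_comp (DV h0 (DI (u x))) (hu' x Ux)) _.
by rewrite -invfM -expr2 mulN1r.
Qed.

Lemma smooth_div g u : smooth U g -> smooth U u -> (forall x, U x -> u x != 0) ->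
  smooth U (fun x => g x / u x).
Proof. by move=> sg su u0; exact: (smoothM sg (smoothV su u0)). Qed.

Lemma smooth_cos_sin u : smooth U u ->
  smooth U (fun x => cos (u x)) /\ smooth U (fun x => sin (u x)).
Proof.
move=> su; have [c d] := smooth_dclosed su.
pose G g := g = (fun x => cos (u x)) \/ g = (fun x => sin (u x)).
have cc x : U x -> {for x, continuous (fun x => cos (u x))}.
  by move=> Ux; apply: (@continuous_comp _ _ _ u cos); [exact: c|exact: continuous_cos].
have sc x : U x -> {for x, continuous (fun x => sin (u x))}.
  by move=> Ux; apply: (@continuous_comp _ _ _ u sin); [exact: c|exact: continuous_sin].
suff H h : alg (fun h => G h \/ smooth U h) h -> smooth U h.
  by split; apply/H/alg_gen; left; [left|right].
apply: smooth_extend Uo _ h => g [->|->]; split => // i; have [u' su' hu'] := d i.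
- exists (fun x => - sin (u x) * u' x) => [|x Ux].
    by apply: alg_mul; [apply: alg_opp; apply: alg_gen; left; right|apply: alg_gen; right].
  exact: is_derive_comp (is_derive_cos _) (hu' x Ux).
- exists (fun x => cos (u x) * u' x) => [|x Ux].
    by apply: alg_mul; apply: alg_gen; [left; left|right].
  exact: is_derive_comp (is_derive_sin _) (hu' x Ux).
Qed.

Lemma smooth_atan u : smooth U u -> smooth U (fun x => atan (u x)).
Proof.
move=> su; apply: (smooth_comp_of (phi' := fun t => (1 + t ^+ 2)^-1) su).
apply: (smoothV (smoothD (smooth_cst 1) (smoothX 2 su))).
by move=> y _; rewrite gt_eqF// ltr_pwDl// sqr_ge0.
Qed.

Lemma smooth_coord j : smooth U (fun x => x 0 j).
Proof.
apply: (smooth_of_partials (h' := fun i _ => (i == j)%:R)) => [x _|i|i x _].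
- exact: coord_continuous.
- exact: smooth_cst.
- apply/is_derive_line; rewrite (_ : (fun t => _) = fun t : R => x 0 j + t * (i == j)%:R).
    by apply: D_eq (DD (DC (x 0 j) 0) (DM (DI 0) (DC ((i == j)%:R : R) 0))) _; ring.
  by apply/funext => t; rewrite !mxE eqxx eq_sym.
Qed.

End Closure.

Lemma smooth_subset U U' h : U' `<=` U -> smooth U h -> smooth U' h.
Proof. by move=> UU sh s x /UU; exact: sh. Qed.

End Smooth.

(** * Vector-valued maps and the chain rule *)

Section SmoothOn.
Variables (R : realType) (k l : nat).
Local Notation V := 'rV[R]_k.
Implicit Types (U : set V) (g : V -> 'rV[R]_l).

Lemma row_continuous (T : topologicalType) (g : T -> 'rV[R]_l) (x : T) :
  (forall j, {for x, continuous (fun y => g y 0 j)}) -> {for x, continuous g}.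
Proof.
move=> hc; apply/cvgrPdist_le => e e0; near=> y.
rewrite [leLHS]/Num.Def.normr/= mx_normrE; apply: (bigmax_le _ (ltW e0)) => -[i j] _ /=.
rewrite !mxE (ord1 i); move: j; near: y; apply: filter_forall => j.
by have /cvgrPdist_le/(_ e e0) := hc j.
Unshelve. all: by end_near. Qed.

Lemma is_derive_row (W : normedModType R) (g : W -> 'rV[R]_l) (x v : W) (a : 'rV[R]_l) :
  (forall j, is_derive x v (fun y => g y 0 j) (a 0 j)) -> is_derive x v g a.
Proof.
move=> h; have dg : derivable g x v.
  by apply/derivable_mxP => i j; rewrite (ord1 i); have [] := h j.
split=> //; rewrite derive_mx//; apply/rowP => j; rewrite mxE.
by have [] := h j.
Qed.

Lemma is_derive_coord (W : normedModType R) (g : W -> 'rV[R]_l) (x v : W) (a : 'rV[R]_l) j :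
  is_derive x v g a -> is_derive x v (fun y => g y 0 j) (a 0 j).
Proof.
move=> [dg eg]; split; first by have /derivable_mxP := dg; exact.
by rewrite -eg derive_mx// mxE.
Qed.

(** Iterated partial derivatives commute with taking coordinates on the open set; this reduces
    vector-valued smoothness to the scalar calculus. *)
Lemma smooth_on_coords U g : open U ->
  smooth_on U g <-> forall j, smooth U (fun x => g x 0 j).
Proof.
move=> Uo; split=> [sg j|sg s].
- suff E s x : U x -> foldr (@pder R k) (fun x => g x 0 j) s x = foldr pderive g s x 0 j.
    move=> s x Ux; have [c d] := sg s x Ux; split.
      apply: (near_continuous Uo Ux (E s)).
      by apply: (@continuous_comp _ _ _ (foldr pderive g s) (fun M => M 0 j)) => //;
        exact: coord_continuous.
    move=> i; have dj : derivable (fun x => foldr pderive g s x 0 j) x (delta_mx 0 i).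
      by have /derivable_mxP := d i; exact.
    by have [] := near_is_derive Uo Ux (E s) (DeriveDef dj erefl).
  elim: s x => [|i s IH] x Ux //=; have [_ d] := sg s x Ux.
  have dj : derivable (fun x => foldr pderive g s x 0 j) x (delta_mx 0 i).
    by have /derivable_mxP := d i; exact.
  rewrite /pder /pderive; have [_ ->] := near_is_derive Uo Ux IH (DeriveDef dj erefl).
  by rewrite derive_mx// mxE.
- suff E x : U x -> foldr pderive g s x =
      \row_j foldr (@pder R k) (fun x => g x 0 j) s x.
    move=> x Ux.
    have Ej y j : U y -> foldr pderive g s y 0 j = foldr (@pder R k) (fun x => g x 0 j) s y.
      by move=> Uy; rewrite E// mxE.
    split.
      apply: row_continuous => j; apply: (near_continuous Uo Ux (fun y => @Ej y j)).
      by have [] := sg j s x Ux.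
    move=> i; apply/derivable_mxP => i' j; rewrite (ord1 i').
    have [_ d] := sg j s x Ux.
    by have [] := near_is_derive Uo Ux (fun y => @Ej y j) (DeriveDef (d i) erefl).
  elim: s x => [|i s IH] x Ux /=; first by apply/rowP => j; rewrite mxE.
  apply/rowP => j; rewrite mxE /pderive.
  have d : forall j, is_derive x (delta_mx 0 i) (fun y => foldr pderive g s y 0 j)
      ((\row_j pder i (foldr (@pder R k) (fun x => g x 0 j) s) x) 0 j).
    move=> j'; rewrite mxE; have [_ d'] := sg j' s x Ux.
    apply: (near_is_derive Uo Ux _ (DeriveDef (d' i) erefl)) => y Uy.
    by rewrite IH// mxE.
  by have [_ ->] := is_derive_row d; rewrite mxE.
Qed.

End SmoothOn.

Lemma cvg_sumr (R : realType) (T : Type) (F : set_system T) (FF : Filter F)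
  (I : finType) (h : I -> T -> R) (a : I -> R) :
  (forall i, h i t @[t --> F] --> a i) -> \sum_i h i t @[t --> F] --> \sum_i a i.
Proof.
move=> hc; elim: (index_enum I) => [|i s IH].
  rewrite big_nil (_ : (fun t => _) = fun=> 0); first exact: cvg_cst.
  by apply/funext => t; rewrite big_nil.
rewrite big_cons (_ : (fun t => _) = fun t => h i t + \sum_(j <- s) h j t).
  exact: cvgD (hc i) IH.
by apply/funext => t; rewrite big_cons.
Qed.

Section ChainRule.
Variables (R : realType) (k : nat).
Local Notation V := 'rV[R]_k.
Local Notation e i := (delta_mx 0 i : V).
Variables (U : set V) (H : V -> R) (p : V).
Hypothesis Uo : open U.
Hypothesis Up : U p.
Hypothesis sH : smooth U H.

Lemma rv_normP (v : V) (a : R) : 0 <= a -> (`|v| <= a) <-> forall j, `|v 0 j| <= a.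
Proof.
move=> a0; split=> [h j|h].
  apply: le_trans h; rewrite [leRHS]/Num.Def.normr/= mx_normrE.
  exact: (@le_bigmax _ _ _ 0 (fun ij => `|v ij.1 ij.2|) (0, j)).
rewrite [leLHS]/Num.Def.normr/= mx_normrE; apply: (bigmax_le _ a0) => -[i j] _ /=.
by rewrite (ord1 i).
Qed.

(* The increment of [H] is telescoped over the coordinates, and the mean value
   theorem is applied along each edge. *)
Lemma mean_value_coords : exists2 d, 0 < d & forall q, `|q - p| < d ->
  exists xi : 'I_k -> V, (forall j, `|xi j - p| <= `|q - p|) /\
    H q - H p = \sum_j (q 0 j - p 0 j) * pder j H (xi j).
Proof.
have /nbhs_ballP[d /= d0 hd] : nbhs p U by exact: open_nbhs_nbhs.
exists d => // q hq.
have HU y : `|y - p| <= `|q - p| -> U y.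
  by move=> h; apply: hd; rewrite -ball_normE /= distrC; exact: le_lt_trans hq.
pose Q (i : nat) : V := \row_j (if (j < i)%N then q 0 j else p 0 j).
pose P (j : 'I_k) (t : R) := Q j + (t * (q 0 j - p 0 j)) *: e j.
have coord j' := (rv_normP (q - p) (normr_ge0 _)).1 (lexx _) j'.
have PB j (t : R) : 0 <= t <= 1 -> `|P j t - p| <= `|q - p|.
  move=> /andP[t0 t1]; apply/rv_normP => // j'; have := coord j'.
  rewrite /P /Q !mxE eqxx /=; case: (eqVneq j' j) => [->|_].
    rewrite ltnn mulr1 addrAC subrr add0r normrM (ger0_norm t0) => h.
    by apply: le_trans h; rewrite ler_piMl.
  by rewrite mulr0 addr0; case: ifP => // _ _; rewrite subrr normr0.
have P0 j : P j 0 = Q j by rewrite /P mul0r scale0r addr0.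
have P1 j : P j 1 = Q j.+1.
  apply/rowP => j'; rewrite /P /Q !mxE eqxx mul1r /= [(j' < j.+1)%N]ltnS [(j' <= j)%N]leq_eqVlt.
  have [->|ne] := eqVneq j' j; first by rewrite eqxx ltnn mulr1 addrC subrK.
  by rewrite (negbTE (_ : val j' != val j))// mulr0 addr0.
have dP j (t : R) : 0 <= t <= 1 ->
    is_derive t (1 : R) (fun t => H (P j t)) ((q 0 j - p 0 j) * pder j H (P j t)).
  move=> ht; have [_ d1] := sH [::] (HU _ (PB j t ht)).
  have /is_derive_line dl : is_derive (P j t) (e j) H (pder j H (P j t)) by split.
  have ds : is_derive t (1 : R) (fun s => (s - t) * (q 0 j - p 0 j)) (q 0 j - p 0 j).
    by apply: D_eq (DM (DB (DI t) (DC t t)) (DC (q 0 j - p 0 j) t)) _; ring.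
  have e0 : (t - t) * (q 0 j - p 0 j) = 0 by rewrite subrr mul0r.
  rewrite -[X in is_derive X] e0 in dl.
  have := DComp (g := fun s => (s - t) * (q 0 j - p 0 j)) dl ds.
  rewrite mulrC; congr (is_derive _ _ _ _); apply/funext => s.
  by rewrite /P -addrA -scalerDl; congr (H (_ + _ *: _)); ring.
have /choice[xi hxi] : forall j : 'I_k, exists y : V, `|y - p| <= `|q - p| /\
    H (Q j.+1) - H (Q j) = (q 0 j - p 0 j) * pder j H y.
  move=> j; have [||c hc] := @MVT R (fun t => H (P j t))
      (fun t => (q 0 j - p 0 j) * pder j H (P j t)) 0 1 ltr01.
  - by move=> t /andP[/ltW t0 /ltW t1]; apply: dP; rewrite t0 t1.
  - apply: continuous_in_subspaceT => t; rewrite inE /= in_itv /= => ht.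
    exact: D_cont (dP j t ht).
  rewrite subr0 mulr1 P0 P1 => E; exists (P j c); split=> //.
  by apply: PB; move: hc; rewrite in_itv /= => /andP[/ltW -> /ltW ->].
exists xi; split=> [j|]; first by have [] := hxi j.
have Q0 : Q 0%N = p by apply/rowP => j; rewrite mxE.
have Qk : Q k = q by apply/rowP => j; rewrite mxE ltn_ord.
rewrite -{1}Qk -{1}Q0 -(telescope_sumr (fun i => H (Q i)) (leq0n k)) big_mkord.
by apply: eq_bigr => j _; have [] := hxi j.
Qed.

(** The difference quotient of [H] along the curve is, by [mean_value_coords], a sum of the
    coordinate quotients times partial derivatives at points that tend to [p]. *)
Lemma chain_rule (gam : R -> V) (v : V) : gam 0 = p ->
  (forall j, is_derive (0 : R) (1 : R) (fun t => gam t 0 j) (v 0 j)) ->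
  is_derive (0 : R) (1 : R) (fun t => H (gam t)) (\sum_j v 0 j * pder j H p).
Proof.
move=> g0 dg; have [d d0 hd] := mean_value_coords.
have /choice[xi hxi] : forall q : V, exists xi : 'I_k -> V,
    (forall j, `|xi j - p| <= `|q - p|) /\ (`|q - p| < d ->
    H q - H p = \sum_j (q 0 j - p 0 j) * pder j H (xi j)).
  move=> q; have [/hd[xi [h1 h2]]|h] := ltP `|q - p| d; first by exists xi.
  by exists (fun=> p); split=> // j; rewrite subrr normr0.
have gc : {for 0, continuous gam}.
  by apply: row_continuous => j; exact: D_cont (dg j).
have near_d : \forall t \near (0 : R)^', `|gam t - p| < d.
  apply: nbhs_dnbhs; have /cvgrPdist_lt/(_ d d0) := gc; rewrite g0.
  by apply: filterS => t; rewrite distrC.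
have lim : (t^-1 *: ((((fun t => H (gam t)) \o shift 0) (t *: (1 : R))) - H (gam 0)))
    @[t --> (0 : R)^'] --> \sum_j v 0 j * pder j H p.
  have cj j : (t^-1 *: (((fun t => gam t 0 j) \o shift 0) (t *: (1 : R)) - gam 0 0 j) *
      pder j H (xi (gam t) j)) @[t --> (0 : R)^'] --> v 0 j * pder j H p.
    apply: cvgM; first by have [h1 h2] := dg j; rewrite -h2; exact: h1.
    have pc : {for p, continuous (pder j H)} by have [] := sH [:: j] Up.
    apply: (@cvg_comp _ _ _ (fun t => xi (gam t) j) (pder j H) _ (nbhs p)) => //.
    apply/cvgrPdist_lt => eps eps0; apply: nbhs_dnbhs; have /cvgrPdist_lt/(_ eps eps0) := gc.
    rewrite g0; apply: filterS => t; rewrite distrC => h.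
    by rewrite distrC; apply: le_lt_trans h; have [] := hxi (gam t).
  have E : \forall t \near (0 : R)^', \sum_j t^-1 *:
      (((fun t => gam t 0 j) \o shift 0) (t *: (1 : R)) - gam 0 0 j) * pder j H (xi (gam t) j) =
      t^-1 *: (((fun t => H (gam t)) \o shift 0) (t *: (1 : R)) - H (gam 0)).
    near=> t; rewrite /= !addr0 [t *: _]mulr1 g0.
    have [_ ->] := hxi (gam t); last by near: t.
    rewrite /GRing.scale /= mulr_sumr; apply: eq_bigr => j _.
    by rewrite -mulrA.
  exact: cvg_trans (near_eq_cvg E) (cvg_sumr _ cj).
by split; [exact: cvgP lim|exact: cvg_lim lim].
Unshelve. all: by end_near. Qed.

End ChainRule.

(** * Simplicity of the profile curve *)

Lemma periodic_int (R : realType) (g : R -> R) (a : R) :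
  (forall s, g (s + a) = g s) -> forall (k : int) s, g (s + a * k%:~R) = g s.
Proof.
move=> hg; elim/int_rec => [s|n IH s|n IH s]; first by rewrite mulr0 addr0.
- by rewrite -addn1 PoszD intrD mulrDr mulr1 addrA hg IH.
- rewrite -[RHS](IH s) -(hg (s + a * _)); congr g.
  by rewrite -addn1 PoszD opprD intrD mulrDr mulrN1 addrA subrK.
Qed.

Lemma local_inverse (R : realType) (h h' : R -> R) (s0 : R) :
  (forall s, is_derive s (1 : R) h (h' s)) -> (forall s, {for s, continuous h'}) ->
  0 < h' s0 -> exists (d : R) (g : R -> R), [/\ 0 < d,
    forall s, `|s - s0| < d -> g (h s) = s /\ h (s0 - d) < h s < h (s0 + d) &
    forall t, h (s0 - d) < t < h (s0 + d) ->
      [/\ `|g t - s0| < d, 0 < h' (g t) & is_derive t (1 : R) g (h' (g t))^-1]].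
Proof.
move=> dh ch h0; have [d1 d10 hd1] := cont_eps (ch s0) h0.
have [d [d0 d1d]] : exists d, 0 < d /\ d < d1 by exists (d1 / 2); split; lra.
have hp (s : R) : s0 - d <= s <= s0 + d -> 0 < h' s.
  move=> /andP[h1 h2]; have /hd1 : `|s - s0| < d1 by rewrite ltr_norml; apply/andP; split; lra.
  by rewrite ltr_norml => /andP[h3 _]; lra.
have mono (s t : R) : s0 - d <= s -> s < t -> t <= s0 + d -> h s < h t.
  move=> h1 st h2; apply: (mono_lt st (f' := h')) => // u hu; first exact: D_cont (dh u).
  by apply: hp; have /andP[h3 h4] := hu; rewrite (ltW (le_lt_trans h1 h3)) (ltW (lt_le_trans h4 h2)).
have in_d (s : R) : `|s - s0| < d -> s0 - d < s < s0 + d.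
  by rewrite ltr_norml => /andP[h1 h2]; apply/andP; split; lra.
(* The local inverse is chosen pointwise, with the default value [s0] off the image; monotonicity
   makes the choice unique on the image. *)
have /choice[g hg] : forall t, exists s, (exists2 s', `|s' - s0| < d & h s' = t) ->
    `|s - s0| < d /\ h s = t.
  move=> t; have [[s hs1 hs2]|no] := pselect (exists2 s', `|s' - s0| < d & h s' = t).
    by exists s.
  by exists s0.
have gh (s : R) : `|s - s0| < d -> g (h s) = s.
  move=> hs; have [|h1 h2] := hg (h s); first by exists s.
  have /andP[a1 a2] := in_d _ hs; have /andP[b1 b2] := in_d _ h1.
  have [lt|lt|//] := ltgtP (g (h s)) s.
    by have := mono _ _ (ltW b1) lt (ltW a2); rewrite h2 ltxx.
  by have := mono _ _ (ltW a1) lt (ltW b2); rewrite h2 ltxx.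
exists d, g; split=> // [s hs|t /andP[t1 t2]].
  have /andP[a1 a2] := in_d _ hs; split; first exact: gh.
  by rewrite (mono _ _ (lexx _) a1 (ltW a2)) (mono _ _ (ltW a1) a2 (lexx _)).
have dd : s0 - d <= s0 + d by lra.
have [||s /andP[s1 s2] hs] := @ivt _ h _ _ t dd.
- by move=> u _; exact: D_cont (dh u).
- by rewrite !ltW.
have sd : `|s - s0| < d.
  move: s1 s2; rewrite !le_eqVlt => /predU1P[e|s1]; first by move: t1; rewrite e hs ltxx.
  move=> /predU1P[e|s2]; first by move: t2; rewrite -e hs ltxx.
  by rewrite ltr_norml; apply/andP; split; lra.
have gt : g t = s by rewrite -hs gh.
have /andP[a1 a2] := in_d _ sd.
have hs0 : 0 < h' s by apply: hp; rewrite !ltW.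
rewrite gt; split=> //; rewrite -hs; apply: is_derive_inverse (dh s) _.
- near=> u; apply: gh; near: u.
  apply/nbhs_ballP; exists (d - `|s - s0|); first by rewrite /= subr_gt0.
  move=> u; rewrite -ball_normE /= distrC => hu.
  rewrite -[u](subrK s) -addrA; apply: le_lt_trans (ler_normD _ _) _; lra.
- by near=> u; exact: D_cont (dh u).
- by rewrite gt_eqF.
Unshelve. all: by end_near. Qed.

Section Curve.
Variables (R : realType) (F : R -> R) (n1 : nat) (l : R) (x r th : R -> R).
Hypothesis cp : closed_profile F n1 l x r th.
Implicit Type s : R.

Let l0 : 0 < l. Proof. exact: cp_l cp. Qed.

Definition same_param (s s' : R) := exists k : int, s' = s + 2 * l * k%:~R.

Lemma same_param_curve s s' : same_param s s' ->
  [/\ x s' = x s, r s' = r s, cos (pi * s' / l) = cos (pi * s / l) &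
      sin (pi * s' / l) = sin (pi * s / l)].
Proof.
move=> [k ->]; have e u : pi * (u + 2 * l) / l = pi * u / l + pi *+ 2.
  by rewrite mulr2n; field; rewrite gt_eqF.
split.
- exact: (periodic_int (cp_xper cp)).
- exact: (periodic_int (cp_rper cp)).
- apply: (@periodic_int _ (fun s => cos (pi * s / l)) (2 * l)) => u.
  by rewrite e (cosD2pi (pi * u / l)).
- apply: (@periodic_int _ (fun s => sin (pi * s / l)) (2 * l)) => u.
  by rewrite e (sinD2pi (pi * u / l)).
Qed.

Lemma same_param_reduce s : exists2 s1, - l <= s1 < l & same_param s1 s.
Proof.
pose k := Num.floor ((s + l) / (2 * l)).
have l2 : 0 < 2 * l by rewrite mulr_gt0.
exists (s - 2 * l * k%:~R); last by exists k; rewrite subrK.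
have /andP[h1 h2] := floor_itv ((s + l) / (2 * l)); rewrite -/k in h1 h2.
rewrite ler_pdivlMr// mulrC in h1; rewrite ltr_pdivrMr// mulrC intrD mulrDr mulr1 in h2.
by apply/andP; split; lra.
Qed.

Lemma same_param_sym s s' : same_param s s' -> same_param s' s.
Proof. by move=> [k ->]; exists (- k); rewrite mulrNz mulrN addrK. Qed.

Lemma same_param_trans s s' s'' : same_param s s' -> same_param s' s'' -> same_param s s''.
Proof. by move=> [k ->] [k' ->]; exists (k + k'); rewrite intrD mulrDr addrA. Qed.

(** Parameters are reduced to [[- l, l[]. There [r] is even and strictly increasing in [|s|], so
    equal radii give [|a| = |a'|]. If [a = - a'], oddness makes [x] vanish, which leaves [0] or the
    one representative [- l] of the other crossing. *)
Lemma curve_injective s s' : x s = x s' -> r s = r s' -> same_param s s'.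
Proof.
have [a ha sa] := same_param_reduce s; have [a' ha' sa'] := same_param_reduce s'.
have [-> -> _ _] := same_param_curve sa; have [-> -> _ _] := same_param_curve sa'.
move=> ex er; suff e : a = a'.
  by rewrite -e in sa'; exact: same_param_trans (same_param_sym sa) sa'.
have rm u v : 0 <= u -> u < v -> v <= l -> r u < r v.
  move=> u0 uv vl; apply: (mono_lt uv (f' := fun s => sin (th s))).
  - by move=> w _; exact: D_cont (cp_r cp w).
  - by move=> w _; exact: cp_r cp w.
  - move=> w /andP[h1 h2]; apply: (cp_sin cp).
    by rewrite (le_lt_trans u0 h1) (lt_le_trans h2 vl).
have rabs u : r `|u| = r u by case: (ger0P u) => h; rewrite ?(cp_reven cp).
have al u : - l <= u < l -> `|u| <= l by move=> /andP[h1 /ltW h2]; rewrite ler_norml h1.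
have e : `|a| = `|a'|.
  have [lt|lt|//] := ltgtP `|a| `|a'|.
    by have := rm _ _ (normr_ge0 _) lt (al _ ha'); rewrite !rabs er ltxx.
  by have := rm _ _ (normr_ge0 _) lt (al _ ha); rewrite !rabs er ltxx.
have x0 : x a = - x a' -> x `|a| = 0.
  move=> h; have xa : x a = 0 by move: ex h => -> h; lra.
  by case: (ger0P a) => _ //; rewrite (cp_xodd cp) xa oppr0.
have /eqP : `|a| = `|a'| by [].
rewrite eqr_norm2 => /orP[/eqP//|/eqP e'].
have := x0; rewrite e' (cp_xodd cp) => /(_ erefl) h.
have : ~~ (0 < `|a'| < l).
  by apply/negP => /(cp_xgt0 cp); rewrite -e e' h ltxx.
rewrite negb_and -!leNgt => /orP[|h1].
  by rewrite normr_le0 => /eqP ->; rewrite oppr0.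
have ea' : `|a'| = l by apply/eqP; rewrite eq_le h1 al.
have := e; rewrite ea' -e'; move: ha ha' ea'; clear.
have neg u : - l <= u < l -> `|u| = l -> u = - l.
  move=> /andP[h1 h2]; case: (ger0P u) => h; first by move=> e; move: h2; rewrite e ltxx.
  by move=> <-; rewrite opprK.
by move=> ha ha' ea' ea; rewrite (neg _ ha ea) (neg _ ha' ea').
Qed.

(** Compactness of one period with a neighbourhood of [s0] removed, on which the squared distance to
    the point at [s0] in the coordinates [(x, r ^ 2)] is positive. *)
Lemma curve_separation s0 (d : R) : 0 < d -> exists2 eps, 0 < eps &
  forall s, (x s - x s0) ^+ 2 + (r s ^+ 2 - r s0 ^+ 2) ^+ 2 < eps ->
    exists2 s1, `|s1 - s0| < d & same_param s1 s.
Proof.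
move=> d0; pose D s := (x s - x s0) ^+ 2 + (r s ^+ 2 - r s0 ^+ 2) ^+ 2.
have [e [e0 ed el]] : exists e, [/\ 0 < e, e <= d & e < l].
  by exists (Num.min d (l / 2)); rewrite lt_min d0 divr_gt0// ge_min lexx gt_min; split=> //;
    rewrite ltr_pdivrMr// ltr_pMr// ltr1n orbT.
have Dc s : {for s, continuous D}.
  exact: D_cont (DD (DX 2 (DB (cp_x cp s) (DC (x s0) s)))
    (DX 2 (DB (DX 2 (cp_r cp s)) (DC (r s0 ^+ 2) s)))).
have ab : s0 + e <= s0 + 2 * l - e by lra.
have Dp s : s0 + e <= s <= s0 + 2 * l - e -> 0 < D s.
  move=> /andP[h1 h2]; rewrite lt_neqAle addr_ge0 ?sqr_ge0// andbT; apply/eqP => h.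
  have /eqP := esym h; rewrite paddr_eq0 ?sqr_ge0// !expf_eq0 /= !subr_eq0.
  move=> /andP[/eqP ex /eqP er].
  have er' : r s = r s0.
    apply/eqP; rewrite -(eqrXn2 (n := 2))//; first exact/eqP.
      exact: ltW (cp_rgt0 cp s).
    exact: ltW (cp_rgt0 cp s0).
  have [k hk] := curve_injective (esym ex) (esym er').
  have l2 : 0 < 2 * l by rewrite mulr_gt0.
  have k0 : (0 < k)%R by rewrite -(ltr0z R) -(pmulr_rgt0 _ l2); lra.
  have k1 : (k < 1)%R.
    rewrite -(ltr_int R) -(ltr_pM2l l2) mulr1; lra.
  by move: k1; rewrite ltNge -gtz0_ge1 k0.
have [eps eps0 heps] := min_pos ab Dc Dp.
exists eps => // s hs; have [a /andP[a1 a2] [k hk]] := same_param_reduce (s - s0).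
have sa : same_param (s0 + a) s by exists k; rewrite -addrA -hk addrC subrK.
have [|far] := ltP `|a| e.
  by move=> h; exists (s0 + a) => //; rewrite addrAC subrr add0r; exact: lt_le_trans ed.
have Da u : same_param (s0 + a) u -> D u < eps.
  move=> su; have [ex er _ _] := same_param_curve su; have [ex' er' _ _] := same_param_curve sa.
  by move: hs; rewrite /D ex er -ex' -er'.
move: far; case: (ger0P a) => h far.
  have := Da (s0 + a) (ex_intro _ 0 _); rewrite mulr0 addr0 => /(_ erefl).
  by rewrite ltNge heps//; apply/andP; split; lra.
have := Da (s0 + a + 2 * l) (ex_intro _ 1 _); rewrite mulr1 => /(_ erefl).
by rewrite ltNge heps//; apply/andP; split; lra.
Qed.

End Curve.

(** * Smoothness of the curve and of its local parameter *)

Lemma alg_comp (R : realType) (T T' : Type) (G : (T -> R) -> Prop) (u : T' -> T)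
  (phi : T -> R) : alg G phi ->
  alg (fun g => exists2 phi, G phi & g = (fun y => phi (u y))) (fun y => phi (u y)).
Proof.
elim=> {phi} [phi Gphi|c|g h _ ag _ ah|g h _ ag _ ah].
- by apply: alg_gen; exists phi.
- exact: alg_cst.
- exact: (alg_add ag ah).
- exact: (alg_mul ag ah).
Qed.

Section OneVariable.
Variable R : realType.
Implicit Types (C : (R -> R) -> Prop) (D : set R) (phi : R -> R).

Definition derivation_closed C D := forall phi, C phi ->
  exists2 phi', alg C phi' & forall t, D t -> is_derive t (1 : R) phi (phi' t).

Lemma alg_derivation C D phi : derivation_closed C D -> alg C phi ->
  exists2 phi', alg C phi' & forall t, D t -> is_derive t (1 : R) phi (phi' t).
Proof.
move=> HC; elim=> {phi} [phi /HC//|c|g h ag [g' ag' dg] ah [h' ah' dh]|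
  g h ag [g' ag' dg] ah [h' ah' dh]].
- by exists (fun=> 0); [exact: alg_cst|move=> t _; exact: DC].
- exists (fun t => g' t + h' t); first exact: alg_add.
  by move=> t Dt; exact: DD (dg t Dt) (dh t Dt).
- exists (fun t => g' t * h t + g t * h' t); first by apply: alg_add; apply: alg_mul.
  by move=> t Dt; exact: DM (dg t Dt) (dh t Dt).
Qed.

Lemma smooth_alg_comp k C D (U : set 'rV[R]_k) u phi : derivation_closed C D ->
  open U -> smooth U u -> (forall y, U y -> D (u y)) -> alg C phi ->
  smooth U (fun y => phi (u y)).
Proof.
move=> HC Uo su UD aphi.
pose G g := exists2 phi, C phi & g = (fun y => phi (u y)).
apply: (@smooth_extend _ _ U G) => //; last first.
  by apply: alg_subset (alg_comp u aphi) => g Gg; apply: alg_gen; left.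
move=> _ [psi Cpsi ->]; have [psi' apsi' dpsi] := HC psi Cpsi.
have [c d] := smooth_dclosed su; split=> [y Uy|i].
  apply: (@continuous_comp _ _ _ u psi); first exact: c.
  exact: D_cont (dpsi _ (UD y Uy)).
have [u' su' hu'] := d i; exists (fun y => psi' (u y) * u' y).
  apply: alg_mul; last by apply: alg_gen; right.
  by apply: alg_subset (alg_comp u apsi') => g Gg; apply: alg_gen; left.
by move=> y Uy; exact: is_derive_comp (dpsi _ (UD y Uy)) (hu' y Uy).
Qed.

(* The inverse [g] of a function [h] has derivative [1 / h' (g t)]. *)
Lemma smooth_inverse k C (D : set R) (h' g : R -> R) (U : set 'rV[R]_k) u :
  derivation_closed C setT -> alg C h' ->
  (forall t, D t -> h' (g t) != 0 /\ is_derive t (1 : R) g (h' (g t))^-1) ->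
  open U -> smooth U u -> (forall y, U y -> D (u y)) -> smooth U (fun y => g (u y)).
Proof.
move=> HC ah' dg Uo su UD.
pose C' phi := [\/ phi = g, exists2 psi, C psi & phi = (fun t => psi (g t)) |
  phi = (fun t => (h' (g t))^-1)].
have acomp psi : alg C psi -> alg C' (fun t => psi (g t)).
  by move=> apsi; apply: alg_subset (alg_comp g apsi) => phi Gphi; apply: alg_gen; constructor 2.
have ainv : alg C' (fun t => (h' (g t))^-1) by apply: alg_gen; constructor 3.
apply: (@smooth_alg_comp k C' D) => //; last by apply: alg_gen; constructor 1.
move=> phi [->|[psi Cpsi ->]|->].
- by exists (fun t => (h' (g t))^-1) => // t /dg[].
- have [psi' apsi' dpsi] := HC psi Cpsi.
  exists (fun t => psi' (g t) * (h' (g t))^-1); first by apply: alg_mul => //; exact: acomp.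
  by move=> t /dg[_ dgt]; exact: DComp (dpsi _ I) dgt.
- have [h'' ah'' dh'] := alg_derivation HC ah'.
  exists (fun t => - (h'' (g t) * (h' (g t))^-1) * ((h' (g t))^-1 * (h' (g t))^-1)).
    apply: alg_mul; last exact: alg_mul.
    by apply: alg_opp; apply: alg_mul => //; exact: acomp.
  move=> t /dg[h0 dgt]; apply: D_eq (DV h0 (DComp (dh' _ I) dgt)) _.
  by rewrite -invfM -expr2.
Qed.

End OneVariable.

Section SmoothCurve.
Variables (R : realType) (F : R -> R) (Fj : nat -> R -> R) (n1 : nat) (l : R) (x r th : R -> R).
Hypothesis cp : closed_profile F n1 l x r th.
Hypothesis Fj0 : Fj 0 = F.
Hypothesis dFj : forall j (u : R), 0 < u -> is_derive u (1 : R) (Fj j) (Fj j.+1 u).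

(** Generators of an algebra that the profile equation makes closed under differentiation. [Fj j] is
    the [j]-th derivative of [F], so all derivatives of the curvature stay in the algebra. *)
Definition curve_class (phi : R -> R) := [\/ phi = x \/ phi = r,
  phi = (fun s => cos (th s)) \/ phi = (fun s => sin (th s)), phi = (fun s => (r s)^-1) |
  exists j, phi = (fun s => Fj j (x s ^+ 2 + r s ^+ 2))].

Let ax : alg curve_class x. Proof. by apply: alg_gen; constructor 1; left. Qed.
Let ar : alg curve_class r. Proof. by apply: alg_gen; constructor 1; right. Qed.
Let ac : alg curve_class (fun s => cos (th s)).
Proof. by apply: alg_gen; constructor 2; left. Qed.
Let as_ : alg curve_class (fun s => sin (th s)).
Proof. by apply: alg_gen; constructor 2; right. Qed.
Let ai : alg curve_class (fun s => (r s)^-1).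
Proof. by apply: alg_gen; constructor 3. Qed.
Let aF j : alg curve_class (fun s => Fj j (x s ^+ 2 + r s ^+ 2)).
Proof. by apply: alg_gen; constructor 4; exists j. Qed.
Let cst c : alg curve_class (fun=> c). Proof. exact: alg_cst. Qed.

Let akap : alg curve_class (fun s => kap F n1 (x s) (r s) (th s)).
Proof.
rewrite /kap -Fj0; apply: alg_add; first by do 2?apply: alg_mul.
apply: alg_mul; first exact: (alg_mul (aF 0) (cst 2^-1)).
by apply: alg_sub; apply: alg_mul.
Qed.

Lemma curve_derivation : derivation_closed curve_class setT.
Proof.
move=> phi [[->|->]|[->|->]|->|[j ->]].
- by exists (fun s => cos (th s)) => // s _; exact: cp_x cp s.
- by exists (fun s => sin (th s)) => // s _; exact: cp_r cp s.
- exists (fun s => - sin (th s) * kap F n1 (x s) (r s) (th s)).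
    by apply: alg_mul => //; exact: alg_opp.
  by move=> s _; exact: Dcos (cp_th cp s).
- exists (fun s => cos (th s) * kap F n1 (x s) (r s) (th s)); first exact: alg_mul.
  by move=> s _; exact: Dsin (cp_th cp s).
- exists (fun s => - sin (th s) * ((r s)^-1 * (r s)^-1)).
    by apply: alg_mul; [exact: alg_opp|exact: alg_mul].
  move=> s _; have r0 : r s != 0 by rewrite gt_eqF// (cp_rgt0 cp).
  by apply: D_eq (DV r0 (cp_r cp s)) _; rewrite -invfM -expr2.
- exists (fun s => Fj j.+1 (x s ^+ 2 + r s ^+ 2) *
      (2 * (x s * cos (th s) + r s * sin (th s)))).
    apply: alg_mul => //; apply: alg_mul => //.
    by apply: alg_add; apply: alg_mul.
  move=> s _; have h : 0 < x s ^+ 2 + r s ^+ 2.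
    by rewrite ltr_wpDl ?sqr_ge0// exprn_gt0// (cp_rgt0 cp).
  apply: (D_eq (DComp (f := Fj j) (g := fun s => x s ^+ 2 + r s ^+ 2) (dFj j h) (DD (DX 2 (cp_x cp s)) (DX 2 (cp_r cp s))))).
  by rewrite /= !expr1; ring.
Qed.

Lemma smooth_curve k (U : set 'rV[R]_k) u : open U -> smooth U u ->
  smooth U (fun y => x (u y)) /\ smooth U (fun y => r (u y)).
Proof.
by move=> Uo su; split; apply: (smooth_alg_comp curve_derivation Uo su).
Qed.

(* The linearization along the unit tangent at [s0], in the coordinates
   [(x, r ^ 2)]. *)
Definition lin (s0 X Q : R) := (X - x s0) * cos (th s0) + (Q - r s0 ^+ 2) * sin (th s0).

(** On the curve, [lin] has derivative [cos ^ 2 + 2 * r * sin ^ 2 > 0] at [s0], so the parameter is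
    a smooth function of it nearby. [curve_separation] excludes other branches of the curve. *)
Lemma local_param (s0 : R) : exists (d : R) (g : R -> R) (D : set R) (eps : R), [/\
  0 < d, open D, 0 < eps,
  forall s, `|s - s0| < d -> g (lin s0 (x s) (r s ^+ 2)) = s /\ D (lin s0 (x s) (r s ^+ 2)) &
  (forall s, (x s - x s0) ^+ 2 + (r s ^+ 2 - r s0 ^+ 2) ^+ 2 < eps ->
    exists2 s1, `|s1 - s0| < d & same_param l s1 s) /\
  (forall t, D t -> `|g t - s0| < d) /\ forall k (U : set 'rV[R]_k) u,
    open U -> smooth U u -> (forall y, U y -> D (u y)) -> smooth U (fun y => g (u y))].
Proof.
pose h s := lin s0 (x s) (r s ^+ 2).
pose h' s := cos (th s) * cos (th s0) + 2 * r s * sin (th s) * sin (th s0).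
have dh s : is_derive s (1 : R) h (h' s).
  apply: D_eq (DD (DM (DB (cp_x cp s) (DC (x s0) s)) (DC (cos (th s0)) s))
    (DM (DB (DX 2 (cp_r cp s)) (DC (r s0 ^+ 2) s)) (DC (sin (th s0)) s))) _.
  by rewrite /h' /= expr1; ring.
have ah' : alg curve_class h'.
  apply: alg_add; first exact: alg_mul.
  by do 2?apply: alg_mul => //; apply: alg_mul.
have hc s : {for s, continuous h'}.
  by have [h'' _ dh'] := alg_derivation curve_derivation ah'; exact: D_cont (dh' s I).
have h0 : 0 < h' s0.
  have r0 := cp_rgt0 cp s0; have := cos2Dsin2 (th s0).
  have := sqr_ge0 (cos (th s0)); have := sqr_ge0 (sin (th s0)); rewrite /h'.
  move: (cos _) (sin _) => c s s2 c2 e; rewrite -expr2 -mulrA -expr2.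
  have [z|nz] := eqVneq (c ^+ 2) 0.
    by rewrite z add0r; move: e; rewrite z add0r => ->; rewrite mulr1 mulr_gt0.
  by apply: ltr_pwDl; [rewrite lt_neqAle eq_sym nz|rewrite mulr_ge0// mulr_ge0// ltW].
have [d [g [d0 hg1 hg2]]] := local_inverse dh hc h0.
have [eps eps0 heps] := curve_separation cp s0 d0.
exists d, g, ([set t | h (s0 - d) < t] `&` [set t | t < h (s0 + d)]), eps; split=> //.
- by apply: openI; [exact: open_gt|exact: open_lt].
- by move=> s /hg1[-> /andP[h1 h2]].
- have hD t : ([set t | h (s0 - d) < t] `&` [set t | t < h (s0 + d)]) t ->
    h (s0 - d) < t < h (s0 + d) by case=> /= -> ->.
  split=> //; split=> [t /hD/hg2[]//|k U u Uo su UD].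
  apply: (smooth_inverse curve_derivation ah' _ Uo su UD).
  by move=> t' /hD/hg2[_ h2 h3]; split=> //; rewrite gt_eqF.
Qed.

End SmoothCurve.

(** * The rotated hypersurface and its charts *)

Section Rows.
Variable R : realType.

Definition mkrow m (a : R) (b : 'I_m -> R) : 'rV[R]_m.+1 :=
  \row_i oapp b a (unlift ord0 i).

Lemma mkrow0 m (a : R) (b : 'I_m -> R) : mkrow a b 0 ord0 = a.
Proof. by rewrite mxE unlift_none. Qed.

Lemma mkrowS m (a : R) (b : 'I_m -> R) k : mkrow a b 0 (lift ord0 k) = b k.
Proof. by rewrite mxE liftK. Qed.

Lemma mkrowP m (p : 'rV[R]_m.+1) (a : R) (b : 'I_m -> R) :
  p 0 ord0 = a -> (forall k, p 0 (lift ord0 k) = b k) -> mkrow a b = p.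
Proof.
move=> pa pb; apply/rowP => i; case: (unliftP ord0 i) => [k ->|->].
  by rewrite mkrowS pb.
by rewrite mkrow0 pa.
Qed.

Lemma smooth_mkrow k m (U : set 'rV[R]_k) (a : 'rV[R]_k -> R) (b : 'rV[R]_k -> 'I_m -> R) :
  open U -> smooth U a -> (forall j, smooth U (fun y => b y j)) ->
  smooth_on U (fun y => mkrow (a y) (b y)).
Proof.
move=> Uo sa sb; apply/(smooth_on_coords _ Uo) => i; case: (unliftP ord0 i) => [j ->|->].
  rewrite (_ : (fun y => _) = fun y => b y j); first exact: sb.
  by apply/funext => y; rewrite mkrowS.
by rewrite (_ : (fun y => _) = a); [exact: sa|apply/funext => y; rewrite mkrow0].
Qed.

Lemma open_pos k (U : set 'rV[R]_k) (q : 'rV[R]_k -> R) : open U -> smooth U q ->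
  open (U `&` [set y | 0 < q y]).
Proof.
move=> Uo sq; rewrite openE => y [Uy /= qy]; rewrite /interior.
have [c _] := smooth_dclosed sq; have h := c y Uy.
apply: filterI; first exact: open_nbhs_nbhs.
have hq : nbhs (q y) [set t : R | 0 < t].
  by apply: open_nbhs_nbhs; split => //; exact: open_gt.
exact: (h _ hq).
Qed.

Lemma smooth_on_within k m (U : set 'rV[R]_k) (A : set 'rV[R]_k) (g : 'rV[R]_k -> 'rV[R]_m) :
  open U -> A `<=` U -> smooth_on U g -> smooth_within A g.
Proof. by move=> Uo AU sg y Ay; exists U, g; split => //; exact: AU. Qed.

End Rows.

Section Torus.
Variables (R : realType) (F : R -> R) (Fj : nat -> R -> R) (n1 : nat) (l : R) (x r th : R -> R).
Hypothesis cp : closed_profile F n1 l x r th.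
Hypothesis Fj0 : Fj 0 = F.
Hypothesis dFj : forall j (u : R), 0 < u -> is_derive u (1 : R) (Fj j) (Fj j.+1 u).
Local Notation V := 'rV[R]_n1.+2.
Implicit Types p : V.

Definition radial2 p : R := \sum_k p 0 (lift ord0 k) ^+ 2.

(** As [r > 0], comparing squares determines the radius, and the conditions stay polynomial in the
    point. *)
Definition on_torus p s := p 0 ord0 = x s /\ radial2 p = r s ^+ 2.

Definition torus : set V := [set p | exists s, on_torus p s].

Lemma smooth_radial2 (U : set V) : open U -> smooth U radial2.
Proof.
by move=> Uo; apply: (smooth_sum Uo) => k; exact: (smoothX Uo 2 (smooth_coord Uo _)).
Qed.

Lemma on_torus_same p s s' : on_torus p s -> on_torus p s' -> same_param l s s'.
Proof.
move=> [h1 h2] [h3 h4]; apply: (curve_injective cp); first by rewrite -h1.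
apply/eqP; rewrite -(eqrXn2 (n := 2)) ?ltW ?(cp_rgt0 cp)//.
by rewrite -h2 -h4.
Qed.

(** The curve parameter extends to a smooth function on an open set of the ambient space. Smoothness
    of chart inverses and derivatives of the parameter along arbitrary parametrizations both rest on
    this. *)
Lemma torus_param (s0 : R) : exists (d : R) (U : set V) (sg : V -> R), [/\
  0 < d, open U, smooth U sg, forall p, on_torus p s0 -> U p &
  [/\ forall p, U p -> `|sg p - s0| < d,
      forall p s, U p -> on_torus p s -> same_param l (sg p) s &
      forall p s, `|s - s0| < d -> on_torus p s -> sg p = s]].
Proof.
have [d [g [D [eps [d0 Do eps0 hg [sep [hD sg]]]]]]] := local_param cp Fj0 dFj s0.
have oT : open [set: V] by exact: openT.
pose u p := lin x r th s0 (p 0 ord0) (radial2 p).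
have su (U : set V) : open U -> smooth U u.
  move=> Uo; have s2 := smooth_radial2 Uo.
  exact: (smoothD Uo
    (smoothM Uo (smoothB Uo (smooth_coord Uo ord0) (smooth_cst Uo _)) (smooth_cst Uo _))
    (smoothM Uo (smoothB Uo s2 (smooth_cst Uo _)) (smooth_cst Uo _))).
have uc : continuous u by move=> p; have [c _] := smooth_dclosed (su _ oT); exact: (c p I).
pose q p := eps - ((p 0 ord0 - x s0) ^+ 2 + (radial2 p - r s0 ^+ 2) ^+ 2).
have sq (U : set V) : open U -> smooth U q.
  move=> Uo; have s2 := smooth_radial2 Uo.
  exact: (smoothB Uo (smooth_cst Uo eps)
    (smoothD Uo (smoothX Uo 2 (smoothB Uo (smooth_coord Uo ord0) (smooth_cst Uo _)))
      (smoothX Uo 2 (smoothB Uo s2 (smooth_cst Uo _))))).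
have Uo : open (u @^-1` D) by apply: open_comp => // p _; exact: uc.
exists d, (u @^-1` D `&` [set p | 0 < q p]), (fun p => g (u p)).
have Uo' := open_pos Uo (sq _ Uo).
have key p s : on_torus p s -> `|s - s0| < d -> g (u p) = s /\ D (u p).
  by move=> [h1 h2] hs; rewrite /u h1 h2; exact: hg.
split=> //.
- by apply: sg => // [|p []//]; exact: su.
- move=> p [h1 h2]; have s0d : `|s0 - s0| < d by rewrite subrr normr0.
  split; first by have [] := key p s0 (conj h1 h2) s0d.
  by rewrite /= /q h1 h2 !subrr expr0n addr0 subr0.
- split=> [p [Dp _]|p s [Dp /= qp] hp|p s hs hp]; first exact: hD.
    have [h1 h2] := hp; move: qp; rewrite /q h1 h2 subr_gt0 => /sep[s1 hs1 ss1].
    have [ex er _ _] := same_param_curve cp ss1.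
    have hp1 : on_torus p s1 by rewrite /on_torus -ex -er.
    by have [-> _] := key p s1 hp1 hs1.
  by have [] := key p s hp hs.
Qed.

Section Chart.
Variables (s0 eps : R).
Hypothesis eps2 : eps ^+ 2 = 1.

(** The first coordinate is the curve parameter; the others are mapped to the sphere by inverse
    stereographic projection from the pole [eps] (which is [1] or [-1]) on the first axis. *)
Definition chart (w : 'rV[R]_n1.+1) : V :=
  let S := \sum_k w 0 (lift ord0 k) ^+ 2 in
  mkrow (x (w 0 ord0)) (fun j => r (w 0 ord0) *
    oapp (fun k => 2 * w 0 (lift ord0 k) / (S + 1)) (eps * (S - 1) / (S + 1)) (unlift ord0 j)).

Definition chart_inv (sg : V -> R) (p : V) : 'rV[R]_n1.+1 :=
  mkrow (sg p) (fun k => p 0 (lift ord0 (lift ord0 k)) /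
    (r (sg p) - eps * p 0 (lift ord0 ord0))).

Lemma chart_on_torus w : on_torus (chart w) (w 0 ord0).
Proof.
split; first exact: mkrow0.
rewrite /radial2 big_ord_recl /chart mkrowS unlift_none /=.
set S := \sum_k _; have S0 : 0 <= S by apply: sumr_ge0 => k _; exact: sqr_ge0.
have -> : \sum_(k < n1) (mkrow (x (w 0 ord0)) (fun j => r (w 0 ord0) *
    oapp (fun k => 2 * w 0 (lift ord0 k) / (S + 1)) (eps * (S - 1) / (S + 1)) (unlift ord0 j)))
      0 (lift ord0 (lift ord0 k)) ^+ 2 = r (w 0 ord0) ^+ 2 * (4 / (S + 1) ^+ 2) * S.
  rewrite mulr_sumr; apply: eq_bigr => k _; rewrite mkrowS liftK /=.
  by field; rewrite gt_eqF// ltr_wpDl.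
have S1 : S + 1 != 0 by rewrite gt_eqF// ltr_wpDl.
transitivity (r (w 0 ord0) ^+ 2 * ((eps ^+ 2 * (S - 1) ^+ 2 + 4 * S) / (S + 1) ^+ 2)).
  by field.
by rewrite eps2; field.
Qed.

Lemma smooth_chart (W : set 'rV[R]_n1.+1) : open W -> smooth_on W chart.
Proof.
move=> Wo; have [sx sr] := smooth_curve cp Fj0 dFj Wo (smooth_coord Wo ord0).
have sS : smooth W (fun w => \sum_k w 0 (lift ord0 k) ^+ 2).
  by apply: (smooth_sum Wo) => k; exact: (smoothX Wo 2 (smooth_coord Wo _)).
have S1 (w : 'rV[R]_n1.+1) : \sum_k w 0 (lift ord0 k) ^+ 2 + 1 != 0.
  by rewrite gt_eqF// ltr_wpDl// sumr_ge0// => k _; exact: sqr_ge0.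
have sS1 := smoothD Wo sS (smooth_cst Wo 1).
have S1' w (_ : W w) := S1 w.
apply: (smooth_mkrow Wo sx) => j; apply: (smoothM Wo sr); case: (unliftP ord0 j) => [k _|_] /=.
  exact: (smooth_div Wo (smoothM Wo (smooth_cst Wo 2) (smooth_coord Wo _)) sS1 S1').
exact: (smooth_div Wo (smoothM Wo (smooth_cst Wo eps) (smoothB Wo sS (smooth_cst Wo 1))) sS1 S1').
Qed.

Lemma chartK sg w : sg (chart w) = w 0 ord0 -> chart_inv sg (chart w) = w.
Proof.
move=> e; apply: mkrowP => [//|k].
rewrite e /chart !mkrowS liftK unlift_none /=.
set S := \sum_k _; have S0 : 0 <= S by apply: sumr_ge0 => i _; exact: sqr_ge0.
have S1 : S + 1 != 0 by rewrite gt_eqF// ltr_wpDl.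
have r0 : r (w 0 ord0) != 0 by rewrite gt_eqF// (cp_rgt0 cp).
have -> : r (w 0 ord0) - eps * (r (w 0 ord0) * (eps * (S - 1) / (S + 1))) =
    r (w 0 ord0) * (2 / (S + 1)).
  transitivity (r (w 0 ord0) * (1 - eps ^+ 2 * (S - 1) / (S + 1))); first by ring.
  by rewrite eps2; field.
by field; rewrite S1 r0.
Qed.

Lemma chart_invK sg p : on_torus p (sg p) ->
  0 < r (sg p) - eps * p 0 (lift ord0 ord0) -> chart (chart_inv sg p) = p.
Proof.
move=> [h1 h2]; have r0 := cp_rgt0 cp (sg p); move: h2.
rewrite /radial2 big_ord_recl /chart /chart_inv mkrow0.
set rho := r (sg p); set q := p 0 (lift ord0 ord0) => h2 pos.
set S := \sum_k _.
have SE : S = (rho + eps * q) / (rho - eps * q).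
  have -> : S = (\sum_(k < n1) p 0 (lift ord0 (lift ord0 k)) ^+ 2) / (rho - eps * q) ^+ 2.
    rewrite mulr_suml; apply: eq_bigr => k _; rewrite mkrowS; field.
    by rewrite gt_eqF.
  have -> : \sum_(k < n1) p 0 (lift ord0 (lift ord0 k)) ^+ 2 = rho ^+ 2 - eps ^+ 2 * q ^+ 2.
    by rewrite -h2 eps2 mul1r addrAC subrr add0r.
  by field; rewrite gt_eqF.
have S1 : S + 1 = 2 * rho / (rho - eps * q) by rewrite SE; field; rewrite gt_eqF.
have rn : rho != 0 by rewrite gt_eqF.
have pn : rho - eps * q != 0 by rewrite gt_eqF.
apply: mkrowP => // j; case: (unliftP ord0 j) => [k ->|->] /=.
  by rewrite mkrowS S1; field; rewrite pn rn.
rewrite S1 -/q SE.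
transitivity (eps ^+ 2 * q); first by rewrite eps2 mul1r.
by field; rewrite pn rn.
Qed.

End Chart.

Lemma torus_embedded : embedded_hypersurface torus.
Proof.
move=> p [s0 ps0]; have [d [U [sg [d0 Uo ssg Us0 [sgd sgs sgE]]]]] := torus_param s0.
have r0 := cp_rgt0 cp s0.
(* The pole is taken on the side opposite to the point [p], so that the denominator of the inverse
   chart is positive near [p]. *)
have [eps [eps2 hpos]] : exists eps : R, eps ^+ 2 = 1 /\ 0 < r s0 - eps * p 0 (lift ord0 ord0).
  have [h|h] := leP 0 (p 0 (lift ord0 ord0)).
    by exists (-1); rewrite sqrrN expr1n; split => //; rewrite mulN1r opprK ltr_pwDl.
  by exists 1; rewrite expr1n; split => //; rewrite mul1r subr_gt0 (lt_trans h).
have [_ sr] := smooth_curve cp Fj0 dFj Uo ssg.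
pose q p := r (sg p) - eps * p 0 (lift ord0 ord0).
have sq : smooth U q.
  exact: (smoothB Uo sr (smoothM Uo (smooth_cst Uo eps) (smooth_coord Uo _))).
pose U' := U `&` [set p | 0 < q p]; have Uo' : open U' by exact: open_pos.
pose W := [set w : 'rV[R]_n1.+1 | `|w 0 ord0 - s0| < d] `&` (chart eps @^-1` U').
have onT w : on_torus (chart eps w) (w 0 ord0) by exact: chart_on_torus.
have sc : smooth_on setT (chart eps) by apply: smooth_chart; exact: openT.
have Wo : open W.
  apply: openI.
    apply: (@open_comp _ _ (fun w : 'rV[R]_n1.+1 => w 0 ord0) [set t | `|t - s0| < d]).
      by move=> w _; exact: coord_continuous.
    rewrite (_ : [set t | _] = ball s0 d); first exact: ball_open.
    by apply/seteqP; split=> t; rewrite -ball_normE /= distrC.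
  by apply: open_comp => // w _; exact: (sc [::] w I).1.
have sgp p' s : U p' -> on_torus p' s -> on_torus p' (sg p').
  move=> Up hp; have [ex er _ _] := same_param_curve cp (sgs _ _ Up hp).
  by rewrite /on_torus -ex -er.
exists W, (chart eps); split.
- split=> //; exists U', (chart_inv eps sg); split=> //; split.
  + exact: (smooth_on_within openT).
  + apply: (smooth_on_within Uo' (@subIsetr _ _ _)).
    have sU' h := @smooth_subset _ _ U U' h (@subIsetl _ _ _).
    apply: (smooth_mkrow Uo' (sU' _ ssg)) => j.
    apply: (smooth_div Uo' (smooth_coord Uo' _) (sU' _ sq)).
    by move=> y [_ /= h]; rewrite gt_eqF.
  + move=> w [w0 w1]; split; first by split => //; exists (w 0 ord0).
    by apply: chartK => //; exact: sgE.
  + move=> y [[s ys] [Uy qy]]; have ysg := sgp y s Uy ys.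
    have E : chart eps (chart_inv eps sg y) = y by exact: chart_invK.
    by split=> //; split; [rewrite /= mkrow0; exact: sgd|rewrite /= E].
- have sgp0 : sg p = s0 by apply: sgE => //; rewrite subrr normr0.
  have E : chart eps (chart_inv eps sg p) = p by apply: chart_invK => //; rewrite sgp0.
  exists (chart_inv eps sg p) => //; split; first by rewrite /= mkrow0 sgp0 subrr normr0.
  by rewrite /= E; split; [exact: Us0|rewrite /= /q sgp0].
Qed.

End Torus.

(** * The diffeomorphism with the product of spheres *)

Lemma angle_shift (R : realType) (p l s a : R) : p != 0 -> l != 0 ->
  p * (s + l / p * a) / l = p * s / l + a.
Proof. by move=> p0 l0; field; rewrite p0 l0. Qed.

Lemma circle_angle (R : realType) (u v : R) : u ^+ 2 + v ^+ 2 = 1 ->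
  exists t, cos t = u /\ sin t = v.
Proof.
move=> uv; have hu : -1 <= u <= 1.
  by rewrite -ler_norml -(@ler_pXn2r _ 2) ?nnegrE// real_normK ?num_real// expr1n -uv lerDl sqr_ge0.
have s2 : sin (acos u) ^+ 2 = v ^+ 2.
  by apply: (@addrI _ (cos (acos u) ^+ 2)); rewrite cos2Dsin2 acosK ?uv// inE.
have s0 : 0 <= sin (acos u) by apply: sin_ge0_pi; rewrite acos_ge0// acos_lepi.
have [v0|v0] := leP 0 v.
  exists (acos u); split; first by rewrite acosK// inE.
  by apply/eqP; rewrite -(eqrXn2 (n := 2))// s2.
exists (- acos u); split; first by rewrite cosN acosK// inE.
rewrite sinN; apply/eqP; rewrite eqr_oppLR -(eqrXn2 (n := 2))//; first by rewrite s2 sqrrN.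
by rewrite oppr_ge0 ltW.
Qed.

Section Diffeo.
Variables (R : realType) (F : R -> R) (Fj : nat -> R -> R) (n1 : nat) (l : R) (x r th : R -> R).
Hypothesis cp : closed_profile F n1 l x r th.
Hypothesis Fj0 : Fj 0 = F.
Hypothesis dFj : forall j (u : R), 0 < u -> is_derive u (1 : R) (Fj j) (Fj j.+1 u).
Local Notation V := 'rV[R]_n1.+2.
Local Notation Q := 'rV[R]_(2 + n1.+1).
Local Notation torus := (@torus R n1 x r).

Let l0 : 0 < l. Proof. exact: cp_l cp. Qed.

Lemma same_param_angle s s' : cos (pi * s / l) = cos (pi * s' / l) ->
  sin (pi * s / l) = sin (pi * s' / l) -> same_param l s s'.
Proof.
move=> ec es; have [a /andP[a1 a2] [k hk]] := same_param_reduce cp (s' - s).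
suff a0 : a = 0 by exists k; rewrite -[s'](subrK s) hk a0 add0r addrC.
have ca : cos (pi * a / l) = 1.
  have [_ _ <- _] := same_param_curve cp (ex_intro _ k hk : same_param l a (s' - s)).
  by rewrite mulrBr mulrBl cosB -ec -es -!expr2 cos2Dsin2.
have pi0 := pi_gt0 R.
have hb : `|pi * a / l| \in `[0, pi].
  rewrite in_itv /= normr_ge0 !normrM (gtr0_norm pi0) normfV (gtr0_norm l0) ler_pdivrMr//=.
  by rewrite ler_pM2l// ler_norml a1 ltW.
have h0 : (0 : R) \in `[0, pi] by rewrite in_itv /= lexx pi_ge0.
have eb : cos `|pi * a / l| = cos 0.
  by rewrite cos0 -ca; case: (ger0P (pi * a / l)) => // _; rewrite cosN.
have := cos_inj hb h0 eb.
by move=> /normr0_eq0 /eqP; rewrite !mulf_eq0 invr_eq0 (gt_eqF pi0) (gt_eqF l0) /= orbF => /eqP.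
Qed.

Definition circle_param (q : Q) s := cos (pi * s / l) = q 0 (lshift n1.+1 ord0) /\
  sin (pi * s / l) = q 0 (lshift n1.+1 ord_max).

Lemma circle_param_ex q : S1xS R n1.+1 q -> exists s, circle_param q s.
Proof.
move=> [h _]; have [|t [h1 h2]] := @circle_angle R (q 0 (lshift n1.+1 ord0)) (q 0 (lshift n1.+1 ord_max)).
  by rewrite -h /sqnorm !big_ord_recr big_ord0 /= add0r !mxE; congr (q _ _ ^+ 2 + _ ^+ 2);
    apply: val_inj.
have e : pi * (t * l / pi) / l = t.
  have := @angle_shift R pi l 0 t; rewrite !gt_eqF ?pi_gt0// add0r mulr0 mul0r add0r.
  have -> : t * l / pi = l / pi * t by rewrite [RHS]mulrAC [l * t]mulrC.
  by apply.
by exists (t * l / pi); rewrite /circle_param !e h1 h2; split.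
Qed.

Definition to_torus (s : R) (q : Q) : V := mkrow (x s) (fun k => r s * q 0 (rshift 2 k)).

Definition of_torus (s : R) (p : V) : Q :=
  row_mx (\row_i if i == ord0 then cos (pi * s / l) else sin (pi * s / l))
         (\row_k (p 0 (lift ord0 k) / r s)).

Lemma to_torus_on s q : S1xS R n1.+1 q -> on_torus x r (to_torus s q) s.
Proof.
move=> [_ h]; split; first exact: mkrow0.
rewrite /radial2 -[RHS]mulr1 -h /sqnorm mulr_sumr; apply: eq_bigr => k _.
by rewrite mkrowS exprMn mxE.
Qed.

Lemma of_torus_on s p : on_torus x r p s ->
  S1xS R n1.+1 (of_torus s p) /\ circle_param (of_torus s p) s.
Proof.
move=> [_ h2]; have r0 := cp_rgt0 cp s; split; last first.
  by rewrite /circle_param /of_torus !row_mxEl !mxE.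
split; rewrite /sqnorm ?row_mxKl ?row_mxKr.
  by rewrite !big_ord_recr big_ord0 /= !mxE add0r /= cos2Dsin2.
transitivity ((\sum_k p 0 (lift ord0 k) ^+ 2) / r s ^+ 2).
  by rewrite mulr_suml; apply: eq_bigr => k _; rewrite mxE expr_div_n.
by rewrite -/(radial2 p) h2 divff// expf_neq0// gt_eqF.
Qed.

Lemma to_torus_same s s' q : same_param l s s' -> to_torus s' q = to_torus s q.
Proof. by move=> /(same_param_curve cp)[ex er _ _]; rewrite /to_torus ex er. Qed.

Lemma of_torus_same s s' p : same_param l s s' -> of_torus s' p = of_torus s p.
Proof. by move=> /(same_param_curve cp)[_ er ec es]; rewrite /of_torus er ec es. Qed.

Lemma of_to_torus s q : circle_param q s -> of_torus s (to_torus s q) = q.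
Proof.
move=> [h1 h2]; have r0 := cp_rgt0 cp s.
rewrite -[RHS]hsubmxK; congr row_mx; apply/rowP => k.
  rewrite !mxE; case: eqP => [->//|/eqP h]; rewrite h2; congr (q _ (lshift _ _)); apply: val_inj.
  by case: k h => [[|[|]]].
by rewrite mxE mkrowS [RHS]mxE mulrC mulKf// gt_eqF.
Qed.

Lemma to_of_torus s p : on_torus x r p s -> to_torus s (of_torus s p) = p.
Proof.
move=> [h1 h2]; have r0 := cp_rgt0 cp s; apply: mkrowP => // k.
by rewrite /of_torus row_mxEr mxE mulrC divfK// gt_eqF.
Qed.

(** In the half plane around the direction of [s0], the angle is the base angle plus the arctangent
    of cross product over dot product, a smooth function on an open set. *)
Lemma local_angle (s0 : R) : exists (U : set Q) (sg : Q -> R), [/\ open U, smooth U sg,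
  forall q, circle_param q s0 -> U q &
  forall q s, U q -> S1xS R n1.+1 q -> circle_param q s -> same_param l (sg q) s].
Proof.
have oT : open [set: Q] by exact: openT.
pose a0 := pi * s0 / l; pose c0 := cos a0; pose t0 := sin a0.
pose dot (q : Q) := q 0 (lshift n1.+1 ord0) * c0 + q 0 (lshift n1.+1 ord_max) * t0.
pose crs (q : Q) := q 0 (lshift n1.+1 ord_max) * c0 - q 0 (lshift n1.+1 ord0) * t0.
have sdot (U : set Q) (Uo : open U) : smooth U dot := smoothD Uo
  (smoothM Uo (smooth_coord Uo _) (smooth_cst Uo _))
  (smoothM Uo (smooth_coord Uo _) (smooth_cst Uo _)).
have scrs (U : set Q) (Uo : open U) : smooth U crs := smoothB Uo
  (smoothM Uo (smooth_coord Uo _) (smooth_cst Uo _))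
  (smoothM Uo (smooth_coord Uo _) (smooth_cst Uo _)).
pose U := [set: Q] `&` [set q | 0 < dot q].
have Uo : open U by apply: open_pos => //; exact: sdot.
pose sg q := s0 + l / pi * atan (crs q / dot q).
have d0 q : U q -> dot q != 0 by move=> [_ /= h]; rewrite gt_eqF.
exists U, sg; split=> //.
- exact: (smoothD Uo (smooth_cst Uo s0) (smoothM Uo (smooth_cst Uo (l / pi))
    (smooth_atan Uo (smooth_div Uo (scrs U Uo) (sdot U Uo) d0)))).
- by move=> q [h1 h2]; split=> //=; rewrite /dot -h1 -h2 -!expr2 cos2Dsin2.
- move=> q s [_ /= dq] [hq _] [h1 h2]; have pi0 := pi_gt0 R.
  set a := atan (crs q / dot q).
  have e : pi * sg q / l = a0 + a by rewrite /sg -/a /a0; apply: angle_shift; rewrite gt_eqF.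
  have ca : 0 < cos a by apply: cos_gt0_pihalf; rewrite atan_gtNpi2 atan_ltpi2.
  have sa : sin a * dot q = crs q * cos a.
    have : tan a = crs q / dot q by exact: atanK.
    rewrite /tan => /(congr1 (fun t => t * (cos a * dot q))).
    have -> : sin a / cos a * (cos a * dot q) = sin a * dot q by field; rewrite gt_eqF.
    by move=> ->; field; rewrite gt_eqF.
  have dc : dot q ^+ 2 + crs q ^+ 2 = 1.
    have uv : q 0 (lshift n1.+1 ord0) ^+ 2 + q 0 (lshift n1.+1 ord_max) ^+ 2 = 1.
      by rewrite -h1 -h2 cos2Dsin2.
    have := cos2Dsin2 a0; rewrite -/c0 -/t0 => ct; rewrite /dot /crs.
    transitivity ((q 0 (lshift n1.+1 ord0) ^+ 2 + q 0 (lshift n1.+1 ord_max) ^+ 2) * (c0 ^+ 2 + t0 ^+ 2)).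
      by ring.
    by rewrite uv ct mulr1.
  have cd : cos a = dot q.
    apply/eqP; rewrite -(eqrXn2 (n := 2)) ?ltW//; apply/eqP.
    have := cos2Dsin2 a => cs.
    have E : sin a ^+ 2 * dot q ^+ 2 = crs q ^+ 2 * cos a ^+ 2 by rewrite -!exprMn sa.
    have -> : cos a ^+ 2 = cos a ^+ 2 * (dot q ^+ 2 + crs q ^+ 2) by rewrite dc mulr1.
    by rewrite mulrDr [_ * crs q ^+ 2]mulrC -E -mulrDl cs mul1r.
  have sc : sin a = crs q.
    by apply: (mulIf (lt0r_neq0 dq)); rewrite sa cd.
  have ct := cos2Dsin2 a0; rewrite -/c0 -/t0 in ct.
  apply: same_param_angle; rewrite e ?h1 ?h2.
    rewrite cosD -/c0 -/t0 cd sc /dot /crs.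
    transitivity (q 0 (lshift n1.+1 ord0) * (c0 ^+ 2 + t0 ^+ 2)); first by ring.
    by rewrite ct mulr1.
  rewrite sinD -/c0 -/t0 cd sc /dot /crs.
  transitivity (q 0 (lshift n1.+1 ord_max) * (c0 ^+ 2 + t0 ^+ 2)); first by ring.
  by rewrite ct mulr1.
Qed.

(** The angle and the curve parameter are chosen globally without continuity. Both maps depend on
    them only modulo the period, so they agree locally with the maps built from the smooth choices
    of [local_angle] and [torus_param]. *)
Lemma torus_diffeomorphic : diffeomorphic (S1xS R n1.+1) torus.
Proof.
have /choice[ang hang] : forall q, exists s, S1xS R n1.+1 q -> circle_param q s.
  move=> q; have [/circle_param_ex[s hs]|no] := pselect (S1xS R n1.+1 q); first by exists s.
  by exists 0.
have /choice[par hpar] : forall p, exists s, torus p -> on_torus x r p s.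
  by move=> p; have [[s hs]|no] := pselect (torus p); [exists s|exists 0].
exists (fun q => to_torus (ang q) q), (fun p => of_torus (par p) p); split.
- move=> q Sq; have [U [sg [Uo ssg Uq hU]]] := local_angle (ang q).
  have [sx sr] := smooth_curve cp Fj0 dFj Uo ssg.
  exists U, (fun q => to_torus (sg q) q); split=> //.
  + exact: Uq (hang q Sq).
  + apply: (smooth_mkrow Uo sx) => k; exact: (smoothM Uo sr (smooth_coord Uo _)).
  + by move=> y Sy Uy; apply/esym/to_torus_same; exact: hU Uy Sy (hang y Sy).
- move=> p Tp; have [d [U [sg [_ Uo ssg Up [_ hU _]]]]] := torus_param cp Fj0 dFj (par p).
  have [_ sr] := smooth_curve cp Fj0 dFj Uo ssg.
  exists U, (fun p => of_torus (sg p) p); split=> //.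
  + exact: Up (hpar p Tp).
  + apply/(smooth_on_coords _ Uo) => j.
    have [sc ss] := smooth_cos_sin Uo
      (smoothM Uo (smoothM Uo (smooth_cst Uo pi) ssg) (smooth_cst Uo l^-1)).
    case: (split_ordP j) => k ->.
      have [->|k0] := eqVneq k ord0.
        rewrite (_ : (fun y => _) = fun y => cos (pi * sg y / l)); first exact: sc.
        by apply/funext => y; rewrite /of_torus row_mxEl mxE eqxx.
      rewrite (_ : (fun y => _) = fun y => sin (pi * sg y / l)); first exact: ss.
      by apply/funext => y; rewrite /of_torus row_mxEl mxE (negbTE k0).
    rewrite (_ : (fun y => _) = fun y : V => y 0 (lift ord0 k) / r (sg y)).
      apply: (smooth_div Uo (smooth_coord Uo _) sr) => y _.
      by rewrite gt_eqF// (cp_rgt0 cp).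
    by apply/funext => y; rewrite /of_torus row_mxEr mxE.
  + by move=> y Ty Uy; apply/esym/of_torus_same; exact: hU Uy (hpar y Ty).
- move=> q Sq; have hq := to_torus_on (ang q) Sq.
  have Tq : torus (to_torus (ang q) q) by exists (ang q).
  split=> //; rewrite -[RHS](of_to_torus (hang q Sq)); apply: of_torus_same.
  exact: (on_torus_same cp hq (hpar _ Tq)).
- move=> p Tp; have [Sp cpp] := of_torus_on (hpar p Tp); split=> //.
  rewrite -[RHS](to_of_torus (hpar p Tp)); apply: to_torus_same.
  have [h1 h2] := cpp; have [h3 h4] := hang _ Sp.
  by apply: same_param_angle; rewrite ?h1 ?h2 ?h3 ?h4.
Qed.

End Diffeo.

(** * Linear algebra of hypersurfaces *)

Section Trace.
Variable R : realType.

Definition dot m (u v : 'rV[R]_m) : R := \sum_c u 0 c * v 0 c.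

Lemma dotE m (u v : 'rV[R]_m) : dot u v = (u *m v^T) 0 0.
Proof. by rewrite mxE; apply: eq_bigr => c _; rewrite mxE. Qed.

Lemma dotC m (u v : 'rV[R]_m) : dot u v = dot v u.
Proof. by apply: eq_bigr => c _; rewrite mulrC. Qed.

Lemma dot_eq0 m (u : 'rV[R]_m) : dot u u = 0 -> u = 0.
Proof.
move=> h; apply/rowP => c; rewrite mxE; apply/eqP.
rewrite -sqrf_eq0 expr2; have := h; rewrite /dot => /eqP.
by rewrite psumr_eq0 => [/allP/(_ c)|i _]; [rewrite mem_index_enum => /(_ isT)|rewrite -expr2 sqr_ge0].
Qed.

Lemma dotBZl m (u v w : 'rV[R]_m) a : dot (u - a *: v) w = dot u w - a * dot v w.
Proof.
rewrite /dot mulr_sumr -sumrB; apply: eq_bigr => c _.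
by rewrite !mxE; ring.
Qed.

Variables (n : nat) (J : 'M[R]_(n, n.+1)) (N : 'rV[R]_n.+1).
Hypothesis Jfree : row_free J.
Hypothesis JN : forall i, dot (row i J) N = 0.
Hypothesis NN : dot N N = 1.

(** The rows of [J] lie in the orthogonal complement of [N], and both have dimension [n]. *)
Lemma normal_complement (T : 'rV[R]_n.+1) : dot T N = 0 -> exists a, T = a *m J.
Proof.
move=> TN; apply/submxP.
have ker (u : 'rV[R]_n.+1) : dot u N = 0 -> (u <= kermx N^T)%MS.
  by move=> h; apply/sub_kermxP/rowP => i; rewrite (ord1 i) -dotE h mxE.
have Jk : (J <= kermx N^T)%MS by apply/row_subP => i; exact: ker.
have N0 : N != 0.
  by apply/eqP => h; have := NN; rewrite /dot big1 => [/esym/eqP|c _]; rewrite ?oner_eq0// h mxE mul0r.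
apply: submx_trans (ker T TN) _; rewrite -(mxrank_leqif_sup Jk) mxrank_ker mxrank_tr.
by rewrite (eqP Jfree) rank_rV N0 subn1.
Qed.

Lemma normal_unique (v : 'rV[R]_n.+1) : (forall i, dot (row i J) v = 0) ->
  v = dot v N *: N.
Proof.
move=> Jv; apply/eqP; rewrite -subr_eq0; apply/eqP; set u := v - _.
have uN : dot u N = 0 by rewrite dotBZl NN mulr1 subrr.
have [a ua] := normal_complement uN.
have Ju i : dot (row i J) u = 0.
  by rewrite dotC dotBZl dotC Jv [dot N _]dotC JN mulr0 subrr.
apply: dot_eq0; rewrite {1}ua dotE -mulmxA mxE big1// => i _.
have -> : (J *m u^T) i 0 = dot (row i J) u.
  by rewrite mxE /dot; apply: eq_bigr => c _; rewrite [u^T _ _]mxE [row _ _ _ _]mxE.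
by rewrite Ju mulr0.
Qed.

Lemma gram_unit : J *m J^T \in unitmx.
Proof.
rewrite -row_free_unit; apply: inj_row_free => v h.
have vJ : v *m J = 0.
  by apply: dot_eq0; rewrite dotE trmx_mul mulmxA -[v *m J *m _]mulmxA h mul0mx mxE.
by apply: (row_free_inj Jfree); rewrite vJ mul0mx.
Qed.

Lemma trace_rank_one (T : 'rV[R]_n.+1) (A : 'M[R]_n) (E alpha beta : R) : E != 0 ->
  A = E *: (J *m J^T) -> dot T N = 0 -> dot T T = 1 ->
  \tr (invmx A *m (alpha *: ((T *m J^T)^T *m (T *m J^T)) + beta *: A)) =
  alpha / E + beta * n%:R.
Proof.
move=> E0 AE TN TT; have [a Ta] := normal_complement TN.
have Au : A \in unitmx by rewrite AE unitmxZ ?gram_unit// unitfE.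
rewrite mulmxDr mxtraceD -!scalemxAr !mxtraceZ mulVmx// mxtrace1; congr (_ * _ + _).
set s := T *m J^T; have sE : s = E^-1 *: (a *m A).
  by rewrite AE -scalemxAr scalerA mulVf// scale1r mulmxA -Ta.
rewrite mulmxA mxtrace_mulC {1}sE -scalemxAl mxtraceZ -[RHS]mulr1; congr (_ * _).
rewrite -mulmxA mulKVmx// /mxtrace big_ord1 -TT dotE {1}Ta -mulmxA.
by rewrite /s trmx_mul trmxK.
Qed.

End Trace.

(** * The conformal metric *)

Section Conformal.
Variables (R : realType) (n : nat) (f F : R -> R).
Local Notation V := 'rV[R]_n.+1.
Local Notation e a := (delta_mx 0 a : V).
Implicit Types (p u v nu : V).
Hypothesis n_gt0 : (0 < n)%N.

Definition conf p := expR (- (f (sqnorm p) / (2 * n%:R))).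

Lemma sum_delta m (c : 'I_m) (g : 'I_m -> R) : \sum_b (b == c)%:R * g b = g c.
Proof.
rewrite (bigD1 c)//= eqxx mul1r big1 ?addr0// => b /negbTE ->.
by rewrite mul0r.
Qed.

Lemma D_sqnorm p a : is_derive p (e a) sqnorm (2 * p 0 a).
Proof.
apply/is_derive_line.
rewrite (_ : (fun t => _) = fun t : R => sqnorm p + (2 * p 0 a * t + t ^+ 2)).
  apply: (D_eq (DD (DC (sqnorm p) 0) (DD (DM (DC (2 * p 0 a) 0) (DI 0)) (DX 2 (DI 0))))).
  by rewrite /=; ring.
apply/funext => t; rewrite /sqnorm (bigD1 a)//= [in RHS](bigD1 a)//= !mxE !eqxx mulr1.
rewrite (eq_bigr (fun i => p 0 i ^+ 2)); first by ring.
by move=> i /negbTE ia; rewrite !mxE eqxx ia mulr0 addr0.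
Qed.

Variable p : V.
Hypothesis df : is_derive (sqnorm p : R) (1 : R) f (F (sqnorm p)).
Let E := conf p.
Let mu := - (F (sqnorm p) / n%:R).

Let E0 : E != 0. Proof. by rewrite gt_eqF// expR_gt0. Qed.

Lemma D_metric a b d :
  'D_(e a) (fun x => f_metric f x b d) p = E * mu * p 0 a * (b == d)%:R.
Proof.
have dE : is_derive p (e a) (conf : V -> R) (E * mu * p 0 a).
  have dphi : is_derive (sqnorm p : R) (1 : R) (fun u : R => expR (- (f u * (2 * n%:R)^-1))) _ :=
    Dexp (DN (DM df (DC (2 * n%:R)^-1 (sqnorm p)))).
  apply: is_derive_eq (is_derive_comp (u := sqnorm) (x := p) dphi (D_sqnorm p a)) _.
  rewrite mulr0 addr0 -/(conf p) -/E /mu.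
  by field; rewrite pnatr_eq0 -lt0n.
have [bd|bd] := eqVneq b d.
  rewrite mulr1 (_ : (fun x => _) = conf); first by have [_ ->] := dE.
  by apply/funext => x; rewrite /f_metric mxE bd eqxx mulr1n.
rewrite mulr0 (_ : (fun x => _) = fun=> 0); first exact: derive_cst.
by apply/funext => x; rewrite /f_metric mxE (negbTE bd).
Qed.

(** The usual formula for a conformally flat metric: the logarithm of the factor [E] has gradient
    [mu * p]. *)
Lemma christoffel_conf c a b : christoffel (f_metric f) p c a b =
  mu / 2 * (p 0 a * (b == c)%:R + p 0 b * (a == c)%:R - p 0 c * (a == b)%:R).
Proof.
rewrite /christoffel {1}/f_metric -/(conf p) -/E invmx_scalar.
rewrite (eq_bigr (fun d => (d == c)%:R * (E^-1 * ('D_(e a) (fun x => f_metric f x b d) p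
     + 'D_(e b) (fun x => f_metric f x a d) p - 'D_(e d) (fun x => f_metric f x a b) p)))).
  by rewrite sum_delta !D_metric; field.
by move=> d _; rewrite mxE eq_sym; case: (d == c); rewrite ?mulr1n ?mulr0n ?mul0r ?mul1r.
Qed.

Lemma christoffel_sum c u v : \sum_a \sum_b christoffel (f_metric f) p c a b * u 0 a * v 0 b =
  mu / 2 * (dot p u * v 0 c + dot p v * u 0 c - p 0 c * dot u v).
Proof.
transitivity (\sum_a (mu / 2 * (p 0 a * u 0 a) * v 0 c
    + (a == c)%:R * (mu / 2 * dot p v * u 0 a) - mu / 2 * p 0 c * (u 0 a * v 0 a))).
  apply: eq_bigr => a _.
  transitivity (\sum_b ((b == c)%:R * (mu / 2 * (p 0 a * u 0 a) * v 0 b)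
      + (a == c)%:R * (mu / 2 * (p 0 b * v 0 b) * u 0 a)
      - (b == a)%:R * (mu / 2 * p 0 c * (u 0 a * v 0 b)))).
    apply: eq_bigr => b _; rewrite christoffel_conf [b == a]eq_sym.
    by move: (_ == _)%:R (_ == _)%:R (_ == _)%:R => d1 d2 d3; ring.
  rewrite sumrB big_split /= !sum_delta; congr (_ + _ - _).
  rewrite -mulr_sumr; congr (_ * _).
  by rewrite /dot mulr_sumr mulr_suml; apply: eq_bigr => b _.
rewrite sumrB big_split /= sum_delta -mulr_sumr -mulr_suml -mulr_sumr /dot.
by ring.
Qed.

(** Against a vector orthogonal to [u] and [v], only the term of the Christoffel symbols along [p]
    survives. *)
Lemma christoffel_dot (h u v nu : V) : dot u nu = 0 -> dot v nu = 0 ->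
  \sum_c (h 0 c + \sum_a \sum_b christoffel (f_metric f) p c a b * u 0 a * v 0 b) * nu 0 c =
  dot h nu - mu / 2 * dot p nu * dot u v.
Proof.
move=> un vn.
transitivity (dot h nu + mu / 2 * (dot p u * dot v nu + dot p v * dot u nu - dot u v * dot p nu)).
  rewrite [dot h nu]/dot [dot v nu]/dot [dot u nu]/dot [dot p nu]/dot !mulr_sumr.
  rewrite -big_split -sumrB mulr_sumr -big_split; apply: eq_bigr => c _ /=.
  rewrite christoffel_sum; move: (dot _ _) (dot _ _) (dot _ _) => a1 a2 a3.
  by move: (h 0 c) (u 0 c) (v 0 c) (nu 0 c) (p 0 c) => b1 b2 b3 b4 b5; ring.
rewrite un vn; move: (dot _ _) (dot _ _) (dot _ _) (dot _ _) (dot _ _) => a1 a2 a3 a4 a5; ring.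
Qed.

Lemma inner_conf u v : inner (f_metric f) p u v = E * dot u v.
Proof. by rewrite /inner mul_mx_scalar -scalemxAl mxE dotE. Qed.

Lemma second_form_conf k (phi : 'rV[R]_k -> V) w nu i j : phi w = p ->
  (forall i, dot (pderive i phi w) nu = 0) ->
  second_form (f_metric f) phi nu w i j =
  E * (dot (pderive i (pderive j phi) w) nu
     - mu / 2 * dot p nu * dot (pderive i phi w) (pderive j phi w)).
Proof.
move=> pw hnu; rewrite mxE pw inner_conf -(christoffel_dot _ (hnu i) (hnu j)); congr (_ * _).
by rewrite /dot; apply: eq_bigr => c _; rewrite mxE pw.
Qed.

Lemma first_form_conf k (phi : 'rV[R]_k -> V) w : phi w = p ->
  first_form (f_metric f) phi w =
  E *: ((\matrix_(i, c) pderive i phi w 0 c) *m (\matrix_(i, c) pderive i phi w 0 c)^T).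
Proof.
move=> pw; apply/matrixP => i j; rewrite mxE pw inner_conf mxE; congr (_ * _).
by rewrite mxE /dot; apply: eq_bigr => c _; rewrite !mxE.
Qed.

End Conformal.

(** * Second fundamental form of the hypersurface of rotation *)

Lemma second_order_algebra (R : realFieldType) (K C S r ai aj SY SB P0 : R) :
  C ^+ 2 + S ^+ 2 = 1 -> r != 0 ->
  - S * P0 + C * aj * (- (C * K * ai)) + (C * r^-1 * (SY + SB) +
    r * S * aj * ((- S * K * r^-1 + C * (- S / r ^+ 2)) * ai)) = 0 ->
  - S * P0 + C / r * SY = (K + C / r) * (ai * aj) - C / r * (C * ai * (C * aj) + SB).
Proof.
move=> cs rn E; apply/eqP; rewrite -subr_eq0; apply/eqP.
transitivity (- S * P0 + C * aj * (- (C * K * ai)) + (C * r^-1 * (SY + SB) +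
    r * S * aj * ((- S * K * r^-1 + C * (- S / r ^+ 2)) * ai)) +
    (C ^+ 2 + S ^+ 2 - 1) * ((K + C / r) * (ai * aj))); first by field.
by rewrite E cs subrr mul0r addr0.
Qed.

Section MeanCurvature.
Variables (R : realType) (f F : R -> R) (Fj : nat -> R -> R) (n1 : nat) (l : R) (x r th : R -> R).
Hypothesis cp : closed_profile F n1 l x r th.
Hypothesis Fj0 : Fj 0 = F.
Hypothesis dFj : forall j (u : R), 0 < u -> is_derive u (1 : R) (Fj j) (Fj j.+1 u).
Local Notation V := 'rV[R]_n1.+2.
Local Notation W0 := 'rV[R]_n1.+1.
Local Notation torus := (@torus R n1 x r).
Implicit Types (W O : set W0) (w : W0).

(** On an open set the local smooth extensions coincide with the map, so its coordinates are smooth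
    near each point. *)
Lemma smooth_within_local k m (A : set 'rV[R]_k) (g : 'rV[R]_k -> 'rV[R]_m) y :
  open A -> smooth_within A g -> A y ->
  exists B : set 'rV[R]_k, [/\ open B, B y, B `<=` A & forall j, smooth B (fun z => g z 0 j)].
Proof.
move=> Ao sg Ay; have [U [h [Uo Uy sh hg]]] := sg y Ay.
have UAo : open (U `&` A) by exact: openI.
exists (U `&` A); split=> // j.
have E z : (U `&` A) z -> g z 0 j = h z 0 j by move=> [Uz Az]; rewrite hg.
have sj : smooth U (fun z => h z 0 j) by move: j {E}; apply/(smooth_on_coords h Uo).
exact: (smooth_congr UAo E (smooth_subset (@subIsetl _ U A) sj)).
Qed.

Lemma line_coords m (O : set W0) (phi : W0 -> 'rV[R]_m) w i :
  (forall j, smooth O (fun z => phi z 0 j)) -> O w ->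
  forall j, is_derive (0 : R) (1 : R) (fun t : R => phi (w + t *: delta_mx 0 i) 0 j)
    (pderive i phi w 0 j).
Proof.
move=> sp Ow j; apply/(is_derive_line (fun z => phi z 0 j)).
have d : derivable phi w (delta_mx 0 i).
  apply/derivable_mxP => i' j'; rewrite (ord1 i').
  by have [_ d] := sp j' [::] w Ow.
exact: (is_derive_coord (g := phi) j (DeriveDef d erefl)).
Qed.

Lemma smooth_pderive m (O : set W0) (phi : W0 -> 'rV[R]_m) i j : open O ->
  (forall j, smooth O (fun z => phi z 0 j)) -> smooth O (fun z => pderive i phi z 0 j).
Proof.
move=> Oo sp; have E z : O z -> pderive i phi z 0 j = pder i (fun z => phi z 0 j) z.
  by move=> Oz; have [_ <-] :=
    (is_derive_line (fun z => phi z 0 j) z (delta_mx 0 i) _).2 (line_coords i sp Oz j).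
apply: (smooth_congr Oo E) => s z Oz.
by have := sp j (rcons s i) z Oz; rewrite foldr_rcons.
Qed.

(** [y] is the component of the point orthogonal to the axis; on the hypersurface it has length
    [r s], so that [y / r] is a unit vector. *)
Definition unormal s (y : 'I_n1.+1 -> R) : V :=
  mkrow (- sin (th s)) (fun k => cos (th s) / r s * y k).

Definition utangent s (y : 'I_n1.+1 -> R) : V :=
  mkrow (cos (th s)) (fun k => sin (th s) / r s * y k).

Lemma dot_recl m (u v : 'rV[R]_m.+1) : dot u v =
  u 0 ord0 * v 0 ord0 + \sum_k u 0 (lift ord0 k) * v 0 (lift ord0 k).
Proof. by rewrite /dot big_ord_recl. Qed.

Lemma dot_mkrow m (a c : R) (y : 'I_m -> R) (v : 'rV[R]_m.+1) :
  dot (mkrow a (fun k => c * y k)) v = a * v 0 ord0 + c * \sum_k y k * v 0 (lift ord0 k).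
Proof.
rewrite dot_recl mkrow0 mulr_sumr; congr (_ + _); apply: eq_bigr => k _.
by rewrite mkrowS mulrA.
Qed.

Section Point.
Variables (O : set W0) (phi : W0 -> V) (sg : V -> R) (U : set V).
Hypothesis Oo : open O.
Hypothesis sphi : forall j, smooth O (fun z => phi z 0 j).
Hypothesis Uo : open U.
Hypothesis ssg : smooth U sg.
Hypothesis OU : forall w, O w -> U (phi w).
Hypothesis onsg : forall w, O w -> on_torus x r (phi w) (sg (phi w)).

Let y w (k : 'I_n1.+1) := phi w 0 (lift ord0 k).
Let s w := sg (phi w).
Let T w := utangent (s w) (y w).
Let N w := unormal (s w) (y w).

Lemma param_derivable w i : O w -> exists a, is_derive w (delta_mx 0 i) s a.
Proof.
move=> Ow; pose gam t := phi (w + t *: delta_mx 0 i).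
have g0 : gam 0 = phi w by rewrite /gam scale0r addr0.
have h := chain_rule Uo (OU Ow) ssg g0 (line_coords i sphi Ow).
by eexists; apply/is_derive_line; exact: h.
Qed.

Lemma coord_derive w i j : O w ->
  is_derive w (delta_mx 0 i) (fun z => phi z 0 j) (pderive i phi w 0 j).
Proof. by move=> Ow; apply/is_derive_line; exact: line_coords. Qed.

Lemma sum_derive m w i (g g' : 'I_m -> W0 -> R) :
  (forall k, is_derive w (delta_mx 0 i) (g k) (g' k w)) ->
  is_derive w (delta_mx 0 i) (fun z => \sum_k g k z) (\sum_k g' k w).
Proof.
move=> dg; elim: (index_enum _) => [|k ks IH].
  rewrite big_nil (_ : (fun z => _) = fun=> 0); first exact: is_derive_cst.
  by apply/funext => z; rewrite big_nil.
rewrite big_cons (_ : (fun z => _) = fun z => g k z + \sum_(k <- ks) g k z).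
  exact: is_deriveD (dg k) IH.
by apply/funext => z; rewrite big_cons.
Qed.

(* The derivative of the parameter is the tangential component of the velocity. *)
Lemma first_order w i (a : R) : O w -> is_derive w (delta_mx 0 i) s a ->
  [/\ a = dot (T w) (pderive i phi w), pderive i phi w 0 ord0 = cos (th (s w)) * a,
      \sum_k y w k * pderive i phi w 0 (lift ord0 k) = r (s w) * sin (th (s w)) * a &
      dot (N w) (pderive i phi w) = 0].
Proof.
move=> Ow da; have r0 := cp_rgt0 cp (s w).
have e0 : pderive i phi w 0 ord0 = cos (th (s w)) * a.
  have d1 := is_derive_comp (cp_x cp (s w)) da.
  have d2 := coord_derive i ord0 Ow.
  have := near_is_derive Oo Ow (fun z Oz => (onsg Oz).1) d1.
  by case: d2 => _ <- [_ <-].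
have e1 : \sum_k y w k * pderive i phi w 0 (lift ord0 k) = r (s w) * sin (th (s w)) * a.
  have d1 := is_derive_comp (DX 2 (cp_r cp (s w))) da.
  have d2 : is_derive w (delta_mx 0 i) (fun z => radial2 (phi z))
      (\sum_k 2 * (y w k * pderive i phi w 0 (lift ord0 k))).
    apply: (sum_derive (g' := fun k w => 2 * (y w k * pderive i phi w 0 (lift ord0 k)))) => k.
    apply: is_derive_eq (is_derive_comp (DX 2 (DI _)) (coord_derive i (lift ord0 k) Ow)) _.
    by rewrite /= expr1 mulr1 mulrA.
  have d3 := near_is_derive Oo Ow (fun z Oz => (onsg Oz).2) d1.
  case: d2 => _ E; case: d3 => _; rewrite E -mulr_sumr /= expr1 => h.
  have h2 : 2 * (\sum_k y w k * pderive i phi w 0 (lift ord0 k)) =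
      2 * (r (s w) * sin (th (s w)) * a) by rewrite h; ring.
  by have /mulfI := lt0r_neq0 (@ltr0Sn R 1); apply.
have cs := cos2Dsin2 (th (s w)).
split=> //.
- rewrite dot_mkrow e0 e1; transitivity ((cos (th (s w)) ^+ 2 + sin (th (s w)) ^+ 2) * a).
    by rewrite cs mul1r.
  by field; rewrite gt_eqF.
- rewrite dot_mkrow e0 e1; field; by rewrite gt_eqF.
Qed.

Lemma normal_dot w i : O w -> dot (N w) (pderive i phi w) = 0.
Proof. by move=> Ow; have [a da] := param_derivable i Ow; have [] := first_order Ow da. Qed.

(** The identity [dot (N w) (pderive j phi w) = 0] is differentiated in the [i]-th direction. The
    derivative of the normal is known, since by [first_order] the parameter changes at the rate of
    the tangential component and the angle then changes at the rate [kap]. *)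
Lemma second_order w i j : O w ->
  dot (N w) (pderive i (pderive j phi) w) =
  (kap F n1 (x (s w)) (r (s w)) (th (s w)) + cos (th (s w)) / r (s w)) *
    (dot (T w) (pderive i phi w) * dot (T w) (pderive j phi w)) -
  cos (th (s w)) / r (s w) * dot (pderive i phi w) (pderive j phi w).
Proof.
move=> Ow; have rn : r (s w) != 0 by rewrite gt_eqF// (cp_rgt0 cp).
have [ai dai] := param_derivable i Ow; have [aj daj] := param_derivable j Ow.
have [<- ei0 ei1 _] := first_order Ow dai; have [<- ej0 ej1 _] := first_order Ow daj.
have sp k := smooth_pderive j k Oo sphi.
have [K KE] : exists t, t = kap F n1 (x (s w)) (r (s w)) (th (s w)) by eexists.
have [C CE] : exists t, t = cos (th (s w)) by eexists.
have [S SE] : exists t, t = sin (th (s w)) by eexists.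
have [r0 rE] : exists t, t = r (s w) by eexists.
have [P0 PE] : exists t, t = pderive i (pderive j phi) w 0 ord0 by eexists.
have [SY SYE] : exists t,
  t = \sum_k y w k * pderive i (pderive j phi) w 0 (lift ord0 k) by eexists.
have [SB SBE] : exists t,
  t = \sum_k pderive j phi w 0 (lift ord0 k) * pderive i phi w 0 (lift ord0 k) by eexists.
have dpj k : is_derive w (delta_mx 0 i) (fun z => pderive j phi z 0 k)
    (pderive i (pderive j phi) w 0 k).
  by apply/is_derive_line; exact: line_coords.
have dsin : is_derive w (delta_mx 0 i) (fun z => - sin (th (s z))) (- (C * K * ai)).
  by rewrite CE KE; exact: is_deriveN (is_derive_comp (Dsin (cp_th cp (s w))) dai).
have dcr : is_derive w (delta_mx 0 i) (fun z => cos (th (s z)) * (r (s z))^-1)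
    ((- S * K * r0^-1 + C * (- S / r0 ^+ 2)) * ai).
  rewrite CE SE KE rE.
  exact: is_derive_comp (DM (Dcos (cp_th cp (s w))) (DV rn (cp_r cp (s w)))) dai.
have dsum : is_derive w (delta_mx 0 i)
    (fun z => \sum_k y z k * pderive j phi z 0 (lift ord0 k)) (SY + SB).
  rewrite SYE SBE -big_split.
  apply: (sum_derive (g' := fun k w => y w k * pderive i (pderive j phi) w 0 (lift ord0 k)
      + pderive j phi w 0 (lift ord0 k) * pderive i phi w 0 (lift ord0 k))) => k.
  exact: is_deriveM (coord_derive i (lift ord0 k) Ow) (dpj (lift ord0 k)).
have dP0 := dpj ord0; rewrite -PE in dP0.
have d1 := is_deriveD (is_deriveM dsin dP0) (is_deriveM dcr dsum).
have d0 : is_derive w (delta_mx 0 i) (fun z : W0 => (0 : R)) 0 by exact: is_derive_cst.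
have /(near_is_derive Oo Ow)/(_ d0)[_ E0] : forall z, O z ->
    - sin (th (s z)) * pderive j phi z 0 ord0 +
    cos (th (s z)) * (r (s z))^-1 * (\sum_k y z k * pderive j phi z 0 (lift ord0 k)) = 0.
  by move=> z /(normal_dot j); rewrite dot_mkrow.
have [_ E1] := d1.
have E : - sin (th (s w)) * P0 + pderive j phi w 0 ord0 * (- (C * K * ai)) +
    (cos (th (s w)) * (r (s w))^-1 * (SY + SB) +
     (\sum_k y w k * pderive j phi w 0 (lift ord0 k)) *
       ((- S * K * r0^-1 + C * (- S / r0 ^+ 2)) * ai)) = 0 := etrans (esym E1) E0.
clear E0 E1 d0 d1 dP0 dsum dcr dsin dpj sp.
have L : dot (N w) (pderive i (pderive j phi) w) = - S * P0 + C / r0 * SY.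
  by rewrite SE PE CE rE SYE; exact: dot_mkrow.
have G : dot (pderive i phi w) (pderive j phi w) = C * ai * (C * aj) + SB.
  have SB' : \sum_k pderive i phi w 0 (lift ord0 k) * pderive j phi w 0 (lift ord0 k) = SB.
    by rewrite SBE; apply: eq_bigr => k _; exact: mulrC.
  by rewrite CE -ei0 -ej0 -SB'; exact: dot_recl.
have cs := cos2Dsin2 (th (s w)).
move: E cs rn; rewrite ej0 ej1 L G -KE -CE -SE -rE => E cs rn.
exact: second_order_algebra cs rn E.
Qed.

End Point.
End MeanCurvature.

(** * Vanishing of the mean curvature *)

Lemma open_preimage (R : realType) k m (O : set 'rV[R]_k) (phi : 'rV[R]_k -> 'rV[R]_m)
  (U : set 'rV[R]_m) : open O -> (forall j, smooth O (fun z => phi z 0 j)) -> open U ->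
  open (O `&` (phi @^-1` U)).
Proof.
move=> Oo sp Uo; rewrite openE => z [hz Uz]; rewrite /interior.
have c : {for z, continuous phi}.
  by apply: row_continuous => j; have [h _] := smooth_dclosed (sp j); exact: h.
by apply: filterI; [exact: open_nbhs_nbhs|apply: c; exact: open_nbhs_nbhs].
Qed.

(** The inverse of the parametrization has a local smooth extension [H], and the chain rule applied
    to [H] after [phi] exhibits a right inverse of the Jacobian matrix in row convention. *)
Lemma jacobian_free (R : realType) n1 (A : set 'rV[R]_n1.+2) (W : set 'rV[R]_n1.+1)
  (phi : 'rV[R]_n1.+1 -> 'rV[R]_n1.+2) psi w : open W -> diffeomorphism W A phi psi ->
  W w -> row_free (\matrix_(i, c) pderive i phi w 0 c).
Proof.
move=> Wo [sphi spsi hphi _] Ww; have [B [hBo Ow OW sp]] := smooth_within_local Wo sphi Ww.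
have [U [H [Uo Up sH HE]]] := spsi _ (hphi w Ww).1.
have O'o := open_preimage hBo sp Uo; set O' := B `&` _ in O'o.
have O'w : O' w by split.
have HK m z : O' z -> H (phi z) 0 m = z 0 m.
  by move=> [hz Uz]; have [Az Ez] := hphi z (OW z hz); rewrite HE// Ez.
apply/row_freeP; exists (\matrix_(c, m) pder c (fun q => H q 0 m) (phi w)).
apply/matrixP => i m; rewrite !mxE.
pose gam (t : R) := phi (w + t *: delta_mx 0 i).
have g0 : gam 0 = phi w by rewrite /gam scale0r addr0.
have [_ e2] := (is_derive_line (fun z => H (phi z) 0 m) w _ _).2
  (chain_rule Uo Up ((smooth_on_coords H Uo).1 sH m) g0 (line_coords i sp Ow)).
have d2 := is_derive_coord m (is_derive_id w (delta_mx 0 i)).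
have [_ e1] := near_is_derive O'o O'w (HK m) d2.
rewrite e2 in e1; rewrite mxE eqxx [_ == i]eq_sym /= in e1; rewrite -e1.
by apply: eq_bigr => c _; rewrite !mxE.
Qed.

Lemma form_algebra (R : realFieldType) (E c K P g q a1 a2 a3 : R) :
  E * (c * ((K + P) * (a1 * a2) - P * a3) - - g / 2 * (c * q) * a3) =
  c * (- P - - g / 2 * q) * (E * a3) + E * c * (K + P) * (a1 * a2).
Proof. by ring. Qed.

Section Minimal.
Variables (R : realType) (f F : R -> R) (Fj : nat -> R -> R) (n1 : nat) (l : R) (x r th : R -> R).
Hypothesis cp : closed_profile F n1 l x r th.
Hypothesis Fj0 : Fj 0 = F.
Hypothesis dFj : forall j (u : R), 0 < u -> is_derive u (1 : R) (Fj j) (Fj j.+1 u).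
Hypothesis df : forall u : R, 0 < u -> is_derive u (1 : R) f (F u).
Local Notation torus := (@torus R n1 x r).

(** This is the profile equation: [kap] balances the rotational curvatures and the conformal
    term. *)
Lemma trace_algebra (c E K C S rr xx G : R) : E != 0 -> rr != 0 ->
  K = n1%:R * C / rr + G / 2 * (xx * S - rr * C) ->
  E * c * (K + C / rr) / E + c * (- (C / rr) - - (G / n1.+1%:R) / 2 * (- S * xx + C / rr * rr ^+ 2))
    * n1.+1%:R = 0.
Proof.
move=> E0 r0 ->; have n0 : n1.+1%:R != 0 :> R by rewrite pnatr_eq0.
rewrite -natr1 in n0 *; move: (n1%:R : R) n0 => N n0.
by field; rewrite r0 E0 n0.
Qed.

(** In an arbitrary parametrization the second form is a rank-one term along the profile direction
    plus a multiple of the first form; [trace_rank_one] evaluates its trace and [trace_algebra]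
    shows that it vanishes. *)
Lemma torus_minimal : f_minimal f torus.
Proof.
move=> W phi [Wo [U1 [psi [U1o D]]]] w nu Ww [_ nu0].
have Jfree := jacobian_free Wo D Ww; case: D => sphi _ hphi _.
have [[[s0 ps0] _] _] := hphi w Ww.
have [d [U [sg [d0 Uo ssg Us0 [_ sgs _]]]]] := torus_param cp Fj0 dFj s0.
have [B [B1o O1w O1W sp1]] := smooth_within_local Wo sphi Ww.
have Oo := open_preimage B1o sp1 Uo; set O := B `&` _ in Oo.
have Ow : O w by split=> //; exact: Us0.
have sp j : smooth O (fun z => phi z 0 j) := smooth_subset (@subIsetl _ _ _) (sp1 j).
have OU z : O z -> U (phi z) by case.
have onsg z : O z -> on_torus x r (phi z) (sg (phi z)).
  move=> [Bz Uz]; have [[[s hs] _] _] := hphi z (O1W z Bz).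
  have [ex er _ _] := same_param_curve cp (sgs _ _ Uz hs).
  by rewrite /on_torus -ex -er.
have [s sE] : exists s, s = sg (phi w) by eexists.
have r0 := cp_rgt0 cp s; have rn : r s != 0 by rewrite gt_eqF.
have [p0 p1] := onsg w Ow; rewrite -sE in p0 p1.
have [y yE] : exists y, y = (fun k => phi w 0 (lift ord0 k)) by eexists.
have y2 : \sum_k y k * y k = r s ^+ 2.
  by rewrite -p1 /radial2 yE; apply: eq_bigr => k _; rewrite expr2.
have [p pE] : exists p, p = phi w by eexists.
have p2 : sqnorm p = x s ^+ 2 + r s ^+ 2.
  by rewrite /sqnorm big_ord_recl pE p0 -p1.
have dfp : is_derive (sqnorm p : R) (1 : R) f (F (sqnorm p)).
  by apply: df; rewrite p2 ltr_wpDl ?sqr_ge0// exprn_gt0.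
have [N NE] : exists N, N = unormal r th s y by eexists.
have [T TE] : exists T, T = utangent r th s y by eexists.
have [C CE] : exists t, t = cos (th s) by eexists.
have [S SE] : exists t, t = sin (th s) by eexists.
have cs : C ^+ 2 + S ^+ 2 = 1 by rewrite CE SE cos2Dsin2.
pose J := \matrix_(i, c) pderive i phi w 0 c.
have Jrow i : row i J = pderive i phi w by apply/rowP => c; rewrite !mxE.
have dN v : dot N v = - S * v 0 ord0 + C / r s * \sum_k y k * v 0 (lift ord0 k).
  by rewrite NE SE CE; exact: dot_mkrow.
have dT v : dot T v = C * v 0 ord0 + S / r s * \sum_k y k * v 0 (lift ord0 k).
  by rewrite TE SE CE; exact: dot_mkrow.
have N0 : N 0 ord0 = - S by rewrite NE mkrow0 SE.
have T0 : T 0 ord0 = C by rewrite TE mkrow0 CE.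
have yN : \sum_k y k * N 0 (lift ord0 k) = C / r s * r s ^+ 2.
  rewrite -y2 mulr_sumr; apply: eq_bigr => k _; rewrite NE mkrowS -CE; ring.
have yT : \sum_k y k * T 0 (lift ord0 k) = S / r s * r s ^+ 2.
  rewrite -y2 mulr_sumr; apply: eq_bigr => k _; rewrite TE mkrowS -SE; ring.
have NN : dot N N = 1 by rewrite dN N0 yN -cs; field.
have TT : dot T T = 1 by rewrite dT T0 yT -cs; field.
have TN : dot T N = 0 by rewrite dT N0 yN; field.
have dotpN : dot p N = - S * x s + C / r s * r s ^+ 2.
  rewrite dotC dN pE p0 -y2; congr (_ + _ * _).
  by apply: eq_bigr => k _; rewrite yE.
have JN i : dot (row i J) N = 0.
  by rewrite Jrow dotC NE sE yE; exact: (normal_dot cp Oo sp Uo ssg OU onsg i Ow).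
have E0 : conf f p != 0 by rewrite gt_eqF// expR_gt0.
have hnu i : dot (pderive i phi w) nu = 0.
  by have /eqP := nu0 i; rewrite -pE inner_conf mulf_eq0 (negbTE E0) => /eqP.
have nuE := normal_unique Jfree JN NN (v := nu) _.
have {nuE}nuE : nu = dot nu N *: N by apply: nuE => i; rewrite Jrow.
have [c cE] : exists c, c = dot nu N by eexists.
rewrite -cE in nuE.
have dnu v : dot v nu = c * dot N v.
  by rewrite nuE /dot mulr_sumr; apply: eq_bigr => k _; rewrite mxE; ring.
have [K KE] : exists t, t = kap F n1 (x s) (r s) (th s) by eexists.
have so i j : dot N (pderive i (pderive j phi) w) =
    (K + C / r s) * (dot T (pderive i phi w) * dot T (pderive j phi w)) -
    C / r s * dot (pderive i phi w) (pderive j phi w).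
  by rewrite KE CE NE TE sE yE; exact: (second_order cp Oo sp Uo ssg OU onsg i j Ow).
have [G GE] : exists t, t = F (sqnorm p) by eexists.
have Af : first_form (f_metric f) phi w = conf f p *: (J *m J^T).
  exact: (first_form_conf f (esym pE)).
pose beta := c * (- (C / r s) - - (G / n1.+1%:R) / 2 * (- S * x s + C / r s * r s ^+ 2)).
have Sf : second_form (f_metric f) phi nu w =
    (conf f p * c * (K + C / r s)) *: ((T *m J^T)^T *m (T *m J^T)) +
    beta *: first_form (f_metric f) phi w.
  apply/matrixP => i j; rewrite (second_form_conf (ltn0Sn n1) dfp i j (esym pE) hnu).
  have TJ k : (T *m J^T) 0 k = dot T (pderive k phi w).
    by rewrite mxE /dot; apply: eq_bigr => a _; rewrite !mxE.
  have JJ : (J *m J^T) i j = dot (pderive i phi w) (pderive j phi w).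
    by rewrite mxE /dot; apply: eq_bigr => a _; rewrite !mxE.
  have tt : ((T *m J^T)^T *m (T *m J^T)) i j =
      dot T (pderive i phi w) * dot T (pderive j phi w).
    by rewrite mxE big_ord1 [_^T _ _]mxE !TJ.
  rewrite dnu so [dot p nu]dnu [dot N p]dotC dotpN -GE Af mxE [RHS]addrC.
  have sc (b : R) (B' : 'M[R]_n1.+1) : (b *: B') i j = b * B' i j by rewrite mxE.
  rewrite !sc JJ tt /beta.
  exact: form_algebra.
rewrite /mean_curvature Sf (trace_rank_one Jfree JN NN _ beta E0 Af TN TT).
apply: trace_algebra => //.
by rewrite KE /kap -p2 -GE -CE -SE.
Qed.

End Minimal.

Theorem theorem1p1 (R : realType) (n : nat) (hn : (2 <= n)%N)
  (f : R -> R) (f_smooth : smooth_halfline f)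
  (f_convex : forall t : R, 0 <= t ->
     0 <= derive_halfline (derive_halfline f) t)
  (m M : R) (m_gt0 : 0 < m) (le_mM : m <= M)
  (f_bounds : forall t : R, 0 <= t -> m <= derive_halfline f t <= M) :
  exists S : set 'rV[R]_n.+1,
    [/\ embedded_hypersurface S, f_minimal f S & diffeomorphic (S1xS R n) S].
Proof.
case: n hn => [//|n1]; rewrite ltnS => n1_gt0.
pose Fj j := iter j.+1 derive_halfline f.
have dF j (u : R) : 0 < u -> is_derive u (1 : R) (iter j derive_halfline f) (Fj j u).
  by move=> u0; apply: derive_halflineP => //; apply: f_smooth; exact: ltW.
have dFj j (u : R) : 0 < u -> is_derive u (1 : R) (Fj j) (Fj j.+1 u) by exact: dF.
have pd : profile_data m M f (Fj 0%N) (Fj 1%N).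
  split=> //.
  - by move=> u; exact: (dF 0%N).
  - by move=> u; exact: dFj.
  - by move=> u u0; exact: D_cont (dFj 1%N u u0).
  - move=> u v u0 uv; apply: (mono_le uv (f' := Fj 1%N)).
    + by move=> s /andP[us _]; exact: D_cont (dFj 0%N s (lt_le_trans u0 us)).
    + by move=> s /andP[us _]; exact: (dFj 0%N s (lt_trans u0 us)).
    + by move=> s /andP[us _]; apply/f_convex/ltW/(lt_trans u0 us).
  - by move=> u /ltW/f_bounds/andP[].
  - by move=> u /ltW/f_bounds/andP[].
have [l [x [r [th cp]]]] := closed_profile_exists pd n1_gt0.
exists (@torus R n1 x r); split.
- exact: (torus_embedded cp erefl dFj).
- exact: (torus_minimal cp erefl dFj (pd_f pd)).
- exact: (torus_diffeomorphic cp erefl dFj).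
Qed.
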